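(* Let $X$ be a smooth projective curve over $\mathbb{C}$ of genus $g$, let $\overline r=(r_1,\stackrel{m_1}{\dots},r_1,\dots,r_s,\stackrel{m_s}{\dots},r_s)$ with $0<r_1<\dots<r_s$ and $\sum_\ell m_\ell r_\ell=n$. Let $\beta\in\mathrm{V}_{\overline r}^{\mathrm{nod}}$ and let $\delta_i=(r_i^2-r_i)(g-1)$. Then $$h^{-1}(\beta)\cap\mathrm{M}_{\overline r}=\check\nu\big(\mathrm{Jac}^{\overline\delta}(\widetilde{X}_\beta)\big),$$ where $\overline\delta=(\delta_1,\stackrel{m_1}{\dots},\delta_1,\dots,\delta_s,\stackrel{m_s}{\dots},\delta_s)$.
   Context: $K$ is the canonical bundle of $X$. For each $r$, $\mathrm{M}_r$ is the moduli space of semistable Higgs bundles of rank $r$ and degree $0$ on $X$, $\mathrm{H}_r=\bigoplus_{i=1}^rH^0(X,K^i)$, and $h:\mathrm{M}_r\to\mathrm{H}_r$ is the Hitchin map (coefficients of the characteristic polynomial). With $\pi:|K|\to X$ the total space of $K$ and $\lambda$ the tautological section of $\pi^*K$, the spectral curve $\overline{X}_b\subset|K|$ of $b\in\mathrm{H}_r$ is the zero locus of $\lambda^r+\pi^*b_1\lambda^{r-1}+\dots+\pi^*b_r$. The spectral correspondence $\mathcal{F}\mapsto\pi_*\mathcal{F}$ identifies the Hitchin fibre over $b\in\mathrm{H}_n$ with the moduli space of semistable torsion-free rank one sheaves of degree $n(n-1)(g-1)$ on $\overline{X}_b$. $\mathrm{M}_{\overline r}\subset\mathrm{M}_n$ is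 the locus of Higgs bundles reducing to the Levi subgroup $\mathrm{L}_{\overline r}=\prod_\ell\mathrm{GL}(r_\ell,\mathbb{C})^{m_\ell}$, i.e. the image of the direct sum morphism $\mathrm{Sym}^{m_1}(\mathrm{M}_{r_1})\times\dots\times\mathrm{Sym}^{m_s}(\mathrm{M}_{r_s})\to\mathrm{M}_n$. $\mathrm{H}_{\overline r}=\mathrm{Sym}^{m_1}(\mathrm{H}_{r_1})\times\dots\times\mathrm{Sym}^{m_s}(\mathrm{H}_{r_s})$ maps to $\mathrm{H}_n$ by multiplying the corresponding characteristic polynomials; $\beta\in\mathrm{H}_{\overline r}$ is identified with its image, and $\overline{X}_\beta$ is its spectral curve. $\mathrm{H}_r^{\mathrm{sm}}\subset\mathrm{H}_r$ is the locus of smooth spectral curves, and $\mathrm{V}_{\overline r}=\mathrm{Sym}^{m_1}(\mathrm{H}^{\mathrm{sm}}_{r_1})\times\dots\times\mathrm{Sym}^{m_s}(\mathrm{H}^{\mathrm{sm}}_{r_s})$. $\mathrm{V}_{\overline r}^{\mathrm{nod}}\subset\mathrm{V}_{\overline r}$ is the locus of those $\beta$ whose spectral curve $\overline{X}_\beta$ has (distinct) smooth irreducible components $\overline{X}_{b^\ell_i}$ ($1\le\ell\le s$, $1\le i\le m_\ell$, $b_i^\ell\in\mathrm{H}_{r_\ell}$) intersecting only in nodal points. The normalization is $\nu_\beta:\widetilde{X}_\beta=\bigsqcup_{\ell,i}\overline{X}_{b_i^\ell}\to\overline{X}_\beta$. $\mathrm{Jac}^{\overline\delta}(\widetilde{X}_\beta)$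 parametrizes line bundles on $\widetilde{X}_\beta$ having degree $\delta_\ell$ on each $\overline{X}_{b^\ell_i}$, and $\check\nu$ is the push-forward $L\mapsto\nu_{\beta,*}L$, viewed in $h^{-1}(\beta)$ through the spectral correspondence. *)

(* Defs.v *)
From HB Require Import structures.
From mathcomp Require Import all_boot all_order all_algebra all_field.
From mathcomp Require Import boolp classical_sets functions cardinality fsbigop.
From mathcomp Require Import reals.
From mathcomp Require Import complex ring.
From mathcomp.multinomials Require Import mpoly.

Set Implicit Arguments.
Unset Strict Implicit.
Unset Printing Implicit Defensive.

Import Order.TTheory GRing.Theory Num.Theory.
Local Open Scope ring_scope.
Local Open Scope classical_set_scope.

(* Conventions.  An integral curve is given by its function field, its closed
   points and its local rings, which are subrings of the function field; the
   Zariski topology is the cofinite one and O(U) is the intersection of the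
   local rings at the points of U.  A locally free sheaf is a subsheaf of a
   constant sheaf 'rV_rk over the function field (its generic stalk), so it is
   given by its stalks, and its sections over U are the elements of 'rV_rk
   lying in all the stalks at points of U.  Vectors are rows, and linear maps
   act on the right. *)

Record curve (C : fieldType) := Curve {
  fld : fieldType;
  cst : {rmorphism C -> fld};
  pt : choiceType;
  loc : pt -> set fld }.

Section Curves.
Variables (C : fieldType) (Y : curve C).
Implicit Types (p q : pt Y) (t u x : fld Y).

Definition loc_unit p : set (fld Y) :=
  [set u | [/\ u != 0, loc p u & loc p u^-1]].

Definition loc_max p : set (fld Y) := [set u | loc p u /\ ~ loc_unit p u].

Definition uniformizer p t : Prop :=
  t != 0 /\ forall x, loc_max p x <-> exists2 y, loc p y & x = y * t.

Definition ord p x : int :=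
  xget 0 [set n | exists t u,
    [/\ uniformizer p t, loc_unit p u & x = u * t ^ n]].

(* transcendence degree 1 over C *)
Definition one_dimensional : Prop :=
  exists2 t : fld Y,
    (forall P : {poly C}, P != 0 -> (map_poly (cst Y) P).[t] != 0) &
    (forall x : fld Y, exists2 G : {poly {poly C}}, G != 0 &
       (map_poly (fun P : {poly C} => (map_poly (cst Y) P).[t]) G).[x] = 0).

(* Y is an irreducible closed subvariety of P^N: f is its generic point, e p are
   homogeneous coordinates of the closed point p, and the homogeneous ideal of Y
   consists of the equations satisfied by f. *)
Definition projective : Prop :=
  exists (N : nat) (f : 'I_N.+1 -> fld Y) (e : pt Y -> 'I_N.+1 -> C),
    let on_Y (a : 'I_N.+1 -> C) :=
      forall d (G : {mpoly C[N.+1]}), G \is d.-homog ->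
        mmap (cst Y) f G = 0 -> G.@[a] = 0 in
    [/\ (forall x : fld Y, exists d (G H : {mpoly C[N.+1]}),
          [/\ G \is d.-homog, H \is d.-homog, mmap (cst Y) f H != 0 &
              x = mmap (cst Y) f G / mmap (cst Y) f H]),
        (forall p, (exists i, e p i != 0) /\ on_Y (e p)),
        (forall a, (exists i, a i != 0) -> on_Y a ->
          exists p, exists2 c : C, c != 0 & forall i, a i = c * e p i),
        (forall p p', (exists c : C, forall i, e p i = c * e p' i) -> p = p') &
        (forall p (x : fld Y), loc p x <-> exists d (G H : {mpoly C[N.+1]}),
          [/\ G \is d.-homog, H \is d.-homog, H.@[e p] != 0 &
              x = mmap (cst Y) f G / mmap (cst Y) f H])].

(* In dimension one, a local ring is regular iff its maximal ideal is
   generated by one nonzero element. *)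
Definition smooth_projective_curve : Prop :=
  [/\ projective, one_dimensional & forall p, exists t, uniformizer p t].

Record bundle := Bundle {
  rk : nat;
  stalk : pt Y -> set 'rV[fld Y]_rk }.

Implicit Type E : bundle.

Definition frame E p (B : 'M[fld Y]_(rk E)) : Prop :=
  B \in unitmx /\
  forall v, stalk p v <->
    exists2 c : 'rV_(rk E), (forall j, loc p (c 0 j)) & v = c *m B.

Definition vector_bundle E : Prop :=
  forall p, exists (S : set (pt Y)) (B : 'M_(rk E)),
    [/\ finite_set S, ~ S p & forall q, ~ S q -> frame q B].

(* The degree of the divisor of the rational section e_1 /\ ... /\ e_rk of
   det E, where e_i is the standard basis of the generic stalk: at p this
   section is (det B)^-1 times a generator of the stalk of det E if B is a
   frame at p. *)
Definition degree E : int :=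
  - \sum_(p \in [set: pt Y]) ord p (\det (xget 0 [set B | @frame E p B])).

Definition line_bundle E : Prop := rk E = 1%N /\ vector_bundle E.

End Curves.

Section Derivations.
Variables (C : fieldType) (X : curve C).
Local Notation F := (fld X).

Definition derivation (D : F -> F) : Prop :=
  [/\ forall x y, D (x + y) = D x + D y,
      forall x y, D (x * y) = D x * y + x * D y &
      forall c, D (cst X c) = 0].

(* the tangent sheaf at the generic point *)
Record der := Der { der_fun :> F -> F; derP : derivation der_fun }.

HB.instance Definition _ := gen_eqMixin der.
HB.instance Definition _ := gen_choiceMixin der.

Lemma der0_subproof : derivation (fun=> 0).
Proof. by split=> [x y|x y|c] //; rewrite ?addr0 // mul0r mulr0 addr0. Qed.
Definition der0 : der := Der der0_subproof.

Lemma der_scale_subproof (f : F) (D : der) : derivation (fun x => f * D x).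
Proof.
have [DD DM DC] := derP D.
by split=> [x y|x y|c]; rewrite ?DD ?DM ?DC ?mulr0 //; ring.
Qed.
Definition der_scale (f : F) (D : der) : der := Der (der_scale_subproof f D).

(* the stalk at p of the tangent sheaf *)
Definition tangent (p : pt X) : set der :=
  [set D | forall x, loc p x -> loc p (D x)].

(* d/dt for some uniformizer t, up to a unit of the local ring; it serves as a
   local frame of the tangent bundle at p *)
Definition tangent_frame (p : pt X) : der :=
  xget der0 [set D | tangent p D /\
    forall D', tangent p D' -> exists2 f, loc p f & D' = der_scale f D].

(* H^0(X, K^i), K being the dual of the tangent bundle.  As the tangent sheaf
   has rank one, a section of K^i is a homogeneous function of degree i on it
   (in particular additivity is automatic for i = 1). *)
Definition pluridifferential (i : nat) : set (der -> F) :=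
  [set w | (forall f D, w (der_scale f D) = f ^+ i * w D) /\
           (forall p D, tangent p D -> loc p (w D))].

Definition genus (g : nat) : Prop :=
  exists2 w : 'I_g -> der -> F, (forall i, pluridifferential 1 (w i)) &
    forall eta, pluridifferential 1 eta ->
      exists! c : 'rV[C]_g, forall D, eta D = \sum_i cst X (c 0 i) * w i D.

End Derivations.

Section Higgs.
Variables (C : fieldType) (X : curve C).
Local Notation F := (fld X).

(* E -> E (x) K, seen as an action on E of the tangent sheaf *)
Record higgs := Higgs {
  hbun :> bundle X;
  phi : der X -> 'M[F]_(rk hbun) }.

Implicit Types E G : higgs.

Definition higgs_bundle E : Prop :=
  [/\ vector_bundle E,
      (forall f D, phi E (der_scale f D) = f *: phi E D) &
      (forall p D v, tangent p D -> stalk p v -> stalk p (v *m phi E D))].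

Definition higgs_iso E G : Prop :=
  exists M : 'M[F]_(rk E, rk G),
    [/\ row_free M, row_full M,
        (forall p v, stalk p v <-> stalk p (v *m M)) &
        (forall D, phi E D *m M = M *m phi G D)].

Definition higgs0 : higgs :=
  @Higgs (@Bundle C X 0%N (fun=> setT)) (fun=> 0).

Definition dsum E G : higgs :=
  @Higgs (@Bundle C X (rk E + rk G)
            (fun p => [set v | stalk p (lsubmx v) /\ stalk p (rsubmx v)]))
         (fun D => block_mx (phi E D) 0 0 (phi G D)).

Definition invariant E k (B : 'M[F]_(k, rk E)) : Prop :=
  forall D, (B *m phi E D <= B)%MS.

(* the saturated Higgs subsheaf whose generic stalk is the row space of B *)
Definition subhiggs E k (B : 'M[F]_(k, rk E)) : higgs :=
  @Higgs (@Bundle C X k (fun p => [set v | stalk p (v *m B)]))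
         (fun D => B *m phi E D *m pinvmx B).

(* the quotient of E by the saturated subsheaf with generic stalk ker Q *)
Definition quohiggs E k (Q : 'M[F]_(rk E, k)) : higgs :=
  @Higgs (@Bundle C X k
            (fun p => [set w | exists2 v, stalk p v & w = v *m Q]))
         (fun D => pinvmx Q *m phi E D *m Q).

Definition semistable E : Prop :=
  forall k (B : 'M[F]_(k, rk E)), (0 < k)%N -> row_free B -> invariant B ->
    degree (subhiggs B) * (rk E)%:Z <= degree E * k%:Z.

Definition stable E : Prop :=
  (0 < rk E)%N /\
  forall k (B : 'M[F]_(k, rk E)), (0 < k < rk E)%N -> row_free B ->
    invariant B -> degree (subhiggs B) * (rk E)%:Z < degree E * k%:Z.

(* [jordan_holder E s]: s lists the successive quotients of some Jordan-Hoelder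
   filtration of E. *)
Inductive jordan_holder : higgs -> seq higgs -> Prop :=
| JH0 E : rk E = 0%N -> jordan_holder E [::]
| JHS E k l (B : 'M[F]_(k, rk E)) (Q : 'M[F]_(rk E, l)) s :
    row_free B -> row_full Q -> (kermx Q == B)%MS -> invariant B ->
    stable (subhiggs B) ->
    degree (subhiggs B) * (rk E)%:Z = degree E * k%:Z ->
    jordan_holder (quohiggs Q) s -> jordan_holder E (subhiggs B :: s).

Definition S_equivalent E G : Prop :=
  exists s s', [/\ jordan_holder E s, jordan_holder G s' &
    higgs_iso (\big[dsum/higgs0]_(H <- s) H) (\big[dsum/higgs0]_(H <- s') H)].

Definition semistable_higgs (r : nat) E : Prop :=
  [/\ higgs_bundle E, rk E = r, degree E = 0 & semistable E].

(* The point of M_r defined by E, as an S-equivalence class; it is empty when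
   E is not a semistable Higgs bundle of rank r and degree 0, hence then it is
   not a point of M_r. *)
Definition moduli_point (r : nat) E : set higgs :=
  [set G | [/\ semistable_higgs r E, semistable_higgs r G & S_equivalent E G]].

(* An element of H_r is (b_1, ..., b_r), with b_(i+1) stored at index i. *)
Definition hitchin_tuple (r : nat) := 'I_r -> der X -> F.

Definition hitchin_base (r : nat) : set (hitchin_tuple r) :=
  [set b : hitchin_tuple r | forall i : 'I_r, pluridifferential i.+1 (b i)].

Definition hitchin (r : nat) E : hitchin_tuple r :=
  fun i D => (char_poly (phi E D))`_(r - i.+1).

Definition hitchin_fibre (r : nat) (b : hitchin_tuple r) : set (set higgs) :=
  [set c | exists E,
     [/\ semistable_higgs r E, hitchin E = b & c = moduli_point r E]].

(* lambda^r + b_1 lambda^(r-1) + ... + b_r, evaluated at D *)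
Definition spectral_poly (r : nat) (b : hitchin_tuple r) (D : der X)
    : {poly F} :=
  'X^r + \sum_(i < r) b i D *: 'X^(r - i.+1).

Lemma spectral_poly_monic r (b : hitchin_tuple r) D :
  spectral_poly b D \is monic.
Proof.
rewrite /spectral_poly monicE lead_coefDl ?lead_coefXn // size_polyXn ltnS.
apply: (leq_trans (size_sum _ _ _)); apply/bigmax_leqP => i _.
apply: leq_trans (size_scale_leq _ _) _.
by rewrite size_polyXn -subSn ?subSS ?leq_subr.
Qed.

Section Family.
(* A point of Sym^(m_1) x ... x Sym^(m_s) is represented by a family indexed
   by a finite type I, with I = {l : 'I_s & 'I_(m l)}. *)
Variables (I : finType) (r : I -> nat) (n : nat).

Definition hitchin_mul (b : forall k, hitchin_tuple (r k)) : hitchin_tuple n :=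
  fun i D => (\prod_k spectral_poly (b k) D)`_(n - i.+1).

Definition levi_locus : set (set higgs) :=
  [set moduli_point n (\big[dsum/higgs0]_k E k) | E in
     [set E : I -> higgs | forall k, semistable_higgs (r k) (E k)]].

End Family.

End Higgs.

Arguments hitchin_mul {C X I r} n b.
Arguments levi_locus {C} X {I} r n.
Arguments hitchin_fibre {C X r} b.


Section Spectral.
Variables (C : fieldType) (X : curve C).
Local Notation F := (fld X).

(* Closed points of |K|: (p, a) is the cotangent vector at p taking the value a
   at [tangent_frame p].  Over a neighbourhood of p, |K| is Spec O[x], where x
   is the value of lambda at [tangent_frame p]. *)
Definition cotangent_pt := (pt X * C)%type.

Implicit Type q : cotangent_pt.

Definition spectral_locus r (b : hitchin_tuple X r) : set cotangent_pt :=
  [set q | loc_max q.1 (spectral_poly b (tangent_frame q.1)).[cst X q.2]].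

Definition unif (p : pt X) : F := xget 0 [set t | uniformizer p t].

Definition max_pow (p : pt X) (k : nat) : set F :=
  [set x | exists2 y, loc p y & x = y * unif p ^+ k].

(* (m_p, x - a)^k as an ideal of O_p[x], for q = (p, a); it is described by
   expansion in powers of x - a *)
Definition cotangent_max_pow q (k : nat) : set {poly F} :=
  [set G | forall j,
     max_pow q.1 (k - j) (G \Po ('X + (cst X q.2)%:P))`_j].

Definition smooth_spectral r (b : hitchin_tuple X r) : Prop :=
  forall q, spectral_locus b q ->
    ~ cotangent_max_pow q 2 (spectral_poly b (tangent_frame q.1)).

(* G = 0 has a node at q: G is congruent, modulo the cube of the maximal ideal,
   to a product of two independent linear forms in the local coordinates
   (unif p, x - a). *)
Definition node q (G : {poly F}) : Prop :=
  exists a1 b1 a2 b2 : C, a1 * b2 - a2 * b1 != 0 /\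
    let line a b := (cst X a * unif q.1)%:P
                    + cst X b *: ('X - (cst X q.2)%:P) in
    cotangent_max_pow q 3 (G - line a1 b1 * line a2 b2).

(* Any nonzero derivation trivializes K generically. *)
Definition base_der : der X :=
  xget (der0 X) [set D | exists x, D x != 0].

Definition der_coord (D : der X) : F :=
  xget 0 [set h | forall x, D x = h * base_der x].

(* For a smooth spectral curve (or any reduced one), this is irreducibility of
   the zero locus: the polynomial is monic and the local rings of X are
   integrally closed. *)
Definition irreducible_spectral r (b : hitchin_tuple X r) : Prop :=
  irreducible_poly (spectral_poly b base_der).

Section SpectralCurve.
Variables (r : nat) (b : hitchin_tuple X r) (b_irr : irreducible_spectral b).

Let P := spectral_poly b base_der.
Let mi : monic_irreducible_poly P := (b_irr, spectral_poly_monic b base_der).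

Definition spectral_fld : fieldType := {poly %/ P with mi}.

Definition spectral_incl : {rmorphism F -> spectral_fld} := qpolyC P.

Definition spectral_cst : {rmorphism C -> spectral_fld} :=
  (spectral_incl \o cst X)%FUN.

(* the tautological section, evaluated at D *)
Definition lambda (D : der X) : spectral_fld :=
  spectral_incl (der_coord D) * qpolyX P.

(* O_{|K|,q} / (equation of the curve), inside the function field *)
Definition spectral_loc (q : set_type (spectral_locus b))
    : set spectral_fld :=
  [set z | exists G H : {poly F},
    let y := lambda (tangent_frame (val q).1) in
    [/\ (forall i, loc (val q).1 G`_i), (forall i, loc (val q).1 H`_i),
        loc_unit (val q).1 H.[cst X (val q).2] &
        z = (map_poly spectral_incl G).[y] / (map_poly spectral_incl H).[y]]].

Definition spectral_curve : curve C := Curve spectral_cst spectral_loc.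

(* the function field as F^r, with basis 1, x, ..., x^(r-1) *)
Definition to_spectral (v : 'rV[F]_r) : spectral_fld := in_qpoly P (rVpoly v).
Definition of_spectral (z : spectral_fld) : 'rV[F]_r :=
  poly_rV (z : {poly %/ P}).

(* pi_* L with Higgs field the multiplication by lambda, for L of rank one
   (const_mx z is then the vector with single coordinate z) *)
Definition spectral_push (L : bundle spectral_curve) : higgs X :=
  @Higgs C X
    (@Bundle C X r (fun p =>
       [set v | forall q : pt spectral_curve, (val q).1 = p ->
                stalk q (const_mx (to_spectral v) : 'rV_(rk L))]))
    (fun D => lin1_mx (fun v => of_spectral (lambda D * to_spectral v))).

End SpectralCurve.

Section Nodal.
Variables (I : finType) (r : I -> nat) (b : forall k, hitchin_tuple X (r k)).
Arguments b k : clear implicits.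

Definition nodal_locus : Prop :=
  [/\ (forall k, hitchin_base (b k) /\ smooth_spectral (b k)),
      (forall k, irreducible_spectral (b k)),
      (forall k k', k != k' ->
         spectral_locus (b k) <> spectral_locus (b k')) &
      (forall k k' q, k != k' ->
         spectral_locus (b k) q -> spectral_locus (b k') q ->
         node q (\prod_j spectral_poly (b j) (tangent_frame q.1)))].

Lemma nodal_irreducible (hb : nodal_locus) k : irreducible_spectral (b k).
Proof. by case: hb. Qed.

Variable hb : nodal_locus.

(* the components of the normalization, which is their disjoint union *)
Definition normalization (k : I) : curve C :=
  spectral_curve (nodal_irreducible hb k).

Definition jacobian (d : I -> int)
    : set (forall k, bundle (normalization k)) :=
  [set L | forall k, line_bundle (L k) /\ degree (L k) = d k].

(* The Higgs bundle of nu_* L under the spectral correspondence: the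
   push-forward of L along the map from the normalization to X. *)
Definition nu_push (L : forall k, bundle (normalization k)) : higgs X :=
  \big[@dsum C X/higgs0 X]_k spectral_push (L k).

Definition nu_check (n : nat) (L : forall k, bundle (normalization k))
    : set (higgs X) := moduli_point n (nu_push L).

End Nodal.
End Spectral.

Arguments jacobian {C X I r b} hb d.
Arguments nu_check {C X I r b hb} n L.

(* Main.v *)
(* Let P_k be the equation of the k-th spectral curve over the function field F of X.
   A point of h^{-1}(beta) in the Levi locus is the class of a direct sum of Higgs
   bundles E_k, and S-equivalent Higgs bundles have the same characteristic polynomial;
   so the product of the characteristic polynomials of the E_k is the product of the
   P_k, with as many factors, and unique factorization in F[x] matches them up to a
   permutation.  A Higgs bundle with characteristic polynomial P_k has a one-dimensional
   generic stalk over the function field F[x]/P_k of the spectral curve.  Its stalks on X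
   are modules over O[lambda], which is the intersection of the local rings of the
   spectral curve at the points of the fibre, and localizing them gives the line bundle
   with push-forward E_k.  Conversely, as P_k is irreducible, a push-forward from the
   spectral curve has no proper invariant subbundle, so it is semistable.

   The degrees match because deg pi_* L = deg L - r(r-1)/2 deg K: the stalk of pi_* L at p
   is z O[lambda] for a generator z of L near the fibre, whose norm accounts for deg L, and
   1, lambda, ..., lambda^(r-1) identify pi_* O with the sum of the K^-i.  Finally
   deg K = 2g - 2 comes from a finite map x from X to P^1: the divisor of dx is computed
   from the ramification, hence from the discriminant of O_X over P^1, hence from the
   splitting of x_* O_X, whose trace dual computes g. *)

From HB Require Import structures.
From mathcomp Require Import all_boot all_order all_algebra all_field.
From mathcomp Require Import boolp classical_sets cardinality fsbigop.
From mathcomp Require Import reals complex ring zify.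
From mathcomp.multinomials Require Import mpoly.
Require Import Defs.

Set Implicit Arguments.
Unset Strict Implicit.
Unset Printing Implicit Defensive.

Import Order.TTheory GRing.Theory Num.Theory.
Local Open Scope ring_scope.
Local Open Scope classical_set_scope.

(** A spectral curve comes without a projective embedding, so orders, norms and lattices are treated
    for a [regular_curve]: discrete valuation rings with residue field C at all points. X, the
    projective line and the smooth spectral curves satisfy it. For X these valuations have to be
    extracted from homogeneous coordinates, and the existence of poles goes through a valuation ring
    given by Zorn's lemma. Finite maps are recorded by [cover_at], a basis of the semilocal ring of
    a fibre; it serves for X over the line and for a spectral curve over X. From it follow that the
    order of a norm is the sum of the orders along the fibre, and that the trace dual has exponents
    1 - e, where e is the ramification index; the latter relies on characteristic 0. A point of the
    moduli space is a set of Higgs bundles that is empty when its representative is not semistable.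
    Equalities of points therefore come from isomorphisms of representatives, while extracting an
    S-equivalence from an equality requires Jordan-Hoelder filtrations to exist, hence the stability
    of semistability of degree 0 under quotients and direct sums. *)

Record regular_curve (C : fieldType) (Y : curve C) : Prop := RegularCurve {
  rc_loc_cst : forall p c, loc p (cst Y c);
  rc_locB : forall (p : pt Y) x y, loc p x -> loc p y -> loc p (x - y);
  rc_locM : forall (p : pt Y) x y, loc p x -> loc p y -> loc p (x * y);
  rc_ex_uniformizer : forall p : pt Y, exists t, uniformizer p t;
  rc_ex_ord : forall (p : pt Y) x, x != 0 -> exists t u (n : int),
    [/\ uniformizer p t, loc_unit p u & x = u * t ^ n];
  rc_ex_value : forall (p : pt Y) x, loc p x -> exists c, loc_max p (x - cst Y c) }.

(** [ord] has the default value 0 at 0, so the first disjunct is what gives 0 an infinite order. *)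
Definition vge (C : fieldType) (Y : curve C) (p : pt Y) (n : int) (x : fld Y) :=
  (x == 0) || (n <= ord p x).

(** * Regular curves *)

Section Valuation.
Variables (C : fieldType) (Y : curve C) (hY : regular_curve Y).
Implicit Types (p : pt Y) (x y z t u : fld Y) (c : C).

Let loc_cst := rc_loc_cst hY.

Lemma locB p x y : loc p x -> loc p y -> loc p (x - y).
Proof. exact: rc_locB. Qed.

Lemma locM p x y : loc p x -> loc p y -> loc p (x * y).
Proof. exact: rc_locM. Qed.

Lemma loc0 p : loc p 0.
Proof. rewrite -(rmorph0 (cst Y)) ; exact: loc_cst. Qed.

Lemma loc1 p : loc p 1.
Proof. by rewrite -(rmorph1 (cst Y)); exact: loc_cst. Qed.

Lemma locN p x : loc p x -> loc p (- x).
Proof. by move=> xp; rewrite -sub0r; apply: locB => //; exact: loc0. Qed.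

Lemma locD p x y : loc p x -> loc p y -> loc p (x + y).
Proof. by move=> xp yp; rewrite -[y]opprK; apply: locB => //; exact: locN. Qed.

Lemma locX p x n : loc p x -> loc p (x ^+ n).
Proof.
move=> xp; elim: n => [|n IH]; first by rewrite expr0; exact: loc1.
by rewrite exprS; exact: locM.
Qed.

Lemma loc_sum p (I : Type) (s : seq I) (P : pred I) (f : I -> fld Y) :
  (forall i, P i -> loc p (f i)) -> loc p (\sum_(i <- s | P i) f i).
Proof. by move=> fP; apply: big_ind => //; [exact: loc0 | exact: locD]. Qed.

Lemma loc_prod p (I : Type) (s : seq I) (P : pred I) (f : I -> fld Y) :
  (forall i, P i -> loc p (f i)) -> loc p (\prod_(i <- s | P i) f i).
Proof. by move=> fP; apply: big_ind => //; [exact: loc1 | exact: locM]. Qed.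

Lemma loc_unit_neq0 p u : loc_unit p u -> u != 0. Proof. by case. Qed.

Lemma loc_unit1 p : loc_unit p 1.
Proof. by split; rewrite ?oner_eq0 ?invr1 //; exact: loc1. Qed.

Lemma loc_unitV p u : loc_unit p u -> loc_unit p u^-1.
Proof. by case=> u0 up uVp; split; rewrite ?invr_eq0 ?invrK. Qed.

Lemma loc_unitM p u v : loc_unit p u -> loc_unit p v -> loc_unit p (u * v).
Proof.
move=> [u0 up uV] [v0 vp vV]; split; rewrite ?mulf_neq0 ?invfM //; exact: locM.
Qed.

Lemma loc_unitX p u n : loc_unit p u -> loc_unit p (u ^+ n).
Proof.
move=> uu; elim: n => [|n IH]; first by rewrite expr0; exact: loc_unit1.
by rewrite exprS; exact: loc_unitM.
Qed.

Lemma loc_unitXz p u (n : int) : loc_unit p u -> loc_unit p (u ^ n).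
Proof.
case: n => n uu; first exact: loc_unitX.
by rewrite -[_ ^ _]/(u ^- n.+1); apply/loc_unitV/loc_unitX.
Qed.

Lemma loc_unit_cst p c : c != 0 -> loc_unit p (cst Y c).
Proof.
move=> c0; split; rewrite ?fmorph_eq0 //.
by rewrite -fmorphV; exact: loc_cst.
Qed.

Lemma unif_neq0 p t : uniformizer p t -> t != 0. Proof. by case. Qed.

Lemma unif_max p t : uniformizer p t -> loc_max p t.
Proof. by move=> [t0 tP]; apply/tP; exists 1; [exact: loc1 | rewrite mul1r]. Qed.

Lemma unif_loc p t : uniformizer p t -> loc p t.
Proof. by move/unif_max=> []. Qed.

Lemma unif_invN p t : uniformizer p t -> ~ loc p t^-1.
Proof.
by move=> tt tV; have [tp] := unif_max tt; apply; split; rewrite ?(unif_neq0 tt).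
Qed.

Lemma unif_expz_unit p t (n : int) : uniformizer p t -> loc_unit p (t ^ n) -> n = 0.
Proof.
move=> tt; have key k : ~ loc p (t ^+ k.+1)^-1.
  move=> h; apply: (unif_invN tt).
  have -> : t^-1 = (t ^+ k.+1)^-1 * t ^+ k.
    by rewrite exprS invfM -mulrA mulVf ?mulr1 // expf_neq0 // (unif_neq0 tt).
  by apply: locM => //; apply: locX; exact: unif_loc.
case: n => [[|n]|n] // [_ h1 h2]; first by case: (key n).
by case: (key n).
Qed.

Lemma unif_assoc p t t' : uniformizer p t -> uniformizer p t' ->
  exists2 u, loc_unit p u & t = u * t'.
Proof.
move=> tt tt'; have [y yp ty] := (tt'.2 t).1 (unif_max tt).
have [y' yp' ty'] := (tt.2 t').1 (unif_max tt').
have t0 := unif_neq0 tt; have y0 : y != 0.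
  by apply: contraNneq t0 => y0; rewrite ty y0 mul0r.
have yy : y' = y^-1.
  apply: (mulIf t0); rewrite -ty' ty mulrA mulVf ?mul1r //.
by exists y => //; split=> //; rewrite -yy.
Qed.

Lemma ordvE p t u (n : int) :
  uniformizer p t -> loc_unit p u -> ord p (u * t ^ n) = n.
Proof.
move=> tt uu; rewrite /ord; apply: xget_subset1; first by exists t, u.
move=> a b [t1 [u1 [tt1 uu1 E1]]] [t2 [u2 [tt2 uu2 E2]]].
(* Both expressions are written with the uniformizer [t2]; a power of a uniformizer that is a unit
   has exponent 0. *)
have [v vu tv] := unif_assoc tt1 tt2; have t20 := unif_neq0 tt2.
have : t2 ^ (a - b) = u2 / (u1 * v ^ a).
  move: E1; rewrite E2 tv expfzMl => E.
  rewrite expfzDr // -(invr_expz _ b).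
  apply: (mulIf (expfz_neq0 b t20)); rewrite -mulrA mulVf ?expfz_neq0 // mulr1.
  rewrite mulrAC E; field.
  by rewrite (loc_unit_neq0 uu1) expfz_neq0 ?(loc_unit_neq0 vu).
move=> E; suff : a - b = 0 by move/subr0_eq.
apply: (unif_expz_unit tt2); rewrite E.
by apply: loc_unitM => //; apply/loc_unitV/loc_unitM => //; exact: loc_unitXz.
Qed.

Lemma ordvP p t x : uniformizer p t -> x != 0 ->
  exists2 u, loc_unit p u & x = u * t ^ ord p x.
Proof.
move=> tt x0; have [t1 [u [n [tt1 uu xE]]]] := rc_ex_ord hY p x0.
have [v vv tE] := unif_assoc tt1 tt.
exists (u * v ^ n); first by apply: loc_unitM => //; exact: loc_unitXz.
by rewrite {2}xE ordvE // xE tE expfzMl mulrA.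
Qed.

Lemma ord_unit p u : loc_unit p u -> ord p u = 0.
Proof.
move=> uu; have [t tt] := rc_ex_uniformizer hY p.
by rewrite -[u in LHS](mulr1 u) -(expr0z t) ordvE.
Qed.

Lemma ordv1 p : ord p 1 = 0. Proof. exact/ord_unit/loc_unit1. Qed.

Lemma ord_unif p t : uniformizer p t -> ord p t = 1.
Proof. by move=> tt; rewrite -[t in LHS](mul1r t) -(expr1z t) ordvE //; exact: loc_unit1. Qed.

Lemma ordv0 p : ord p 0 = 0.
Proof.
rewrite /ord; apply: xgetPN => n [t [u [tt uu]]] /esym/eqP.
by rewrite mulf_eq0 (negPf (loc_unit_neq0 uu)) (negPf (expfz_neq0 _ (unif_neq0 tt))).
Qed.

Lemma ordM p x y : x != 0 -> y != 0 -> ord p (x * y) = ord p x + ord p y.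
Proof.
move=> x0 y0; have [t tt] := rc_ex_uniformizer hY p.
have [u uu xE] := ordvP tt x0; have [v vv yE] := ordvP tt y0.
rewrite {1}xE {1}yE mulrACA -expfzDr ?(unif_neq0 tt) // ordvE //.
exact: loc_unitM.
Qed.

Lemma ordV p x : ord p x^-1 = - ord p x.
Proof.
have [->|x0] := eqVneq x 0; first by rewrite invr0 ordv0 oppr0.
apply/eqP; rewrite -addr_eq0 -ordM ?invr_eq0 // mulVf //; exact/eqP/ordv1.
Qed.

Lemma ordX p x n : ord p (x ^+ n) = ord p x *+ n.
Proof.
have [->|x0] := eqVneq x 0.
  by case: n => [|n]; rewrite ?expr0 ?ordv1 // expr0n /= ordv0 mul0rn.
elim: n => [|n IH]; first by rewrite expr0 ordv1.
by rewrite exprS ordM ?expf_neq0 // IH mulrS.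
Qed.

Lemma ordXz p x (n : int) : ord p (x ^ n) = ord p x * n.
Proof.
case: n => n; first by rewrite -exprnP ordX -mulr_natr natz.
by rewrite -[_ ^ _]/(x ^- n.+1) ordV ordX NegzE mulrN -mulr_natr natz.
Qed.

Lemma ord_prod p (I : Type) (s : seq I) (f : I -> fld Y) :
  (forall i, f i != 0) -> ord p (\prod_(i <- s) f i) = \sum_(i <- s) ord p (f i).
Proof.
move=> f0; elim: s => [|i s IH]; first by rewrite !big_nil ordv1.
rewrite !big_cons ordM ?f0 ?IH //; elim/big_rec: _ => [|j x _ x0]; rewrite ?oner_eq0 //.
by rewrite mulf_neq0.
Qed.

Lemma loc_ord p x : x != 0 -> loc p x <-> 0 <= ord p x.
Proof.
move=> x0; have [t tt] := rc_ex_uniformizer hY p.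
have [u uu xE] := ordvP tt x0; split; last first.
  rewrite {2}xE; case: (ord p x) => // n _; apply: locM; first by case: uu.
  exact: (locX n (unif_loc tt)).
move: xE; case: (ord p x) => // n; rewrite -[_ ^ _]/(t ^- n.+1) => xE xp.
case: (unif_invN tt); have -> : t^-1 = x * u^-1 * t ^+ n.
  rewrite xE exprS; field.
  by rewrite expf_neq0 ?(unif_neq0 tt) ?(loc_unit_neq0 uu).
apply: locM; last by apply: locX; exact: unif_loc.
by apply: locM => //; case: uu.
Qed.

Lemma loc_unit_ord p x : loc_unit p x <-> (x != 0 /\ ord p x = 0).
Proof.
split=> [ux|[x0 ox]]; first by split; [case: ux | exact: ord_unit].
by split=> //; apply/loc_ord; rewrite ?invr_eq0 ?ordV ?ox.
Qed.

Lemma vgeE p t n x : uniformizer p t -> vge p n x <-> loc p (x * t ^ (- n)).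
Proof.
move=> tt; have t0 := unif_neq0 tt; rewrite /vge.
have [->|x0] /= := eqVneq x 0; first by rewrite mul0r; split=> // _; exact: loc0.
rewrite loc_ord ?mulf_neq0 ?expfz_neq0 // ordM ?expfz_neq0 // ordXz (ord_unif tt) //.
by rewrite mul1r subr_ge0.
Qed.

Lemma vge0 p n : vge p n 0. Proof. by rewrite /vge eqxx. Qed.

Lemma vge_loc p x : vge p 0 x <-> loc p x.
Proof.
have [t tt] := rc_ex_uniformizer hY p.
by rewrite (vgeE _ _ tt) oppr0 expr0z mulr1.
Qed.

Lemma vgeD p n x y : vge p n x -> vge p n y -> vge p n (x + y).
Proof.
have [t tt] := rc_ex_uniformizer hY p.
move=> /(vgeE _ _ tt) xn /(vgeE _ _ tt) yn; apply/(vgeE _ _ tt).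
by rewrite mulrDl; exact: locD.
Qed.

Lemma vgeN p n x : vge p n (- x) = vge p n x.
Proof.
have [->|x0] := eqVneq x 0; first by rewrite oppr0.
rewrite /vge oppr_eq0 -mulN1r ordM ?oppr_eq0 ?oner_eq0 //.
suff -> : ord p (-1) = 0 by rewrite add0r.
by rewrite -(rmorph1 (cst Y)) -rmorphN ord_unit //; apply: loc_unit_cst; rewrite oppr_eq0 oner_eq0.
Qed.

Lemma vgeB p n x y : vge p n x -> vge p n y -> vge p n (x - y).
Proof. by move=> xn yn; apply: vgeD; rewrite ?vgeN. Qed.

Lemma vgeM p n m x y : vge p n x -> vge p m y -> vge p (n + m) (x * y).
Proof.
rewrite /vge mulf_eq0; have [->//|x0] := eqVneq x 0; have [->|y0 /=] := eqVneq y 0.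
  by rewrite orbT.
by move=> xn ym; rewrite ordM // lerD.
Qed.

Lemma vge_sum p n (I : Type) (s : seq I) (P : pred I) (f : I -> fld Y) :
  (forall i, P i -> vge p n (f i)) -> vge p n (\sum_(i <- s | P i) f i).
Proof. by move=> fP; apply: (big_ind (fun x => vge p n x)) => //; [exact: vge0 | exact: vgeD]. Qed.

Lemma vgeW p n m x : (m <= n)%R -> vge p n x -> vge p m x.
Proof. by move=> mn; rewrite /vge => /orP[->//|/(le_trans mn)->]; rewrite orbT. Qed.

Lemma vgeX p n x k : vge p n x -> vge p (n *+ k) (x ^+ k).
Proof.
move=> xn; elim: k => [|k IH]; first by rewrite expr0; apply/vge_loc; exact: loc1.
by rewrite exprS mulrS; exact: vgeM.
Qed.

Lemma vge_locM p n x y : loc p x -> vge p n y -> vge p n (x * y).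
Proof. by move=> /vge_loc xp yn; rewrite -[n]add0r; exact: vgeM. Qed.

Lemma vge_ord p x : vge p (ord p x) x.
Proof. by rewrite /vge lexx orbT. Qed.

Lemma loc_maxP p x : loc_max p x <-> vge p 1 x.
Proof.
rewrite /vge; have [->|x0] /= := eqVneq x 0.
  by split=> // _; split; [exact: loc0 | case; rewrite eqxx].
rewrite /loc_max /= loc_unit_ord loc_ord //; split=> [[h1 h2]|h].
  by rewrite -gtz0_ge1 lt_def h1 andbT; apply/eqP => h; apply: h2.
by split; [exact: le_trans h | case=> _ h1; rewrite h1 in h].
Qed.

Lemma loc_maxD p x y : loc_max p x -> loc_max p y -> loc_max p (x + y).
Proof. by rewrite !loc_maxP; exact: vgeD. Qed.

Lemma loc_maxB p x y : loc_max p x -> loc_max p y -> loc_max p (x - y).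
Proof. by rewrite !loc_maxP; exact: vgeB. Qed.

Lemma loc_maxMl p x y : loc p x -> loc_max p y -> loc_max p (x * y).
Proof. by rewrite !loc_maxP => h; exact: vge_locM. Qed.

Lemma loc_max_cst p c : loc_max p (cst Y c) -> c = 0.
Proof.
by move=> [_ h]; apply/eqP/negPn/negP => c0; apply: h; exact: loc_unit_cst.
Qed.

(** The residue of [x] at [p]; outside the local ring no [c] qualifies and the default 0 is
    returned. *)
Definition value p x : C := xget 0 [set c | loc_max p (x - cst Y c)].

Lemma valueP p x : loc p x -> loc_max p (x - cst Y (value p x)).
Proof. by move=> xp; exact: (@xgetPex C 0 [set c : C | loc_max p (x - cst Y c)] (rc_ex_value hY xp)). Qed.

Lemma valueE p x c : loc_max p (x - cst Y c) -> value p x = c.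
Proof.
move=> cP; apply: xget_subset1 => // a b /= ap bp; apply/subr0_eq/(@loc_max_cst p).
have -> : cst Y (a - b) = (x - cst Y b) - (x - cst Y a) by rewrite rmorphB /=; ring.
exact: loc_maxB.
Qed.

Lemma value_cst p c : value p (cst Y c) = c.
Proof. by apply: valueE; rewrite subrr; apply/loc_maxP; exact: vge0. Qed.

Lemma valueD p x y : loc p x -> loc p y -> value p (x + y) = value p x + value p y.
Proof.
move=> xp yp; apply: valueE; rewrite rmorphD /= opprD addrACA.
by apply: loc_maxD; exact: valueP.
Qed.

Lemma valueN p x : loc p x -> value p (- x) = - value p x.
Proof.
move=> xp; apply: valueE; rewrite rmorphN /= -opprD.
by apply/loc_maxP; rewrite vgeN; apply/loc_maxP/valueP.
Qed.

Lemma valueM p x y : loc p x -> loc p y -> value p (x * y) = value p x * value p y.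
Proof.
move=> xp yp; apply: valueE; rewrite rmorphM /=.
have -> : x * y - cst Y (value p x) * cst Y (value p y) =
  x * (y - cst Y (value p y)) + cst Y (value p y) * (x - cst Y (value p x)) by ring.
by apply: loc_maxD; apply: loc_maxMl => //; exact: valueP.
Qed.

Lemma value1 p : value p 1 = 1.
Proof. by rewrite -(rmorph1 (cst Y)) value_cst. Qed.

Lemma value0 p : value p 0 = 0.
Proof. by rewrite -(rmorph0 (cst Y)) value_cst. Qed.

Lemma value_eq0 p x : loc p x -> value p x = 0 <-> loc_max p x.
Proof.
move=> xp; split=> [h|h]; first by have := valueP xp; rewrite h rmorph0 subr0.
by apply: valueE; rewrite rmorph0 subr0.
Qed.

Lemma value_unit p x : loc p x -> value p x <> 0 <-> loc_unit p x.
Proof.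
move=> xp; rewrite value_eq0 //; split; last by move=> h [].
by move=> h; apply: contrapT => h1; apply: h.
Qed.

Lemma vgeV p n x : ord p x <= n -> x != 0 -> vge p (- n) x^-1.
Proof. by move=> h x0; rewrite /vge ordV lerN2 h orbT. Qed.

Lemma vge_ordE p n x : x != 0 -> vge p n x = (n <= ord p x).
Proof. by rewrite /vge => /negPf->. Qed.

(** If the order went up, [x = (x + y) - y] would have order larger than its own. Nonvanishing of
    the sum is recorded because an order is meaningful for nonzero elements only. *)
Lemma ordD_eq p x y : x != 0 -> vge p (ord p x + 1) y -> x + y != 0 /\ ord p (x + y) = ord p x.
Proof.
move=> x0 yp; have xy0 : x + y != 0.
  apply/eqP => /eqP; rewrite addr_eq0 => /eqP h; move: yp.
  by rewrite -vgeN -h vge_ordE // gerDl.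
split=> //; apply/eqP; rewrite eq_le; apply/andP; split; last first.
  rewrite -vge_ordE //; apply: vgeD; first exact: vge_ord.
  by apply: vgeW yp; rewrite lerDl.
rewrite leNgt; apply/negP => h; have : vge p (ord p x + 1) x.
  rewrite -[X in vge _ _ X](addrK y); apply: vgeB => //.
  by rewrite vge_ordE // lezD1.
by rewrite vge_ordE // gerDl.
Qed.

End Valuation.

(** * Finite extensions of function fields *)

Section FiniteExtension.
Variables (K L : fieldType) (io : {rmorphism K -> L}) (d : nat).

Definition lin (e : 'I_d -> L) (c : 'rV[K]_d) : L := \sum_i io (c 0 i) * e i.

Definition is_basis (e : 'I_d -> L) :=
  (forall c, lin e c = 0 -> c = 0) /\ (forall y, exists c, y = lin e c).

Definition coord_in (e : 'I_d -> L) (y : L) : 'rV[K]_d := xget 0 [set c | y = lin e c].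

Lemma linP e a c c' : lin e (a *: c + c') = io a * lin e c + lin e c'.
Proof.
rewrite /lin mulr_sumr -big_split /=; apply: eq_bigr => i _.
by rewrite !mxE rmorphD rmorphM mulrDl mulrA.
Qed.

Lemma linB e c c' : lin e (c - c') = lin e c - lin e c'.
Proof. by rewrite addrC -scaleN1r linP rmorphN1 mulN1r addrC. Qed.

Lemma lin_delta e i : lin e (delta_mx 0 i) = e i.
Proof.
rewrite /lin (bigD1 i) //= mxE !eqxx rmorph1 mul1r big1 ?addr0 // => j ji.
by rewrite mxE eqxx (negPf ji) rmorph0 mul0r.
Qed.

Section Basis.
Variables (e : 'I_d -> L) (he : is_basis e).
Local Notation co := (coord_in e).

Lemma coord_inK y : lin e (co y) = y.
Proof.
by case: he => _ /(_ y) h; symmetry; exact: (@xgetPex _ 0 [set c | y = lin e c] h).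
Qed.

Lemma lin_inj : injective (lin e).
Proof.
move=> c c' /eqP; rewrite -subr_eq0 -linB => /eqP h.
by apply/subr0_eq; case: he => + _; exact.
Qed.

Lemma linK c : co (lin e c) = c.
Proof. by apply: lin_inj; rewrite coord_inK. Qed.

Lemma coord_inP a x y : co (io a * x + y) = a *: co x + co y.
Proof. by apply: lin_inj; rewrite linP !coord_inK. Qed.

Lemma coord_in0 : co 0 = 0.
Proof. by have := coord_inP (-1) 0 0; rewrite mulr0 addr0 scaleN1r addNr. Qed.

Lemma coord_inD x y : co (x + y) = co x + co y.
Proof. by rewrite -[x in LHS]mul1r -(rmorph1 io) coord_inP scale1r. Qed.

Lemma coord_inZ a x : co (io a * x) = a *: co x.
Proof. by rewrite -[_ * _]addr0 coord_inP coord_in0 addr0. Qed.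

Lemma coord_in_e i : co (e i) = delta_mx 0 i.
Proof. by rewrite -lin_delta linK. Qed.

Lemma coord_in_sum (I : Type) (s : seq I) (f : I -> L) :
  co (\sum_(i <- s) f i) = \sum_(i <- s) co (f i).
Proof. by apply: (big_morph co coord_inD coord_in0). Qed.

Definition mulmat (z : L) : 'M[K]_d := \matrix_(i < d) co (z * e i).
Definition fnorm z := \det (mulmat z).
Definition ftrace z := \tr (mulmat z).

Lemma coord_inM z y : co (z * y) = co y *m mulmat z.
Proof.
rewrite mulmx_sum_row -[y in LHS]coord_inK /lin mulr_sumr coord_in_sum.
by apply: eq_bigr => i _; rewrite mulrCA coord_inZ rowK.
Qed.

Lemma mulmatP z A : (forall y, co (z * y) = co y *m A) -> mulmat z = A.
Proof.
by move=> h; apply/row_matrixP => i; rewrite rowK h coord_in_e -rowE.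
Qed.

Lemma mulmatM z z' : mulmat (z * z') = mulmat z *m mulmat z'.
Proof. by apply: mulmatP => y; rewrite (_ : z * z' * y = z' * (z * y)) 1?coord_inM 1?coord_inM ?mulmxA //; ring. Qed.

Lemma mulmat1 : mulmat 1 = 1%:M.
Proof. by apply: mulmatP => y; rewrite mul1r mulmx1. Qed.

Lemma mulmatZ a z : mulmat (io a * z) = a *: mulmat z.
Proof. by apply: mulmatP => y; rewrite -mulrA coord_inZ coord_inM -scalemxAr. Qed.

Lemma mulmatC a : mulmat (io a) = a%:M.
Proof. by rewrite -[io a]mulr1 mulmatZ mulmat1 scalemx1. Qed.

Lemma mulmatD z z' : mulmat (z + z') = mulmat z + mulmat z'.
Proof. by apply: mulmatP => y; rewrite mulrDl coord_inD !coord_inM mulmxDr. Qed.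

Lemma mulmatB z z' : mulmat (z - z') = mulmat z - mulmat z'.
Proof.
rewrite mulmatD; congr (_ + _).
by rewrite -mulN1r -(rmorphN1 io) mulmatZ scaleN1r.
Qed.

Lemma mulmatV z : z != 0 -> mulmat z^-1 *m mulmat z = 1%:M.
Proof. by move=> z0; rewrite -mulmatM mulVf // mulmat1. Qed.

Lemma fnormM z z' : fnorm (z * z') = fnorm z * fnorm z'.
Proof. by rewrite /fnorm mulmatM det_mulmx. Qed.

Lemma fnorm1 : fnorm 1 = 1. Proof. by rewrite /fnorm mulmat1 det1. Qed.

Lemma fnormC a : fnorm (io a) = a ^+ d. Proof. by rewrite /fnorm mulmatC det_scalar. Qed.

Lemma fnorm_neq0 z : z != 0 -> fnorm z != 0.
Proof.
move=> z0; apply/eqP => h; have : fnorm (z^-1 * z) = 0 by rewrite fnormM h mulr0.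
by rewrite mulVf // fnorm1 => /eqP; rewrite oner_eq0.
Qed.

Lemma fnormV z : fnorm z^-1 = (fnorm z)^-1.
Proof.
have [->|z0] := eqVneq z 0.
  (* For [d = 0] both determinants are empty and equal 1; for [d > 0] the norm of 0 is 0, which is
     its own inverse. *)
  have [d0|] := posnP d; first by rewrite /fnorm; move: (mulmat _) (mulmat _); rewrite d0 => A B; rewrite !det_mx00 invr1.
  by move=> d0; rewrite invr0 -(rmorph0 io) fnormC expr0n gtn_eqF // invr0.
by apply: (mulIf (fnorm_neq0 z0)); rewrite -fnormM !mulVf ?fnorm_neq0 // fnorm1.
Qed.

Lemma fnormX z n : fnorm (z ^+ n) = fnorm z ^+ n.
Proof. by elim: n => [|n IH]; rewrite ?expr0 ?fnorm1 // !exprS fnormM IH. Qed.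

Lemma fnormXz z (n : int) : fnorm (z ^ n) = fnorm z ^ n.
Proof. by case: n => n; rewrite ?NegzE -?exprnN -?exprnP ?fnormV fnormX. Qed.

Lemma fnorm_prod (I : Type) (s : seq I) (f : I -> L) :
  fnorm (\prod_(i <- s) f i) = \prod_(i <- s) fnorm (f i).
Proof. by apply: (big_morph fnorm fnormM fnorm1). Qed.

Lemma ftraceD z z' : ftrace (z + z') = ftrace z + ftrace z'.
Proof. by rewrite /ftrace mulmatD mxtraceD. Qed.

Lemma ftraceZ a z : ftrace (io a * z) = a * ftrace z.
Proof. by rewrite /ftrace mulmatZ mxtraceZ. Qed.

Lemma ftrace_lin c z : ftrace (lin e c * z) = \sum_i c 0 i * ftrace (z * e i).
Proof.
rewrite /lin mulr_suml (big_morph ftrace ftraceD (_ : ftrace 0 = 0)); last first.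
  by rewrite -(mul0r 0) -(rmorph0 io) ftraceZ mul0r.
by apply: eq_bigr => i _; rewrite -mulrA ftraceZ [e i * z]mulrC.
Qed.

Lemma basis_change (e' : 'I_d -> L) (A : 'M[K]_d) :
  A \in unitmx -> (forall i, e' i = lin e (row i A)) -> is_basis e'.
Proof.
move=> uA e'E; have lE c : lin e' c = lin e (c *m A).
  rewrite mulmx_sum_row {1}/lin -[RHS]coord_inK linK.
  rewrite (big_morph (lin e) (id1 := 0) (op1 := +%R)) /=.
  - by apply: eq_bigr => i _; rewrite e'E -[_ *: _]addr0 linP (_ : lin e 0 = 0) ?addr0 // /lin big1 // => j _; rewrite mxE rmorph0 mul0r.
  - by move=> x y; rewrite -[x]scale1r linP rmorph1 mul1r scale1r.
  - by rewrite /lin big1 // => j _; rewrite mxE rmorph0 mul0r.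
split=> [c|y].
  rewrite lE => h; have : c *m A = 0 by apply: lin_inj; rewrite h /lin big1 // => j _; rewrite mxE rmorph0 mul0r.
  by move/(congr1 (mulmx^~ (invmx A))); rewrite mulmxK // mul0mx.
by exists (co y *m invmx A); rewrite lE mulmxKV // coord_inK.
Qed.

End Basis.

Section TwoBases.
Variables (e e' : 'I_d -> L) (he : is_basis e) (he' : is_basis e').

Definition chgmx : 'M[K]_d := \matrix_i coord_in e (e' i).

Lemma coord_chg y : coord_in e y = coord_in e' y *m chgmx.
Proof.
rewrite mulmx_sum_row -[y in LHS](coord_inK he') /lin (coord_in_sum he).
by apply: eq_bigr => i _; rewrite (coord_inZ he) rowK.
Qed.

End TwoBases.

Lemma chgmx_inv e e' : is_basis e -> is_basis e' -> chgmx e e' *m chgmx e' e = 1%:M.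
Proof.
move=> he he'; apply/row_matrixP => i; rewrite row_mul rowK -(coord_chg he' he).
by rewrite (coord_in_e he') rowE mulmx1.
Qed.

Lemma mulmat_chg e e' z : is_basis e -> is_basis e' ->
  mulmat e' z = chgmx e e' *m mulmat e z *m chgmx e' e.
Proof.
move=> he he'; apply: (mulmatP he') => y.
rewrite (coord_chg he' he) (coord_inM he) (coord_chg he he') !mulmxA.
by [].
Qed.

Lemma fnorm_chg e e' z : is_basis e -> is_basis e' -> fnorm e' z = fnorm e z.
Proof.
move=> he he'; rewrite /fnorm (mulmat_chg _ he he') !det_mulmx mulrAC -det_mulmx.
by rewrite chgmx_inv // det1 mul1r.
Qed.

Lemma ftrace_chg e e' z : is_basis e -> is_basis e' -> ftrace e' z = ftrace e z.
Proof.
move=> he he'; rewrite /ftrace (mulmat_chg _ he he') mxtrace_mulC mulmxA.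
by rewrite chgmx_inv // mul1mx.
Qed.

End FiniteExtension.

Lemma ker_nontrivial (F : fieldType) (m k : nat) (M : 'M[F]_(m, k)) :
  (k < m)%N -> exists2 c : 'rV_m, c != 0 & c *m M = 0.
Proof.
move=> km; have : kermx M != 0.
  rewrite -mxrank_eq0 mxrank_ker subn_eq0 -ltnNge.
  by apply: leq_ltn_trans km; exact: rank_leq_col.
by move=> /rowV0Pn[v /sub_kermxP vM v0]; exists v.
Qed.

(** Write [A = U *m V] with inner size the rank; cancelling [U] on the left and [V] on the right of
    [A *m A = A] gives [V *m U = 1], and the trace is cyclic. In characteristic 0 a nonzero
    idempotent thus has nonzero trace. *)
Lemma tr_idempotent (F : fieldType) (n : nat) (A : 'M[F]_n) :
  A *m A = A -> \tr A = (\rank A)%:R.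
Proof.
have := mulmx_base A; have /row_freeP := row_base_free A.
have : exists X, X *m col_base A = 1%:M by apply/row_fullP; exact: col_base_full.
move: (col_base A) (row_base A) => U V [X XU] [Y VY] {1 2 3 4}<- E.
have VU : V *m U = 1%:M.
  have := congr1 (fun B => X *m B *m Y) E.
  by rewrite !mulmxA XU mul1mx -!mulmxA VY mulmx1.
by rewrite mxtrace_mulC VU mxtrace1.
Qed.

(** All eigenvalues vanish, so the characteristic polynomial, split over the algebraically closed
    field, is a power of the variable; its subleading coefficient is minus the trace. *)
Lemma tr_nilpotent (F : closedFieldType) (n k : nat) (A : 'M[F]_n.+1) :
  A ^+ k = 0 -> \tr A = 0.
Proof.
move=> Ak; have [s sE] := closed_field_poly_normal (char_poly A).
have sr x : x \in s -> x = 0.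
  move=> xs; have : root (char_poly A) x.
    by rewrite sE (monicP (char_poly_monic A)) scale1r root_prod_XsubC.
  rewrite -eigenvalue_root_char => /eigenvalueP[v vA v0].
  have h j : v *m (A ^+ j) = x ^+ j *: v.
    elim: j => [|j IH]; first by rewrite !expr0 mulmx1 scale1r.
    by rewrite exprSr -mulmxE mulmxA IH -scalemxAl vA scalerA exprSr.
  move: (h k); rewrite Ak mulmx0 => /esym/eqP; rewrite scaler_eq0 (negPf v0) orbF.
  by rewrite expf_eq0 => /andP[_ /eqP].
have cA : char_poly A = 'X^(n.+1).
  have ss : size s = n.+1.
    have := size_char_poly A; rewrite sE (monicP (char_poly_monic A)) scale1r.
    by rewrite size_prod_XsubC => -[].
  rewrite sE (monicP (char_poly_monic A)) scale1r -ss.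
  elim: s sr {sE ss} => [|x s IH] sr; first by rewrite big_nil expr0.
  rewrite big_cons IH => [|y ys]; last by apply: sr; rewrite inE ys orbT.
  by rewrite (sr x) ?mem_head // subr0 -exprS.
have := char_poly_trace A (ltn0Sn n); rewrite cA coefXn /= ltn_eqF // => /esym/eqP.
by rewrite oppr_eq0 => /eqP.
Qed.

Lemma seq_dec (T : eqType) (s : seq T) : s = [::] \/ exists x, x \in s.
Proof. by case: s => [|x s]; [left | right; exists x; rewrite mem_head]. Qed.

(** * Simultaneous approximation at finitely many points *)

Section Approximation.
Variables (C : fieldType) (Y : curve C) (hY : regular_curve Y).
Variable (qs : seq (pt Y)).
Implicit Types (q : pt Y) (x y z : fld Y).

Definition separating := forall q, q \in qs -> exists w : fld Y,
  [/\ forall q', q' \in qs -> loc q' w, loc_unit q w &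
      forall q', q' \in qs -> q' != q -> loc_max q' w].

Definition semiloc x := forall q, q \in qs -> loc q x.

Variables (uqs : uniq qs) (sep : separating).

(** Separating functions are turned into functions that are 1 at one point and 0 at the others to
    first order, then sharpened to any order: approximate idempotents of the semilocal ring. *)
Lemma idem_approx q (N : nat) : q \in qs -> exists h,
  [/\ semiloc h, vge q N%:Z (1 - h) &
      forall q', q' \in qs -> q' != q -> vge q' N%:Z h].
Proof.
move=> qqs.
have /choice[w wP] : forall q0, exists w0, q0 \in qs ->
  [/\ forall q', q' \in qs -> loc q' w0, loc_unit q0 w0 &
      forall q', q' \in qs -> q' != q0 -> loc_max q' w0].
  by move=> q0; case: (boolP (q0 \in qs)) => [/sep[w wP]|_]; [exists w | exists 0].
(* At each point all summands but one vanish, so [s] is a unit along [qs] and [w q / s] is congruent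
   to 1 at [q]. *)
pose s := \sum_(q0 <- qs) w q0.
have sw q0 : q0 \in qs -> loc_max q0 (s - w q0).
  move=> q0s; rewrite /s (bigD1_seq q0) //= addrAC subrr add0r big_seq_cond.
  apply/(loc_maxP hY)/(vge_sum hY) => q1 /andP[q1s q10]; apply/(loc_maxP hY).
  by case: (wP _ q1s) => _ _; apply; rewrite // eq_sym.
have su q0 : q0 \in qs -> loc_unit q0 s.
  move=> q0s; have [wl wu _] := wP _ q0s; have sl : loc q0 s.
    by rewrite -(subrK (w q0) s); apply: locD => //; [case: (sw _ q0s) | case: wu].
  apply/(value_unit hY sl); rewrite -(subrK (w q0) s) (valueD hY); last first.
    by case: wu.
    by case: (sw _ q0s).
  have /(value_eq0 hY) -> := sw _ q0s; last by case: (sw _ q0s).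
  by rewrite add0r; apply/(value_unit hY) => //; case: wu.
have [wl wu wm] := wP _ qqs.
have s0 : s != 0 by case: (su _ qqs).
pose ep := w q / s.
have epl : semiloc ep by move=> q' q's; apply: (locM hY); [exact: wl | case: (su _ q's)].
have ep1 : vge q 1 (1 - ep).
  rewrite -(divff s0) -mulrBl mulrC; apply: vge_locM => //.
    by case: (su _ qqs).
  exact/(loc_maxP hY)/sw.
have ep0 q' : q' \in qs -> q' != q -> vge q' 1 ep.
  move=> q's q'q; rewrite /ep mulrC; apply: vge_locM => //; first by case: (su _ q's).
  by apply/(loc_maxP hY)/wm.
(* The polynomial $1-(1-x^{N+1})^{N+1}$ is divisible by $x^{N+1}$, and its difference with 1 by
   $(1-x)^{N+1}$; so it raises both first-order congruences to order N+1. *)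
exists (1 - (1 - ep ^+ N.+1) ^+ N.+1); split=> [q' q's|| q' q's q'q].
- apply: (locB hY); first exact: (loc1 hY).
  apply: (locX hY); apply: (locB hY); first exact: (loc1 hY).
  by apply: (locX hY); exact: epl.
- rewrite opprB addrC subrK.
  apply: (@vgeW _ _ q N.+1%:Z); first by rewrite lez_nat.
  rewrite -[N.+1%:Z]natz; apply: (vgeX hY).
  rewrite -opprB subrX1 vgeN // mulrC -opprB mulrN vgeN //; apply: vge_locM => //.
  by apply: (loc_sum hY) => i _; apply: (locX hY); exact: epl.
- rewrite -opprB subrX1 vgeN // mulrC; apply: vge_locM => //.
    apply: (loc_sum hY) => i _; apply: (locX hY); apply: (locB hY); first exact: (loc1 hY).
    by apply: (locX hY); exact: epl.
  rewrite addrAC subrr add0r vgeN //.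
  apply: (@vgeW _ _ q' N.+1%:Z); first by rewrite lez_nat.
  by rewrite -[N.+1%:Z]natz; apply: (vgeX hY); exact: ep0.
Qed.

(** Each target is multiplied by an approximate idempotent of precision [M], chosen so that [N - M]
    bounds the orders of all targets from below; then every error term has order at least [N]. *)
Lemma approx (y : pt Y -> fld Y) (N : int) :
  exists z, forall q, q \in qs -> vge q N (z - y q).
Proof.
have [M MP] : exists M : nat, forall q q', q \in qs -> q' \in qs -> N - M%:Z <= ord q (y q').
  exists (`|N| + \sum_(q <- qs) \sum_(q' <- qs) `|ord q (y q')|)%N => q q' qs1 q's.
  rewrite PoszD; have h1 : N - `|N|%N%:Z <= 0 by have := ler_norm N; rewrite abszE; lia.
  have h2 : (`|ord q (y q')| <= \sum_(q <- qs) \sum_(q' <- qs) `|ord q (y q')|)%N.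
    rewrite (bigD1_seq q) //= (bigD1_seq q') //=.
    by rewrite -addnA leq_addr.
  have h3 : - (`|ord q (y q')|%N%:Z) <= ord q (y q') by rewrite abszE; lia.
  lia.
have /choice[h hP] : forall q, exists h, q \in qs -> [/\ semiloc h, vge q M%:Z (1 - h) &
      forall q', q' \in qs -> q' != q -> vge q' M%:Z h].
  move=> q; case: (boolP (q \in qs)) => [/(idem_approx M)[h hP]|_]; last by exists 0.
  by exists h.
exists (\sum_(q <- qs) h q * y q) => q qqs.
rewrite (bigD1_seq q) //= addrAC; apply: (vgeD hY).
  have -> : h q * y q - y q = - ((1 - h q) * y q) by ring.
  rewrite vgeN //; apply: (@vgeW _ _ _ (M%:Z + (N - M%:Z))); first by lia.
  by apply: (vgeM hY); [case: (hP _ qqs) | rewrite /vge MP ?orbT].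
rewrite big_seq_cond; apply: (vge_sum hY) => q' /andP[q's q'q].
apply: (@vgeW _ _ _ (M%:Z + (N - M%:Z))); first by lia.
apply: (vgeM hY); last by rewrite /vge MP ?orbT.
by case: (hP _ q's) => _ _; apply => //; rewrite eq_sym.
Qed.

Lemma ex_orders (n : pt Y -> int) :
  exists z, z != 0 /\ forall q, q \in qs -> ord q z = n q.
Proof.
have /choice[t tP] : forall q, exists t, uniformizer q t by exact: rc_ex_uniformizer.
(* One more than every prescribed order, so that the approximation has exactly the order of its
   target. *)
pose N : int := 1 + \sum_(q <- qs) `|n q|.
have [z zP] := approx (fun q => t q ^ n q) N.
have zz q : q \in qs -> z != 0 /\ ord q z = n q.
  move=> qqs; have t0 : t q ^ n q != 0 by rewrite expfz_neq0 // (unif_neq0 (tP q)).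
  have ot : ord q (t q ^ n q) = n q by rewrite (ordXz hY) (ord_unif hY (tP q)) mul1r.
  suff zo : vge q (ord q (t q ^ n q) + 1) (z - t q ^ n q).
    by have := ordD_eq hY t0 zo; rewrite addrC subrK ot.
  rewrite ot; apply: vgeW (zP _ qqs); rewrite /N addrC lerD2l (bigD1_seq q) //=.
  apply: le_trans (ler_norm _) _; rewrite lerDl.
  by rewrite sumr_ge0.
have [qsE|[q0 q0s]] := seq_dec qs.
  by exists 1; split; rewrite ?oner_eq0 // => q; rewrite qsE.
by exists z; split; [case: (zz _ q0s) | move=> q /zz[]].
Qed.

Section Expansion.
Variable (t : pt Y -> fld Y) (tP : forall q, uniformizer q (t q)).

(** The remainder of the $t$-adic expansion: $x=c_0+c_1t+\dots+c_{n-1}t^{n-1}+\rho_nt^n$, where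
    $\rho_n$ is [expansion_rest q n x] and $c_j$ is the value of $\rho_j$. The coefficients $c_j$
    are linear in [x]. *)
Fixpoint expansion_rest q (n : nat) x : fld Y :=
  if n is n'.+1 then
    let y := expansion_rest q n' x in (y - cst Y (value q y)) / t q
  else x.

Lemma expansion_rest_loc q n x : loc q x -> loc q (expansion_rest q n x).
Proof.
move=> xq; elim: n => [//|n IH] /=.
have := valueP hY IH => /(loc_maxP hY)/(vgeE hY _ _ (tP q)).
by rewrite -exprnN expr1.
Qed.

Lemma expansion_restD q n a x b y : loc q x -> loc q y ->
  expansion_rest q n (cst Y a * x + cst Y b * y) =
  cst Y a * expansion_rest q n x + cst Y b * expansion_rest q n y.
Proof.
move=> xq yq; elim: n => [//|n /= ->].
have lx := expansion_rest_loc n xq; have ly := expansion_rest_loc n yq.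
have lc c : loc q (cst Y c) := rc_loc_cst hY q c.
rewrite (valueD hY) ?(valueM hY) ?(value_cst hY) //; try exact: (locM hY).
by rewrite rmorphD !rmorphM /=; field; exact: (unif_neq0 (tP q)).
Qed.

Lemma value_rest_sum q n (m : nat) (c : 'I_m -> C) (v : 'I_m -> fld Y) :
  (forall i, loc q (v i)) ->
  value q (expansion_rest q n (\sum_i cst Y (c i) * v i)) =
  \sum_i c i * value q (expansion_rest q n (v i)).
Proof.
move=> vq; have lc c0 : loc q (cst Y c0) := rc_loc_cst hY q c0.
suff h (s : seq 'I_m) : loc q (\sum_(i <- s) cst Y (c i) * v i) /\
    value q (expansion_rest q n (\sum_(i <- s) cst Y (c i) * v i)) =
    \sum_(i <- s) c i * value q (expansion_rest q n (v i)) by case: (h (index_enum _)).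
elim: s => [|i s [IH1 IH2]].
  rewrite !big_nil; split; first exact: (loc0 hY).
  have := expansion_restD n 0 0 (loc0 hY q) (loc0 hY q).
  by rewrite !mulr0 addr0 rmorph0 !mul0r addr0 => ->; rewrite -(rmorph0 (cst Y)) (value_cst hY).
rewrite !big_cons; split; first by apply: (locD hY) => //; exact: (locM hY).
rewrite -[X in _ + X]mul1r -[X in _ + X * _](rmorph1 (cst Y)) expansion_restD // rmorph1 mul1r.
have l1 := expansion_rest_loc n (vq i); have l2 := expansion_rest_loc n IH1.
by rewrite (valueD hY) // ?(valueM hY) ?(value_cst hY) ?IH2 //; exact: (locM hY).
Qed.

Lemma expansion_vge q n x : loc q x ->
  (forall j, (j < n)%N -> value q (expansion_rest q j x) = 0) -> vge q n%:Z x.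
Proof.
move=> xq; elim: n => [|n IH] h; first exact/(vge_loc hY).
have xE j : (j <= n)%N -> x = expansion_rest q j x * t q ^+ j.
  elim: j => [|j IHj] jn; first by rewrite expr0 mulr1.
  rewrite {1}IHj ?(ltnW jn) //= h ?(ltn_trans jn) // rmorph0 subr0 exprS mulrA.
  by rewrite divfK // (unif_neq0 (tP q)).
rewrite (xE n) // -addn1 PoszD addrC; apply: (vgeM hY).
  by apply/(loc_maxP hY)/(value_eq0 hY); [exact: expansion_rest_loc | exact: h].
rewrite -[n%:Z]natz; apply: (vgeX hY); apply/(loc_maxP hY)/unif_max => //.
Qed.

End Expansion.

(** The vanishing conditions are $\sum_qk_q$ linear forms in [m] constants: the Taylor coefficients
    below order $k_q$ at each [q]. *)
Lemma dependent_mod (k : pt Y -> nat) (m : nat) (v : 'I_m -> fld Y) :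
  (forall i, semiloc (v i)) -> (\sum_(q <- qs) k q < m)%N ->
  exists2 c : 'rV[C]_m, c != 0 &
    forall q, q \in qs -> vge q (k q)%:Z (\sum_i cst Y (c 0 i) * v i).
Proof.
move=> vl km.
have /choice[t tP] : forall q, exists t, uniformizer q t by exact: rc_ex_uniformizer.
pose s := [seq (q, j) | q <- qs, j <- iota 0 (k q)].
have ss : size s = (\sum_(q <- qs) k q)%N.
  rewrite size_allpairs_dep sumnE big_map; apply: eq_bigr => q _.
  by rewrite size_iota.
have [qsE|[q0 _]] := seq_dec qs.
  exists (const_mx 1); last by move=> q; rewrite qsE.
  move: km; rewrite qsE big_nil; case: m v vl => // m v vl _.
  by apply/eqP => /rowP/(_ 0)/eqP; rewrite !mxE oner_eq0.
pose M : 'M[C]_(m, size s) :=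
  \matrix_(i, j) let u := nth (q0, 0%N) s j in value u.1 (expansion_rest t u.1 u.2 (v i)).
have [c c0 cM] : exists2 c : 'rV_m, c != 0 & c *m M = 0 by apply: ker_nontrivial; rewrite ss.
exists c => // q qqs; apply: (expansion_vge tP).
  by apply: (loc_sum hY) => i _; apply: (locM hY); [exact: rc_loc_cst | exact: vl].
move=> j jk; rewrite (value_rest_sum tP) => [|i]; last exact: vl.
have us : (q, j) \in s by apply/allpairsPdep; exists q, j; rewrite mem_iota add0n.
have ui : (index (q, j) s < size s)%N by rewrite index_mem.
have := congr1 (fun B : 'rV_(size s) => B 0 (Ordinal ui)) cM; rewrite !mxE => E; rewrite -[RHS]E.
by apply: eq_bigr => i _; rewrite !mxE /= nth_index.
Qed.

End Approximation.

(** * Matrices over a local ring *)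

Section LocalMatrices.
Variables (C : fieldType) (Y : curve C) (hY : regular_curve Y) (p : pt Y).
Local Notation F := (fld Y).

Definition mxloc m n (A : 'M[F]_(m, n)) := forall i j, loc p (A i j).

Definition mxunit n (A : 'M[F]_n) := mxloc A /\ loc_unit p (\det A).

Lemma mxloc_mul m n k (A : 'M_(m, n)) (B : 'M_(n, k)) :
  mxloc A -> mxloc B -> mxloc (A *m B).
Proof.
by move=> lA lB i j; rewrite mxE; apply: (loc_sum hY) => l _; apply: (locM hY).
Qed.

Lemma mxlocZ m n a (A : 'M_(m, n)) : loc p a -> mxloc A -> mxloc (a *: A).
Proof. by move=> la lA i j; rewrite mxE; apply: (locM hY). Qed.

Lemma loc_det n (A : 'M_n) : mxloc A -> loc p (\det A).
Proof.
move=> lA; rewrite /determinant; apply: (loc_sum hY) => s _.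
apply: (locM hY); last by apply: (loc_prod hY).
by apply: (locX hY); apply: (locN hY); exact: loc1.
Qed.

Lemma loc_trace n (A : 'M_n) : mxloc A -> loc p (\tr A).
Proof. by move=> lA; apply: (loc_sum hY). Qed.

Lemma mxloc_adj n (A : 'M_n) : mxloc A -> mxloc (\adj A).
Proof.
move=> lA i j; rewrite mxE /cofactor; apply: (locM hY).
  by apply: (locX hY); apply: (locN hY); exact: loc1.
by apply: loc_det => k l; rewrite !mxE.
Qed.

Lemma mxunit_unitmx n (A : 'M_n) : mxunit A -> A \in unitmx.
Proof. by move=> [_ [d0 _ _]]; rewrite unitmxE unitfE. Qed.

Lemma mxunit_inv n (A : 'M_n) : mxunit A -> mxloc (invmx A).
Proof.
move=> uA; rewrite /invmx (mxunit_unitmx uA); apply: mxlocZ; first by case: uA => _ [].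
by apply: mxloc_adj; case: uA.
Qed.

Lemma mxunit_pair n (A B : 'M_n) : mxloc A -> mxloc B -> A *m B = 1%:M -> mxunit A.
Proof.
move=> lA lB AB; split=> //; have dd : \det A * \det B = 1 by rewrite -det_mulmx AB det1.
have dA : \det A != 0 by apply: contraTneq isT => d0; move: dd; rewrite d0 mul0r => /esym/eqP; rewrite oner_eq0.
split=> //; first exact: loc_det.
suff -> : (\det A)^-1 = \det B by exact: loc_det.
by apply: (mulfI dA); rewrite divff.
Qed.

Lemma value_sum (I : Type) (s : seq I) (f : I -> F) : (forall i, loc p (f i)) ->
  value p (\sum_(i <- s) f i) = \sum_(i <- s) value p (f i).
Proof.
move=> lf; elim: s => [|i s IH]; first by rewrite !big_nil -(rmorph0 (cst Y)) (value_cst hY).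
by rewrite !big_cons (valueD hY) ?IH //; exact: (loc_sum hY).
Qed.

Lemma map_value_mul m n k (A : 'M_(m, n)) (B : 'M_(n, k)) : mxloc A -> mxloc B ->
  map_mx (value p) (A *m B) = map_mx (value p) A *m map_mx (value p) B.
Proof.
move=> lA lB; apply/matrixP => i j; rewrite !mxE value_sum => [|l]; last exact: (locM hY).
by apply: eq_bigr => l _; rewrite (valueM hY) // !mxE.
Qed.

End LocalMatrices.

(** The semilocal data of a finite map from Y to Z at [a]: [qs] is the fibre and [e] a basis, over
    the local ring of [a], of the functions regular along [qs]. The last clause says at once that
    the [e i] are regular and that their integral combinations exhaust these functions. *)
Record cover_at (C : fieldType) (Z Y : curve C) (io : {rmorphism fld Z -> fld Y})
    (a : pt Z) (qs : seq (pt Y)) (d : nat) (e : 'I_d -> fld Y) : Prop := CoverAt {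
  cv_uniq : uniq qs;
  cv_sep : separating qs;
  cv_loc : forall q x, q \in qs -> loc a x -> loc q (io x);
  cv_max : forall q x, q \in qs -> loc_max a x -> loc_max q (io x);
  cv_cst : forall c, io (cst Z c) = cst Y c;
  cv_basis : is_basis io e;
  cv_semiloc : forall y, semiloc qs y <-> mxloc a (coord_in io e y) }.

(** * Norms and ramification *)

Section Norm.
Variables (C : fieldType) (Z Y : curve C) (hZ : regular_curve Z) (hY : regular_curve Y).
Variables (io : {rmorphism fld Z -> fld Y}) (a : pt Z) (qs : seq (pt Y)).
Variables (d : nat) (e : 'I_d -> fld Y) (cv : cover_at io a qs e).
Variables (t : fld Z) (tt : uniformizer a t).
Let he := cv_basis cv.

Definition ram q := ord q (io t).

Lemma ram_ge1 q : q \in qs -> 1 <= ram q.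
Proof.
move=> qqs; rewrite -vge_ordE ?fmorph_eq0 ?(unif_neq0 tt) //.
by apply/(loc_maxP hY)/(cv_max cv qqs)/unif_max.
Qed.

Lemma semiloc_e i : semiloc qs (e i).
Proof.
apply/(cv_semiloc cv) => i' j; rewrite (coord_in_e he) mxE.
by case: (_ && _); [exact: (loc1 hZ) | exact: (loc0 hZ)].
Qed.

Lemma semilocM x y : semiloc qs x -> semiloc qs y -> semiloc qs (x * y).
Proof. by move=> lx ly q qqs; apply: (locM hY); [exact: lx | exact: ly]. Qed.

Lemma mulmat_loc z : semiloc qs z -> mxloc a (mulmat io e z).
Proof.
move=> lz i j; rewrite mxE.
have /(cv_semiloc cv) h : semiloc qs (z * e i) by apply: semilocM => //; exact: semiloc_e.
exact: (h 0 j).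
Qed.

(** Otherwise some combination $v=\sum c_ie_i$ with constant coefficients, not all 0, vanishes at
    each [q] to the order of [t]. Then $v/t$ is regular along the fibre although one of its
    coordinates $c_i/t$ has a pole at [a]. *)
Lemma sum_ram : d%:Z <= \sum_(q <- qs) ram q.
Proof.
rewrite leNgt; apply/negP => lt_d.
have ramE q : q \in qs -> ram q = (`|ram q|%N)%:Z.
  by move=> /ram_ge1 h; rewrite abszE ger0_norm // (le_trans _ h).
have [||c c0 cP] := @dependent_mod _ _ hY qs (fun q => `|ram q|%N) d e.
- exact: semiloc_e.
- rewrite -ltz_nat; apply: le_lt_trans lt_d; rewrite -natz natr_sum big_seq [leRHS]big_seq.
  by apply: ler_sum => q qqs; rewrite natz -ramE.
have [i ci] : exists i, c 0 i != 0.
  by apply/existsP; apply: contraNT c0 => /existsPn h; apply/eqP/rowP => i; rewrite mxE; apply/eqP/negPn.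
pose v := lin io e (map_mx (cst Z) c).
have : semiloc qs (io t^-1 * v).
  move=> q qqs; apply/(vge_loc hY); have := cP _ qqs; rewrite -ramE //.
  have -> : \sum_i cst Y (c 0 i) * e i = v.
    by apply: eq_bigr => j _; rewrite mxE (cv_cst cv).
  rewrite fmorphV -[0](addNr (ram q)); apply: (vgeM hY); apply: (vgeV hY) => //.
  by rewrite fmorph_eq0 (unif_neq0 tt).
move/(cv_semiloc cv) => /(_ 0 i); rewrite (coord_inZ he) (linK he) !mxE.
move=> h; have : loc_max a (cst Z (c 0 i)).
  have -> : cst Z (c 0 i) = (t^-1 * cst Z (c 0 i)) * t by field; exact: (unif_neq0 tt).
  by apply: (loc_maxMl hZ) => //; exact: (unif_max hZ).
by move/(loc_max_cst hZ)/eqP; apply/negP.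
Qed.

Lemma fnorm_semiloc_unit u : u != 0 -> (forall q, q \in qs -> ord q u = 0) ->
  ord a (fnorm io e u) = 0.
Proof.
move=> u0 ou.
have lu : semiloc qs u by move=> q /ou h; apply/(loc_ord hY) => //; rewrite h.
have lV : semiloc qs u^-1.
  by move=> q /ou h; apply/(loc_ord hY); rewrite ?invr_eq0 // (ordV hY) h oppr0.
apply: (ord_unit hZ); have := mxunit_pair hZ (mulmat_loc lu) (mulmat_loc lV).
by rewrite -(mulmatM he) divff // (mulmat1 he) => /(_ erefl)[].
Qed.

(** If the norm were a unit, the inverse of the multiplication matrix would be integral, and [z]
    would be invertible along the whole fibre. *)
Lemma fnorm_nonunit (z : fld Y) q : z != 0 -> semiloc qs z -> q \in qs -> 0 < ord q z ->
  0 < ord a (fnorm io e z).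
Proof.
move=> z0 lz qqs oz; have N0 := fnorm_neq0 he z0.
have := (loc_ord hZ _ N0).1 (loc_det hZ (mulmat_loc lz)).
rewrite le_eqVlt => /orP[/eqP/esym oN|//]; have uM : mxunit a (mulmat io e z).
  split; first exact: mulmat_loc.
  by apply/(loc_unit_ord hZ); rewrite (fnorm_neq0 he).
have zV : mulmat io e z^-1 = invmx (mulmat io e z).
  by rewrite -[LHS](mulmxK (mxunit_unitmx uM)) (mulmatV he z0) mul1mx.
have : semiloc qs z^-1.
  apply/(cv_semiloc cv); rewrite -[z^-1]mulr1 (coord_inM he) zV.
  apply: (mxloc_mul hZ); last exact: (mxunit_inv hZ).
  by apply/(cv_semiloc cv) => q' _; exact: (loc1 hY).
move=> /(_ _ qqs)/(loc_ord hY); rewrite invr_eq0 => /(_ z0).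
by rewrite (ordV hY) oppr_ge0 leNgt oz.
Qed.

(** Let $n_q$ be the order of the norm of a function with a simple zero at [q] and order 0 elsewhere
    on the fibre. Norms of units along the fibre are units, so the order of a norm is
    $\sum_qn_q\,\mathrm{ord}_q$. For [t] this reads $d=\sum_qe_qn_q$; as $n_q\ge1$ and
    $d\le\sum_qe_q$, every $n_q$ is 1. *)
Lemma ord_fnorm z : z != 0 -> ord a (fnorm io e z) = \sum_(q <- qs) ord q z.
Proof.
have /choice[pi piP] : forall q, exists z : fld Y, z != 0 /\
    forall q', q' \in qs -> ord q' z = (q' == q)%:R.
  by move=> q; exact: (ex_orders hY (cv_uniq cv) (cv_sep cv)).
pose n q := ord a (fnorm io e (pi q)).
have pi0 q : pi q != 0 by case: (piP q).
have piX0 q (k : int) : pi q ^ k != 0 by rewrite expfz_neq0.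
have step y : y != 0 -> ord a (fnorm io e y) = \sum_(q <- qs) ord q y * n q.
  move=> y0; pose w := \prod_(q <- qs) pi q ^ ord q y.
  have w0 : w != 0 by rewrite prodf_seq_neq0; apply/allP => q _; rewrite piX0.
  have ow q : q \in qs -> ord q w = ord q y.
    move=> qqs; rewrite (ord_prod hY) // (bigD1_seq q) ?(cv_uniq cv) //=.
    rewrite (ordXz hY); have [_ ->] := piP q => //; rewrite eqxx mul1r.
    rewrite big_seq_cond big1 ?addr0 // => q' /andP[q's q'q].
    by rewrite (ordXz hY); have [_ ->] := piP q' => //; rewrite eq_sym (negPf q'q) mul0r.
  rewrite -[y in LHS](divfK w0) (fnormM he) (ordM hZ) ?(fnorm_neq0 he) ?mulf_neq0 ?invr_eq0 //.
  rewrite fnorm_semiloc_unit ?mulf_neq0 ?invr_eq0 // => [|q qqs]; last first.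
    by rewrite (ordM hY) ?invr_eq0 // (ordV hY) ow // subrr.
  rewrite add0r (fnorm_prod he) (ord_prod hZ) => [|q]; last by rewrite (fnorm_neq0 he).
  by apply: eq_bigr => q _; rewrite (fnormXz he) (ordXz hZ) mulrC.
have n1 q : q \in qs -> 1 <= n q.
  move=> qqs; rewrite -gtz0_ge1; apply: (fnorm_nonunit (q := q)) => //.
  - by move=> q' q's; apply/(loc_ord hY) => //; have [_ ->] := piP q.
  - by have [_ ->] := piP q => //; rewrite eqxx.
have n_eq1 q : q \in qs -> n q = 1.
  move=> qqs; have := step (io t); rewrite fmorph_eq0 (unif_neq0 tt) => /(_ isT).
  rewrite (fnormC he) (ordX hZ) (ord_unif hZ tt) natz => dE.
  have := sum_ram; rewrite dE -subr_ge0 -sumrB => le0.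
  have : \sum_(q <- qs) (ram q * n q - ram q) = 0.
    apply/eqP; rewrite eq_le -oppr_ge0 -sumrN.
    under eq_bigr do rewrite opprB; rewrite le0 /= big_seq sumr_ge0 // => q' q's.
    by rewrite -{2}[ram q']mulr1 -mulrBr mulr_ge0 ?subr_ge0 ?n1 // (le_trans _ (ram_ge1 q's)).
  move/eqP; rewrite big_seq psumr_eq0 => [/allP/(_ _ qqs)|q' q's]; last first.
    by rewrite -{2}[ram q']mulr1 -mulrBr mulr_ge0 ?subr_ge0 ?n1 // (le_trans _ (ram_ge1 q's)).
  rewrite qqs /= -{2}[ram q]mulr1 -mulrBr mulf_eq0 subr_eq0 => /orP[/eqP h|/eqP //].
  by have := ram_ge1 qqs; rewrite h.
move=> z0; rewrite (step _ z0) !big_seq; apply: eq_bigr => q qqs.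
by rewrite n_eq1 ?mulr1.
Qed.

Lemma sum_ram_eq : \sum_(q <- qs) ram q = d%:Z.
Proof.
rewrite -ord_fnorm ?fmorph_eq0 ?(unif_neq0 tt) // (fnormC he) (ordX hZ).
by rewrite (ord_unif hZ tt) natz.
Qed.

End Norm.

(** * The trace dual of the semilocal ring *)

Section Trace.
Variables (C : numClosedFieldType) (Z Y : curve C) (hZ : regular_curve Z) (hY : regular_curve Y).
Variables (io : {rmorphism fld Z -> fld Y}) (a : pt Z) (qs : seq (pt Y)).
Variables (d : nat) (e : 'I_d -> fld Y) (cv : cover_at io a qs e).
Variables (t : fld Z) (tt : uniformizer a t).
Let he := cv_basis cv.
Local Notation ram := (ram io t).

(** The action of [z] on the fibre algebra $R/tR$, of dimension [d] over C, where $R$ is the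
    semilocal ring. *)
Let vmat z := map_mx (value a) (mulmat io e z).

Lemma ram_bound : exists k : nat, forall q, q \in qs -> ram q <= k%:Z.
Proof.
exists (\sum_(q <- qs) `|ram q|)%N => q qqs; rewrite (bigD1_seq q) ?(cv_uniq cv) //=.
by apply: le_trans (ler_norm _) _; rewrite PoszD -abszE lerDl.
Qed.

Lemma vmat_eq0 z : semiloc qs z -> vmat z = 0 <->
  forall q, q \in qs -> vge q (ram q) z.
Proof.
move=> lz; have lM := mulmat_loc hZ hY cv lz; split=> [h q qqs|h].
  have l1 : semiloc qs (io t^-1 * z).
    apply/(cv_semiloc cv); rewrite (coord_inZ he) -[z]mulr1 (coord_inM he) scalemxAr.
    apply: (mxloc_mul hZ).
      by apply/(cv_semiloc cv) => q' _; exact: (loc1 hY).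
    move=> i j; rewrite mxE; have /(value_eq0 hZ (lM i j)) hm : value a (mulmat io e z i j) = 0.
      by have := congr1 (fun A : 'M_d => A i j) h; rewrite /vmat [LHS]mxE [RHS]mxE.
    have := (loc_maxP hZ _ _).1 hm => /(vgeE hZ _ _ tt).
    by rewrite mulrC -exprnN expr1.
  have := l1 _ qqs => /(vge_loc hY) l2.
  have -> : z = io t * (io t^-1 * z) by rewrite mulrA -rmorphM divff ?rmorph1 ?mul1r // (unif_neq0 tt).
  by rewrite -[X in vge _ X]addr0; apply: (vgeM hY) => //; exact: vge_ord.
have l1 : semiloc qs (io t^-1 * z).
  move=> q qqs; apply/(vge_loc hY); rewrite fmorphV -(addNr (ram q)).
  by apply: (vgeM hY); [apply: (vgeV hY); rewrite // fmorph_eq0 (unif_neq0 tt) | exact: h].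
apply/matrixP => i j; rewrite [LHS]mxE [RHS]mxE; apply/(value_eq0 hZ); first exact: lM.
have -> : mulmat io e z i j = mulmat io e (io t^-1 * z) i j * t.
  by rewrite (mulmatZ he) [X in _ = X * _]mxE mulrAC mulVf ?mul1r // (unif_neq0 tt).
apply: (loc_maxMl hZ); last exact: (unif_max hZ).
exact: (mulmat_loc hZ hY cv).
Qed.

Lemma vmatM z z' : semiloc qs z -> semiloc qs z' -> vmat (z * z') = vmat z *m vmat z'.
Proof.
move=> lz lz'; rewrite /vmat (mulmatM he) (map_value_mul hZ) //;
  exact: (mulmat_loc hZ hY cv).
Qed.

Lemma vmat_congr z z' : semiloc qs z -> semiloc qs z' ->
  (forall q, q \in qs -> vge q (ram q) (z - z')) -> vmat z = vmat z'.
Proof.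
move=> lz lz' h; have lB : semiloc qs (z - z').
  by move=> q qqs; apply: (locB hY); [exact: lz | exact: lz'].
have := (vmat_eq0 lB).2 h => /matrixP E; apply/matrixP => i j.
have l1 := mulmat_loc hZ hY cv lz i j; have l2 := mulmat_loc hZ hY cv lz' i j.
have := E i j; rewrite [vmat _ _ _]mxE [vmat z i j]mxE [vmat z' i j]mxE [X in _ = X -> _]mxE.
have -> : mulmat io e (z - z') i j = mulmat io e z i j + - mulmat io e z' i j.
  by rewrite (mulmatB he) [LHS]mxE [X in _ + X = _]mxE.
by rewrite (valueD hZ) ?(valueN hZ) // => [/subr0_eq|]; last exact: (locN hZ).
Qed.

Lemma semilocX z k : semiloc qs z -> semiloc qs (z ^+ k).
Proof. by move=> lz q qqs; apply: (locX hY); exact: lz. Qed.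

Lemma value_ftrace z : semiloc qs z -> value a (ftrace io e z) = \tr (vmat z).
Proof.
move=> lz; rewrite /ftrace /mxtrace (value_sum hZ) => [|i]; last exact: (mulmat_loc hZ hY cv).
by apply: eq_bigr => i _; rewrite [in RHS]mxE.
Qed.

(** A function vanishing along the fibre has a power in $tR$, so it acts nilpotently on $R/tR$. *)
Lemma ftrace_radical z : (forall q, q \in qs -> loc_max q z) -> loc_max a (ftrace io e z).
Proof.
move=> mz; have lz : semiloc qs z by move=> q /mz[].
have lM := mulmat_loc hZ hY cv lz.
apply/(value_eq0 hZ); first exact: (loc_trace hZ).
rewrite value_ftrace //; have [k kP] := ram_bound.
have : vmat (z ^+ k) = 0.
  apply/vmat_eq0; first exact: semilocX.
  move=> q qqs; apply: vgeW (kP _ qqs) _; rewrite -[k%:Z]natz; apply: (vgeX hY).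
  exact/(loc_maxP hY)/mz.
have : forall j, vmat (z ^+ j) = iter j (mulmx (vmat z)) 1%:M.
  elim=> [|j IH]; last by rewrite exprS vmatM ?IH //; exact: semilocX.
  apply/matrixP => i j; rewrite expr0 /vmat (mulmat1 he) !mxE.
  by case: (i == j); rewrite ?(value1 hZ) ?(value0 hZ).
move=> /(_ k) ->; move: (vmat z); clear; case: d => [|d'] A; first by rewrite /mxtrace big_ord0.
move=> h; apply: (@tr_nilpotent _ _ k); rewrite -{}h.
by elim: k => [|k IH]; rewrite ?expr0 //= exprS IH mulmxE.
Qed.

(** The inverse different, with exponent $1-e_q$ because ramification is tame in characteristic 0.
    For such [y], $t\,y\,e_i$ lies in the radical and its trace vanishes at [a]. Conversely, if [y]
    had order at most $-e_q$ at some [q], an approximate idempotent [x] at [q] would be $ty$ times a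
    regular function, so the trace of [x] would vanish at [a], against [tr_idempotent]. *)
Lemma ftrace_dual y :
  (forall q, q \in qs -> vge q (1 - ram q) y) <->
  (forall i, loc a (ftrace io e (y * e i))).
Proof.
have t0 := unif_neq0 tt; have it0 : io t != 0 by rewrite fmorph_eq0.
split=> [h i|h q qqs].
  have : loc_max a (ftrace io e (io t * (y * e i))).
    apply: ftrace_radical => q qqs; apply/(loc_maxP hY).
    have -> : 1 = ram q + (1 - ram q) + 0 by rewrite /=; ring.
    rewrite mulrA; apply: (vgeM hY); last by apply/(vge_loc hY); exact: (semiloc_e hZ cv).
    by apply: (vgeM hY); [exact: vge_ord | exact: h].
  rewrite (ftraceZ he) => /(loc_maxP hZ)/(vgeE hZ _ _ tt).
  by rewrite mulrAC -exprnN expr1 divff // mul1r.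
have {}h b : semiloc qs b -> loc a (ftrace io e (y * b)).
  move=> /(cv_semiloc cv) lb; rewrite -(coord_inK he b) mulrC (ftrace_lin he).
  by apply: (loc_sum hZ) => i _; apply: (locM hZ).
case: (boolP (vge q (1 - ram q) y)) => //; rewrite negb_or -ltNge => /andP[y0 oy].
have [k kP] := ram_bound.
(* [N] dominates the ramification indices, so that [x] is idempotent modulo [t], and the orders of
   $ty$, so that $x/(ty)$ is regular at the other points. *)
pose N := (k + \sum_(q <- qs) `|ord q y|)%N.
have [x [lx x1 x0]] := idem_approx hY (cv_uniq cv) (cv_sep cv) N.+1 qqs.
have ox : ord q x = 0.
  have := @ordD_eq _ _ hY q 1 (x - 1) (oner_neq0 _).
  rewrite (ordv1 hY) (_ : 1 + (x - 1) = x); last by ring.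
  case=> //; rewrite -opprB vgeN //; apply: vgeW x1; rewrite add0r; lia.
have xn0 : x != 0.
  apply/eqP => h0; move: x1; rewrite h0 subr0 vge_ordE ?oner_eq0 // (ordv1 hY); lia.
have Nq q' : q' \in qs -> ram q' + ord q' y <= N%:Z.
  move=> q's; rewrite /N PoszD lerD ?kP //; apply: le_trans (ler_norm _) _.
  by rewrite (bigD1_seq q') ?(cv_uniq cv) //= PoszD -abszE lerDl.
have lb : semiloc qs (x / (io t * y)).
  move=> q' q's; have [->|q'q] := eqVneq q' q.
    apply/(loc_ord hY); first by rewrite mulf_neq0 // invr_eq0 mulf_neq0.
    rewrite (ordM hY) ?invr_eq0 ?mulf_neq0 // (ordV hY) (ordM hY) // ox add0r.
    by rewrite -/(ram q); lia.
  apply/(vge_loc hY); rewrite -(subrr (ord q' (io t * y))); apply: (vgeM hY).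
    apply: vgeW (x0 _ q's q'q); rewrite (ordM hY) //.
    by apply: le_trans (Nq _ q's) _; rewrite lez_nat.
  by apply: (vgeV hY); rewrite // mulf_neq0.
have := h _ lb; have -> : y * (x / (io t * y)) = io t^-1 * x.
  by rewrite fmorphV; field; rewrite y0 it0.
rewrite (ftraceZ he) => ltr; have : loc_max a (ftrace io e x).
  have -> : ftrace io e x = (t^-1 * ftrace io e x) * t by field.
  by apply: (loc_maxMl hZ) => //; exact: (unif_max hZ).
move=> mtr; have := (value_eq0 hZ (proj1 mtr)).2 mtr.
have xx : vmat x *m vmat x = vmat x.
  rewrite -vmatM //; apply: vmat_congr => // [|q' q's]; first exact: (semilocM hY).
  have -> : x * x - x = - (x * (1 - x)) by ring.
  rewrite vgeN //; apply: (@vgeW _ _ _ N.+1%:Z).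
    by apply: le_trans (kP _ q's) _; rewrite lez_nat /N; lia.
  have [->|q'q] := eqVneq q' q; first by apply: (vge_locM hY) => //; exact: lx.
  rewrite mulrC; apply: (vge_locM hY); last exact: x0.
  by apply: (locB hY); [exact: (loc1 hY) | exact: lx].
rewrite value_ftrace // (tr_idempotent xx).
move=> /eqP; rewrite pnatr_eq0 mxrank_eq0 => /eqP/vmat_eq0 => /(_ lx _ qqs).
by rewrite vge_ordE // ox; have := ram_ge1 hZ hY cv tt qqs; lia.
Qed.

End Trace.

(** * The projective line and the embedding of the curve *)

Section RationalSubfield.
Variables (C F : fieldType) (k : {rmorphism C -> F}) (u : F).

Definition peval (P : {poly C}) : F := (map_poly k P).[u].

Lemma peval_is_zmod : zmod_morphism peval.
Proof. by move=> P Q; rewrite /peval rmorphB hornerD hornerN. Qed.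
Lemma peval_is_monoid : monoid_morphism peval.
Proof. by split=> [|P Q]; rewrite /peval ?rmorph1 ?hornerC // rmorphM hornerM. Qed.
HB.instance Definition _ := GRing.isZmodMorphism.Build {poly C} F peval peval_is_zmod.
HB.instance Definition _ := GRing.isMonoidMorphism.Build {poly C} F peval peval_is_monoid.

Lemma pevalM P Q : peval (P * Q) = peval P * peval Q. Proof. exact: rmorphM. Qed.
Lemma pevalB P Q : peval (P - Q) = peval P - peval Q. Proof. exact: rmorphB. Qed.
Lemma peval1 : peval 1 = 1. Proof. exact: rmorph1. Qed.
Lemma peval0 : peval 0 = 0. Proof. exact: rmorph0. Qed.

Lemma pevalC c : peval c%:P = k c.
Proof. by rewrite /peval map_polyC hornerC. Qed.

Lemma pevalX : peval 'X = u.
Proof. by rewrite /peval map_polyX hornerX. Qed.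

(** The field C(u) is realized inside F as a set of quotients, so that its embedding is the
    projection of a subtype. *)
Definition ratpred : pred F := fun x =>
  `[< exists P Q : {poly C}, peval Q != 0 /\ x = peval P / peval Q >].

Lemma ratpredP x : reflect (exists P Q : {poly C}, peval Q != 0 /\ x = peval P / peval Q)
  (x \in ratpred).
Proof. by apply: (iffP idP) => [/asboolP|h]; last exact/asboolP. Qed.

Lemma ratpred_divring : divring_closed ratpred.
Proof.
split=> [|x y|x y].
- by apply/ratpredP; exists 1, 1; rewrite !peval1 oner_eq0 divr1.
- move=> /ratpredP[P [Q [Q0 ->]]] /ratpredP[P' [Q' [Q'0 ->]]]; apply/ratpredP.
  exists (P * Q' - P' * Q), (Q * Q'); rewrite pevalB !pevalM mulf_neq0 //; split=> //.
  by field; rewrite Q0 Q'0.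
- move=> /ratpredP[P [Q [Q0 ->]]] /ratpredP[P' [Q' [Q'0 ->]]]; apply/ratpredP.
  have [P'0|P'0] := eqVneq (peval P') 0.
    by exists 0, 1; rewrite peval1 oner_eq0 P'0 mul0r invr0 mulr0 peval0 mul0r.
  exists (P * Q'), (Q * P'); rewrite !pevalM mulf_neq0 //; split=> //.
  by field; rewrite Q0 P'0 Q'0.
Qed.
HB.instance Definition _ := GRing.isDivringClosed.Build F ratpred ratpred_divring.

Record ratfield := RatField { ratval :> F; ratvalP : ratval \in ratpred }.
HB.instance Definition _ := [isSub for ratval].
HB.instance Definition _ := [Choice of ratfield by <:].
HB.instance Definition _ := [SubChoice_isSubComUnitRing of ratfield by <:].
HB.instance Definition _ := [SubComUnitRing_isSubIntegralDomain of ratfield by <:].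
HB.instance Definition _ := [SubIntegralDomain_isSubField of ratfield by <:].

Definition ratincl : {rmorphism ratfield -> F} := val.

Lemma peval_rat P : peval P \in ratpred.
Proof. by apply/ratpredP; exists P, 1; rewrite rmorph1 oner_eq0 divr1. Qed.

Definition rateval P : ratfield := RatField (peval_rat P).

Lemma rateval_is_zmod : zmod_morphism rateval.
Proof. by move=> P Q; apply: val_inj; rewrite /= rmorphB. Qed.
Lemma rateval_is_monoid : monoid_morphism rateval.
Proof. by split=> [|P Q]; apply: val_inj; rewrite /= ?rmorph1 ?rmorphM. Qed.
HB.instance Definition _ := GRing.isZmodMorphism.Build {poly C} ratfield rateval rateval_is_zmod.
HB.instance Definition _ := GRing.isMonoidMorphism.Build {poly C} ratfield rateval rateval_is_monoid.

Lemma ratinclE P : ratincl (rateval P) = peval P. Proof. by []. Qed.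

Lemma ratP (x : ratfield) : exists P Q : {poly C}, peval Q != 0 /\ x = rateval P / rateval Q.
Proof.
have /ratpredP[P [Q [Q0 E]]] := ratvalP x; exists P, Q; split=> //.
by apply: (fmorph_inj ratincl); rewrite fmorph_div !ratinclE -E.
Qed.

Lemma clear_denominators (p : {poly ratfield}) :
  exists (D : {poly C}) (G : {poly {poly C}}), peval D != 0 /\
    map_poly rateval G = rateval D *: p.
Proof.
elim/poly_ind: p => [|p c [D [G [D0 GE]]]].
  by exists 1, 0; rewrite rmorph1 oner_eq0 rmorph0 scaler0.
have [P [Q [Q0 cE]]] := ratP c.
have rQ0 : rateval Q != 0 by rewrite -(fmorph_eq0 ratincl).
exists (D * Q), (Q *: G * 'X + (P * D)%:P); rewrite pevalM mulf_neq0 //; split=> //.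
have rM P1 P2 : rateval (P1 * P2) = rateval P1 * rateval P2 by exact: rmorphM.
rewrite rmorphD rmorphM /= map_polyX map_polyC /= map_polyZ GE scalerDr !rM scalerA.
rewrite [rateval D * _]mulrC -scalerAl; congr (_ + _).
rewrite -mul_polyC -polyCM cE; congr (_ %:P).
by field.
Qed.

End RationalSubfield.

Section Transcendence.
Variables (C : closedFieldType) (F : fieldType) (k : {rmorphism C -> F}).
Local Notation peval := (peval k).

Lemma peval_neq0 u (P : {poly C}) : (forall c, u <> k c) -> P != 0 -> peval u P != 0.
Proof.
move=> uC P0; have [s PE] := closed_field_poly_normal P.
have lP : k (lead_coef P) != 0 by rewrite fmorph_eq0 lead_coef_eq0.
rewrite PE -mul_polyC rmorphM /= pevalC mulf_neq0 // rmorph_prod prodf_seq_neq0.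
apply/allP => a _; rewrite rmorphB /= pevalC pevalX subr_eq0.
by apply/negP => /eqP/uC.
Qed.

Definition algdep (u x : F) := exists2 G : {poly {poly C}}, G != 0 & (map_poly (peval u) G).[x] = 0.

Lemma horner_rat u (G : {poly {poly C}}) x :
  (map_poly (ratincl k u) (map_poly (rateval k u) G)).[x] = (map_poly (peval u) G).[x].
Proof. by rewrite -map_poly_comp. Qed.

Lemma rateval_inj u (P : {poly C}) : (forall c, u <> k c) -> P != 0 -> rateval k u P != 0.
Proof. by move=> uC P0; rewrite -(fmorph_eq0 (ratincl k u)) /=; exact: peval_neq0. Qed.

Lemma algdep_algebraic u x : (forall c, u <> k c) -> algdep u x ->
  algebraicOver (ratincl k u) x.
Proof.
move=> uC [G G0 Gx]; exists (map_poly (rateval k u) G).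
  rewrite -lead_coef_eq0 lead_coef_map_eq ?rateval_inj ?lead_coef_eq0 //.
by rewrite /root horner_rat Gx.
Qed.

Lemma algebraic_algdep u x : algebraicOver (ratincl k u) x -> algdep u x.
Proof.
move=> [p p0 px]; have [D [G [D0 GE]]] := clear_denominators p.
have rD : rateval k u D != 0 by rewrite -(fmorph_eq0 (ratincl k u)).
exists G; first by apply/eqP => G0; move: GE; rewrite G0 rmorph0 => /esym/eqP; rewrite scaler_eq0 (negPf rD) (negPf p0).
by rewrite -horner_rat GE linearZ /= hornerZ (rootP px) mulr0.
Qed.

Lemma peval2 u x (G : {poly {poly C}}) :
  (map_poly (peval u) G).[x] = (map_poly (map_poly k) G).[x, u].
Proof.
rewrite -[RHS]/(horner_eval u _) -horner_map /= [horner_eval _ _]hornerC.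
by rewrite -map_poly_comp.
Qed.

(** One nonzero polynomial in two variables expresses both dependences. *)
Lemma algdep_swap u x : algdep u x -> algdep x u.
Proof.
move=> [G G0 Gx]; exists (swapXY G); first by rewrite swapXY_eq0.
by rewrite -[RHS]Gx !peval2 -swapXY_map horner2_swapXY.
Qed.

Variable (t0 : F).
Hypothesis t0_tr : forall P : {poly C}, P != 0 -> peval t0 P != 0.
Hypothesis t0_alg : forall x, algdep t0 x.

Lemma tr_notin u : (forall P : {poly C}, P != 0 -> peval u P != 0) -> forall c, u <> k c.
Proof.
move=> h c uc; have := h ('X - c%:P) (negbT (polyXsubC_eq0 _)).
by rewrite pevalB pevalC pevalX uc subrr eqxx.
Qed.

(** Exchange: the relation between [t0] and [u] makes [t0] algebraic over C(u), and [x] is algebraic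
    over C(t0). A nonconstant [u] is transcendental since C is algebraically closed. *)
Lemma algdep_all u x : (forall c, u <> k c) -> algdep u x.
Proof.
move=> uC; apply: algebraic_algdep.
have t0C := tr_notin t0_tr.
have tu : algebraicOver (ratincl k u) t0 by apply: algdep_algebraic => //; exact: algdep_swap.
have [G G0 Gx] := t0_alg x.
apply/integral_algebraic; apply: (integral_root (p := map_poly (peval t0) G)).
- by rewrite -lead_coef_eq0 lead_coef_map_eq ?peval_neq0 ?lead_coef_eq0.
- exact/rootP.
apply/integral_poly => i; rewrite coef_map.
rewrite -[X in integralOver _ X]/((map_poly k G`_i).[t0]).
apply: (integral_horner (p := map_poly k G`_i)); last exact/integral_algebraic.
apply/integral_poly => j; rewrite coef_map.
by have := integral_id (ratincl k u) (rateval k u (G`_i`_j)%:P); rewrite ratinclE pevalC.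
Qed.

Lemma algebraic_all u x : (forall c, u <> k c) -> algebraicOver (ratincl k u) x.
Proof. by move=> uC; apply: algdep_algebraic => //; exact: algdep_all. Qed.

(** A relation with constant coefficient 0 is divisible by the variable, which can be cancelled as
    [x] is nonzero. *)
Lemma algdep_const u x : (forall c, u <> k c) -> x != 0 ->
  exists2 G : {poly {poly C}}, G`_0 != 0 & (map_poly (peval u) G).[x] = 0.
Proof.
move=> uC x0; have [G] := algdep_all x uC.
elim/poly_ind: G => [|G c IH]; first by rewrite eqxx.
have [->|c0 _ h] := eqVneq c 0; last first.
  by exists (G * 'X + c%:P) => //; rewrite coefD coefMX coefC /= add0r.
rewrite addr0 rmorphM /= map_polyX hornerM hornerX => GX /eqP.
rewrite mulf_eq0 (negPf x0) orbF => /eqP; apply: IH.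
by apply: contraNneq GX => ->; rewrite mul0r.
Qed.

End Transcendence.

Section MkRegular.
Variables (C : fieldType) (Y : curve C).
Hypothesis lcst : forall (p : pt Y) c, loc p (cst Y c).
Hypothesis lB : forall (p : pt Y) x y, loc p x -> loc p y -> loc p (x - y).
Hypothesis lM : forall (p : pt Y) x y, loc p x -> loc p y -> loc p (x * y).
Hypothesis lval : forall (p : pt Y) x, loc p x -> exists c, loc_max p (x - cst Y c).
Hypothesis lfrac : forall (p : pt Y) x, exists y z, [/\ loc p y, loc p z, z != 0 & x = y / z].
Hypothesis lfin : forall p : pt Y, exists t, uniformizer p t /\
  forall x, loc p x -> x != 0 -> exists (k : nat) w, loc p w /\ x * w = t ^+ k.

(** Dividing a nonunit by the uniformizer has to stop: by [lfin] the element divides a power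
    [t ^+ k], and each division lowers [k] by one. This takes the place of a Noetherian argument for
    a local ring with principal maximal ideal. *)
Lemma mk_regular : regular_curve Y.
Proof.
split=> // [p|p x x0]; first by have [t [tt _]] := lfin p; exists t.
have l0 : loc p 0 by rewrite -(rmorph0 (cst Y)).
have l1 : loc p 1 by rewrite -(rmorph1 (cst Y)).
have [t [tt fin]] := lfin p; have t0 : t != 0 by case: tt.
have key y : loc p y -> y != 0 -> exists u (n : nat), loc_unit p u /\ y = u * t ^+ n.
  move=> ly y0; have [k [w [lw yw]]] := fin y ly y0.
  elim: k y ly y0 w lw yw => [|k IH] y ly y0 w lw yw.
    exists y, 0%N; rewrite expr0 mulr1; split=> //; split=> //.
    suff -> : y^-1 = w by [].
    by apply: (mulfI y0); rewrite divff // yw expr0.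
  case: (pselect (loc_unit p y)) => [uy|nuy].
    by exists y, 0%N; rewrite expr0 mulr1.
  have [z lz yE] := (tt.2 y).1 (conj ly nuy).
  have z0 : z != 0 by apply: contraNneq y0 => z0; rewrite yE z0 mul0r.
  have zw : z * w = t ^+ k.
    by apply: (mulIf t0); rewrite mulrAC -yE yw exprSr.
  have [u [n [uu zE]]] := IH z lz z0 w lw zw.
  by exists u, n.+1; split=> //; rewrite yE zE exprSr mulrA.
have [y [z [ly lz z0 xE]]] := lfrac p x.
have y0 : y != 0 by apply: contraNneq x0 => y0; rewrite xE y0 mul0r.
have [u [n [[u0 lu luV] yE]]] := key y ly y0; have [v [m [[v0 lv lvV] zE]]] := key z lz z0.
exists t, (u / v), (n%:Z - m%:Z); split=> //.
  split; rewrite ?mulf_neq0 ?invr_eq0 //; first exact: lM.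
  by rewrite invfM invrK; exact: lM.
rewrite xE yE zE expfzDr // -exprnN -exprnP; field.
by rewrite v0 expf_neq0.
Qed.

End MkRegular.

Section Homogeneous.
Variables (C F : fieldType) (k : {rmorphism C -> F}) (N : nat).
Implicit Types (h : 'I_N -> F) (G : {mpoly C[N]}).

Lemma mmap_ind (S : set F) h G :
  (forall c, S (k c)) -> (forall x y, S x -> S y -> S (x + y)) ->
  (forall x y, S x -> S y -> S (x * y)) -> (forall i, S (h i)) -> S (mmap k h G).
Proof.
move=> Sc SD SM Sh; rewrite /mmap; apply: big_ind => //.
  by rewrite -(rmorph0 k).
move=> m _; apply: (SM) => //; rewrite /mmap1; apply: big_ind => // [|i _].
  by rewrite -(rmorph1 k).
elim: (m i) => [|n IH]; first by rewrite expr0 -(rmorph1 k).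
by rewrite exprS; exact: SM.
Qed.

Lemma mmap_var h i : mmap k h 'X_i = h i.
Proof. by rewrite mmapX mmap1U. Qed.

Lemma mmap_cst (a : 'I_N -> C) G : mmap k (fun i => k (a i)) G = k G.@[a].
Proof.
rewrite mevalE /mmap rmorph_sum; apply: eq_bigr => m _.
rewrite rmorphM /mmap1 rmorph_prod; congr (_ * _).
by apply: eq_bigr => i _; rewrite rmorphXn.
Qed.

Lemma mmap_scale d (c : F) h G : G \is d.-homog ->
  mmap k (fun i => c * h i) G = c ^+ d * mmap k h G.
Proof.
move=> /dhomogP hG; rewrite /mmap mulr_sumr big_seq [RHS]big_seq.
apply: eq_bigr => m /hG; move=> <-.
rewrite mulrCA; congr (_ * _); rewrite /mmap1 /mdeg.
rewrite (eq_bigr (fun i => c ^+ m i * h i ^+ m i)) => [|i _]; last by rewrite exprMn.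
by rewrite big_split /= prodrXr mdegE.
Qed.

(* [S] is meant to be an ideal of the subring [R]. *)
Lemma mmap_congr (R S : set F) h (a : 'I_N -> C) G :
  (forall c, R (k c)) -> (forall x y, R x -> R y -> R (x + y)) ->
  (forall x y, R x -> R y -> R (x * y)) -> (forall i, R (h i)) ->
  S 0 -> (forall x y, S x -> S y -> S (x + y)) -> (forall x y, R x -> S y -> S (x * y)) ->
  (forall i, S (h i - k (a i))) -> S (mmap k h G - k G.@[a]).
Proof.
move=> Rc RD RM Rh S0 SD SM Sh.
suff h1 : forall m, S (mmap1 h m - mmap1 (fun i => k (a i)) m).
  rewrite -mmap_cst /mmap -sumrB; apply: big_ind => // m _.
  by rewrite -mulrBr; apply: SM.
move=> m; rewrite /mmap1.
suff [] : R (\prod_(i < N) h i ^+ m i) /\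
   S (\prod_(i < N) h i ^+ m i - \prod_(i < N) k (a i) ^+ m i) by [].
have Rc1 i : R (k (a i) ^+ m i) by rewrite -rmorphXn.
have pw i : R (h i ^+ m i) /\ S (h i ^+ m i - k (a i) ^+ m i).
  elim: (m i) => [|n [IH1 IH2]].
    by rewrite !expr0 subrr; split=> //; rewrite -(rmorph1 k).
  rewrite !exprS; split; first exact: RM.
  have -> : h i * h i ^+ n - k (a i) * k (a i) ^+ n =
     h i * (h i ^+ n - k (a i) ^+ n) + k (a i) ^+ n * (h i - k (a i)) by ring.
  by apply: SD; apply: SM => //; rewrite -rmorphXn.
elim: (index_enum _) => [|i s [IH1 IH2]].
  by rewrite !big_nil subrr; split=> //; rewrite -(rmorph1 k).
rewrite !big_cons; case: (pw i) => p1 p2; split; first exact: RM.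
have -> : forall A B A' B' : F, A * B - A' * B' = A * (B - B') + B' * (A - A') by move=> *; ring.
apply: SD; apply: SM => //; rewrite -(eq_bigr _ (fun i _ => rmorphXn k (m i) (a i))).
by rewrite -rmorph_prod.
Qed.

End Homogeneous.

(** * Places of a function field of one variable *)

Section Places.
Variables (C : closedFieldType) (F : fieldType) (k : {rmorphism C -> F}).
Hypothesis alg : forall u x, (forall c, u <> k c) -> x != 0 ->
  exists2 G : {poly {poly C}}, G`_0 != 0 & (map_poly (peval k u) G).[x] = 0.

Definition subalg (R : set F) := [/\ forall c, R (k c),
  forall x y, R x -> R y -> R (x - y) & forall x y, R x -> R y -> R (x * y)].

Section Subalg.
Variables (R : set F) (hR : subalg R).

Lemma sa0 : R 0. Proof. by rewrite -(rmorph0 k); case: hR. Qed.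
Lemma sa1 : R 1. Proof. by rewrite -(rmorph1 k); case: hR. Qed.
Lemma saB x y : R x -> R y -> R (x - y). Proof. by case: hR => _ + _; exact. Qed.
Lemma saM x y : R x -> R y -> R (x * y). Proof. by case: hR => _ _; exact. Qed.
Lemma saN x : R x -> R (- x). Proof. by move=> Rx; rewrite -sub0r; apply: saB => //; exact: sa0. Qed.
Lemma saD x y : R x -> R y -> R (x + y).
Proof. by move=> Rx Ry; rewrite -[y]opprK; apply: saB => //; exact: saN. Qed.
Lemma saX x n : R x -> R (x ^+ n).
Proof. by move=> Rx; elim: n => [|n IH]; rewrite ?expr0 ?exprS; [exact: sa1 | exact: saM]. Qed.
Lemma sa_sum (I : Type) (s : seq I) (P : pred I) (f : I -> F) :
  (forall i, P i -> R (f i)) -> R (\sum_(i <- s | P i) f i).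
Proof. by move=> h; apply: big_ind => //; [exact: sa0 | exact: saD]. Qed.
Lemma sa_horner (a : {poly F}) x : (forall i, R a`_i) -> R x -> R a.[x].
Proof. by move=> ha Rx; rewrite horner_coef; apply: sa_sum => i _; apply: saM => //; exact: saX. Qed.

Definition adjoin (u : F) : set F := [set x | exists2 a : {poly F}, (forall i, R a`_i) & x = a.[u]].

Lemma adjoin_subalg u : subalg (adjoin u).
Proof.
split=> [c|x y [a ha ->] [b hb ->]|x y [a ha ->] [b hb ->]].
- exists (k c)%:P; last by rewrite hornerC.
  by move=> i; rewrite coefC; case: ifP => _; [case: hR | exact: sa0].
- by exists (a - b); [move=> i; rewrite coefB; exact: saB | rewrite hornerD hornerN].
- exists (a * b); last by rewrite hornerM.
  by move=> i; rewrite coefM; apply: sa_sum => j _; exact: saM.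
Qed.

Lemma adjoin_sub u : R `<=` adjoin u.
Proof.
move=> x Rx; exists x%:P; last by rewrite hornerC.
by move=> i; rewrite coefC; case: ifP => // _; exact: sa0.
Qed.

Lemma adjoin_mem u : adjoin u u.
Proof.
exists 'X; last by rewrite hornerX.
by move=> i; rewrite coefX; case: eqP => _; [exact: sa1 | exact: sa0].
Qed.

Definition sa_unit x := x != 0 /\ R x^-1.

Lemma sa_unitM x y : sa_unit x -> sa_unit y -> sa_unit (x * y).
Proof. by move=> [x0 Rx] [y0 Ry]; split; rewrite ?mulf_neq0 // invfM; exact: saM. Qed.

End Subalg.

Section Maximal.
Variables (z : F) (zC : forall c, z <> k c).

(** Chevalley's construction: a subalgebra maximal among those containing [z] but not its inverse
    turns out to be a valuation ring. *)
Let good (R : set F) := [/\ subalg R, R z & ~ R z^-1].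

Let z0 : z != 0. Proof. by apply/eqP => h; apply: (@zC 0); rewrite h rmorph0. Qed.

Lemma peval_sa R u (P : {poly C}) : subalg R -> R u -> R (peval k u P).
Proof.
by move=> hR Ru; apply: (sa_horner hR) => // i; rewrite coef_map; case: hR => h _ _; exact: h.
Qed.

Lemma good_start : good [set x | exists P : {poly C}, x = peval k z P].
Proof.
split.
- split=> [c|x y [P ->] [Q ->]|x y [P ->] [Q ->]].
  + by exists c%:P; rewrite pevalC.
  + by exists (P - Q); rewrite pevalB.
  + by exists (P * Q); rewrite pevalM.
- by exists 'X; rewrite pevalX.
- move=> [P PE]; have Q0 : 'X * P - 1 != 0.
    by apply/eqP => /polyP/(_ 0%N)/eqP; rewrite coefB coefXM coefC /= sub0r coef0 oppr_eq0 oner_eq0.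
  have := peval_neq0 zC Q0; rewrite pevalB pevalM pevalX -PE divff // peval1 subrr eqxx.
  by [].
Qed.

Lemma ex_maximal : exists R, good R /\ forall R', R `<=` R' -> good R' -> R' `<=` R.
Proof.
have [|A [AP Amax]] := @Zorn_bigcup F [set R | R = set0 \/ good R].
  move=> Fm FP Ftot; have [h|/existsNP[R0 /not_implyP[R0F R0n]]] := pselect (forall R, Fm R -> R = set0).
    by left; rewrite -subset0 => x [R /h ->].
  have g0 : good R0 by case: (FP _ R0F).
  right; split; last first.
  - by move=> [R RF Rz]; case: (FP _ RF) => [R0'|[]//]; rewrite R0' in Rz.
  - by exists R0 => //; case: g0.
  have pick2 x y : (\bigcup_(X in Fm) X) x -> (\bigcup_(X in Fm) X) y ->
      exists R, [/\ Fm R, good R, R x & R y].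
    move=> [R RF Rx] [R' R'F R'y].
    have gR : good R by case: (FP _ RF) => // E; rewrite E in Rx.
    have gR' : good R' by case: (FP _ R'F) => // E; rewrite E in R'y.
    have [RR'|R'R] := Ftot _ _ RF R'F; first by exists R'; split=> //; exact: RR'.
    by exists R; split=> //; exact: R'R.
  split=> [c|x y hx hy|x y hx hy].
  - by exists R0 => //; case: g0 => -[].
  - by have [R [RF [hR _ _] Rx Ry]] := pick2 _ _ hx hy; exists R => //; exact: (saB hR).
  - by have [R [RF [hR _ _] Rx Ry]] := pick2 _ _ hx hy; exists R => //; exact: (saM hR).
case: AP => [A0|gA].
  have := Amax [set x | exists P : {poly C}, x = peval k z P].
  case; last by right; exact: good_start.
  rewrite A0; split=> // h; have := h (peval k z 1); apply; by exists 1.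
exists A; split=> // R' AR' gR'; apply: contrapT => nR'; apply: (Amax R'); last by right.
by split.
Qed.

Variables (R : set F) (gR : good R) (maxR : forall R', R `<=` R' -> good R' -> R' `<=` R).

Let hR : subalg R. Proof. by case: gR. Qed.

Lemma max_adjoin u : ~ R u -> adjoin R u z^-1.
Proof.
move=> nu; apply: contrapT => nz; apply: nu.
apply: (maxR (@adjoin_sub R hR u) _ (adjoin_mem hR u)).
split=> //; first exact: adjoin_subalg.
by apply: adjoin_sub => //; case: gR.
Qed.

(** This puts [z] in the Jacobson radical. If $w=1-zb$ had no inverse in R, maximality would write
    $z^{-1}$ as a polynomial in $w^{-1}$; multiplying by a power of $w$, which is congruent to 1
    modulo $z$, would bring $z^{-1}$ into R. *)
Lemma max_unit b : R b -> sa_unit R (1 - z * b).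
Proof.
move=> Rb; have Rz : R z by case: gR.
have nzV : ~ R z^-1 by case: gR.
have w0 : 1 - z * b != 0.
  rewrite subr_eq0; apply/eqP => h; apply: nzV.
  by suff -> : z^-1 = b by []; apply: (mulfI z0); rewrite divff.
split=> //; apply: contrapT => /max_adjoin[a ha E].
set w := 1 - z * b in w0 E; have Rw : R w by apply: (saB hR); [exact: (sa1 hR) | exact: (saM hR)].
have Rw1 n : exists2 b', R b' & w ^+ n = 1 - z * b'.
  elim: n => [|n [b' Rb' IH]]; first by exists 0; [exact: (sa0 hR) | rewrite expr0 mulr0 subr0].
  exists (b + b' * w); first by apply: (saD hR) => //; exact: (saM hR).
  rewrite exprSr IH; suff : w = 1 - z * b by clearbody w => wE; rewrite wE; ring.
  by [].
have [n [r Rr rE]] : exists n, exists2 r, R r & a.[w^-1] * w ^+ n = r.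
  exists (size a); exists (a.[w^-1] * w ^+ size a) => //.
  rewrite horner_coef mulr_suml; apply: (sa_sum hR) => i _.
  rewrite -mulrA; apply: (saM hR) => //.
  have -> : w^-1 ^+ i * w ^+ size a = w ^+ (size a - i).
    by rewrite -[in w ^+ size a](subnK (ltnW (ltn_ord i))) exprD mulrCA -exprMn mulVf // expr1n mulr1.
  exact: (saX hR).
have [b' Rb' bE] := Rw1 n; apply: nzV.
have -> : z^-1 = r + b'.
  by move: rE; rewrite -E bE mulrBr mulr1 mulrA mulVf // mul1r => <-; rewrite subrK.
exact: (saD hR).
Qed.

(** A bound for the degree of an expression $z^{-1}=a(u)$ over R, multiplied out by [z]. *)
Let rel_deg u (n : nat) := exists a : {poly F},
  [/\ (size a <= n.+1)%N, (forall i, R a`_i) & 1 = z * a.[u]].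

Lemma rel_deg_ex u : ~ R u -> exists n, rel_deg u n.
Proof.
move=> /max_adjoin[a ha E]; exists (size a), a; split=> //.
by rewrite -E divff.
Qed.

(** The relation for $u^{-1}$, times $u^n$, expresses $(1-zb_0)u^n$ as $z$ times a polynomial in $u$
    of degree below $n$; as $1-zb_0$ is a unit, this eliminates the term of degree $n$ from the
    relation for [u]. *)
Lemma rel_deg_lower u n m : (0 < n)%N -> (m <= n)%N -> u != 0 -> rel_deg u n -> rel_deg u^-1 m ->
  rel_deg u n.-1.
Proof.
move=> n0 mn u0 [a [sa ha aE]] [b [sb hb bE]].
have m0 : (0 < m)%N.
  case: m sb {mn} => // sb; case: gR => _ _ []; have := bE.
  rewrite (size1_polyC sb) hornerC => E.
  by suff -> : z^-1 = b`_0 by []; apply: (mulfI z0); rewrite divff.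
have [w0 Rw] := max_unit (hb 0%N); set w := 1 - z * b`_0 in w0 Rw.
pose c : {poly F} := \poly_(i < n) (w^-1 * b`_(n - i)).
have unE : u ^+ n = z * c.[u].
  have E1 : w = z * \sum_(1 <= j < n.+1) b`_j * u^-1 ^+ j.
    rewrite /w {1}bE -mulrBr (horner_coef_wide _ (leq_trans sb _ : (size b <= n.+1)%N)) //.
    by rewrite big_ord_recl expr0 mulr1 /= addrAC subrr add0r big_add1 big_mkord.
  have E2 : w * u ^+ n = z * \sum_(0 <= i < n) b`_(n - i) * u ^+ i.
    rewrite E1 -mulrA mulr_suml big_add1 /= big_nat_rev /= add0n; congr (_ * _).
    apply: eq_big_nat => i /andP[_ ilt]; rewrite -mulrA subnSK //.
    congr (_ * _); rewrite -[in u ^+ n](subnK (ltnW ilt)) exprD.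
    by rewrite mulrA -exprMn mulVf // expr1n mul1r.
  rewrite /c horner_poly -[LHS](mulKf w0) E2 mulrCA big_mkord; congr (_ * _).
  by rewrite mulr_sumr; apply: eq_bigr => i _; rewrite mulrA.
exists (\poly_(i < n) a`_i + (a`_n * z) *: c); split.
- rewrite prednK // (leq_trans (size_polyD _ _)) // geq_max size_poly /=.
  by rewrite (leq_trans (size_scale_leq _ _)) // size_poly.
- move=> i; rewrite coefD coefZ !coef_poly; apply: (saD hR).
    by case: ifP => // _; exact: (sa0 hR).
  apply: (saM hR); first by apply: (saM hR) => //; case: gR.
  by case: ifP => _; [exact: (saM hR) | exact: (sa0 hR)].
- rewrite {1}aE; congr (_ * _); rewrite (horner_coef_wide _ sa) big_ord_recr /=.
  by rewrite hornerD hornerZ horner_poly unE mulrA.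
Qed.

(** If neither is in R, both have relations of minimal degree, and the larger of the two degrees can
    be lowered. *)
Lemma max_valuation u : R u \/ R u^-1.
Proof.
have nz : ~ R z^-1 by case: gR.
have pos v n : rel_deg v n -> (0 < n)%N.
  case: n => // -[a [sa ha aE]]; exfalso; apply: nz; move: aE.
  rewrite (size1_polyC sa) hornerC => E.
  by suff -> : z^-1 = a`_0 by []; apply: (mulfI z0); rewrite divff.
have mini v : ~ R v -> exists2 n, rel_deg v n & forall m, rel_deg v m -> (n <= m)%N.
  move=> /rel_deg_ex h.
  have [n /asboolP hn nmin] := ex_minnP (let: ex_intro n hn := h in ex_intro (fun n => `[< rel_deg v n >]) n (asboolT hn)).
  by exists n => // m hm; apply: nmin; exact/asboolP.
apply: contrapT => /not_orP[nu nuV].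
have u0 : u != 0 by apply/eqP => u0; apply: nu; rewrite u0; exact: (sa0 hR).
have [n hn nmin] := mini _ nu; have [m hm mmin] := mini _ nuV.
have [mn|nm] := leqP m n.
  have := nmin _ (rel_deg_lower (pos _ _ hn) mn u0 hn hm).
  by have := pos _ _ hn; lia.
have hn' : rel_deg (u^-1)^-1 n by rewrite invrK.
have uV0 : u^-1 != 0 by rewrite invr_eq0.
have := mmin _ (rel_deg_lower (pos _ _ hm) (ltnW nm) uV0 hm hn').
by have := pos _ _ hm; lia.
Qed.

(** If every $u-c$ were a unit, so would be all nonzero polynomials in [u], which split over C. An
    algebraic relation between [u] and [z] with constant term $g(u)\ne0$ reads $g(u)=-zs$ with $s$
    in R, and $z^{-1}=-s/g(u)$ would be in R. *)
Lemma max_value u : R u -> exists c, ~ sa_unit R (u - k c).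
Proof.
move=> Ru; apply: contrapT => h.
have hu c : sa_unit R (u - k c) by apply: contrapT => nc; apply: h; exists c.
have uC c : u <> k c by move=> uc; case: (hu c); rewrite uc subrr eqxx.
have [G G0 Gz] := alg uC z0.
have uP (P : {poly C}) : P != 0 -> sa_unit R (peval k u P).
  move=> P0; have [s PE] := closed_field_poly_normal P; rewrite PE -mul_polyC pevalM pevalC.
  apply: (sa_unitM hR).
    split; first by rewrite fmorph_eq0 lead_coef_eq0.
    by rewrite -fmorphV; case: hR.
  elim: s {PE} => [|c s IH]; first by rewrite big_nil peval1; split; rewrite ?oner_eq0 ?invr1 //; exact: (sa1 hR).
  by rewrite big_cons pevalM pevalB pevalC pevalX; apply: (sa_unitM hR).
have [g0 RgV] := uP _ G0; case: gR => _ Rz nz; apply: nz.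
pose s := (map_poly (peval k u) (Poly (behead G))).[z].
have Rs : R s by apply: (sa_horner hR) => // i; rewrite coef_map; exact: peval_sa.
have gE : peval k u G`_0 = - (z * s).
  have GE : G = Poly (behead G) * 'X + (G`_0)%:P.
    apply/polyP => -[|i]; rewrite coefD coefMX coefC /= ?add0r //.
    by rewrite addr0 coef_Poly nth_behead.
  by apply/eqP; rewrite -addr_eq0; move: Gz; rewrite {1}GE rmorphD rmorphM /= map_polyX map_polyC hornerMXaddC /= => <-; rewrite addrC mulrC.
have -> : z^-1 = - s * (peval k u G`_0)^-1.
  have s0 : s != 0 by apply: contraNneq g0 => s0; rewrite gE s0 mulr0 oppr0.
  by rewrite gE invrN mulrN mulNr opprK; field; rewrite z0 s0.
by apply: (saM hR) => //; exact: (saN hR).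
Qed.

End Maximal.

Lemma ex_place z : (forall c, z <> k c) -> exists R : set F,
  [/\ subalg R, R z, ~ R z^-1, forall u, R u \/ R u^-1 &
      forall u, R u -> exists c, ~ sa_unit R (u - k c)].
Proof.
move=> zC; have [R [gR maxR]] := ex_maximal zC; exists R.
case: (gR) => h1 h2 h3; split=> //; first exact: max_valuation.
exact: max_value.
Qed.

End Places.

(** * Local rings and poles on a projective curve *)

Section Projective.
Variables (C : numClosedFieldType) (X : curve C).
Local Notation F := (fld X).
Local Notation k := (cst X).
Variables (N : nat) (f : 'I_N.+1 -> F) (e : pt X -> 'I_N.+1 -> C).
Let on_X (a : 'I_N.+1 -> C) := forall d (G : {mpoly C[N.+1]}), G \is d.-homog ->
  mmap k f G = 0 -> G.@[a] = 0.
Implicit Types (p : pt X) (x y t : F) (c : C).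
Hypothesis generated : forall x : F, exists d (G H : {mpoly C[N.+1]}),
  [/\ G \is d.-homog, H \is d.-homog, mmap k f H != 0 & x = mmap k f G / mmap k f H].
Hypothesis e_on : forall p, (exists i, e p i != 0) /\ on_X (e p).
Hypothesis e_surj : forall a, (exists i, a i != 0) -> on_X a ->
  exists p, exists2 c : C, c != 0 & forall i, a i = c * e p i.
Hypothesis e_inj : forall p p', (exists c : C, forall i, e p i = c * e p' i) -> p = p'.
Hypothesis locE : forall p (x : F), loc p x <-> exists d (G H : {mpoly C[N.+1]}),
  [/\ G \is d.-homog, H \is d.-homog, H.@[e p] != 0 & x = mmap k f G / mmap k f H].
Hypothesis unifE : forall p : pt X, exists t, uniformizer p t.
Variable t0 : F.
Hypothesis t0_tr : forall P : {poly C}, P != 0 -> peval k t0 P != 0.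
Hypothesis t0_alg : forall x, algdep k t0 x.

Let ev := mmap k f.

Let evB G H : ev (G - H) = ev G - ev H. Proof. exact: rmorphB. Qed.
Let evM G H : ev (G * H) = ev G * ev H. Proof. exact: rmorphM. Qed.
Let evZ c G : ev (c *: G) = k c * ev G. Proof. exact: mmapZ. Qed.

Lemma proj_ev_neq0 p d (G : {mpoly C[N.+1]}) : G \is d.-homog -> G.@[e p] != 0 -> ev G != 0.
Proof. by move=> hG G0; apply: contraNneq G0 => /(proj2 (e_on p) _ _ hG) ->. Qed.

Lemma proj_loc_cst p c : loc p (k c).
Proof.
apply/locE; exists 0%N, c%:MP, 1; split; rewrite ?dhomog1 ?meval1 ?oner_eq0 //.
  by rewrite -[c%:MP]mulr1 mul_mpolyC dhomogZ // dhomog1.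
by rewrite rmorph1 divr1 mmapC.
Qed.

Lemma proj_locB p x y : loc p x -> loc p y -> loc p (x - y).
Proof.
move=> /locE[d [G [H [hG hH H0 ->]]]] /locE[d' [G' [H' [hG' hH' H'0 ->]]]]; apply/locE.
exists (d + d')%N, (G * H' - G' * H), (H * H'); split.
- by apply: rpredB; [exact: dhomogM | rewrite addnC; exact: dhomogM].
- exact: dhomogM.
- by rewrite mevalM mulf_neq0.
- have e1 := proj_ev_neq0 hH H0; have e2 := proj_ev_neq0 hH' H'0.
  rewrite -/ev evB !evM; field.
  by rewrite e1 e2.
Qed.

Lemma proj_locM p x y : loc p x -> loc p y -> loc p (x * y).
Proof.
move=> /locE[d [G [H [hG hH H0 ->]]]] /locE[d' [G' [H' [hG' hH' H'0 ->]]]]; apply/locE.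
exists (d + d')%N, (G * G'), (H * H'); split; try exact: dhomogM.
- by rewrite mevalM mulf_neq0.
- have e1 := proj_ev_neq0 hH H0; have e2 := proj_ev_neq0 hH' H'0.
  rewrite -/ev !evM; field.
  by rewrite e1 e2.
Qed.

Lemma proj_max p d (G H : {mpoly C[N.+1]}) : G \is d.-homog -> H \is d.-homog ->
  H.@[e p] != 0 -> loc_max p (ev G / ev H) <-> G.@[e p] = 0.
Proof.
move=> hG hH H0; have l1 : loc p (ev G / ev H) by apply/locE; exists d, G, H.
have eH := proj_ev_neq0 hH H0.
split=> [[_ nu]|G0].
  apply/eqP/negPn/negP => G0; have eG := proj_ev_neq0 hG G0; apply: nu.
  split=> //; first by rewrite mulf_neq0 // invr_eq0.
  by apply/locE; exists d, H, G; split=> //; rewrite invf_div.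
split=> // -[GH0 _ /locE[d' [G' [H' [hG' hH' H'0 E]]]]].
have eH' := proj_ev_neq0 hH' H'0.
(* If the inverse were also regular, say $G'/H'$, the form $GG'-HH'$ would vanish on the curve,
   while its value at [p] is nonzero because $G$ vanishes there. *)
have E0 : mmap k f (G * G' - H * H') = 0.
  apply/eqP; rewrite -/ev evB !evM subr_eq0; apply/eqP.
  have eG : ev G != 0 by apply: contraNneq GH0 => ->; rewrite mul0r.
  have := congr1 (fun x => x * ev H' * ev G) E; rewrite /= divfK //.
  move=> E1; have -> : ev G * ev G' = (ev G / ev H)^-1 * ev H' * ev G by rewrite mulrC; exact: esym E1.
  by field; rewrite eG eH.
have := proj2 (e_on p) (d + d')%N _ _ E0.
rewrite mevalB !mevalM G0 mul0r sub0r => /(_ (rpredB _ _))/eqP.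
by rewrite oppr_eq0 mulf_eq0 (negPf H0) (negPf H'0) !dhomogM // => /(_ isT isT).
Qed.

Lemma proj_value p x : loc p x -> exists c, loc_max p (x - k c).
Proof.
move=> /locE[d [G [H [hG hH H0 ->]]]]; exists (G.@[e p] / H.@[e p]).
have eH := proj_ev_neq0 hH H0.
have -> : mmap k f G / mmap k f H - k (G.@[e p] / H.@[e p]) =
    ev (G - (G.@[e p] / H.@[e p]) *: H) / ev H.
  by rewrite evB evZ mulrBl mulfK.
apply/(proj_max (d := d)) => //; last by rewrite mevalB mevalZ divfK // subrr.
by apply: rpredB => //; exact: dhomogZ.
Qed.

Lemma proj_frac p x : exists y z, [/\ loc p y, loc p z, z != 0 & x = y / z].
Proof.
have [d [G [H [hG hH H0 ->]]]] := generated x.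
have [[i ei] _] := e_on p.
have hX : ('X_i ^+ d : {mpoly C[N.+1]}) \is d.-homog.
  by have := dhomogMn d (_ : 'X_i \is 1.-homog); rewrite mul1n; apply; rewrite dhomogX /= mdeg1.
have X0 : ('X_i ^+ d : {mpoly C[N.+1]}).@[e p] != 0 by rewrite rmorphXn /= mevalXU expf_neq0.
have eX := proj_ev_neq0 hX X0.
exists (ev G / ev ('X_i ^+ d)), (ev H / ev ('X_i ^+ d)); split.
- by apply/locE; exists d, G, ('X_i ^+ d).
- by apply/locE; exists d, H, ('X_i ^+ d).
- by rewrite mulf_neq0 ?invr_eq0.
- by rewrite -/ev; field; rewrite H0 eX.
Qed.

Lemma proj_max_cst p c : loc_max p (k c) -> c = 0.
Proof.
move=> [_ h]; apply/eqP/negPn/negP => c0; apply: h; split; rewrite ?fmorph_eq0 //.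
  exact: proj_loc_cst.
by rewrite -fmorphV; exact: proj_loc_cst.
Qed.

(** An algebraic relation between [x] and [t] with constant term $G_0(t)\ne0$ shows that [x] divides
    $G_0(t)$ in the local ring, and a nonzero polynomial in [t] is a unit times a power of [t]. *)
Lemma proj_fin p t x : uniformizer p t -> loc p x -> x != 0 ->
  exists (n : nat) w, loc p w /\ x * w = t ^+ n.
Proof.
move=> tt lx x0; have [t_0 tP] := tt.
have l0 : loc p 0 by rewrite -(rmorph0 k); exact: proj_loc_cst.
have l1 : loc p 1 by rewrite -(rmorph1 k); exact: proj_loc_cst.
have lN y : loc p y -> loc p (- y) by move=> ly; rewrite -sub0r; exact: proj_locB.
have lD y z : loc p y -> loc p z -> loc p (y + z).
  by move=> ly lz; rewrite -[z]opprK; apply: proj_locB => //; exact: lN.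
have tm : loc_max p t by apply/tP; exists 1; rewrite ?mul1r.
have lt : loc p t by case: tm.
have tC c : t <> k c.
  by move=> tc; move: tm t_0; rewrite tc => /proj_max_cst ->; rewrite rmorph0 eqxx.
have lp P : loc p (peval k t P).
  elim/poly_ind: P => [|P c IH]; first by rewrite peval0.
  by rewrite /peval rmorphD rmorphM /= map_polyX map_polyC hornerMXaddC; apply: lD; [exact: proj_locM | exact: proj_loc_cst].
have [G G0 Gx] := algdep_const t0_tr t0_alg tC x0.
have Gs : exists2 s, loc p s & peval k t G`_0 = x * s.
  have -> : peval k t G`_0 = - (x * (map_poly (peval k t) (Poly (behead G))).[x]).
    have GE : G = Poly (behead G) * 'X + (G`_0)%:P.
      apply/polyP => -[|i]; rewrite coefD coefMX coefC /= ?add0r //.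
      by rewrite addr0 coef_Poly nth_behead.
    by apply/eqP; rewrite -addr_eq0; move: Gx; rewrite {1}GE rmorphD rmorphM /= map_polyX map_polyC hornerMXaddC /= => <-; rewrite addrC mulrC.
  exists (- (map_poly (peval k t) (Poly (behead G))).[x]); last by rewrite mulrN.
  apply: lN; rewrite horner_coef; apply: big_ind => // i _; apply: proj_locM.
    by rewrite coef_map; exact: lp.
  by elim: (nat_of_ord i) => [|n IH]; rewrite ?expr0 // exprS; exact: proj_locM.
have [s ls sE] := Gs.
have : exists (n : nat) (u : F), loc_unit p u /\ peval k t G`_0 = u * t ^+ n.
  elim/poly_ind: (G`_0) G0 => [|P c IH]; first by rewrite eqxx.
  have [->|c0 _] := eqVneq c 0.
    rewrite addr0 => PX; have [|n [u [uu E]]] := IH; first by apply: contraNneq PX => ->; rewrite mul0r.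
    by exists n.+1, u; split=> //; rewrite pevalM pevalX E exprSr mulrA.
  exists 0%N, (peval k t (P * 'X + c%:P)); rewrite expr0 mulr1; split=> //.
  apply: contrapT => nu; have mu : loc_max p (peval k t (P * 'X + c%:P)) by split=> //; exact: lp.
  have /tP[y ly yE] := mu.
  have /proj_max_cst : loc_max p (k c).
    apply/tP; exists (y - peval k t P); first exact: proj_locB.
    by rewrite mulrBl -yE /peval rmorphD rmorphM /= map_polyX map_polyC hornerMXaddC addrAC subrr add0r.
  by move/eqP; apply/negP.
move=> [n [u [[u0 lu luV] E]]]; exists n, (s / u); split; first exact: proj_locM.
by rewrite mulrA -sE E mulrAC divff // mul1r.
Qed.

Lemma proj_regular : regular_curve X.
Proof.
apply: mk_regular; [exact: proj_loc_cst | exact: proj_locB | exact: proj_locM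
  | exact: proj_value | exact: proj_frac |].
by move=> p; have [t tt] := unifE p; exists t; split=> // x; exact: proj_fin.
Qed.

Lemma proj_separating (qs : seq (pt X)) : separating qs.
Proof.
have hX i : ('X_i : {mpoly C[N.+1]}) \is 1.-homog by rewrite dhomogX /= mdeg1.
(* The linear forms with coefficients $1,s,s^2,\dots$: at each point of [qs] the value is a nonzero
   polynomial in [s], so a single [s] avoids all zeros. *)
have [s sP] : exists s : C, forall q, q \in qs -> \sum_i e q i * s ^+ i != 0.
  have P0 : \prod_(q <- qs) \poly_(i < N.+1) e q (inord i) != 0.
    rewrite prodf_seq_neq0; apply/allP => q _ /=.
    have [[i ei] _] := e_on q; apply: contraNneq ei => /polyP/(_ i).
    by rewrite coef_poly ltn_ord coef0 inord_val => ->.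
  have /closed_nonrootP[s sP] := P0; exists s => q qqs.
  apply: contra sP => /eqP E; rewrite rootE horner_prod; rewrite prodf_seq_eq0; apply/hasP.
  exists q => //=; rewrite horner_poly -[X in _ == X]E; apply/eqP.
  by apply: eq_bigr => i _; rewrite inord_val.
pose H : {mpoly C[N.+1]} := \sum_(i < N.+1) s ^+ i *: 'X_i.
have hH : H \is 1.-homog by apply: rpred_sum => i _; apply: dhomogZ; exact: hX.
have H0 q : q \in qs -> H.@[e q] != 0.
  move=> qqs; rewrite /H raddf_sum /=.
  by under eq_bigr do rewrite mevalZ mevalXU mulrC; exact: sP.
have pair q q' : q' != q -> exists L : {mpoly C[N.+1]}, [/\ L \is 1.-homog, L.@[e q] != 0 & L.@[e q'] = 0].
  move=> q'q; have [[i ei] _] := e_on q'.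
  have [j ej] : exists j, e q j * e q' i - e q i * e q' j != 0.
    apply: contrapT => h; case/eqP: q'q; apply/esym/e_inj; exists (e q i / e q' i) => j.
    have : ~~ (e q j * e q' i - e q i * e q' j != 0) by apply/negP => h1; apply: h; exists j.
    by rewrite negbK subr_eq0 => /eqP E; apply: (mulIf ei); rewrite E; field.
  exists (e q' i *: 'X_j - e q' j *: 'X_i); split.
  - by apply: rpredB; apply: dhomogZ; exact: hX.
  - by rewrite mevalB !mevalZ !mevalXU mulrC [e q' j * _]mulrC.
  - by rewrite mevalB !mevalZ !mevalXU mulrC subrr.
move=> q qqs.
have /choice[L LP] : forall q', exists L : {mpoly C[N.+1]},
    q' != q -> [/\ L \is 1.-homog, L.@[e q] != 0 & L.@[e q'] = 0].
  move=> q'; case: (boolP (q' == q)) => [_|/(pair q)[L LP]]; first by exists 0.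
  by exists L.
have lq q' q1 : q' != q -> q1 \in qs -> loc q1 (ev (L q') / ev H).
  by move=> q'q q1s; apply/locE; exists 1%N, (L q'), H; case: (LP _ q'q); split=> //; exact: H0.
have hl := proj_regular.
exists (\prod_(q' <- qs | q' != q) (ev (L q') / ev H)); split.
- by move=> q1 q1s; apply: (loc_prod hl) => q' q'q; exact: lq.
- apply: big_ind => [|x y|q' q'q]; [exact: (loc_unit1 hl) | exact: (loc_unitM hl) |].
  have [h1 h2 h3] := LP _ q'q; apply: contrapT => nu.
  have : loc_max q (ev (L q') / ev H) by split=> //; exact: lq.
  by move/(proj_max h1 hH (H0 _ qqs))/eqP; apply/negP.
- move=> q1 q1s q1q; rewrite (big_rem q1) //= q1q mulrC; apply: (loc_maxMl hl).
    by apply: (loc_prod hl) => q' q'q; exact: lq.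
  by have [h1 h2 h3] := LP _ q1q; apply/(proj_max h1 hH (H0 _ q1s)).
Qed.

(** A place with $y^{-1}$ but not $y$ in its ring R has a centre on the curve: dividing by a
    coordinate of least valuation, all ratios $f_j/f_i$ lie in R and their residues are homogeneous
    coordinates of a point [p]. Fractions regular at [p] lie in R, so [y] is not regular there. *)
Lemma proj_pole y : (forall c, y <> k c) -> exists p, ~ loc p y.
Proof.
move=> yC; have zC c : y^-1 <> k c.
  by move=> h; apply: (yC c^-1); rewrite fmorphV -h invrK.
have alg u x : (forall c, u <> k c) -> x != 0 ->
    exists2 G : {poly {poly C}}, G`_0 != 0 & (map_poly (peval k u) G).[x] = 0.
  exact: (algdep_const t0_tr t0_alg).
have [R [hR Rz nRy val res]] := ex_place alg zC; rewrite invrK in nRy.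
have [i0 fi0] : exists i, f i != 0.
  apply: contrapT => h; have f0 : f = fun _ => k 0.
    apply/funext => i; rewrite rmorph0; apply/eqP/negPn/negP => fi; apply: h; by exists i.
  have [d [G [H [_ _ _ E]]]] := generated y.
  apply: (yC (G.@[fun=> 0] / H.@[fun=> 0])).
  by rewrite E f0 !mmap_cst fmorph_div.
have [i fi Rf] : exists2 i, f i != 0 & forall j, R (f j / f i).
  suff h (s : seq 'I_N.+1) : exists2 i, f i != 0 & forall j, j \in s -> R (f j / f i).
    by have [i fi Rf] := h (enum 'I_N.+1); exists i => // j; apply: Rf; rewrite mem_enum.
  elim: s => [|j s [i fi Rf]]; first by exists i0.
  have [fj|fj] := eqVneq (f j) 0.
    exists i => // l; rewrite inE => /predU1P[->|/Rf//]; rewrite fj mul0r; exact: (sa0 hR).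
  have [Rji|Rij] := val (f j / f i).
    by exists i => // l; rewrite inE => /predU1P[->|/Rf].
  exists j => // l; rewrite inE => /predU1P[->|/Rf Rl].
    by rewrite divff //; exact: (sa1 hR).
  have -> : f l / f j = (f l / f i) * (f j / f i)^-1 by field; rewrite fi fj.
  exact: (saM hR).
pose S : set F := [set x | R x /\ ~ sa_unit R x].
have S0 : S 0 by split; [exact: (sa0 hR) | case; rewrite eqxx].
have SM r x : R r -> S x -> S (r * x).
  move=> Rr [Rx nx]; split; first exact: (saM hR).
  move=> [rx0 Rrx]; apply: nx; move: rx0; rewrite mulf_eq0 => /norP[r0 x0]; split=> //.
  have -> : x^-1 = r * (r * x)^-1 by field; rewrite r0 x0.
  exact: (saM hR).
have SD x1 x2 : S x1 -> S x2 -> S (x1 + x2).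
  move=> S1 S2; have [->|x10] := eqVneq x1 0; first by rewrite add0r.
  have [->|x20] := eqVneq x2 0; first by rewrite addr0.
  have [h|h] := val (x1 / x2).
    have -> : x1 + x2 = (x1 / x2 + 1) * x2 by field.
    by apply: SM => //; apply: (saD hR) => //; exact: (sa1 hR).
  have -> : x1 + x2 = (1 + (x1 / x2)^-1) * x1 by field; rewrite x10 x20.
  by apply: SM => //; apply: (saD hR) => //; exact: (sa1 hR).
have Sc c : S (k c) -> c = 0.
  move=> [_ nu]; apply/eqP/negPn/negP => c0; apply: nu; split; rewrite ?fmorph_eq0 //.
  by rewrite -fmorphV; case: hR.
have /choice[a aP] : forall j, exists c, ~ sa_unit R (f j / f i - k c) by move=> j; exact: res.
have Sa j : S (f j / f i - k (a j)).
  by split; [apply: (saB hR) => //; case: hR | exact: aP].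
have cong G : S (mmap k (fun j => f j / f i) G - k G.@[a]).
  apply: (mmap_congr (R := R)) => //; [by case: hR | exact: (saD hR) | exact: (saM hR)].
have sc d (Q : {mpoly C[N.+1]}) : Q \is d.-homog -> mmap k f Q = f i ^+ d * mmap k (fun j => f j / f i) Q.
  move=> hQ; rewrite -(mmap_scale k (f i) _ hQ) /mmap; apply: eq_bigr => m _.
  by congr (_ * _); rewrite /mmap1; apply: eq_bigr => j _; rewrite mulrC divfK.
have ai : a i = 1.
  have := Sa i; rewrite divff // -(rmorph1 k) -rmorphB => /Sc/eqP.
  by rewrite subr_eq0 => /eqP.
have ona : on_X a.
  move=> d G hG; rewrite (sc d) // => /eqP; rewrite mulf_eq0 expf_eq0 (negPf fi) andbF /= => /eqP G0.
  have := cong G; rewrite G0 sub0r -rmorphN => /Sc/eqP; rewrite oppr_eq0 => /eqP.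
  by [].
have a0 : exists i, a i != 0 by exists i; rewrite ai oner_eq0.
have [p [c c0 aE]] := e_surj a0 ona.
exists p => /locE[d [G [H [hG hH H0 E]]]]; apply: nRy; rewrite E !(sc d) //.
set h := mmap _ _ H.
have Ha : H.@[a] != 0.
  have : mmap idfun a H = c ^+ d * mmap idfun (e p) H.
    by rewrite -(mmap_scale _ _ _ hH); congr (mmap _ _ _); apply/funext => j; rewrite aE.
  by rewrite -/(meval a H) -/(meval (e p) H) => ->; rewrite mulf_neq0 // expf_neq0.
have RG Q : R (mmap k (fun j => f j / f i) Q).
  by case: (hR) => hc _ hm; apply: (mmap_ind (S := R)); [exact: hc | exact: (saD hR) | exact: hm | exact: Rf].
have uh : sa_unit R h.
  apply: contrapT => nu; have Sh : S h by split; [exact: RG | exact: nu].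
  have := SD _ _ (SM _ _ (saN hR (sa1 hR)) (cong H)) Sh.
  by rewrite -/h mulN1r opprB subrK => /Sc/eqP; rewrite (negPf Ha).
rewrite -mulf_div divff ?expf_neq0 // mul1r; apply: (saM hR); first exact: RG.
by case: uh.
Qed.

Lemma proj_gen : exists y : 'I_N.+1 -> F, forall x : F, exists G H : {mpoly C[N.+1]},
  mmap k y H != 0 /\ x = mmap k y G / mmap k y H.
Proof.
by exists f => x; have [d [G [H [_ _ H0 E]]]] := generated x; exists G, H.
Qed.

(** On the algebra generated by the ratios $f_j/f_i$ the poles of [D] are bounded by those on the
    finitely many generators; the quotient rule extends the bound to the local ring, whose
    denominators are units at [p]. *)
Lemma proj_der_bound p (D : F -> F) : derivation D ->
  exists n : nat, forall x, loc p x -> vge p (- n%:Z) (D x).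
Proof.
move=> [DD DM DC]; have hl := proj_regular.
have [[i ei] _] := e_on p.
have fi : f i != 0.
  have := @proj_ev_neq0 p 1 'X_i; rewrite /ev mmap_var mevalXU; apply => //.
  by rewrite dhomogX /= mdeg1.
pose y j := f j / f i.
have ly j : loc p (y j).
  apply/locE; exists 1%N, 'X_j, 'X_i; rewrite !dhomogX /= !mdeg1 mevalXU /y.
  by rewrite !mmap_var.
exists (\sum_j `|ord p (D (y j))|)%N.
set n := (\sum_j _)%N.
have ny j : vge p (- n%:Z) (D (y j)).
  rewrite /vge; apply/orP; right; rewrite /n (bigD1 j) //= PoszD abszE.
  have := ler_norm (- ord p (D (y j))); rewrite normrN; lia.
have D1 : D 1 = 0 by rewrite -(rmorph1 k) DC.
have Sgen G : loc p (mmap k y G) /\ vge p (- n%:Z) (D (mmap k y G)).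
  apply: (@mmap_ind _ _ k _ [set x | loc p x /\ vge p (- n%:Z) (D x)]).
  - by move=> c; split; [exact: proj_loc_cst | rewrite DC; exact: vge0].
  - by move=> a b [la va] [lb vb]; split; rewrite ?DD; [exact: (locD hl) | exact: (vgeD hl)].
  - move=> a b [la va] [lb vb]; split; first exact: proj_locM.
    by rewrite DM; apply: (vgeD hl); [rewrite mulrC|]; exact: (vge_locM hl).
  - by move=> j; split.
move=> x /locE[d [G [H [hG hH H0 ->]]]].
have sc (Q : {mpoly C[N.+1]}) : Q \is d.-homog -> mmap k f Q = f i ^+ d * mmap k y Q.
  move=> hQ; rewrite -(mmap_scale k (f i) y hQ) /mmap; apply: eq_bigr => m _.
  by congr (_ * _); rewrite /mmap1; apply: eq_bigr => j _; rewrite /y mulrC divfK.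
have eH : mmap k y H != 0.
  have := proj_ev_neq0 hH H0; rewrite /ev sc // mulf_eq0 => /norP[_].
  by [].
rewrite !sc // -mulf_div divff ?expf_neq0 // mul1r.
set g := mmap k y G; set h := mmap k y H.
have uh : loc_unit p h.
  apply: contrapT => nu; have mh : loc_max p h by split=> //; case: (Sgen H).
  have hX : ('X_i ^+ d : {mpoly C[N.+1]}) \is d.-homog.
    by have := dhomogMn d (_ : 'X_i \is 1.-homog); rewrite mul1n; apply; rewrite dhomogX /= mdeg1.
  have X0 : ('X_i ^+ d : {mpoly C[N.+1]}).@[e p] != 0 by rewrite rmorphXn /= mevalXU expf_neq0.
  have := proj_max hH hX X0; rewrite /ev sc // rmorphXn /= mmap_var mulrC mulKf ?expf_neq0 //.
  by case=> /(_ mh) H00 _; move: H0; rewrite H00 eqxx.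
have DV : D h^-1 = - (D h * (h^-1 * h^-1)).
  have := DM h h^-1; rewrite divff // D1 => /esym/eqP; rewrite addrC addr_eq0 => /eqP E.
  by apply: (mulfI eH); rewrite E -/h; field.
rewrite DM DV; have [lg vg] := Sgen G; have [lh vh] := Sgen H.
have lhV : loc p h^-1 by case: uh.
apply: (vgeD hl); first by rewrite mulrC; apply: (vge_locM hl).
apply: (vge_locM hl) => //; rewrite vgeN // mulrC; apply: (vge_locM hl) => //.
exact: proj_locM.
Qed.

End Projective.

Section SmoothProjective.
Variables (C : numClosedFieldType) (X : curve C) (hX : smooth_projective_curve X).
Local Notation F := (fld X).
Local Notation k := (cst X).
Implicit Types (p : pt X) (x y u : F).

Lemma smooth_regular : regular_curve X.
Proof.
have [[N [f [e [h1 h2 h3 h4 h5]]]] [t0 t1 t2] h6] := hX.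
exact: (proj_regular h1 h2 h5 h6 t1 t2).
Qed.

Lemma smooth_separating (qs : seq (pt X)) : separating qs.
Proof.
have [[N [f [e [h1 h2 h3 h4 h5]]]] [t0 t1 t2] h6] := hX.
exact: (proj_separating h1 h2 h4 h5 h6 t1 t2).
Qed.

Lemma smooth_pole y : (forall c, y <> k c) -> exists p, ~ loc p y.
Proof.
have [[N [f [e [h1 h2 h3 h4 h5]]]] [t0 t1 t2] h6] := hX.
exact: (proj_pole h1 h3 h5 t1 t2).
Qed.

Lemma smooth_der_bound p (D : F -> F) : derivation D ->
  exists n : nat, forall x, loc p x -> vge p (- n%:Z) (D x).
Proof.
have [[N [f [e [h1 h2 h3 h4 h5]]]] [t0 t1 t2] h6] := hX.
exact: (proj_der_bound h1 h2 h5 h6 t1 t2).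
Qed.

Lemma smooth_gen : exists n (y : 'I_n -> F), forall x : F, exists G H : {mpoly C[n]},
  mmap k y H != 0 /\ x = mmap k y G / mmap k y H.
Proof.
have [[N [f [e [h1 _ _ _ _]]]] _ _] := hX.
by exists N.+1; exact: (proj_gen h1).
Qed.

Lemma smooth_alg u x : (forall c, u <> k c) -> algebraicOver (ratincl k u) x.
Proof.
by have [_ [t0 t1 t2] _] := hX => uC; apply: (algebraic_all t1 t2).
Qed.

Lemma smooth_tr : exists t : F, forall c, t <> k c.
Proof. by have [_ [t0 t1 t2] _] := hX; exists t0; exact: tr_notin. Qed.

End SmoothProjective.

Lemma horner_comp_map (K L : fieldType) (io : {rmorphism K -> L}) (P Q : {poly K}) z :
  (map_poly io P).[(map_poly io Q).[z]] = (map_poly io (P \Po Q)).[z].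
Proof. by rewrite map_comp_poly horner_comp. Qed.

(** * Maps to the projective line *)

Section PrimitiveElement.
Variables (C : numClosedFieldType) (X : curve C) (hX : smooth_projective_curve X).
Local Notation F := (fld X).
Local Notation k := (cst X).
Variables (x : F) (xC : forall c : C, x <> k c).
Local Notation K := (ratfield k x).
Local Notation io := (ratincl k x).

Lemma ratfield_pchar0 : [pchar K] =i pred0.
Proof.
apply/pcharf0P => n; rewrite -(fmorph_eq0 io) rmorph_nat.
by rewrite -(rmorph_nat k) fmorph_eq0 pnatr_eq0.
Qed.

Definition in_adjoin (z w : F) := exists P : {poly K}, (map_poly io P).[z] = w.

Lemma in_adjoin_trans z z' w : in_adjoin z' z -> in_adjoin z w -> in_adjoin z' w.
Proof. by move=> [P PE] [Q QE]; exists (Q \Po P); rewrite -horner_comp_map PE QE. Qed.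

(** F is generated over C by finitely many elements, so finitely many applications of the primitive
    element theorem suffice. *)
Lemma ex_primitive : exists z, forall y, in_adjoin z y.
Proof.
have alg y : algebraicOver io y := smooth_alg hX y xC.
have step (s : seq F) : exists z, forall y, y \in s -> in_adjoin z y.
  elim: s => [|y s [z zP]]; first by exists 0.
  have [p p0 pz] := alg z; have [q q0 qy] := alg y.
  have [n [h1 h2]] := pchar0_PET p0 pz q0 qy ratfield_pchar0.
  exists (y *+ n - z) => w; rewrite inE => /predU1P[->|/zP h]; first exact: h2.
  exact: in_adjoin_trans h1 h.
have [n [y yP]] := smooth_gen hX.
have [z zP] := step (codom y); exists z => u; have [G [H [H0 ->]]] := yP u.
have Sgen Q : in_adjoin z (mmap k y Q).
  apply: (@mmap_ind _ _ k _ [set w | in_adjoin z w]) => [c|a b [P <-] [P' <-]|a b [P <-] [P' <-]|i].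
  - exists ((rateval k x c%:P)%:P); rewrite map_polyC hornerC /=.
    by rewrite pevalC.
  - by exists (P + P'); rewrite rmorphD hornerD.
  - by exists (P * P'); rewrite rmorphM hornerM.
  - by apply: zP; exact: codom_f.
have inv h : h != 0 -> in_adjoin z h -> in_adjoin z h^-1.
  move=> h0 hz; apply: in_adjoin_trans hz _.
  have [p p0 /rootP ph] := alg h.
  elim/poly_ind: p p0 ph => [|p c IH]; first by rewrite eqxx.
  have -> : map_poly io (p * 'X + c%:P) = map_poly io p * 'X + (io c)%:P.
    rewrite rmorphD; congr (_ + _); last exact: map_polyC.
    by rewrite rmorphM; congr (_ * _); exact: map_polyX.
  rewrite hornerMXaddC; have [->|c0 _] := eqVneq c 0.
    rewrite polyC0 rmorph0 !addr0 => pX /eqP.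
    rewrite mulf_eq0 (negPf h0) orbF => /eqP; apply: IH.
    by apply: contraNneq pX => ->; rewrite mul0r.
  move=> /eqP; rewrite addr_eq0 => /eqP E.
  exists (- c^-1 *: p); rewrite map_polyZ hornerZ rmorphN fmorphV.
  have c0' : io c != 0 by rewrite fmorph_eq0.
  by apply: (mulIf h0); rewrite mulVf // !mulNr -mulrA E mulrN mulVf // opprK.
have [P <-] := Sgen G; have [Q QE] := inv _ H0 (Sgen H).
by exists (P * Q); rewrite rmorphM hornerM QE.
Qed.

Lemma ex_basis : exists (d : nat) (z : F),
  [/\ (0 < d)%N, is_basis io (fun i : 'I_d => z ^+ i) &
      forall y, in_adjoin z y].
Proof.
have [z zP] := ex_primitive.
have [p0 p00 pz0] := smooth_alg hX z xC.
have h : exists n, `[< exists p : {poly K}, [/\ p != 0, size p = n & root (map_poly io p) z] >].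
  by exists (size p0); apply/asboolP; exists p0.
have [n /asboolP[p [pn0 pn pz]] nmin] := ex_minnP h.
have np : size p = n.-1.+1 by rewrite pn prednK // -pn size_poly_gt0.
have hp (q : {poly K}) : (size q < size p)%N -> (map_poly io q).[z] = 0 -> q = 0.
  move=> sq qz; apply: contraTeq sq => q0; rewrite -leqNgt pn; apply: nmin.
  by apply/asboolP; exists q; split=> //; exact/rootP.
have linE c : lin io (fun i : 'I_n.-1 => z ^+ i) c = (map_poly io (rVpoly c)).[z].
  rewrite (@horner_coef_wide _ n.-1) ?size_map_poly ?size_poly // /lin.
  apply: eq_bigr => i _; rewrite coef_map /= coef_rVpoly_ord.
  by [].
exists n.-1, z; split=> //.
- rewrite lt0n; apply: contraNneq pn0 => n0.
  have sp : (size p <= 1)%N by rewrite np n0.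
  move: pz; rewrite rootE (size1_polyC sp) map_polyC hornerC fmorph_eq0 => /eqP ->.
  by rewrite polyC0.
- split=> [c|y].
    rewrite linE => /hp E; have : rVpoly c = 0.
      by apply: E; rewrite np ltnS size_poly.
    by move=> E0; apply: (can_inj (@rVpolyK _ _)); rewrite E0 linear0.
  have [P PE] := zP y; exists (poly_rV (P %% p)); rewrite linE poly_rV_K.
    rewrite -PE [in LHS](divp_eq P p) rmorphD rmorphM hornerD hornerM.
    by rewrite (rootP pz) mulr0 add0r.
  by rewrite -ltnS -np ltn_modp.
Qed.

End PrimitiveElement.

(** * The projective line *)

Section ProjectiveLine.
Variables (C : numClosedFieldType) (F : fieldType) (k : {rmorphism C -> F}).
Variables (x : F) (xC : forall c : C, x <> k c).
Local Notation K := (ratfield k x).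
Local Notation ev := (rateval k x).

Definition line_cst : {rmorphism C -> K} := (ev \o polyC)%FUN.

(** [Some a] is the point where the coordinate equals [a]; [None] is the point at infinity, where
    regularity compares degrees. *)
Definition line_loc (a : option C) : set K :=
  if a is Some a then
    [set y | exists P Q : {poly C}, Q.[a] != 0 /\ y = ev P / ev Q]
  else [set y | exists P Q : {poly C}, [/\ Q != 0, (size P <= size Q)%N & y = ev P / ev Q]].

Definition line_curve : curve C := Curve line_cst line_loc.

Lemma lev_neq0 P : P != 0 -> ev P != 0. Proof. exact: rateval_inj. Qed.

Lemma levM P Q : ev (P * Q) = ev P * ev Q. Proof. exact: rmorphM. Qed.
Lemma levB P Q : ev (P - Q) = ev P - ev Q. Proof. exact: rmorphB. Qed.
Lemma lev1 : ev 1 = 1. Proof. exact: rmorph1. Qed.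

Lemma lev_inj P Q : ev P = ev Q -> P = Q.
Proof.
move/eqP; rewrite -subr_eq0 -levB => h; apply/eqP; rewrite -subr_eq0.
by apply: contraTT h => /lev_neq0.
Qed.

Lemma horner_neq0 (Q : {poly C}) a : Q.[a] != 0 -> Q != 0.
Proof. by apply: contraNneq => ->; rewrite horner0. Qed.

Lemma line_max_some a P Q : Q.[a] != 0 ->
  @loc_max _ line_curve (Some a) (ev P / ev Q) <-> P.[a] = 0.
Proof.
move=> Qa; have Q0 := lev_neq0 (horner_neq0 Qa); split=> [[_ nu]|Pa].
  apply/eqP/negPn/negP => Pa; have P0 := lev_neq0 (horner_neq0 Pa); apply: nu; split.
  - by rewrite mulf_neq0 // invr_eq0.
  - by exists P, Q.
  - by exists Q, P; rewrite invf_div.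
split; first by exists P, Q.
move=> [PQ0 _ [P' [Q' [Q'a E]]]]; have Q'0 := lev_neq0 (horner_neq0 Q'a).
have P0 : ev P != 0 by apply: contraNneq PQ0 => ->; rewrite mul0r.
have : ev (Q * Q') = ev (P * P').
  by rewrite !levM; move: E; rewrite invf_div => /eqP; rewrite eqr_div // => /eqP ->; rewrite mulrC.
move/lev_inj/(congr1 (fun R : {poly C} => R.[a]))/eqP; rewrite !hornerM Pa mul0r.
by rewrite mulf_eq0 (negPf Qa) (negPf Q'a).
Qed.

Lemma line_max_none (P Q : {poly C}) : Q != 0 -> (size P <= size Q)%N ->
  @loc_max _ line_curve None (ev P / ev Q) <-> (size P < size Q)%N.
Proof.
move=> Q00 sPQ; have Q0 := lev_neq0 Q00; split=> [[_ nu]|sP].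
  rewrite ltn_neqAle sPQ andbT; apply/negP => /eqP sE.
  have P00 : P != 0 by rewrite -size_poly_eq0 sE size_poly_eq0.
  have P0 := lev_neq0 P00; apply: nu; split.
  - by rewrite mulf_neq0 // invr_eq0.
  - by exists P, Q.
  - by exists Q, P; rewrite invf_div sE.
split; first by exists P, Q.
move=> [PQ0 _ [P' [Q' [Q'00 s' E]]]]; have Q'0 := lev_neq0 Q'00.
have P0 : ev P != 0 by apply: contraNneq PQ0 => ->; rewrite mul0r.
have P00 : P != 0 by apply: contraNneq P0 => ->; rewrite rmorph0.
have : ev (Q * Q') = ev (P * P').
  by rewrite !levM; move: E; rewrite invf_div => /eqP; rewrite eqr_div // => /eqP ->; rewrite mulrC.
move/lev_inj/(congr1 (fun R : {poly C} => size R)).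
have [P'0|P'0] := eqVneq P' 0.
  by move=> /eqP; rewrite P'0 mulr0 size_poly0 size_poly_eq0 mulf_eq0 (negPf Q00) (negPf Q'00).
rewrite !size_mul //; have := size_poly_gt0 Q; rewrite Q00.
have := size_poly_gt0 P; rewrite P00; have := size_poly_gt0 Q'; rewrite Q'00.
move: (size P) (size Q) (size P') (size Q') sP s' => a b c d'; lia.
Qed.

Lemma line_unif_some a : @uniformizer _ line_curve (Some a) (ev ('X - a%:P)).
Proof.
split; first by apply: lev_neq0; rewrite polyXsubC_eq0.
move=> y; split=> [my|[_ [P [Q [Qa ->]]] ->]].
  have [P [Q [Qa yE]]] := my.1; move: my; rewrite yE => /(line_max_some _ Qa)/rootP.
  move=> /factor_theorem[P1 ->]; exists (ev P1 / ev Q); first by exists P1, Q.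
  by rewrite levM mulrAC.
by rewrite mulrAC -levM; apply/(line_max_some _ Qa); rewrite hornerM hornerXsubC subrr mulr0.
Qed.

Lemma line_unif_none : @uniformizer _ line_curve None (ev 1 / ev 'X).
Proof.
have X0 : ev 'X != 0 by apply: lev_neq0; rewrite polyX_eq0.
split; first by rewrite lev1 mul1r invr_eq0.
move=> y; split=> [my|[_ [P [Q [Q0 sPQ ->]]] ->]].
  have [P [Q [Q0 sPQ yE]]] := my.1; move: my; rewrite yE => /(line_max_none Q0 sPQ) s'.
  have Q0' := lev_neq0 Q0.
  exists (ev (P * 'X) / ev Q); last by rewrite levM lev1; field; rewrite X0 Q0'.
  exists (P * 'X), Q; split=> //; apply: leq_trans (size_polyMleq _ _) _.
  by rewrite size_polyX addn2.
have Q0' := lev_neq0 Q0.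
have -> : ev P / ev Q * (ev 1 / ev 'X) = ev P / ev (Q * 'X).
  by rewrite levM lev1; field; rewrite X0 Q0'.
have sQX : size (Q * 'X) = (size Q).+1 by rewrite size_mulX.
apply/line_max_none; rewrite ?mulf_neq0 ?polyX_eq0 // sQX //.
exact: leq_trans sPQ _.
Qed.

Lemma line_regular : regular_curve line_curve.
Proof.
have lev0 : ev 0 = 0 by exact: rmorph0.
have XX : ev 'X != 0 by apply: lev_neq0; rewrite polyX_eq0.
apply: mk_regular => [p c|p y z|p y z|p y|p y|p].
- case: p => [a|] /=; exists c%:P, 1; rewrite lev1 divr1 ?hornerC ?oner_eq0 //.
  by split; rewrite ?oner_eq0 // size_poly1 size_polyC_leq1.
- case: p => [a|] /= [P [Q]].
    move=> [Qa ->] [P' [Q' [Qa' ->]]]; exists (P * Q' - P' * Q), (Q * Q').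
    have Q0 := lev_neq0 (horner_neq0 Qa); have Q0' := lev_neq0 (horner_neq0 Qa').
    by rewrite hornerM mulf_neq0 // levB !levM; split=> //; field; rewrite Q0 Q0'.
  move=> [Q0 sPQ ->] [P' [Q' [Q'0 sPQ' ->]]]; exists (P * Q' - P' * Q), (Q * Q').
  have Q1 := lev_neq0 Q0; have Q1' := lev_neq0 Q'0.
  rewrite mulf_neq0 // levB !levM; split=> //; last by field; rewrite Q1 Q1'.
  rewrite size_mul // (leq_trans (size_polyD _ _)) // geq_max size_polyN.
  have h (P1 Q2 : {poly C}) (m n : nat) : (size P1 <= m)%N -> (size Q2 <= n)%N -> (size (P1 * Q2)%R <= (m + n).-1)%N.
    move=> h1 h2; apply: leq_trans (size_polyMleq _ _) _.
    by rewrite -!subn1 leq_sub2r // leq_add.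
  by rewrite h //= addnC h.
- case: p => [a|] /= [P [Q]].
    move=> [Qa ->] [P' [Q' [Qa' ->]]]; exists (P * P'), (Q * Q').
    have Q0 := lev_neq0 (horner_neq0 Qa); have Q0' := lev_neq0 (horner_neq0 Qa').
    by rewrite hornerM mulf_neq0 // !levM; split=> //; field; rewrite Q0 Q0'.
  move=> [Q0 sPQ ->] [P' [Q' [Q'0 sPQ' ->]]]; exists (P * P'), (Q * Q').
  have Q1 := lev_neq0 Q0; have Q1' := lev_neq0 Q'0.
  rewrite mulf_neq0 // !levM; split=> //; last by field; rewrite Q1 Q1'.
  rewrite [leqRHS]size_mul //; apply: leq_trans (size_polyMleq _ _) _.
  by rewrite -!subn1 leq_sub2r // leq_add.
- case: p => [a|] [P [Q]].
    move=> [Qa ->]; exists (P.[a] / Q.[a]); have Q0 := lev_neq0 (horner_neq0 Qa).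
    have -> : ev P / ev Q - cst line_curve (P.[a] / Q.[a]) = ev (P - (P.[a] / Q.[a])%:P * Q) / ev Q.
      by rewrite levB levM mulrBl mulfK.
    by apply/(line_max_some _ Qa); rewrite !hornerE divfK // subrr.
  move=> [Q0 sPQ ->]; exists (P`_(size Q).-1 / lead_coef Q); have Q1 := lev_neq0 Q0.
  set c : C := _ / lead_coef Q.
  have -> : ev P / ev Q - cst line_curve c = ev (P - c%:P * Q) / ev Q.
    by rewrite levB levM mulrBl mulfK.
  have sR : (size (P - c%:P * Q)%R < size Q)%N.
    rewrite -[size Q]prednK ?size_poly_gt0 // ltnS; apply/leq_sizeP => j.
    rewrite leq_eqVlt => /predU1P[<-|jlt].
      by rewrite coefB coefCM /c divfK ?lead_coef_eq0 // subrr.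
    have jQ : (size Q <= j)%N by rewrite -[size Q]prednK ?size_poly_gt0.
    by rewrite coefB coefCM !nth_default ?mulr0 ?subr0 // (leq_trans sPQ).
  by apply/line_max_none => //; exact: ltnW.
- have [P [Q [Q0 ->]]] := ratP y; case: p => [a|].
    exists (ev P), (ev Q); split=> //; rewrite -?(fmorph_eq0 (ratincl k x)) //.
      by exists P, 1; rewrite hornerC oner_eq0 lev1 divr1.
    by exists Q, 1; rewrite hornerC oner_eq0 lev1 divr1.
  have Q1 : ev Q != 0 by rewrite -(fmorph_eq0 (ratincl k x)).
  pose m := (size P + size Q)%N; have Xm : ('X^m : {poly C}) != 0 by rewrite monic_neq0 ?monicXn.
  have Xm1 := lev_neq0 Xm.
  exists (ev P / ev 'X^m), (ev Q / ev 'X^m); split.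
  + by exists P, 'X^m; split=> //; rewrite size_polyXn leqW // leq_addr.
  + by exists Q, 'X^m; split=> //; rewrite size_polyXn leqW // leq_addl.
  + by rewrite mulf_neq0 // invr_eq0.
  + by field; rewrite Xm1 Q1.
- case: p => [a|].
    exists (ev ('X - a%:P)); split=> [|y [P [Q [Qa ->]]] y0]; first exact: line_unif_some.
    have P0 : P != 0 by apply: contraNneq y0 => ->; rewrite lev0 mul0r.
    have [n [P1 P1a PE]] := multiplicity_XsubC P a; move: P1a; rewrite P0 /= => P1a.
    have Q0 := lev_neq0 (horner_neq0 Qa); have P10 := lev_neq0 (horner_neq0 P1a).
    exists n, (ev Q / ev P1); split; first by exists Q, P1.
    rewrite PE levM rmorphXn /=; field.
    by rewrite Q0 P10.
  exists (ev 1 / ev 'X); split=> [|y [P [Q [Q0 sPQ ->]]] y0]; first exact: line_unif_none.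
  have P0 : P != 0 by apply: contraNneq y0 => ->; rewrite lev0 mul0r.
  have Q1 := lev_neq0 Q0; have P1 := lev_neq0 P0.
  pose n := (size Q - size P)%N; have Xn : ('X^n : {poly C}) != 0 by rewrite monic_neq0 ?monicXn.
  exists n, (ev Q / ev (P * 'X^n)); split.
    exists Q, (P * 'X^n); split; rewrite ?mulf_neq0 // size_mul // size_polyXn addnS /= /n.
    by rewrite subnKC.
  rewrite levM lev1 mul1r exprVn -rmorphXn; field.
  by rewrite Q1 P1 lev_neq0.
Qed.

Lemma ord_line_some a b : @ord _ line_curve (Some b) (ev ('X - a%:P)) = (a == b)%:R.
Proof.
have [->|ab] := eqVneq a b; first exact: (ord_unif line_regular (line_unif_some b)).
apply: (ord_unit line_regular); split.
- by apply: lev_neq0; rewrite polyXsubC_eq0.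
- by exists ('X - a%:P), 1; rewrite hornerC oner_eq0 lev1 divr1.
- by exists 1, ('X - a%:P); rewrite hornerXsubC subr_eq0 eq_sym lev1 mul1r.
Qed.

Lemma ord_line_none a : @ord _ line_curve None (ev ('X - a%:P)) = -1.
Proof.
have X0 : ev 'X != 0 by apply: lev_neq0; rewrite polyX_eq0.
have Xa0 : ev ('X - a%:P) != 0 by apply: lev_neq0; rewrite polyXsubC_eq0.
have oX := ord_unif line_regular line_unif_none.
have <- : @ord _ line_curve None (ev ('X - a%:P) / ev 'X / (ev 1 / ev 'X)) = -1.
  rewrite (ordM line_regular) ?(ordV line_regular) ?oX.
  - rewrite (ord_unit line_regular) ?add0r //; split.
    + by rewrite mulf_neq0 // invr_eq0.
    + by exists ('X - a%:P), 'X; rewrite polyX_eq0 size_XsubC size_polyX.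
    + by exists 'X, ('X - a%:P); rewrite polyXsubC_eq0 size_XsubC size_polyX invf_div.
  - by rewrite mulf_neq0 // invr_eq0.
  - by rewrite lev1 mul1r invrK.
by congr ord; rewrite lev1 mul1r invrK divfK.
Qed.

End ProjectiveLine.

(** * Sums of finite support *)

Section FiniteSums.
Variable (T : choiceType).
Implicit Types (f g : T -> int) (s : seq T).

(** A sum over the whole type is 0 by convention when infinitely many terms are nonzero, so
    additivity has to carry this condition. *)
Definition finsupp f := exists s, forall t, t \notin s -> f t = 0.

Lemma fsumE f s : uniq s -> (forall t, t \notin s -> f t = 0) ->
  \sum_(t \in [set: T]) f t = \sum_(t <- s) f t.
Proof.
move=> us fs; rewrite [RHS](fsbig_seq _ _ us).
rewrite (fsbig_widen [set` s] setT) //.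
by move=> t /= [_ ts]; apply: fs; apply/negP.
Qed.

Lemma finsupp_uniq f : finsupp f -> exists2 s, uniq s & forall t, t \notin s -> f t = 0.
Proof. by move=> [s fs]; exists (undup s); rewrite ?undup_uniq // => t; rewrite mem_undup; exact: fs. Qed.

Lemma finsupp2 f g : finsupp f -> finsupp g -> exists2 s, uniq s &
  (forall t, t \notin s -> f t = 0) /\ (forall t, t \notin s -> g t = 0).
Proof.
move=> [s fs] [s' gs]; exists (undup (s ++ s')); rewrite ?undup_uniq //.
by split=> t; rewrite mem_undup mem_cat negb_or => /andP[h1 h2]; [exact: fs | exact: gs].
Qed.

Lemma finsuppD f g : finsupp f -> finsupp g -> finsupp (fun t => f t + g t).
Proof.
by move=> /finsupp2 h /h[s _ [h1 h2]]; exists s => t ts; rewrite h1 ?h2 ?addr0.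
Qed.

Lemma finsuppN f : finsupp f -> finsupp (fun t => - f t).
Proof. by move=> [s fs]; exists s => t /fs ->; rewrite oppr0. Qed.

Lemma fsumD f g : finsupp f -> finsupp g ->
  \sum_(t \in [set: T]) (f t + g t) = \sum_(t \in [set: T]) f t + \sum_(t \in [set: T]) g t.
Proof.
move=> /finsupp2 h /h[s us [h1 h2]]; rewrite (fsumE us h1) (fsumE us h2) -big_split.
by apply: fsumE => // t ts; rewrite h1 ?h2 ?addr0.
Qed.

Lemma fsumN f : finsupp f ->
  \sum_(t \in [set: T]) (- f t) = - \sum_(t \in [set: T]) f t.
Proof.
move=> /finsupp_uniq[s us h1]; rewrite (fsumE us h1) -sumrN.
by apply: fsumE => // t ts; rewrite h1 ?oppr0.
Qed.

Lemma fsum_le f g : finsupp f -> finsupp g -> (forall t, f t <= g t) ->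
  \sum_(t \in [set: T]) f t <= \sum_(t \in [set: T]) g t.
Proof.
by move=> /finsupp2 h /h[s us [h1 h2]] fg; rewrite (fsumE us h1) (fsumE us h2); exact: ler_sum.
Qed.

Lemma fsum0 f : (forall t, f t = 0) -> \sum_(t \in [set: T]) f t = 0.
Proof. by move=> f0; rewrite (@fsumE f [::]) ?big_nil. Qed.

Lemma fsumMn f n : finsupp f ->
  \sum_(t \in [set: T]) (f t * n) = (\sum_(t \in [set: T]) f t) * n.
Proof.
move=> /finsupp_uniq[s us h1]; rewrite (fsumE us h1) mulr_suml.
by apply: fsumE => // t ts; rewrite h1 ?mul0r.
Qed.

Lemma eq_fsum f g : f =1 g -> \sum_(t \in [set: T]) f t = \sum_(t \in [set: T]) g t.
Proof. by move=> fg; apply: eq_fsbigr => t _. Qed.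

End FiniteSums.

Lemma fsum_fibre (T S : choiceType) (pr : T -> S) (fib : S -> seq T) (f : T -> int) :
  (forall a, uniq (fib a)) -> (forall a t, (t \in fib a) = (pr t == a)) -> finsupp f ->
  finsupp (fun a => \sum_(t <- fib a) f t) /\
  \sum_(t \in [set: T]) f t = \sum_(a \in [set: S]) \sum_(t <- fib a) f t.
Proof.
move=> ufib fibP /finsupp_uniq[s us fs].
have fibE a : \sum_(t <- fib a) f t = \sum_(t <- s | pr t == a) f t.
  rewrite (bigID (mem s)) /= [X in _ + X]big1 ?addr0; last by move=> t /fs.
  rewrite -big_filter -[RHS]big_filter; apply: perm_big; apply: uniq_perm; rewrite ?filter_uniq //.
  by move=> t; rewrite !mem_filter fibP andbC.
have out a : a \notin undup (map pr s) -> \sum_(t <- fib a) f t = 0.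
  rewrite mem_undup => /mapP h; rewrite fibE big_seq_cond big1 // => t /andP[ts /eqP ta].
  by case: h; exists t.
split; first by exists (undup (map pr s)).
rewrite (fsumE us fs) (fsumE (undup_uniq _) out).
under [RHS]eq_bigr do rewrite fibE.
rewrite (exchange_big_dep predT) //= [LHS]big_seq [RHS]big_seq; apply: eq_bigr => t ts.
rewrite big_const_seq (@eq_count _ _ (pred1 (pr t))) => [|a]; last by rewrite /= eq_sym.
by rewrite count_uniq_mem ?undup_uniq // mem_undup map_f //= addr0.
Qed.

Lemma scale_primitive (C : fieldType) (Y : curve C) (hY : regular_curve Y) (p : pt Y) n
    (c : 'rV[fld Y]_n) : c != 0 ->
  exists s, [/\ s != 0, mxloc p (s *: c) & exists i, loc_unit p (s * c 0 i)].
Proof.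
move=> c0; have [i0 ci0] : exists i, c 0 i != 0.
  by apply/existsP; apply: contraNT c0 => /existsPn h; apply/eqP/rowP => i; rewrite mxE; apply/eqP/negPn.
have [i ci imin] := @Order.TotalTheory.arg_minP _ _ _ i0 (fun i => c 0 i != 0) (fun i => ord p (c 0 i)) ci0.
exists (c 0 i)^-1; split; first by rewrite invr_eq0.
- move=> j l; rewrite mxE ord1; apply/(vge_loc hY).
  have [->|cl] := eqVneq (c 0 l) 0; first by rewrite mulr0; exact: vge0.
  rewrite vge_ordE ?mulf_neq0 ?invr_eq0 // (ordM hY) ?invr_eq0 // (ordV hY).
  by rewrite addrC subr_ge0; exact: imin.
- by exists i; rewrite mulVf //; exact: (loc_unit1 hY).
Qed.

Lemma basis_scale (K L : fieldType) (io : {rmorphism K -> L}) d (e : 'I_d -> L) (s : 'I_d -> K) :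
  is_basis io e -> (forall i, s i != 0) -> is_basis io (fun i => io (s i) * e i).
Proof.
move=> [he1 he2] s0.
have E c : lin io (fun i => io (s i) * e i) c = lin io e (\row_i (c 0 i * s i)).
  by apply: eq_bigr => i _; rewrite mxE rmorphM mulrA.
split=> [c|y].
  rewrite E => /he1/rowP h; apply/rowP => i; have := h i; rewrite !mxE => /eqP.
  by rewrite mulf_eq0 (negPf (s0 i)) orbF => /eqP.
have [c ->] := he2 y; exists (\row_i (c 0 i / s i)); rewrite E.
by congr lin; apply/rowP => i; rewrite !mxE divfK.
Qed.

Lemma basis_replace (K L : fieldType) (io : {rmorphism K -> L}) d (e : 'I_d -> L)
    (dl : 'rV[K]_d) (j : 'I_d) :
  is_basis io e -> dl 0 j != 0 ->
  is_basis io (fun i => if i == j then lin io e dl else e i).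
Proof.
move=> he dj; pose A : 'M[K]_d := \matrix_i (if i == j then dl else delta_mx 0 i).
apply: (@basis_change _ _ io d e he _ A) => [|i]; last first.
  by rewrite rowK; case: ifP => // _; rewrite lin_delta.
rewrite -row_free_unit -kermx_eq0; apply/eqP/eqP/rowV0P => v /sub_kermxP vA.
have vj : v 0 j = 0.
  have := congr1 (fun B : 'rV_d => B 0 j) vA; rewrite mxE (bigD1 j) //= big1 => [|i ij].
    by rewrite addr0 !mxE eqxx => /eqP; rewrite mulf_eq0 (negPf dj) orbF => /eqP.
  by rewrite mxE (negPf ij) mxE eqxx eq_sym (negPf ij) mulr0.
apply/rowP => l; rewrite [RHS]mxE; have [->//|lj] := eqVneq l j.
have := congr1 (fun B : 'rV_d => B 0 l) vA; rewrite mxE (bigD1 l) //= big1 => [|i il].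
  by rewrite addr0 !mxE (negPf lj) mxE !eqxx mulr1.
rewrite !mxE; have [->|ij] := eqVneq i j; first by rewrite vj mul0r.
by rewrite mxE eqxx eq_sym (negPf il) mulr0.
Qed.

(** Were the order of the product negative, [y] would have a pole, and in $g(y)=0$ the term of
    highest degree would have smaller order than all the others. *)
Lemma integral_lead (C : fieldType) (Y : curve C) (hY : regular_curve Y) (p : pt Y)
    (g : {poly fld Y}) y : (forall i, loc p g`_i) -> g.[y] = 0 -> loc p (lead_coef g * y).
Proof.
move=> lg gy; have [->|g0] := eqVneq (lead_coef g) 0; first by rewrite mul0r; exact: (loc0 hY).
have [->|y0] := eqVneq y 0; first by rewrite mulr0; exact: (loc0 hY).
have gn0 : g != 0 by rewrite -lead_coef_eq0.
have [m sg] : exists m, size g = m.+1 by exists (size g).-1; rewrite prednK // size_poly_gt0.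
have lE : lead_coef g = g`_m by rewrite lead_coefE sg.
apply/(loc_ord hY); first by rewrite mulf_neq0.
rewrite leNgt; apply/negP; rewrite (ordM hY) // => on.
have og : 0 <= ord p (lead_coef g) by apply/(loc_ord hY) => //; rewrite lE.
have oy : ord p y < 0 by lia.
case: m sg lE => [|m] sg lE.
  by move: gy g0; rewrite (size1_polyC (_ : (size g <= 1)%N)) ?sg // hornerC lead_coefC => ->; rewrite eqxx.
have : vge p (ord p y * m%:Z) (g`_m.+1 * y ^+ m.+1).
  move: gy; rewrite horner_coef sg big_ord_recr /= => /eqP; rewrite addrC addr_eq0 => /eqP ->.
  rewrite vgeN //; apply: (vge_sum hY) => i _.
  apply: (vge_locM hY) => //; apply: (@vgeW _ _ _ (ord p y *+ i)); last by apply: (vgeX hY); exact: vge_ord.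
  rewrite -mulr_natr natz; apply: ler_wnM2l; first exact: ltW.
  by rewrite lez_nat -ltnS; exact: ltn_ord.
rewrite -lE vge_ordE ?mulf_neq0 ?expf_neq0 // (ordM hY) ?expf_neq0 // (ordX hY).
rewrite -mulr_natr natz -addn1 PoszD mulrDr mulr1; lia.
Qed.

(** * A nonconstant function as a finite map to the line *)

Section CoverLine.
Variables (C : numClosedFieldType) (X : curve C) (hX : smooth_projective_curve X).
Local Notation F := (fld X).
Local Notation k := (cst X).
Variables (x : F) (xC : forall c : C, x <> k c).
Local Notation K := (ratfield k x).
Local Notation io := (ratincl k x).
Local Notation ev := (rateval k x).
Local Notation Z := (line_curve k x).
Let hR := smooth_regular hX.
Let hZ := line_regular xC.
Implicit Types (p q : pt X).

Definition line_proj p : pt Z := if `[< loc p x >] then Some (value p x) else None.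

Let x0 : x != 0. Proof. by apply/eqP => h; apply: (@xC 0); rewrite h rmorph0. Qed.

Let evX0 : ev 'X != 0. Proof. by apply: (lev_neq0 xC); rewrite polyX_eq0. Qed.

Lemma ioX : io (ev 'X) = x. Proof. by rewrite ratinclE pevalX. Qed.

Lemma line_proj_some p a : line_proj p = Some a <-> loc p x /\ value p x = a.
Proof.
rewrite /line_proj; case: asboolP => h; split=> //.
- by move=> [->].
- by move=> [_ ->].
- by case.
Qed.

Lemma line_proj_none p : line_proj p = None <-> ~ loc p x.
Proof. by rewrite /line_proj; case: asboolP => h; split. Qed.

Lemma pole_inv p : ~ loc p x -> loc_max p x^-1.
Proof.
move=> h; apply/(loc_maxP hR); rewrite vge_ordE ?invr_eq0 // (ordV hR).
have : ~ (0 <= ord p x) by move=> h1; apply: h; apply/(loc_ord hR).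
by move/negP; rewrite -ltNge; lia.
Qed.

Lemma value_peval p P : loc p x -> loc p (peval k x P) /\ value p (peval k x P) = P.[value p x].
Proof.
move=> lx; elim/poly_ind: P => [|P c [IH1 IH2]].
  by rewrite peval0 horner0 (value0 hR); split=> //; exact: (loc0 hR).
have -> : peval k x (P * 'X + c%:P) = peval k x P * x + k c.
  by rewrite /peval rmorphD rmorphM /= map_polyX map_polyC hornerMXaddC.
have lc := rc_loc_cst hR p c; rewrite hornerMXaddC.
split; first by apply: (locD hR) => //; exact: (locM hR).
by rewrite (valueD hR) ?(valueM hR) ?(value_cst hR) ?IH2 //; exact: (locM hR).
Qed.

(** This is the reversed polynomial evaluated at $x^{-1}$; at a pole of [x] only its constant term
    survives. *)
Lemma value_peval_inf p (P : {poly C}) n : ~ loc p x -> (size P <= n.+1)%N ->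
  loc p (peval k x P * x^-1 ^+ n) /\ value p (peval k x P * x^-1 ^+ n) = P`_n.
Proof.
move=> /pole_inv mx; have lx : loc p x^-1 by case: mx.
elim: n P => [|n IH] P sP.
  rewrite (size1_polyC sP) pevalC expr0 mulr1 coefC (value_cst hR); split=> //.
  exact: rc_loc_cst.
pose Q := \poly_(i < n.+1) P`_i.
have PE : P = Q + P`_n.+1 *: 'X^(n.+1).
  apply/polyP => i; rewrite coefD coefZ coefXn coef_poly; have [//|ni|->] := ltngtP i n.+1.
  - by rewrite mulr0 addr0.
  - by rewrite mulr0 addr0 nth_default // (leq_trans sP).
  - by rewrite mulr1 add0r.
have [l1 l2] := IH Q (size_poly _ _).
have -> : peval k x P * x^-1 ^+ n.+1 = (peval k x Q * x^-1 ^+ n) * x^-1 + k P`_n.+1.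
  rewrite {1}PE /peval rmorphD /= hornerD map_polyZ /= map_polyXn hornerZ hornerXn.
  rewrite mulrDl exprSr mulrA; congr (_ + _).
  by rewrite -mulrA -exprSr -exprMn divff // expr1n mulr1.
have lc := rc_loc_cst hR p P`_n.+1; have l3 := locM hR l1 lx.
split; first exact: (locD hR).
by rewrite (valueD hR) // (valueM hR) // (value_cst hR) (value_eq0 hR lx).2 // mulr0 add0r.
Qed.

Lemma line_proj_loc p y : (loc (line_proj p) y -> loc p (io y)) /\
  (loc_max (line_proj p) y -> loc_max p (io y)).
Proof.
case E : (line_proj p) => [a|].
  have [lx <-] := (line_proj_some _ _).1 E.
  have h P Q : Q.[value p x] != 0 -> loc p (io (ev P / ev Q)) /\
     (P.[value p x] = 0 -> loc_max p (io (ev P / ev Q))).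
    move=> Qa; have [lP vP] := value_peval P lx; have [lQ vQ] := value_peval Q lx.
    have uQ : loc_unit p (peval k x Q) by apply/(value_unit hR lQ); rewrite vQ; exact/eqP.
    have lQV : loc p (peval k x Q)^-1 by case: uQ.
    rewrite fmorph_div !ratinclE; split; first exact: (locM hR).
    by rewrite -vP => /(value_eq0 hR lP) mP; rewrite mulrC; exact: (loc_maxMl hR).
  split=> [[P [Q [Qa ->]]]|my]; first exact: (h P Q Qa).1.
  have [P [Q [Qa yE]]] := my.1; move: my; rewrite yE => /(line_max_some xC _ Qa).
  exact: (h P Q Qa).2.
have nx := (line_proj_none _).1 E.
have h (P Q : {poly C}) : Q != 0 -> (size P <= size Q)%N -> loc p (io (ev P / ev Q)) /\
   ((size P < size Q)%N -> loc_max p (io (ev P / ev Q))).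
  move=> Q0 sPQ; have sQ : size Q = (size Q).-1.+1 by rewrite prednK // size_poly_gt0.
  have sP' : (size P <= (size Q).-1.+1)%N by rewrite -sQ.
  have sQ' : (size Q <= (size Q).-1.+1)%N by rewrite -sQ.
  have [lP vP] := value_peval_inf nx sP'; have [lQ vQ] := value_peval_inf nx sQ'.
  set u := x^-1 ^+ _ in lP vP lQ vQ.
  have u0 : u != 0 by rewrite expf_neq0 // invr_eq0.
  have uQ : loc_unit p (peval k x Q * u).
    by apply/(value_unit hR lQ); rewrite vQ -lead_coefE; apply/eqP; rewrite lead_coef_eq0.
  have lQV : loc p (peval k x Q * u)^-1 by case: uQ.
  have E1 : io (ev P / ev Q) = (peval k x P * u) * (peval k x Q * u)^-1.
    have Qx : peval k x Q != 0 := peval_neq0 xC Q0.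
    by rewrite fmorph_div !ratinclE; field; rewrite u0 Qx.
  rewrite E1; split; first exact: (locM hR).
  move=> sPQ1; have : value p (peval k x P * u) = 0.
    by rewrite vP nth_default // -ltnS -sQ.
  by move/(value_eq0 hR lP) => mP; rewrite mulrC; exact: (loc_maxMl hR).
split=> [[P [Q [Q0 sPQ ->]]]|my]; first exact: (h P Q Q0 sPQ).1.
have [P [Q [Q0 sPQ yE]]] := my.1; move: my; rewrite yE => /(line_max_none xC Q0 sPQ).
exact: (h P Q Q0 sPQ).2.
Qed.

(** For more than [d] points, the separating functions $w_i$ are linearly dependent over C(x). With
    coefficients scaled to be integral at [a], one of them a unit, the relation fails at the
    corresponding point, where $w_i$ is a unit and the other $w_j$ vanish. *)
Lemma fibre_bound (d : nat) (e : 'I_d -> F) (a : pt Z) (qs : seq (pt X)) : is_basis io e ->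
  uniq qs -> (forall q, q \in qs -> line_proj q = a) -> (size qs <= d)%N.
Proof.
move=> he uqs qsa; rewrite leqNgt; apply/negP => lt_d.
have /choice[w wP] : forall i : 'I_(size qs), exists w : F,
    [/\ forall q', q' \in qs -> loc q' w, loc_unit (tnth (in_tuple qs) i) w &
      forall q', q' \in qs -> q' != tnth (in_tuple qs) i -> loc_max q' w].
  by move=> i; apply: (smooth_separating hX); exact: mem_tnth.
pose M : 'M[K]_(size qs, d) := \matrix_i coord_in io e (w i).
have [c c0 cM] := ker_nontrivial M lt_d.
have sE : forall c' : 'rV[K]_(size qs), c' *m M = 0 -> \sum_i io (c' 0 i) * w i = 0.
  move=> c' c'M; rewrite -[LHS](coord_inK he) (coord_in_sum he) /=.
  under eq_bigr do rewrite (coord_inZ he).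
  have -> : \sum_i c' 0 i *: coord_in io e (w i) = c' *m M.
    by rewrite mulmx_sum_row; apply: eq_bigr => i _; rewrite rowK.
  by rewrite c'M /lin big1 // => i _; rewrite mxE rmorph0 mul0r.
have [s [s0 sl [i ui]]] := scale_primitive hZ a c0.
have := sE (s *: c); rewrite -scalemxAl cM scaler0 => /(_ erefl).
set q := tnth (in_tuple qs) i; have qqs : q \in qs by exact: mem_tnth.
rewrite (bigD1 i) //= => /eqP; rewrite addr_eq0 => /eqP E.
have lio j : loc q (io ((s *: c) 0 j)).
  by have := (line_proj_loc q ((s *: c) 0 j)).1; rewrite (qsa _ qqs); apply; exact: sl.
have mq : loc_max q (io ((s *: c) 0 i) * w i).
  rewrite E; apply/(loc_maxP hR); rewrite vgeN //; apply: (vge_sum hR) => j ji.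
  apply: (vge_locM hR (lio j)); apply/(loc_maxP hR); case: (wP j) => _ _; apply => //.
  have /tuple_uniqP inj : uniq (in_tuple qs) by [].
  by apply: contra ji => /eqP /inj ->.
have uio : loc_unit q (io ((s *: c) 0 i)).
  split=> //; first by rewrite fmorph_eq0 mxE; case: ui.
  rewrite -fmorphV; have := (line_proj_loc q ((s *: c) 0 i)^-1).1; rewrite (qsa _ qqs).
  by rewrite mxE; apply; case: ui.
case: mq => _; apply; apply: (loc_unitM hR) => //.
by case: (wP i).
Qed.

Lemma ex_fibres : exists fib : pt Z -> seq (pt X),
  (forall a, uniq (fib a)) /\ forall a q, (q \in fib a) = (line_proj q == a).
Proof.
have [d [z [_ he _]]] := ex_basis hX xC.
have h a : exists qs, uniq qs /\ forall q, (q \in qs) = (line_proj q == a).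
  pose P m := `[< exists qs : seq (pt X), [/\ uniq qs, forall q, q \in qs -> line_proj q = a & size qs = m] >].
  have P0 : exists m, P m by exists 0%N; apply/asboolP; exists [::].
  have Pb m : P m -> (m <= d)%N.
    by move=> /asboolP[qs [h1 h2 <-]]; exact: fibre_bound he h1 h2.
  have [m /asboolP[qs [h1 h2 h3]] mmax] := ex_maxnP P0 Pb.
  exists qs; split=> // q; apply/idP/eqP => [/h2//|qa].
  apply: contraT => nq; have : P m.+1.
    apply/asboolP; exists (q :: qs); split; rewrite /= ?nq ?h3 // => q'.
    by rewrite inE => /predU1P[->|/h2].
  by move=> /mmax; rewrite ltnn.
by have [fib fibP] := choice h; exists fib; split=> a; case: (fibP a).
Qed.

Definition bfin y := forall p, loc p x -> loc p y.
Definition binf (n : nat) y := forall p, ~ loc p x -> loc p (x^-1 ^+ n * y).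

Lemma ex_bfin y : exists Q : {poly C}, Q != 0 /\ bfin (peval k x Q * y).
Proof.
have [G G0 Gy] := algebraic_algdep (smooth_alg hX y xC).
exists (lead_coef G); split=> [|p lx]; first by rewrite lead_coef_eq0.
have lG : lead_coef (map_poly (peval k x) G) = peval k x (lead_coef G).
  by apply: lead_coef_map_eq; apply: (peval_neq0 xC); rewrite lead_coef_eq0.
rewrite -lG; apply: (integral_lead hR) => // i; rewrite coef_map.
by case: (value_peval G`_i lx).
Qed.

Lemma ex_binf y : exists n, binf n y.
Proof.
have [fib [ufib fibP]] := ex_fibres.
exists (\sum_(q <- fib None) `|ord q y|)%N => p nx.
have [->|y0] := eqVneq y 0; first by rewrite mulr0; exact: (loc0 hR).
have xi0 : x^-1 != 0 by rewrite invr_eq0.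
have pin : p \in fib None by rewrite fibP; apply/eqP/line_proj_none.
apply/(loc_ord hR); first by rewrite mulf_neq0 // expf_neq0.
rewrite (ordM hR) ?expf_neq0 // (ordX hR) (bigD1_seq p) //=.
have := (loc_maxP hR _ _).1 (pole_inv nx); rewrite vge_ordE // => h1.
set N := (_ + _)%N; have h2 : `|ord p y| <= N%:Z by rewrite /N PoszD abszE lerDl.
have h3 : N%:Z <= ord p x^-1 *+ N by rewrite -mulr_natr natz ler_peMl.
have := ler_norm (- ord p y); rewrite normrN; lia.
Qed.

Lemma everywhere_regular v : (forall p, loc p v) -> exists c, v = k c.
Proof.
move=> h; apply: contrapT => nv; have [|p] := smooth_pole hX (y := v); last by [].
by move=> c vc; apply: nv; exists c.
Qed.

(* Birkhoff's splitting of the direct image of O_X on the projective line: the e_i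
   and the x^(-a_i) e_i are bases of its finite and infinite parts.  The last clause
   is what minimality of the sum of the a_i gives. *)
Definition birkhoff d (e : 'I_d -> F) (a : 'I_d -> nat) :=
  [/\ is_basis io e, forall i, bfin (e i), forall i, binf (a i) (e i) &
      forall (dl : 'rV[K]_d) j, dl 0 j != 0 -> bfin (lin io e dl) ->
        (forall p, ~ loc p x -> loc p (x * x^-1 ^+ a j * lin io e dl)) -> False].

(** Among all bases regular over the finite part, one with least sum of pole bounds is taken: an
    element as in the last clause could replace [e j] with the bound [a j] lowered by one. *)
Lemma ex_birkhoff : exists d (e : 'I_d -> F) a, (0 < d)%N /\ birkhoff e a.
Proof.
have [d [z [d0 he _]]] := ex_basis hX xC; exists d.
pose P m := `[< exists (e : 'I_d -> F) (a : 'I_d -> nat), [/\ is_basis io e, forall i, bfin (e i),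
   forall i, binf (a i) (e i) & (\sum_i a i)%N = m] >].
have P0 : exists m, P m.
  have /choice[Q QP] : forall i : 'I_d, exists Q : {poly C}, Q != 0 /\ bfin (peval k x Q * z ^+ i).
    by move=> i; exact: ex_bfin.
  have /choice[a aP] : forall i : 'I_d, exists n, binf n (peval k x (Q i) * z ^+ i).
    by move=> i; exact: ex_binf.
  exists (\sum_i a i)%N; apply/asboolP; exists (fun i => peval k x (Q i) * z ^+ i), a.
  split=> // [|i]; last by case: (QP i).
  apply: (@basis_scale _ _ io d _ (fun i => ev (Q i)) he) => i.
  by apply: (lev_neq0 xC); case: (QP i).
have [m /asboolP[e [a [be fe ie sa]]] mmin] := ex_minnP P0.
exists e, a; split=> //; split=> // dl j dj bv iv.
(* When [a j = 0] there is no bound to lower: the element is regular everywhere, hence constant, and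
   it vanishes at a pole of [x], hence is 0. *)
case aj : (a j) => [|n] in iv.
  have [|c vc] := @everywhere_regular (lin io e dl).
    move=> p; case: (pselect (loc p x)) => [/bv//|nx].
    have := iv _ nx; rewrite expr0 mulr1 => h.
    have -> : lin io e dl = x^-1 * (x * lin io e dl) by rewrite mulKf.
    by apply: (locM hR) => //; case: (pole_inv nx).
  have [p nx] := smooth_pole hX xC.
  have := iv _ nx; rewrite expr0 mulr1 => h.
  have : loc_max p (k c).
    have -> : k c = (x * lin io e dl) * x^-1 by rewrite -vc mulrAC divff // mul1r.
    by apply: (loc_maxMl hR) => //; exact: pole_inv.
  move=> /(loc_max_cst hR) c0; move: vc; rewrite c0 rmorph0 => v0.
  have dl0 : dl = 0 by case: be => + _; apply.
  by move: dj; rewrite dl0 mxE eqxx.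
pose e' i := if i == j then lin io e dl else e i.
pose a' i := if i == j then n else a i.
have : P (\sum_i a' i)%N.
  apply/asboolP; exists e', a'; split=> //.
  - exact: basis_replace.
  - by move=> i; rewrite /e'; case: ifP.
  - move=> i; rewrite /e' /a'; case: ifP => // _ p nx; have := iv _ nx.
    by rewrite exprS mulrA divff // mul1r.
move=> /mmin; rewrite -sa (bigD1 j) //= [leqRHS](bigD1 j) //= aj /a' eqxx.
rewrite [X in (_ <= _ + X)%N](eq_bigr a) => [|i /negPf->//]; lia.
Qed.

(** * Birkhoff's splitting and the product formula *)

Section Birkhoff.
Variables (d : nat) (e : 'I_d -> F) (a : 'I_d -> nat) (eP : birkhoff e a).
Variables (fib : pt Z -> seq (pt X)) (ufib : forall o, uniq (fib o)).
Hypothesis fibP : forall o q, (q \in fib o) = (line_proj q == o).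

Let t_inf : K := ev 1 / ev 'X.

Let io_inf : io t_inf = x^-1.
Proof. by rewrite fmorph_div ioX (lev1 k x) rmorph1 mul1r. Qed.

Definition twist (o : pt Z) (i : 'I_d) : K := if o is Some _ then 1 else t_inf ^+ a i.

Definition bk_basis (o : pt Z) (i : 'I_d) : F := io (twist o i) * e i.

Lemma twist_neq0 o i : twist o i != 0.
Proof.
case: o => [b|]; rewrite ?oner_eq0 // /twist expf_neq0 // mulf_neq0 ?invr_eq0 //.
by rewrite lev1 oner_eq0.
Qed.

Lemma bk_is_basis o : is_basis io (bk_basis o).
Proof. by apply: basis_scale; [case: eP | exact: twist_neq0]. Qed.

Lemma bk_semiloc o i : semiloc (fib o) (bk_basis o i).
Proof.
move=> q; rewrite fibP /bk_basis => /eqP qo; case: eP => _ h1 h2 _.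
case: o qo => [b /line_proj_some[lx _]|/line_proj_none nx].
  by rewrite rmorph1 mul1r; exact: h1.
by rewrite /twist rmorphXn io_inf; exact: h2.
Qed.

Definition line_unif (o : pt Z) : K := if o is Some b then ev ('X - b%:P) else t_inf.

Lemma line_unifP (o : pt Z) : uniformizer o (line_unif o).
Proof. by case: o => [b|]; [exact: line_unif_some | exact: line_unif_none]. Qed.

(** Let [a j] be the largest pole bound with $c_j\ne0$. If the quotient were regular, then $\sum
    c_ie_i/(x-b)$ at a finite point $b$, or $\sum c_ix^{a_j-a_i}e_i$ at infinity, would have nonzero
    coordinate at [j], be regular over the finite part and satisfy the pole bound $a_j-1$: the last
    clause of [birkhoff] forbids it. *)
Lemma bk_improve (o : pt Z) (c : 'rV[C]_d) (t : K) : c != 0 -> uniformizer o t ->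
  t = line_unif o ->
  ~ semiloc (fib o) (io t^-1 * \sum_i k (c 0 i) * bk_basis o i).
Proof.
move=> c0 tt tE lw; have [be fe ie no] := eP.
have [i0 ci0] : exists i, c 0 i != 0.
  by apply/existsP; apply: contraNT c0 => /existsPn h; apply/eqP/rowP => i; rewrite mxE; apply/eqP/negPn.
have [j cj jmax] := @arg_maxnP _ i0 (fun i => c 0 i != 0) a ci0.
have kio b : k b = io (ev b%:P) by rewrite ratinclE pevalC.
have mono p i : ~ loc p x -> c 0 i != 0 -> loc p (x^-1 ^+ a j * e i).
  move=> nx /jmax ij; rewrite -(subnK ij) exprD -mulrA; apply: (locM hR); last exact: ie.
  by apply: (locX hR); case: (pole_inv nx).
case: o tt tE lw => [b|] tt tE lw.
  have tx : io t = x - k b by rewrite tE ratinclE pevalB pevalX pevalC.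
  have t0 : io t != 0 by rewrite fmorph_eq0 (unif_neq0 tt).
  pose dl : 'rV[K]_d := \row_i (t^-1 * ev (c 0 i)%:P).
  have vE : lin io e dl = io t^-1 * \sum_i k (c 0 i) * e i.
    by rewrite mulr_sumr; apply: eq_bigr => i _; rewrite mxE rmorphM -kio mulrA.
  have wE : io t^-1 * \sum_i k (c 0 i) * bk_basis (Some b) i = lin io e dl.
    by rewrite vE; congr (_ * _); apply: eq_bigr => i _; rewrite /bk_basis rmorph1 mul1r.
  rewrite wE in lw; apply: (no dl j).
  - rewrite mxE mulf_neq0 ?invr_eq0 ?(unif_neq0 tt) //.
    by apply: (lev_neq0 xC); rewrite polyC_eq0.
  - move=> p lx; have [vx|vx] := eqVneq (value p x) b.
      by apply: lw; rewrite fibP; apply/eqP/line_proj_some.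
    rewrite vE; apply: (locM hR); last first.
      by apply: (loc_sum hR) => i _; apply: (locM hR); [exact: rc_loc_cst | exact: fe].
    have lxb : loc p (x - k b) by apply: (locB hR) => //; exact: rc_loc_cst.
    suff : loc_unit p (x - k b) by rewrite fmorphV tx => -[].
    apply/(value_unit hR lxb); rewrite (valueD hR) ?(valueN hR) ?(value_cst hR) //.
    + by apply/eqP; rewrite subr_eq0.
    + exact: rc_loc_cst.
    + by apply: (locN hR); exact: rc_loc_cst.
  - move=> p nx; rewrite vE.
    have -> : x * x^-1 ^+ a j * (io t^-1 * \sum_i k (c 0 i) * e i) =
        (x / io t) * (\sum_i k (c 0 i) * (x^-1 ^+ a j * e i)).
      have -> : \sum_i k (c 0 i) * (x^-1 ^+ a j * e i) = x^-1 ^+ a j * \sum_i k (c 0 i) * e i.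
        by rewrite mulr_sumr; apply: eq_bigr => i _; rewrite mulrCA.
      by rewrite fmorphV; move: (x^-1 ^+ a j) => X1; field.
    have nx' : loc_max p x^-1 := pole_inv nx.
    apply: (locM hR); last first.
      apply: (loc_sum hR) => i _; have [->|ci] := eqVneq (c 0 i) 0.
        by rewrite rmorph0 mul0r; exact: (loc0 hR).
      by apply: (locM hR); [exact: rc_loc_cst | exact: mono].
    have l1 : loc p (1 - k b * x^-1).
      by apply: (locB hR); [exact: (loc1 hR) | apply: (locM hR); [exact: rc_loc_cst | case: nx']].
    suff : loc_unit p (1 - k b * x^-1).
      case=> u0 _; suff -> : x / io t = (1 - k b * x^-1)^-1 by [].
      rewrite tx in t0 *; field; rewrite x0 /=.
      exact: t0.
    apply: contrapT => nu; have m1 : loc_max p (1 - k b * x^-1) by split.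
    have : loc_max p (k 1).
      rewrite rmorph1 -(subrK (k b * x^-1) 1); apply: (loc_maxD hR) => //.
      by apply: (loc_maxMl hR) => //; exact: rc_loc_cst.
    by move/(loc_max_cst hR)/eqP; rewrite oner_eq0.
have iot : io t^-1 = x by rewrite tE fmorphV io_inf invrK.
rewrite iot in lw.
pose dl : 'rV[K]_d := \row_i (ev (c 0 i)%:P * if (a i <= a j)%N then ev 'X ^+ (a j - a i) else 0).
have c0i i : (a i <= a j)%N = false -> c 0 i = 0.
  by move=> h; apply/eqP/negPn/negP => /jmax h1; move: h; rewrite [(a i <= a j)%N]h1.
have vE : lin io e dl = x ^+ a j * \sum_i k (c 0 i) * bk_basis None i.
  rewrite mulr_sumr; apply: eq_bigr => i _; rewrite mxE rmorphM -kio /bk_basis /twist.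
  case: ifP => h; last by rewrite (c0i _ h) rmorph0 !mul0r mulr0.
  rewrite rmorphXn ioX rmorphXn io_inf; rewrite -{2}(subnK h) exprD exprVn.
  by field; rewrite expf_neq0.
apply: (no dl j).
- by rewrite mxE leqnn subnn expr0 mulr1; apply: (lev_neq0 xC); rewrite polyC_eq0.
- move=> p lx; apply: (loc_sum hR) => i _; rewrite mxE rmorphM -kio.
  apply: (locM hR); last exact: fe.
  apply: (locM hR); first exact: rc_loc_cst.
  case: ifP => _; last by rewrite rmorph0; exact: (loc0 hR).
  by rewrite rmorphXn ioX; exact: (locX hR).
- move=> p nx; rewrite vE.
  have -> : x * x^-1 ^+ a j * (x ^+ a j * \sum_i k (c 0 i) * bk_basis None i) =
     x * \sum_i k (c 0 i) * bk_basis None i.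
    by rewrite exprVn; field; rewrite expf_neq0.
  by apply: lw; rewrite fibP; apply/eqP/line_proj_none.
Qed.

(** If a regular [y] had non-integral coordinates, scaling them by some [s] vanishing at [o] would
    make them integral with residues [g], not all 0; then $\sum g_ie_i$, in the local basis, is
    congruent to $sy$ and so divisible by the uniformizer, against [bk_improve]. *)
Lemma bk_cover (o : pt Z) : @cover_at C Z X io o (fib o) d (bk_basis o).
Proof.
split=> //.
- exact: (smooth_separating hX).
- by move=> q y; rewrite fibP => /eqP <-; exact: (line_proj_loc q y).1.
- by move=> q y; rewrite fibP => /eqP <-; exact: (line_proj_loc q y).2.
- by move=> c; rewrite ratinclE pevalC.
- exact: bk_is_basis.
have lio q y : q \in fib o -> loc o y -> loc q (io y).
  by rewrite fibP => /eqP <-; exact: (line_proj_loc q y).1.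
move=> y; split=> [ly|lc]; last first.
  move=> q qo; rewrite -(coord_inK (bk_is_basis o) y); apply: (loc_sum hR) => i _.
  by apply: (locM hR); [apply: lio => //; exact: lc | exact: bk_semiloc].
apply: contrapT => nl; set c := coord_in _ _ _ in nl.
have c0 : c != 0.
  by apply: contra_notN nl => /eqP -> i j; rewrite mxE; exact: (loc0 hZ).
have [s [s0 sl [i ui]]] := scale_primitive hZ o c0.
have os : vge o 1 s.
  apply: contrapT => /negP; rewrite vge_ordE // -ltNge => hs; apply: nl => i' j; have := sl i' j; rewrite mxE => h.
  have -> : c i' j = s^-1 * (s * c i' j) by rewrite mulKf.
  apply: (locM hZ) => //; apply/(loc_ord hZ); rewrite ?invr_eq0 // (ordV hZ); lia.
have [t tt tE] : exists2 t : K, uniformizer o t & t = line_unif o.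
  by exists (line_unif o) => //; exact: line_unifP.
pose g : 'rV[C]_d := \row_l value o (s * c 0 l).
have g0 : g != 0.
  apply/eqP => /rowP/(_ i); rewrite !mxE; apply/(value_unit hZ) => //.
  by case: ui.
apply: (bk_improve g0 tt tE) => q qo.
have -> : io t^-1 * (\sum_l k (g 0 l) * bk_basis o l) =
    \sum_l io (t^-1 * (cst Z (g 0 l) - s * c 0 l)) * bk_basis o l + io (t^-1 * s) * y.
  have yE : y = \sum_l io (c 0 l) * bk_basis o l by rewrite -[LHS](coord_inK (bk_is_basis o)).
  rewrite [X in _ = _ + _ * X]yE mulr_sumr [X in _ + X]mulr_sumr -big_split.
  apply: eq_bigr => l _.
  have kio : io (cst Z (g 0 l)) = k (g 0 l) by rewrite ratinclE pevalC.
  have -> : io (t^-1 * (cst Z (g 0 l) - s * c 0 l)) = io t^-1 * (k (g 0 l) - io s * io (c 0 l)).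
    by rewrite -kio -(rmorphM io) -(rmorphB io) -(rmorphM io).
  rewrite (rmorphM io _ s); move: (io t^-1) (io s) (io (c 0 l)) (k (g 0 l)) (bk_basis o l) => y1 y2 y3 y4 y5.
  rewrite -[RHS]/(y1 * (y4 - y2 * y3) * y5 + y1 * y2 * (y3 * y5)); ring.
have lt z : vge o 1 z -> loc q (io (t^-1 * z)).
  move=> /(vgeE hZ _ _ tt) h; apply: lio => //; move: h.
  by rewrite mulrC -exprnN expr1.
apply: (locD hR); last by apply: (locM hR); [exact: lt | exact: ly].
apply: (loc_sum hR) => l _; apply: (locM hR); last exact: bk_semiloc.
apply: lt; rewrite -vgeN // opprB mxE; apply/(loc_maxP hZ)/(valueP hZ).
by have := sl 0 l; rewrite mxE.
Qed.

End Birkhoff.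

End CoverLine.

(** * Divisors on the line *)

Section LineProduct.
Variables (C : numClosedFieldType) (F : fieldType) (k : {rmorphism C -> F}).
Variables (x : F) (xC : forall c : C, x <> k c).
Local Notation K := (ratfield k x).
Local Notation ev := (rateval k x).
Local Notation Z := (line_curve k x).
Let hZ := line_regular xC.

Let good (y : K) := y != 0 /\
  (finsupp (fun o : pt Z => ord o y) /\ \sum_(o \in [set: pt Z]) ord o y = 0).

Let goodM y z : good y -> good z -> good (y * z).
Proof.
move=> [y0 [fy sy]] [z0 [fz sz]]; split; first by rewrite mulf_neq0.
have E (o : pt Z) : ord o (y * z) = ord o y + ord o z by exact: (ordM hZ).
split; first by have [s sP] := finsuppD fy fz; exists s => o /sP; rewrite E.
by rewrite (eq_fsum E) fsumD // sy sz addr0.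
Qed.

Let goodV y : good y -> good y^-1.
Proof.
move=> [y0 [fy sy]]; split; first by rewrite invr_eq0.
have E (o : pt Z) : ord o y^-1 = - ord o y by exact: (ordV hZ).
split; first by have [s sP] := finsuppN fy; exists s => o /sP; rewrite E.
by rewrite (eq_fsum E) fsumN // sy oppr0.
Qed.

Let good_poly P : P != 0 -> good (ev P).
Proof.
move=> P0; have [s PE] := closed_field_poly_normal P; rewrite PE -mul_polyC levM.
apply: goodM.
  have l0 : lead_coef P != 0 by rewrite lead_coef_eq0.
  have o0 (o : pt Z) : ord o (ev (lead_coef P)%:P) = 0.
    by apply: (ord_unit hZ); exact: (loc_unit_cst hZ o l0).
  split; first by apply: (lev_neq0 xC); rewrite polyC_eq0.
  by split; [exists [::] => o _ | exact: fsum0].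
elim: s {PE} => [|a s IH].
  rewrite big_nil lev1; split; first exact: oner_neq0.
  by split; [exists [::] => o _; exact: (ordv1 hZ) | apply: fsum0 => o; exact: (ordv1 hZ)].
rewrite big_cons levM; apply: goodM => //.
split; first by apply: (lev_neq0 xC); rewrite polyXsubC_eq0.
have out (o : pt Z) : o \notin [:: Some a; None] -> ord o (ev ('X - a%:P)) = 0.
  case: o => [b|]; rewrite !inE // orbF => ab; rewrite (ord_line_some xC).
  by have [abE|//] := eqVneq a b; rewrite abE eqxx in ab.
split; first by exists [:: Some a; None].
rewrite (@fsumE (pt Z) _ [:: Some a; None]) // !big_cons big_nil addr0.
by rewrite (ord_line_some xC) (ord_line_none xC) eqxx addrN.
Qed.

(** Up to constants every function is a product of powers of the $x-a$, each with a simple zero at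
    $a$ and a simple pole at infinity. *)
Lemma line_product y : y != 0 ->
  finsupp (fun o : pt Z => ord o y) /\ \sum_(o \in [set: pt Z]) ord o y = 0.
Proof.
move=> y0; have [P [Q [Q0 yE]]] := ratP y; rewrite yE.
have P0 : P != 0 by apply: contraNneq y0 => P0; rewrite yE P0 rmorph0 mul0r.
have Q1 : Q != 0 by apply: contraNneq Q0 => ->; rewrite peval0.
by case: (goodM (good_poly P0) (goodV (good_poly Q1))).
Qed.

Lemma line_polynomial y : (forall a, @loc _ Z (Some a) y) -> exists P, y = ev P.
Proof.
move=> ly; have [P [Q [Q0 yE]]] := ratP y.
elim: {Q}(size Q) {-2}Q (leqnn (size Q)) P Q0 yE => [|n IH] Q sQ P Q0 yE.
  by move: sQ Q0; rewrite leqn0 size_poly_eq0 => /eqP ->; rewrite peval0 eqxx.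
have Q1 : Q != 0 by apply: contraNneq Q0 => ->; rewrite peval0.
have [sQ1|/closed_rootP] := eqVneq (size Q) 1%N.
  move: sQ1 => /eqP/size_poly1P[c c0 QE]; exists (c^-1 *: P).
  rewrite yE QE -mul_polyC levM mulrC; congr (_ * _).
  apply: (mulfI (_ : ev c%:P != 0)); first by apply: (lev_neq0 xC); rewrite polyC_eq0.
  rewrite divff; last by apply: (lev_neq0 xC); rewrite polyC_eq0.
  by rewrite -levM -polyCM divff // lev1.
move=> [a /factor_theorem[Q' QE]].
have [P2 [Q2 [Q2a yE2]]] := ly a.
have Q'0 : Q' != 0 by apply: contraNneq Q1 => h; rewrite QE h mul0r.
have Q20 := lev_neq0 xC (horner_neq0 Q2a).
have : ev (P * Q2) = ev (P2 * Q).
  have E : ev P / ev Q = ev P2 / ev Q2 by rewrite -yE -yE2.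
  by rewrite !levM; move/eqP: E; rewrite eqr_div ?(lev_neq0 xC Q1) // => /eqP.
move/(lev_inj xC)/(congr1 (fun R : {poly C} => R.[a]))/eqP.
rewrite QE !hornerM hornerXsubC subrr !mulr0 mulf_eq0 (negPf Q2a) orbF => Pa.
have [P' PE] := factor_theorem P a Pa.
have Xa : ev ('X - a%:P) != 0 by apply: (lev_neq0 xC); rewrite polyXsubC_eq0.
apply: (IH Q' _ P').
- by move: sQ; rewrite QE size_mul ?polyXsubC_eq0 // size_XsubC addn2.
- exact: (peval_neq0 xC).
- by rewrite yE PE QE !levM -mulf_div divff // mulr1.
Qed.

End LineProduct.

Section ProductFormula.
Variables (C : numClosedFieldType) (X : curve C) (hX : smooth_projective_curve X).
Local Notation F := (fld X).
Local Notation k := (cst X).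
Let hR := smooth_regular hX.

(** Grouping the points by fibres over the line turns the sum into that of the orders of the norm,
    by [ord_fnorm]. For finiteness, [y] and its inverse are regular outside infinity and the zeros
    of the denominators of their coordinates. *)
Lemma product_formula (y : F) : y != 0 ->
  finsupp (fun p : pt X => ord p y) /\ \sum_(p \in [set: pt X]) ord p y = 0.
Proof.
move=> y0; have [x xC] := smooth_tr hX; have hZ := line_regular xC.
have [d [e [a [d0 eP]]]] := ex_birkhoff hX xC.
have [fib [ufib fibP]] := ex_fibres hX xC.
have cov := bk_cover hX xC eP ufib fibP.
have he : is_basis (ratincl k x) e by case: eP.
have key (o : pt (line_curve k x)) : ord o (fnorm (ratincl k x) e y) = \sum_(q <- fib o) ord q y.
  rewrite -(ord_fnorm hZ hR (cov o) (line_unifP xC o) y0); congr ord.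
  by symmetry; exact: (fnorm_chg y he (bk_is_basis xC eP o)).
have bound (v : F) : exists s : seq (pt (line_curve k x)), forall p, line_proj x p \notin s -> loc p v.
  have /choice[PQ PQP] : forall i, exists PQ : {poly C} * {poly C}, peval k x PQ.2 != 0 /\
      coord_in (ratincl k x) e v 0 i = rateval k x PQ.1 / rateval k x PQ.2.
    by move=> i; have [P [Q h]] := ratP (coord_in (ratincl k x) e v 0 i); exists (P, Q).
  have [rs rsP] := closed_field_poly_normal (\prod_i (PQ i).2).
  exists (None :: map Some rs) => p; rewrite inE negb_or => /andP[].
  case E : (line_proj x p) => [b|//] _ bs.
  have [lx _] := (line_proj_some _ _ _).1 E.
  rewrite -(coord_inK he v); apply: (loc_sum hR) => i _.
  apply: (locM hR); last by case: eP => _ h _ _; exact: h.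
  apply: (line_proj_loc hX xC p _).1; rewrite E; have [Q0 ->] := PQP i.
  exists (PQ i).1, (PQ i).2; split=> //; apply: contra bs => Qb.
  apply/map_f; rewrite -root_prod_XsubC -(rootZ _ _ (_ : lead_coef (\prod_i (PQ i).2) != 0)).
    by rewrite -rsP rootE horner_prod (bigD1 i) //= mulf_eq0 Qb.
  rewrite lead_coef_eq0; apply/prodf_neq0 => j _; have [Qj _] := PQP j.
  by apply: contraNneq Qj => ->; rewrite peval0.
have fin : finsupp (fun p : pt X => ord p y).
  have [s1 h1] := bound y; have [s2 h2] := bound y^-1.
  exists (flatten [seq fib o | o <- s1 ++ s2]) => p np.
  have nps : line_proj x p \notin s1 ++ s2.
    apply: contra np => ps; apply/flatten_mapP; exists (line_proj x p) => //.
    by rewrite fibP.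
  move: nps; rewrite mem_cat negb_or => /andP[n1 n2].
  by apply: (ord_unit hR); split=> //; [exact: h1 | exact: h2].
split=> //; have [_ ->] := fsum_fibre ufib fibP fin.
rewrite -(eq_fsum key).
by case: (line_product xC (fnorm_neq0 he y0)).
Qed.

End ProductFormula.

(** * Derivations *)

Section FractionDerivation.
Variables (S : comNzRingType) (F : fieldType) (A : {rmorphism S -> F}) (dl : S -> F).
Hypothesis dlD : forall G H, dl (G + H) = dl G + dl H.
Hypothesis dlM : forall G H, dl (G * H) = A G * dl H + A H * dl G.
Hypothesis dlK : forall G, A G = 0 -> dl G = 0.
Hypothesis frac : forall y, exists GH : S * S, A GH.2 != 0 /\ y = A GH.1 / A GH.2.

(** The quotient rule, which [dlK] makes independent of the chosen fraction. In the application S is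
    a polynomial ring and [A] an evaluation with a kernel. *)
Lemma fraction_derivation : exists D : F -> F,
  [/\ forall y z, D (y + z) = D y + D z, forall y z, D (y * z) = D y * z + y * D z &
      forall G, D (A G) = dl G].
Proof.
have [r rP] := choice frac.
pose D y := (dl (r y).1 * A (r y).2 - A (r y).1 * dl (r y).2) / A (r y).2 ^+ 2.
have dlN G : dl (- G) = - dl G.
  apply/eqP; rewrite -addr_eq0 -dlD addrC subrr.
  by apply/eqP/dlK; rewrite rmorph0.
have DE G H : A H != 0 -> D (A G / A H) = (dl G * A H - A G * dl H) / A H ^+ 2.
  move=> H0; have [b0 E] := rP (A G / A H); rewrite /D.
  move: (r _).1 (r _).2 b0 E => G' H' b0 E.
  have AE : A G * A H' = A G' * A H.
    by apply/eqP; rewrite -eqr_div // E.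
  have dE : dl G * A H' + A G * dl H' = dl G' * A H + A G' * dl H.
    have /dlK : A (G * H' - G' * H) = 0 by rewrite rmorphB !rmorphM AE subrr.
    rewrite dlD dlN !dlM => /subr0_eq h.
    by rewrite addrC [X in _ + X]mulrC h addrC [X in X + _]mulrC.
  apply/eqP; rewrite eqr_div ?expf_neq0 //; apply/eqP.
  have -> : (dl G' * A H' - A G' * dl H') * A H ^+ 2 =
     A H * A H' * (dl G' * A H) - A H * dl H' * (A G' * A H) by ring.
  have -> : (dl G * A H - A G * dl H) * A H' ^+ 2 =
     A H * A H' * (dl G * A H') - A H' * dl H * (A G * A H') by ring.
  rewrite -AE.
  have -> : dl G' * A H = dl G * A H' + A G * dl H' - A G' * dl H by rewrite dE addrK.
  have -> : A H' * dl H * (A G * A H') = A H' * dl H * (A G' * A H) by rewrite AE.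
  ring.
exists D; split=> [y z|y z|G].
- have [H0 yE] := rP y; have [H0' zE] := rP z; rewrite yE zE.
  move: (r y).1 (r y).2 (r z).1 (r z).2 H0 H0' {yE zE} => G H G' H' H0 H0'.
  have -> : A G / A H + A G' / A H' = A (G * H' + G' * H) / A (H * H').
    by rewrite rmorphD !rmorphM; field; rewrite H0 H0'.
  rewrite !DE ?rmorphM ?mulf_neq0 // dlD !dlM rmorphD !rmorphM; field.
  by rewrite H0 H0'.
- have [H0 yE] := rP y; have [H0' zE] := rP z; rewrite yE zE.
  move: (r y).1 (r y).2 (r z).1 (r z).2 H0 H0' {yE zE} => G H G' H' H0 H0'.
  have -> : A G / A H * (A G' / A H') = A (G * G') / A (H * H').
    by rewrite !rmorphM; field; rewrite H0 H0'.
  rewrite !DE ?rmorphM ?mulf_neq0 // !dlM ?rmorphM; field.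
  by rewrite H0 H0'.
- have dl1 : dl 1 = 0.
    have := dlM 1 1; rewrite mulr1 rmorph1 !mul1r => /esym/eqP.
    by rewrite -subr_eq0 addrK => /eqP.
  have -> : A G = A G / A 1 by rewrite rmorph1 divr1.
  by rewrite DE rmorph1 ?oner_eq0 // dl1 mulr0 subr0 mulr1 expr1n divr1.
Qed.

End FractionDerivation.

Section ExistsDerivation.
Variables (C : numClosedFieldType) (X : curve C) (hX : smooth_projective_curve X).
Local Notation F := (fld X).
Local Notation k := (cst X).

(** With [f] a relation of least degree between [x] and a primitive element [z], the derivation
    $f_z\partial_x-f_x\partial_z$ of polynomials kills [f], hence descends to F. Its value on [x] is
    $f_z$, nonzero by minimality and characteristic 0. *)
Lemma ex_der (x : F) : (forall c : C, x <> k c) -> exists D : der X, D x != 0.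
Proof.
move=> xC; have [z zP] := ex_primitive hX xC.
pose A : {rmorphism {poly {poly C}} -> F} := (horner_eval z \o map_poly (peval k x))%FUN.
have AE G : A G = (map_poly (peval k x) G).[z] by [].
have h : exists n, `[< exists G : {poly {poly C}}, [/\ G != 0, size G = n & A G = 0] >].
  have [G G0 Gz] := algebraic_algdep (smooth_alg hX z xC).
  by exists (size G); apply/asboolP; exists G.
have [n /asboolP[f [f0 sf Af]] nmin] := ex_minnP h.
have Amin (G : {poly {poly C}}) : (size G < size f)%N -> A G = 0 -> G = 0.
  move=> sG AG; apply: contraTeq sG => G0; rewrite -leqNgt sf; apply: nmin.
  by apply/asboolP; exists G.
have AC (P : {poly C}) : A P%:P = peval k x P by rewrite AE map_polyC hornerC.
have f1 : (1 < size f)%N.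
  rewrite ltnNge; apply/negP => sf1; move: f0 Af; rewrite (size1_polyC sf1) AC polyC_eq0.
  by move=> /(peval_neq0 xC)/eqP.
have fZ : A f^`() != 0.
  apply/eqP => /Amin fz; have sd : (size f^`() < size f)%N by exact: lt_size_deriv.
  have := fz sd => /polyP/(_ (size f).-2)/eqP; rewrite coef_deriv coef0.
  have -> : (size f).-2.+1 = (size f).-1 by case: (size f) f1 => [|[|m]].
  rewrite -lead_coefE -mulr_natr mulf_eq0 lead_coef_eq0 (negPf f0) /=.
  rewrite -polyC_natr polyC_eq0 pnatr_eq0.
  by case: (size f) f1 => [|[|m]].
pose dX (G : {poly {poly C}}) := map_poly (fun P : {poly C} => P^`()) G.
have dXD G H : dX (G + H) = dX G + dX H.
  apply/polyP => i; rewrite coefD !coef_map_id0 ?linear0 // coefD; exact: derivD.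
have dXc G i : (dX G)`_i = (G`_i)^`() by rewrite coef_map_id0 // linear0.
have dXM G H : dX (G * H) = dX G * H + G * dX H.
  apply/polyP => i; rewrite dXc coefD !coefM linear_sum /= -big_split; apply: eq_bigr => j _.
  by rewrite derivM !dXc.
pose dl G := A (dX G) * A f^`() - A G^`() * A (dX f).
have dlD G H : dl (G + H) = dl G + dl H.
  by rewrite /dl dXD derivD !rmorphD; ring.
have dlM G H : dl (G * H) = A G * dl H + A H * dl G.
  by rewrite /dl dXM derivM !rmorphD !rmorphM; ring.
have dlK G : A G = 0 -> dl G = 0.
  (* Pseudo-division over C[x]: a nonzero multiple $cG$ equals $qf+r$, and $r=0$ because [f] has
     least degree. *)
  move=> AG; have E := Pdiv.Idomain.divp_eq G f.
  set c := lead_coef f ^+ _ in E; set q := (_ %/ _) in E; set r := (_ %% _) in E.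
  have AcG : A (c *: G) = 0 by rewrite -mul_polyC rmorphM AG mulr0.
  have r0 : r = 0.
    apply: Amin; first by rewrite ltn_modp.
    by move: AcG; rewrite E rmorphD rmorphM Af mulr0 add0r.
  have dlf : dl f = 0 by rewrite /dl [X in _ - X]mulrC subrr.
  have c0 : A c%:P != 0 by rewrite AC; apply: (peval_neq0 xC); rewrite expf_neq0 // lead_coef_eq0.
  have : dl (c%:P * G) = 0 by rewrite mul_polyC E r0 addr0 dlM dlf Af mulr0 mul0r addr0.
  by rewrite dlM AG mul0r addr0 => /eqP; rewrite mulf_eq0 (negPf c0) => /eqP.
have frac y : exists GH : {poly {poly C}} * {poly {poly C}}, A GH.2 != 0 /\ y = A GH.1 / A GH.2.
  have [P PE] := zP y; have [Q [G [Q0 GE]]] := clear_denominators P.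
  exists (G, Q%:P); rewrite AC; split=> //.
  rewrite AE -horner_rat GE linearZ /= hornerZ PE mulrC mulKf //.
have [D [DD DM DA]] := fraction_derivation dlD dlM dlK frac.
have DC c : D (k c) = 0.
  have -> : k c = A (c%:P)%:P by rewrite AC pevalC.
  rewrite DA /dl derivC rmorph0 mul0r subr0.
  have -> : dX (c%:P)%:P = 0 by apply/polyP => i; rewrite dXc coefC; case: ifP; rewrite ?derivC ?linear0 ?coef0.
  by rewrite rmorph0 mul0r.
have Dx : D x = A f^`().
  have -> : x = A ('X)%:P by rewrite AC pevalX.
  rewrite DA /dl derivC rmorph0 mul0r subr0.
  have -> : dX ('X)%:P = 1.
    by apply/polyP => i; rewrite dXc coefC coef1; case: eqP => _; rewrite ?derivX ?linear0.
  by rewrite rmorph1 mul1r.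
by exists (@Der _ _ D (And3 DD DM DC)); rewrite /= Dx.
Qed.

End ExistsDerivation.

Section DerivationFacts.
Variables (C : numClosedFieldType) (X : curve C) (hX : smooth_projective_curve X).
Local Notation F := (fld X).
Local Notation k := (cst X).
Let hR := smooth_regular hX.
Implicit Types (p : pt X) (D : der X) (x y u : F).

Lemma der_ext D D' : (forall x, D x = D' x) -> D = D'.
Proof.
case: D D' => f hf [g hg] /= /funext E; move: hf hg; rewrite E => hf hg.
by congr Der; exact: Prop_irrelevance.
Qed.

Lemma derD D x y : D (x + y) = D x + D y. Proof. by case: (derP D). Qed.
Lemma derM D x y : D (x * y) = D x * y + x * D y. Proof. by case: (derP D). Qed.
Lemma derC D c : D (k c) = 0. Proof. by case: (derP D). Qed.
Lemma der_0 D : D 0 = 0. Proof. by have := derC D 0; rewrite rmorph0. Qed.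
Lemma der_1 D : D 1 = 0. Proof. by have := derC D 1; rewrite rmorph1. Qed.
Lemma derN D x : D (- x) = - D x.
Proof. by apply/eqP; rewrite -addr_eq0 -derD addrC subrr der_0. Qed.
Lemma derB D x y : D (x - y) = D x - D y. Proof. by rewrite derD derN. Qed.

Lemma derV D x : D x^-1 = - D x / x ^+ 2.
Proof.
have [->|x0] := eqVneq x 0; first by rewrite invr0 der_0 oppr0 mul0r.
have := derM D x x^-1; rewrite divff // der_1 => /esym/eqP; rewrite addrC addr_eq0 => /eqP E.
by apply: (mulfI x0); rewrite E; field.
Qed.

Lemma derX D x n : D (x ^+ n) = x ^+ n.-1 * D x *+ n.
Proof.
elim: n => [|n IH]; first by rewrite expr0 der_1 mulr0n.
rewrite exprS derM IH /= mulrS mulrC; congr (_ + _).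
by case: n {IH} => [|n]; rewrite ?mulr0n ?mulr0 //= -mulrnAr mulrA -exprS mulrnAr.
Qed.

Lemma der_peval D u (P : {poly C}) : D (peval k u P) = peval k u P^`() * D u.
Proof.
elim/poly_ind: P => [|P c IH]; first by rewrite deriv0 peval0 der_0 mul0r.
have -> : peval k u (P * 'X + c%:P) = peval k u P * u + k c.
  by rewrite /peval rmorphD rmorphM /= map_polyX map_polyC hornerMXaddC.
rewrite derD derM derC addr0 IH derivD derivM derivX derivC addr0 mulr1.
have -> : peval k u (P^`() * 'X + P) = peval k u P^`() * u + peval k u P.
  by rewrite /peval rmorphD rmorphM /= map_polyX hornerD hornerM hornerX.
by ring.
Qed.

(** [D] kills C(u). For the minimal polynomial [p] of [y] over that field, $0=D(p(y))=p'(y)D(y)$,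
    and $p'(y)\ne0$ in characteristic 0. *)
Lemma der_eq0 D u : (forall c, u <> k c) -> D u = 0 -> forall y, D y = 0.
Proof.
move=> uC Du y.
have Dk (a : ratfield k u) : D (ratincl k u a) = 0.
  have [P [Q [Q0 ->]]] := ratP a; rewrite fmorph_div !ratinclE derM derV !der_peval Du.
  by rewrite !mulr0 mul0r oppr0 mul0r mulr0 addr0.
have h : exists n, `[< exists p : {poly ratfield k u}, [/\ p != 0, size p = n & root (map_poly (ratincl k u) p) y] >].
  by have [p p0 py] := smooth_alg hX y uC; exists (size p); apply/asboolP; exists p.
have [n /asboolP[p [p0 sp /rootP py]] nmin] := ex_minnP h.
have Dp (q : {poly ratfield k u}) : D (map_poly (ratincl k u) q).[y] = (map_poly (ratincl k u) q^`()).[y] * D y.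
  elim/poly_ind: q => [|q c IH]; first by rewrite deriv0 rmorph0 horner0 der_0 mul0r.
  have mp (q1 q2 : {poly ratfield k u}) : map_poly (ratincl k u) (q1 * 'X + q2) =
      map_poly (ratincl k u) q1 * 'X + map_poly (ratincl k u) q2.
    rewrite rmorphD; congr (_ + _).
    by rewrite rmorphM; congr (_ * _); exact: map_polyX.
  rewrite derivD derivM derivX derivC addr0 mulr1 !mp map_polyC !hornerD !hornerM !hornerX hornerC.
  by rewrite derD derM Dk IH addr0; ring.
have p'0 : (map_poly (ratincl k u) p^`()).[y] != 0.
  have sp1 : (1 < size p)%N.
    rewrite ltnNge; apply/negP => sp1; move: p0 py; rewrite (size1_polyC sp1) map_polyC hornerC polyC_eq0.
    by move=> c0 /eqP; rewrite fmorph_eq0 (negPf c0).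
  apply/eqP => E; have : p^`() != 0.
    apply/eqP => /polyP/(_ (size p).-2)/eqP; rewrite coef_deriv coef0.
    have -> : (size p).-2.+1 = (size p).-1 by case: (size p) sp1 => [|[|m]].
    rewrite -lead_coefE -mulr_natr mulf_eq0 lead_coef_eq0 (negPf p0) /=.
    have /pcharf0P -> := ratfield_pchar0 u.
    by case: (size p) sp1 => [|[|m]].
  move=> p'0; have := lt_size_deriv p0; rewrite ltnNge sp => /negP; apply.
  by apply: nmin; apply/asboolP; exists p^`(); split=> //; exact/rootP.
have := Dp p; rewrite py der_0 => /esym/eqP; rewrite mulf_eq0 (negPf p'0).
by move/eqP.
Qed.

Lemma der_neq_cst D u : D u != 0 -> forall c, u <> k c.
Proof. by move=> Du c uc; move: Du; rewrite uc derC eqxx. Qed.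

Lemma der_unique D D' u : D u != 0 -> forall x, D' x = (D' u / D u) * D x.
Proof.
move=> Du x; pose E : F -> F := fun x => D' x - (D' u / D u) * D x.
have hE : derivation E.
  split=> [y z|y z|c]; rewrite /E.
  - by rewrite !derD; ring.
  - by rewrite !derM; ring.
  - by rewrite !derC mulr0 subrr.
have := @der_eq0 (Der hE) u (der_neq_cst Du); rewrite /= /E divfK // subrr.
by move=> /(_ erefl x)/subr0_eq.
Qed.

Lemma unif_notin p t : uniformizer p t -> forall c, t <> k c.
Proof.
move=> tt c tc; have := unif_max hR tt; rewrite tc => /(loc_max_cst hR) c0.
by have := unif_neq0 tt; rewrite tc c0 rmorph0 eqxx.
Qed.

(** [D] has bounded poles on the local ring, and the bound improves step by step: for $y=c+ty_1$ one
    has $D(y)=y_1D(t)+tD(y_1)$, where the factor [t] gains one order. *)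
Lemma tangentP p t D : uniformizer p t -> tangent p D <-> loc p (D t).
Proof.
move=> tt; split=> [h|lDt x]; first by apply: h; exact: (unif_loc hR tt).
have [n nP] := smooth_der_bound hX p (derP D).
suff h m : (forall x, loc p x -> vge p (- m%:Z) (D x)) -> forall x, loc p x -> vge p 0 (D x).
  by move=> lx; apply/(vge_loc hR); exact: h nP _ lx.
elim: m => [|m IH] hm; first by move=> y /hm; rewrite oppr0.
apply: IH => y ly; have [y1 ly1 yE] := (tt.2 _).1 (valueP hR ly).
have -> : D y = y1 * D t + t * D y1.
  have -> : D y = D (y - k (value p y)) by rewrite derB derC subr0.
  by rewrite yE derM; ring.
apply: (vgeD hR).
  apply: (vge_locM hR) => //; apply: (@vgeW _ _ _ 0); first by rewrite oppr_le0.
  exact/(vge_loc hR).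
have -> : - m%:Z = 1 + - m.+1%:Z by lia.
apply: (vgeM hR); last exact: hm.
by apply/(loc_maxP hR)/(unif_max hR).
Qed.

Lemma base_derP : exists x, base_der X x != 0.
Proof.
have [x xC] := smooth_tr hX; have [D Dx] := ex_der hX xC.
have h : exists D : der X, exists x, D x != 0 by exists D, x.
exact: (@xgetPex _ (der0 X) [set D : der X | exists x, D x != 0] h).
Qed.

Lemma base_der_neq0 u : (forall c, u <> k c) -> base_der X u != 0.
Proof.
move=> uC; have [x Dx] := base_derP; apply: contraNneq Dx => Du.
apply/eqP; exact: der_eq0 uC Du x.
Qed.

Lemma der_coordP D x : D x = der_coord D * base_der X x.
Proof.
have [u Du] := base_derP.
have h : exists h, forall x, D x = h * base_der X x.
  by exists (D u / base_der X u) => y; exact: der_unique.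
exact: (@xgetPex _ 0 [set h | forall x, D x = h * base_der X x] h).
Qed.

Lemma der_coordE D h : (forall x, D x = h * base_der X x) -> der_coord D = h.
Proof.
move=> hP; have [u Du] := base_derP; apply: (mulIf Du).
by rewrite -der_coordP -hP.
Qed.

Lemma der_scaleE D : D = der_scale (der_coord D) (base_der X).
Proof. by apply: der_ext => x /=; exact: der_coordP. Qed.

Lemma der_coord_scale f D : der_coord (der_scale f D) = f * der_coord D.
Proof. by apply: der_coordE => x /=; rewrite der_coordP mulrA. Qed.

Lemma tangent_frameP p : tangent p (tangent_frame p) /\ forall D, tangent p D -> exists2 f, loc p f & D = der_scale f (tangent_frame p).
Proof.
have [t tt] := rc_ex_uniformizer hR p.
have Dt := base_der_neq0 (unif_notin tt).
have h : exists D, tangent p D /\ forall D', tangent p D' -> exists2 f, loc p f & D' = der_scale f D.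
  (* This is d/dt, the derivation with value 1 at [t]. *)
  exists (der_scale (base_der X t)^-1 (base_der X)); split.
    by apply/(tangentP _ tt) => /=; rewrite mulVf //; exact: (loc1 hR).
  move=> D' /(tangentP _ tt) lD; exists (D' t) => //; apply: der_ext => x /=.
  by rewrite mulrA; exact: der_unique.
exact: (@xgetPex _ (der0 X) [set D | tangent p D /\ forall D', tangent p D' -> exists2 f, loc p f & D' = der_scale f D] h).
Qed.

Lemma tangent_frame_unit p t : uniformizer p t -> loc_unit p (tangent_frame p t).
Proof.
move=> tt; have [h1 h2] := tangent_frameP p.
have Dt := base_der_neq0 (unif_notin tt).
have tW : tangent p (der_scale (base_der X t)^-1 (base_der X)).
  by apply/(tangentP _ tt) => /=; rewrite mulVf //; exact: (loc1 hR).
have lt := h1 _ (unif_loc hR tt).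
have [f lf E] := h2 _ tW; have : f * tangent_frame p t = 1.
  by have := congr1 (fun D : der X => D t) E; rewrite /= mulVf.
move=> ft; have t0 : tangent_frame p t != 0.
  by apply/eqP => t0; move: ft; rewrite t0 mulr0 => /esym/eqP; rewrite oner_eq0.
split=> //; suff -> : (tangent_frame p t)^-1 = f by [].
by apply: (mulIf t0); rewrite mulVf.
Qed.

Lemma der_coord_frame_neq0 p : der_coord (tangent_frame p) != 0.
Proof.
have [t tt] := rc_ex_uniformizer hR p; have [t0 _ _] := tangent_frame_unit tt.
by apply: contraNneq t0 => h; rewrite der_coordP h mul0r.
Qed.

Lemma ord_frame p t : uniformizer p t ->
  ord p (der_coord (tangent_frame p)) = - ord p (base_der X t).
Proof.
move=> tt; have := ord_unit hR (tangent_frame_unit tt); rewrite der_coordP.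
rewrite (ordM hR) ?der_coord_frame_neq0 ?(base_der_neq0 (unif_notin tt)) //.
lia.
Qed.

(* d/dt lowers a nonzero order by one, as the characteristic is 0. *)
Lemma ord_der D p t y : uniformizer p t -> D t != 0 -> y != 0 -> ord p y != 0 ->
  ord p (D y) = ord p y - 1 + ord p (D t).
Proof.
move=> tt Dt y0 oy; have t0 := unif_neq0 tt.
have tf0 := tangent_frame_unit tt.
have -> : D y = (D t / tangent_frame p t) * tangent_frame p y.
  by apply: der_unique; case: tf0.
have [u uu yE] := ordvP hR tt y0.
set W := tangent_frame p; set n := ord p y in yE oy *.
have WX : W (t ^ n) = n%:~R * t ^ (n - 1) * W t.
  case: (n) => m.
    rewrite -exprnP derX; case: m => [|m]; first by rewrite mulr0n mulr0z !mul0r.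
    have -> : m.+1%:Z - 1 = m by rewrite -addn1 PoszD addrK.
    by rewrite -exprnP -mulr_natr mulrC mulrA.
  rewrite -[t ^ Negz m]/(t ^- m.+1) derV derX /= NegzE mulrNz.
  have -> : (- m.+1%:Z - 1) = - (m.+2%:Z) by lia.
  rewrite -exprnN -mulr_natr !exprS; field.
  by rewrite t0 expf_neq0.
have n0 : (n%:~R : F) != 0.
  by rewrite -(rmorph_int k) fmorph_eq0 intr_eq0.
have un : loc_unit p n%:~R.
  rewrite -(rmorph_int k); apply: (loc_unit_cst hR).
  by rewrite intr_eq0.
have Wt : W t != 0 by case: tf0.
have -> : W y = (n%:~R * u * W t + W u * t) * t ^ (n - 1).
  rewrite yE derM WX; have -> : t ^ n = t * t ^ (n - 1).
    by rewrite -[t in t * _]expr1z -expfzDr // addrC subrK.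
  by ring.
have lu : loc_unit p (n%:~R * u * W t) by do 2![apply: (loc_unitM hR) => //].
have [s0 os] : n%:~R * u * W t + W u * t != 0 /\ ord p (n%:~R * u * W t + W u * t) = ord p (n%:~R * u * W t).
  apply: (ordD_eq hR); first by case: lu.
  rewrite (ord_unit hR lu) add0r; apply/(loc_maxP hR)/(loc_maxMl hR).
    by apply: (tangent_frameP p).1; case: uu.
  exact: (unif_max hR).
have Dt0 : D t / W t != 0 by rewrite mulf_neq0 // invr_eq0.
have tn0 : t ^ (n - 1) != 0 by rewrite expfz_neq0.
have oM (v w : F) : v != 0 -> w != 0 -> ord p (v * w) = ord p v + ord p w.
  by move=> *; exact: (ordM hR).
rewrite (oM _ _ Dt0 (mulf_neq0 s0 tn0)) (oM _ _ s0 tn0) oM ?invr_eq0 // (ordV hR).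
rewrite (ord_unit hR tf0) os (ord_unit hR lu) (ordXz hR) (ord_unif hR tt).
by lia.
Qed.

End DerivationFacts.

Definition gram (K L : fieldType) (io : {rmorphism K -> L}) d (e : 'I_d -> L) : 'M[K]_d :=
  \matrix_(i, j) ftrace io e (e i * e j).

Lemma coord_gram (K L : fieldType) (io : {rmorphism K -> L}) d (e : 'I_d -> L) (he : is_basis io e) y j :
  (coord_in io e y *m gram io e) 0 j = ftrace io e (y * e j).
Proof.
rewrite -[in RHS](coord_inK he y) (ftrace_lin he) mxE.
by apply: eq_bigr => i _; rewrite mxE [e j * e i]mulrC.
Qed.

(** * The degree of the canonical divisor *)

Section Discriminant.
Variables (C : numClosedFieldType) (Z Y : curve C).
Hypotheses (hZ : regular_curve Z) (hY : regular_curve Y).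
Variables (io : {rmorphism fld Z -> fld Y}) (a : pt Z) (qs : seq (pt Y)).
Variables (d : nat) (e : 'I_d -> fld Y) (cv : cover_at io a qs e).
Variables (t : fld Z) (tt : uniformizer a t).
Let he := cv_basis cv.
Let T := gram io e.

(* A generator of the inverse of the trace dual of the semilocal ring turns the Gram
   matrix into an integrally invertible one. *)
Lemma ord_gram : \det (gram io e) != 0 /\ ord a (\det (gram io e)) = \sum_(q <- qs) (ram io t q - 1).
Proof.
rewrite -/T; have [dl [dl0 odl]] := ex_orders hY (cv_uniq cv) (cv_sep cv) (fun q => ram io t q - 1).
set M := mulmat io e dl.
have uM : M \in unitmx by rewrite unitmxE unitfE; exact: (fnorm_neq0 he).
(* The rows with [c *m T] integral are the coordinates of the trace dual; by [ftrace_dual] these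
   elements are those whose product with [dl] is regular along the fibre, which is integrality of
   [c *m M]. *)
have key (c : 'rV_d) : mxloc a (c *m T) <-> mxloc a (c *m M).
  rewrite -[c](linK he) -(coord_inM he) -(cv_semiloc cv).
  have -> : mxloc a (coord_in io e (lin io e c) *m T) <->
      forall i, loc a (ftrace io e (lin io e c * e i)).
    by split=> h i; [rewrite -(coord_gram he); exact: h | move=> j; rewrite ord1 (coord_gram he); exact: h].
  rewrite -(ftrace_dual hZ hY cv tt).
  have [->|y0] := eqVneq (lin io e c) 0.
    split=> h q qs_q; first by rewrite mulr0; exact: loc0.
    exact: vge0.
  split=> h q qs_q.
    apply/(vge_loc hY); rewrite vge_ordE ?mulf_neq0 // (ordM hY) // odl //.
    by have := h _ qs_q; rewrite vge_ordE //; lia.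
  have := h _ qs_q; move/(vge_loc hY); rewrite vge_ordE ?mulf_neq0 // (ordM hY) // odl //.
  by rewrite vge_ordE //; lia.
(* Every multiple of a row killed by [T] is still killed, and [key] would make all these multiples
   integral after [M], in particular one with entry $t^{-1}$. *)
have uT : T \in unitmx.
  rewrite -row_free_unit; apply: inj_row_free => c cT; apply/eqP/negPn/negP => c0.
  have cM0 : c *m M != 0.
    by apply: contraNneq c0 => h; rewrite -[c](mulmxK uM) h mul0mx.
  have /rV0Pn[i vi] := cM0.
  pose l := t^-1 / (c *m M) 0 i.
  have /key/(_ 0 i) : mxloc a ((l *: c) *m T).
    by move=> i' j; rewrite -scalemxAl cT scaler0 mxE; exact: loc0.
  rewrite -scalemxAl mxE /l divfK // => /(vge_loc hZ).
  rewrite vge_ordE ?invr_eq0 ?(unif_neq0 tt) // (ordV hZ) (ord_unif hZ tt).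
  by [].
have int_row (A B : 'M_d) : A \in unitmx ->
    (forall c : 'rV_d, mxloc a (c *m A) -> mxloc a (c *m B)) -> mxloc a (invmx A *m B).
  move=> uA h i j; have := h (row i (invmx A)).
  rewrite -!row_mul mulVmx // => /(_ _ 0 j); rewrite mxE; apply=> i' j'; rewrite !mxE.
  by case: (_ == _); [exact: loc1 | exact: loc0].
have [_ uW] : mxunit a (invmx M *m T).
  apply: (mxunit_pair hZ) (int_row _ _ uM (fun c => (key c).2)) (int_row _ _ uT (fun c => (key c).1)) _.
  by rewrite mulmxA mulmxK // mulVmx.
have dT : \det T != 0 by move: uT; rewrite unitmxE unitfE.
split=> //; have -> : T = M *m (invmx M *m T) by rewrite mulKVmx.
rewrite det_mulmx (ordM hZ); [|by move: uM; rewrite unitmxE unitfE|by case: uW].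
rewrite (ord_unit hZ uW) addr0 (ord_fnorm hZ hY cv tt dl0).
by apply: eq_big_seq => q /odl.
Qed.

End Discriminant.

Section CanonicalDegree.
Variables (C : numClosedFieldType) (X : curve C) (hX : smooth_projective_curve X).
Local Notation F := (fld X).
Local Notation k := (cst X).
Let hR := smooth_regular hX.
Variables (x : F) (xC : forall c : C, x <> k c).
Local Notation K := (ratfield k x).
Local Notation io := (ratincl k x).
Local Notation ev := (rateval k x).
Local Notation Z := (line_curve k x).
Let hZ := line_regular xC.
Variables (d : nat) (e : 'I_d -> F) (a : 'I_d -> nat) (eP : birkhoff x e a).
Variables (fib : pt Z -> seq (pt X)) (ufib : forall o, uniq (fib o)).
Hypothesis fibP : forall o q, (q \in fib o) = (line_proj x q == o).
Let cov o := bk_cover hX xC eP ufib fibP o.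
Let he : is_basis io e. Proof. by case: eP. Qed.
Variables (D : der X) (Dx : D x = 1).
Variables (t : pt X -> F) (tt : forall p, uniformizer p (t p)).
(** As [D] is d/dx, this is minus the order of the differential $dx$ at [p]. *)
Let om p := ord p (D (t p)).
Local Notation bk := (@bk_basis C X x d e a).
Local Notation twist := (@twist C X x d a).
Let rm p := @ram C Z X io (line_unif (line_proj x p)) p.

Let two (S : int) : S *+ 2 = 2 * S. Proof. by rewrite mulr2n; ring. Qed.

Let rm1 p : 1 <= rm p.
Proof.
have hp : p \in fib (line_proj x p) by rewrite fibP.
apply: (ram_ge1 hZ hR (cov (line_proj x p)) (line_unifP xC _) hp).
Qed.

Let Dt p : D (t p) != 0.
Proof.
apply/eqP => /(der_eq0 hX (unif_notin hX (tt p)))/(_ x).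
by rewrite Dx => /eqP; rewrite oner_eq0.
Qed.

Lemma ftrace_bk o y : ftrace io (bk o) y = ftrace io e y.
Proof. exact: (ftrace_chg y he (bk_is_basis xC eP o)). Qed.

Lemma det_gram_bk o : \det (gram io (bk o)) =
  (\prod_i twist o i) ^+ 2 * \det (gram io e).
Proof.
have -> : gram io (bk o) =
    diag_mx (\row_i twist o i) *m gram io e *m diag_mx (\row_i twist o i).
  apply/matrixP => i j; rewrite mul_mx_diag mul_diag_mx !mxE ftrace_bk.
  rewrite /bk_basis mulrACA -rmorphM (ftraceZ he); ring.
rewrite !det_mulmx det_diag (eq_bigr (twist o)) => [|i _]; last by rewrite mxE.
by rewrite expr2; ring.
Qed.

(** The differential of a function with a zero of order $e$ vanishes to order $e-1$. *)
Lemma om_some p : loc p x -> om p = 1 - rm p.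
Proof.
move=> lx; have px : line_proj x p = Some (value p x) by apply/line_proj_some.
have ioE : io (line_unif (line_proj x p)) = x - k (value p x).
  by rewrite px /line_unif ratinclE pevalB pevalX pevalC.
have r1 := rm1 p.
have n0 : x - k (value p x) != 0 by rewrite subr_eq0; apply/eqP/xC.
have := ord_der hX (tt p) (Dt p) n0; rewrite derB derC subr0 Dx (ordv1 hR).
move: r1; rewrite /rm /ram ioE => r1 /(_ _); rewrite -/(om p); lia.
Qed.

(** From $dx=-x^2\,d(1/x)$, the order of $dx$ at a pole of order $e$ is $e-1-2e$. *)
Lemma om_none p : ~ loc p x -> om p = 1 - rm p + rm p * 2.
Proof.
move=> lx; have px : line_proj x p = None by apply/line_proj_none.
have ioE : io (line_unif (line_proj x p)) = x^-1.
  by rewrite px /line_unif fmorph_div !ratinclE pevalX peval1 mul1r.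
have r1 := rm1 p.
have x0 : x != 0 by apply/eqP => x0; apply: (xC (c := 0)); rewrite rmorph0.
have n0 : x^-1 != 0 by rewrite invr_eq0.
have := ord_der hX (tt p) (Dt p) n0; rewrite derV Dx mulN1r -exprVn.
have -> : ord p (- x^-1 ^+ 2) = ord p x^-1 * 2.
  have u1 : loc_unit p (-1).
    by rewrite -(rmorphN1 k); apply: (loc_unit_cst hR); rewrite oppr_eq0 oner_eq0.
  have n1 : (-1 : F) != 0 by case: u1.
  rewrite -[- _]mulN1r.
  rewrite (ordM hR p n1 (expf_neq0 2 n0)).
  by rewrite (ord_unit hR u1) add0r (ordX hR) mulr_natr.
move: r1; rewrite /rm /ram ioE => r1 /(_ _); rewrite -/(om p); lia.
Qed.

(** The Riemann-Hurwitz formula up to sign. The sum of the $e_q-1$ over a fibre is the order of the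
    discriminant of the local basis. The discriminant of [e] has total order 0 on the line, and the
    change of basis at infinity contributes $2\sum a_i$; the double pole of $dx$ on the line
    contributes $2d$. *)
Lemma om_sum : finsupp om /\ \sum_(p \in [set: pt X]) om p = 2 * d%:Z - 2 * (\sum_i a i)%:Z.
Proof.
have tw0 o : \prod_i twist o i != 0 by apply/prodf_neq0 => i _; exact: (twist_neq0 xC).
have dT (o : pt Z) : \det (gram io e) != 0 /\
    ord o (\det (gram io e)) + (if (o : option C) is None then 2 * (\sum_i a i)%:Z else 0) = \sum_(q <- fib o) (rm q - 1).
  have [] := ord_gram hZ hR (cov o) (line_unifP xC o); rewrite det_gram_bk mulf_eq0 negb_or.
  rewrite expf_neq0 //= => dT0; rewrite (ordM hZ) ?expf_neq0 // (ordX hZ) => E; split=> //.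
  have -> : \sum_(q <- fib o) (rm q - 1) = \sum_(q <- fib o) (@ram C Z X io (line_unif o) q - 1).
    by apply: eq_big_seq => q; rewrite fibP /rm => /eqP ->.
  rewrite -{}E addrC; congr (_ + _).
  case: o => [b|]; first by rewrite big1 // (ordv1 hZ) mul0rn.
  rewrite (ord_prod hZ) => [|i]; last exact: (twist_neq0 xC).
  have -> : \sum_i ord (None : pt Z) (twist None i) = (\sum_i a i)%:Z.
    rewrite (big_morph Posz PoszD (erefl _)); apply: eq_bigr => i _.
    by rewrite (ordX hZ) (ord_unif hZ (line_unifP xC None)) natz.
  exact: (esym (two _)).
have [T0 _] := dT None.
have [[s sP] sT] := line_product xC T0.
have r1 := rm1.
have fom : finsupp om.
  exists (flatten [seq fib o | o <- None :: s]) => p np.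
  have : line_proj x p \notin None :: s.
    apply: contra np => ps; apply/flatten_mapP; exists (line_proj x p) => //.
    by rewrite fibP.
  rewrite inE negb_or => /andP[pN ps].
  case E : (line_proj x p) pN => [b|//] _; have [lx _] := (line_proj_some _ _ _).1 E.
  rewrite om_some //; have [_] := dT (line_proj x p); rewrite sP // E add0r.
  move/esym/eqP; rewrite (big_rem p) /=; last by rewrite fibP E.
  have : 0 <= \sum_(q <- rem p (fib (Some b))) (rm q - 1).
    by apply: sumr_ge0 => q _; rewrite subr_ge0.
  by have := r1 p; move: (\sum_(q <- _) _) => S; lia.
split=> //; have [_ ->] := fsum_fibre ufib fibP fom.
pose f1 (o : pt Z) := - ord o (\det (gram io e)).
pose f2 (o : pt Z) : int := if (o : option C) is None then 2 * d%:Z - 2 * (\sum_i a i)%:Z else 0.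
have E o : \sum_(q <- fib o) om q = f1 o + f2 o.
  have [_] := dT o; rewrite /f1 /f2; case: o => [b|] /=.
    rewrite !addr0 => ->; rewrite -sumrN; apply: eq_big_seq => q; rewrite fibP => /eqP qb.
    by have [lx _] := (line_proj_some _ _ _).1 qb; rewrite om_some //; ring.
  move=> E; have -> : \sum_(q <- fib None) om q = \sum_(q <- fib None) (1 - rm q) + (\sum_(q <- fib None) rm q) * 2.
    rewrite mulr_suml -big_split; apply: eq_big_seq => q; rewrite fibP => /eqP qN.
    by rewrite om_none //; exact/line_proj_none.
  have -> : \sum_(q <- fib None) rm q = d%:Z.
    rewrite -(sum_ram_eq hZ hR (cov None) (line_unifP xC None)).
    by apply: eq_big_seq => q; rewrite fibP /rm => /eqP ->.
  have -> : \sum_(q <- fib None) (1 - rm q) = - \sum_(q <- fib None) (rm q - 1).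
    by rewrite -sumrN; apply: eq_bigr => q _; rewrite opprB.
  by rewrite -E; ring.
rewrite (eq_fsum E) fsumD; last 2 first.
- by exists s => o /sP; rewrite /f1 => ->; rewrite oppr0.
- by exists [:: None] => -[b|//].
rewrite [X in X + _]fsumN ?sT ?oppr0 ?add0r; last by exists s.
by rewrite (@fsumE _ _ [:: None]) ?big_seq1 // => -[b|].
Qed.

Lemma ord_line_poly (P : {poly C}) : P != 0 -> ord (None : pt Z) (ev P) = - (size P).-1%:Z.
Proof.
move=> P0; set n := (size P).-1; have sP : size P = n.+1 by rewrite prednK // size_poly_gt0.
have Xn0 : ('X^n : {poly C}) != 0 by rewrite -size_poly_eq0 size_polyXn.
have sX : size ('X^n : {poly C}) = n.+1 by rewrite size_polyXn.
have u : loc_unit (None : pt Z) (ev P / ev 'X^n).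
  apply: contrapT => nu; have : loc_max (None : pt Z) (ev P / ev 'X^n).
    by split=> //; exists P, 'X^n; split; rewrite ?sP ?sX.
  by move/(line_max_none xC Xn0); rewrite sP sX ltnn => /(_ (leqnn _)).
have -> : ev P = (ev P / ev 'X^n) * (line_unif (None : pt Z)) ^ (- n%:Z).
  rewrite /line_unif -exprnN lev1 mul1r exprVn invrK -rmorphXn.
  by rewrite divfK // (lev_neq0 xC).
have t0 := unif_neq0 (line_unifP xC None).
rewrite (ordM hZ) ?expfz_neq0 //; last by case: u.
by rewrite (ord_unit hZ u) (ordXz hZ) (ord_unif hZ (line_unifP xC None)) ?mulr1 ?mul1r add0r.
Qed.

(** This is $H^0(X,O_X)=C$. The [e i] with [a i = 0] are constants, so there is at most one; the
    coordinates of 1 are polynomials in [x] of degree at most $-a_i$, so there is one. *)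
Lemma birkhoff_zeros : (\sum_i (a i == 0%N) = 1)%N.
Proof.
have [_ bf bi _] := eP.
have const0 i : a i = 0%N -> exists c, e i = k c.
  move=> ai; apply: (everywhere_regular hX) => p.
  have [lx|lx] := pselect (loc p x); first exact: bf.
  by have := bi i p lx; rewrite ai expr0 mul1r.
have uniq0 i j : a i = 0%N -> a j = 0%N -> i = j.
  move=> /const0[c cE] /const0[c' c'E]; apply/eqP/negPn/negP => ij.
  have c0 : c' != 0.
    apply/eqP => c0; move: c'E; rewrite c0 rmorph0 => ej.
    have := congr1 (fun v : 'rV_d => v 0 j) (coord_in_e he j); rewrite ej (coord_in0 he) !mxE !eqxx.
    by move/esym/eqP; rewrite oner_eq0.
  have E : e i = io (ev (c / c')%:P) * e j.
    by rewrite ratinclE pevalC cE c'E -rmorphM divfK.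
  have := congr1 (fun v : 'rV_d => v 0 i) (coord_in_e he i).
  rewrite E (coord_inZ he) (coord_in_e he) !mxE eqxx (negPf ij) !eqxx mulr0.
  by move/esym/eqP; rewrite oner_eq0.
have [i ai] : exists i, a i = 0%N.
  have /rV0Pn[i ci] : coord_in io e 1 != 0.
    apply/eqP => c1; have := coord_inK he 1; rewrite c1 /lin big1 => [/esym/eqP|j _].
      by rewrite oner_eq0.
    by rewrite mxE rmorph0 mul0r.
  exists i; have lo (o : pt Z) : loc o (coord_in io (bk o) 1 0 i).
    apply: (cv_semiloc (cov o) 1).1 => q _; exact: (loc1 hR).
  have cE (o : pt Z) : coord_in io e 1 0 i = twist o i * coord_in io (bk o) 1 0 i.
    have : coord_in io e 1 = \row_j (twist o j * coord_in io (bk o) 1 0 j).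
      apply: (lin_inj he); rewrite (coord_inK he) -{1}(coord_inK (bk_is_basis xC eP o) 1).
      by apply: eq_bigr => j _; rewrite mxE rmorphM /bk_basis; ring.
    by move=> ->; rewrite mxE.
  have [P PE] : exists P, coord_in io e 1 0 i = ev P.
    by apply: (line_polynomial xC) => b; rewrite (cE (Some b)) mul1r; exact: lo.
  have P0 : P != 0 by apply: contraNneq ci => P0; rewrite PE P0 rmorph0.
  have := lo None; rewrite -[coord_in _ _ _ _ _](mulKf (twist_neq0 xC a None i)) -cE PE.
  move=> /(vge_loc hZ); rewrite vge_ordE ?mulf_neq0 ?invr_eq0 ?(lev_neq0 xC) ?(twist_neq0 xC) //.
  rewrite (ordM hZ) ?invr_eq0 ?(lev_neq0 xC) ?(twist_neq0 xC) // (ordV hZ) (ord_line_poly P0).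
  rewrite (ordX hZ) (ord_unif hZ (line_unif_none xC)) natz.
  by move: P0; rewrite -size_poly_gt0; case: (size P) => // n _ /=; lia.
rewrite (bigD1 i) //= ai eqxx big1 // => j ji; have [aj|//] := eqVneq (a j) 0%N.
by move: ji; rewrite (uniq0 j i aj ai) eqxx.
Qed.

(** The sections of $O(n-2)$ on the line are the polynomials of degree at most $n-2$. The 2 is the
    pole order of $dx$ at infinity, and the truncation in [n.-1] makes the space 0 for both [n = 0]
    and [n = 1]. *)
Lemma bounded_polynomial (c : K) (n : nat) :
  (forall b, loc (Some b : pt Z) c) /\
    loc (None : pt Z) (line_unif (None : pt Z) ^+ n / line_unif (None : pt Z) ^+ 2 * c) <->
  exists2 P : {poly C}, (size P <= n.-1)%N & c = ev P.
Proof.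
set tn := line_unif _; have t0 : tn != 0 := unif_neq0 (line_unifP xC None).
have ot : ord (None : pt Z) tn = 1 := ord_unif hZ (line_unifP xC None).
have key (P : {poly C}) : loc (None : pt Z) (tn ^+ n / tn ^+ 2 * ev P) <-> (size P <= n.-1)%N.
  have [->|P0] := eqVneq P 0.
    by rewrite size_poly0 rmorph0 mulr0; split=> // _; exact: (loc0 hZ).
  have Q0 := lev_neq0 xC P0; have tn0 m : tn ^+ m != 0 by rewrite expf_neq0.
  have iv : (tn ^+ 2)^-1 != 0 by rewrite invr_eq0.
  have -> : loc (None : pt Z) (tn ^+ n / tn ^+ 2 * ev P) <-> 0 <= ord (None : pt Z) (tn ^+ n / tn ^+ 2 * ev P).
    by apply: (loc_ord hZ); rewrite !mulf_neq0.
  rewrite (ordM hZ) ?mulf_neq0 // (ordM hZ) // (ordV hZ) !(ordX hZ) ot !natz (ord_line_poly P0).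
  by move: P0; rewrite -size_poly_gt0; case: (size P) => // m _ /=; split; lia.
split=> [[lc ln]|[P sP ->]].
  have [P cP] := line_polynomial xC lc; exists P => //; apply/key.
  by rewrite -cP.
split; last exact/key.
move=> b; exists P, 1; split; rewrite ?hornerC ?oner_eq0 //.
by rewrite lev1 divr1.
Qed.

(** Duality for the map to the line: regularity of $y\,dx$ means that $v\mapsto\mathrm{tr}(yv)$
    sends the direct image of $O_X$ into $O(-2)$. As this direct image is the sum of the $O(-a_i)$,
    each $\mathrm{tr}(ye_i)$ has to be a section of $O(a_i-2)$. *)
Lemma differential_space y : (forall p, vge p (om p) y) <->
  forall i, exists2 P : {poly C}, (size P <= (a i).-1)%N & ftrace io e (y * e i) = ev P.
Proof.
(* At infinity the factor of order $-2$ accounts for the double pole of $dx$ on the line. *)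
pose s (o : pt Z) : K := if (o : option C) is None then (line_unif (None : pt Z) ^+ 2)^-1 else 1.
have s0 o : s o != 0.
  rewrite /s; case: o => [b|]; first exact: oner_neq0.
  by rewrite invr_eq0 expf_neq0 // (unif_neq0 (line_unifP xC None)).
have local o : (forall q, q \in fib o -> vge q (om q) y) <->
    forall i, loc o (twist o i * s o * ftrace io e (y * e i)).
  have -> : (forall i, loc o (twist o i * s o * ftrace io e (y * e i))) <->
      (forall i, loc o (ftrace io (bk o) ((io (s o) * y) * bk o i))).
    by split=> h i; have := h i; rewrite ftrace_bk /bk_basis mulrACA -rmorphM (ftraceZ he) [s o * _]mulrC.
  rewrite -(ftrace_dual hZ hR (cov o) (line_unifP xC o)).
  have [->|y0] := eqVneq y 0; first by split=> h q _; rewrite ?mulr0; exact: vge0.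
  suff E q : q \in fib o -> vge q (om q) y = vge q (1 - @ram C Z X io (line_unif o) q) (io (s o) * y).
    by split=> h q qo; have := h q qo; rewrite E.
  have iy : io (s o) * y != 0 by rewrite mulf_neq0 // fmorph_eq0.
  rewrite fibP => /eqP qo; rewrite !vge_ordE // (ordM hR) ?fmorph_eq0 //.
  have rE : rm q = @ram C Z X io (line_unif o) q by rewrite /rm qo.
  rewrite -rE; rewrite /s; case: o {iy} qo rE => [b|] qo rE.
    rewrite rmorph1 (ordv1 hR) add0r om_some //.
    by have [] := (line_proj_some _ _ _).1 qo.
  rewrite om_none; last exact/line_proj_none.
  have -> : ord q (io (line_unif (None : pt Z) ^+ 2)^-1) = - (rm q * 2).
    by rewrite fmorphV rmorphXn (ordV hR) (ordX hR) rE /ram two mulrC.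
  by apply/idP/idP; lia.
have -> : (forall p, vge p (om p) y) <-> forall o q, q \in fib o -> vge q (om q) y.
  by split=> [h o q _|h p]; [exact: h | apply: (h (line_proj x p)); rewrite fibP].
have -> : (forall o q, q \in fib o -> vge q (om q) y) <->
   forall i o, loc o (twist o i * s o * ftrace io e (y * e i)).
  by split=> [h i o|h o]; [move: i; apply/local/h | apply/local => i; exact: h].
split=> h i.
  have /bounded_polynomial [P sP PE] : (forall b, loc (Some b : pt Z) (ftrace io e (y * e i))) /\
    loc (None : pt Z) (line_unif (None : pt Z) ^+ (a i) / line_unif (None : pt Z) ^+ 2 * ftrace io e (y * e i)).
    split; last exact: (h i None).
    by move=> b; have := h i (Some b); rewrite /= !mul1r.
  by exists P.
have /bounded_polynomial [h1 h2] := h i; case=> [b|]; last exact: h2.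
by rewrite /= !mul1r; exact: h1.
Qed.

Lemma pluri_space (w : der X -> F) : pluridifferential 1 w -> forall p, vge p (om p) (w D).
Proof.
move=> [wS wT] p; have := wT p (der_scale (D (t p))^-1 D).
rewrite wS expr1 => /(_ _)/(vge_loc hR) => h.
have [->|w0] := eqVneq (w D) 0; first exact: vge0.
have := h ((tangentP hX _ (tt p)).2 _).
rewrite /= mulVf // vge_ordE ?mulf_neq0 ?invr_eq0 // => /(_ (loc1 hR p)).
by rewrite (ordM hR) ?invr_eq0 // (ordV hR) vge_ordE // /om; lia.
Qed.

Lemma D_scale (D' : der X) : D' = der_scale (D' x) D.
Proof.
apply: (der_ext) => z /=; have Dx0 : D x != 0 by rewrite Dx oner_neq0.
by rewrite (der_unique hX D' Dx0) Dx divr1.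
Qed.

Lemma space_pluri y : (forall p, vge p (om p) y) -> pluridifferential 1 (fun D' => D' x * y).
Proof.
move=> h; split=> [f D'|p D' tD]; first by rewrite /= expr1 mulrA.
have [->|y0] := eqVneq y 0; first by rewrite mulr0; exact: (loc0 hR).
have [->|D0] := eqVneq (D' x) 0; first by rewrite mul0r; exact: (loc0 hR).
apply/(loc_ord hR); rewrite ?mulf_neq0 // (ordM hR) //.
have := tD _ (unif_loc hR (tt p)); rewrite {1}(D_scale D') /= => /(vge_loc hR).
rewrite vge_ordE ?mulf_neq0 // (ordM hR) //; have := h p; rewrite vge_ordE // /om; lia.
Qed.

(** The coefficients of the traces $\mathrm{tr}(ye_i)$ identify $H^0(X,K)$ with the product of the
    $C^{a_i-1}$ over the $a_i\ge1$: nondegeneracy of the trace form gives injectivity,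
    [differential_space] surjectivity. The dimension is $\sum a_i-d$, plus 1 for the unique
    vanishing $a_i$. *)
Lemma genus_birkhoff g : genus X g -> g%:Z = (\sum_i a i)%:Z - d%:Z + 1.
Proof.
move=> [w wP wB].
have /choice[Q QP] : forall li : 'I_g * 'I_d, exists P : {poly C},
    (size P <= (a li.2).-1)%N /\ ftrace io e (w li.1 D * e li.2) = ev P.
  move=> [l i]; have [P sP PE] := (differential_space _).1 (pluri_space (wP l)) i.
  by exists P.
pose J := {i : 'I_d & 'I_(a i).-1}.
pose ix (j : J) : nat := nat_of_ord (tagged j).
pose M : 'M[C]_(g, #|{: J}|) := \matrix_(l, j) (Q (l, tag (enum_val j)))`_(ix (enum_val j)).
have T_unit : gram io e \in unitmx.
  have [dT _] := ord_gram hZ hR (cov None) (line_unifP xC None).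
  move: dT; rewrite det_gram_bk mulf_eq0 negb_or => /andP[_ dT].
  by rewrite unitmxE unitfE.
have sumQ (c : 'rV[C]_g) i : ftrace io e ((\sum_l k (c 0 l) * w l D) * e i) = ev (\sum_l c 0 l *: Q (l, i)).
  rewrite rmorph_sum mulr_suml (big_morph (ftrace io e) (ftraceD he) (_ : ftrace io e 0 = 0)); last first.
    by have := ftraceZ he 0 0; rewrite rmorph0 !mul0r.
  apply: eq_bigr => l _; have [_ E] := QP (l, i).
  rewrite /= in E; rewrite -[RHS]/(ev (c 0 l *: Q (l, i))) -mulrA -mul_polyC levM -E -(ftraceZ he); congr ftrace; congr (_ * _).
  by rewrite ratinclE pevalC.
have trace_inj y y' : (forall i, ftrace io e (y * e i) = ftrace io e (y' * e i)) -> y = y'.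
  move=> h; rewrite -(coord_inK he y) -(coord_inK he y'); congr lin.
  apply: (can_inj (mulmxK T_unit)); apply/rowP => i.
  by rewrite !(coord_gram he).
have coefM0 (c : 'rV[C]_g) j : (c *m M) 0 j = (\sum_l c 0 l *: Q (l, tag (enum_val j)))`_(ix (enum_val j)).
  by rewrite mxE coef_sum; apply: eq_bigr => l _; rewrite mxE coefZ.
have fM : row_free M.
  apply: inj_row_free => c cM.
  have Q0 i : \sum_l c 0 l *: Q (l, i) = 0.
    apply/polyP => j; rewrite coef0.
    have [lj|ja] := ltnP j (a i).-1; last first.
      rewrite coef_sum big1 // => l _; rewrite coefZ nth_default ?mulr0 //.
      by apply: leq_trans ja; have [] := QP (l, i).
    have := coefM0 c (enum_rank (Tagged (fun i => 'I_(a i).-1) (Ordinal lj) : J)).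
    by rewrite enum_rankK /= cM mxE.
  have wP0 : @pluridifferential C X 1 (fun=> 0).
    by split=> [f D'|p D' _]; [rewrite mulr0 | exact: (loc0 hR)].
  have [c' [_ c'u]] := wB _ wP0.
  have c'0 : c' = 0 by apply: c'u => D'; rewrite big1 // => l _; rewrite mxE rmorph0 mul0r.
  rewrite -c'0; symmetry; apply: c'u => D'.
  have : \sum_l k (c 0 l) * w l D = 0.
    by apply: trace_inj => i; rewrite sumQ Q0 rmorph0 mul0r; have := ftraceZ he 0 0; rewrite rmorph0 !mul0r.
  rewrite (D_scale D') => E; symmetry; rewrite -[RHS](mulr0 (D' x)) -[in RHS]E mulr_sumr.
  by apply: eq_bigr => l _; case: (wP l) => -> _; rewrite expr1 mulrCA.
have uM : row_full M.
  rewrite -sub1mx; apply/row_subP => j0.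
  (* The family of polynomials with a single coefficient 1, at the place [enum_val j0], and all
     others 0. *)
  pose S i : {poly C} := \sum_(u < (a i).-1) ((Tagged (fun i => 'I_(a i).-1) u : J) == enum_val j0)%:R *: 'X^u.
  pose sv : 'rV[K]_d := \row_i ev (S i).
  have SE i : ftrace io e (lin io e (sv *m invmx (gram io e)) * e i) = ev (S i).
    by rewrite -(coord_gram he) (linK he) mulmxKV // mxE.
  have sS i : (size (S i) <= (a i).-1)%N.
    apply: leq_trans (size_sum _ _ _) _; apply/bigmax_leqP => u _.
    by apply: leq_trans (size_scale_leq _ _) _; rewrite size_polyXn.
  have h : forall p, vge p (om p) (lin io e (sv *m invmx (gram io e))).
    by apply/differential_space => i; exists (S i).
  have [c [cE _]] := wB _ (space_pluri h).
  have := cE D; rewrite Dx mul1r => E.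
  apply/submxP; exists c; apply/rowP => j; rewrite coefM0 !mxE.
  have -> : \sum_l c 0 l *: Q (l, tag (enum_val j)) = S (tag (enum_val j)).
    by apply: (lev_inj xC); rewrite -sumQ -E SE.
  rewrite /S coef_sum (bigD1 (tagged (enum_val j))) //= coefZ coefXn eqxx mulr1 big1 => [|u uj].
    by rewrite addr0 taggedK (inj_eq enum_val_inj) eq_sym.
  rewrite coefZ coefXn (_ : (_ == _ :> nat) = false) ?mulr0 //.
  by apply: contraNF uj => /eqP E'; apply/eqP/val_inj.
have gE : g = (\sum_i (a i).-1)%N.
  have : g = #|{: J}| by rewrite -(eqP fM) (eqP uM).
  rewrite card_tagged sumnE big_map big_enum => ->; apply: eq_bigr => i _.
  by rewrite card_ord.
have : (\sum_i a i + \sum_i (a i == 0%N) = \sum_i (a i).-1 + d)%N.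
  have -> : (\sum_i (a i).-1 + d = \sum_i ((a i).-1 + 1))%N.
    by rewrite big_split sum1_card card_ord.
  rewrite -big_split; apply: eq_bigr => i _ /=.
  by case: (a i) => // n; rewrite addn1 addn0.
rewrite birkhoff_zeros -gE; lia.
Qed.

End CanonicalDegree.

(** The frame at [p] is d/dt up to a unit, so its coordinate has minus the order of [base_der X t],
    and the sum is the degree of K. Since [base_der] is a function times d/dx, the product formula
    reduces it to [om_sum], where [genus_birkhoff] eliminates the $a_i$. *)
Lemma canonical_degree (C : numClosedFieldType) (X : curve C) g :
  smooth_projective_curve X -> genus X g ->
  finsupp (fun p : pt X => ord p (der_coord (tangent_frame p))) /\
  \sum_(p \in [set: pt X]) ord p (der_coord (tangent_frame p)) = 2 * g%:Z - 2.
Proof.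
move=> hX hg; have hR := smooth_regular hX; have [x xC] := smooth_tr hX.
have [d [e [a [d0 eP]]]] := ex_birkhoff hX xC.
have [fib [ufib fibP]] := ex_fibres hX xC.
have Bx := base_der_neq0 hX xC.
pose D := der_scale (base_der X x)^-1 (base_der X).
have Dx : D x = 1 by rewrite /D /= mulVf.
have /choice[t tt] : forall p : pt X, exists t, uniformizer p t by exact: rc_ex_uniformizer hR.
have [f1 s1] := om_sum hX xC eP ufib fibP Dx tt.
have [f2 s2] := product_formula hX Bx.
have E p : ord p (der_coord (tangent_frame p)) = - (ord p (D (t p)) + ord p (base_der X x)).
  have Bt := base_der_neq0 hX (unif_notin hX (tt p)).
  by rewrite (ord_frame hX (tt p)) /D /= (ordM hR) ?invr_eq0 // (ordV hR) addrAC addNr add0r.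
have f3 := finsuppD f1 f2.
split; first by have [s sP] := finsuppN f3; exists s => p /sP; rewrite E.
rewrite (eq_fsum E) fsumN // fsumD // s1 s2 (genus_birkhoff hX xC eP ufib fibP Dx tt hg).
by ring.
Qed.

(** * Lattices and degrees of bundles *)

Section Lattices.
Variables (C : fieldType) (Y : curve C) (hY : regular_curve Y) (p : pt Y).
Local Notation F := (fld Y).

Definition lframe n (S : set 'rV[F]_n) (B : 'M[F]_n) : Prop :=
  B \in unitmx /\
  forall v, S v <-> exists2 c : 'rV_n, (forall j, loc p (c 0 j)) & v = c *m B.

(** These conditions pass to subspaces and to images more directly than the datum of a frame, which
    [lattice_frame] recovers from them. *)
Definition lattice n (S : set 'rV[F]_n) : Prop :=
  [/\ forall u v, S u -> S v -> S (u + v),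
      forall c v, loc p c -> S v -> S (c *: v),
      exists N : int, forall v, S v -> forall j, vge p N (v 0 j) &
      forall v, exists2 c, c != 0 & S (c *: v)].

Lemma mxlocP n (c : 'rV[F]_n) : (forall j, loc p (c 0 j)) <-> mxloc p c.
Proof. by split=> h => [i|] j; rewrite ?ord1. Qed.

Lemma mxloc_row m n k (A : 'M[F]_(m, n)) (B : 'M[F]_(m, k)) :
  mxloc p A -> mxloc p B -> mxloc p (row_mx A B).
Proof. by move=> lA lB i j; rewrite mxE; case: fintype.split. Qed.

Lemma mx_bounded m n (A : 'M[F]_(m, n)) : exists N : nat, forall i j, vge p (- N%:Z) (A i j).
Proof.
exists (\sum_i \sum_j `|ord p (A i j)|)%N => i j.
have [->|a0] := eqVneq (A i j) 0; first exact: vge0.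
rewrite vge_ordE // (bigD1 i) //= (bigD1 j) //=; lia.
Qed.

Lemma lframe_lattice n (S : set 'rV[F]_n) B : lframe S B -> lattice S.
Proof.
move=> [uB SP]; split.
- move=> _ _ /SP[c lc ->] /SP[c' lc' ->]; apply/SP; exists (c + c'); last by rewrite mulmxDl.
  by move=> j; rewrite mxE; apply: (locD hY).
- move=> a _ la /SP[c lc ->]; apply/SP; exists (a *: c); last by rewrite scalemxAl.
  by move=> j; rewrite mxE; apply: (locM hY).
- have [N NP] := mx_bounded B; exists (- N%:Z) => _ /SP[c lc ->] j; rewrite mxE.
  by apply: (vge_sum hY) => i _; apply: (vge_locM hY).
- move=> v; have [t tt] := rc_ex_uniformizer hY p; have t0 := unif_neq0 tt.
  have [N NP] := mx_bounded (v *m invmx B).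
  exists (t ^+ N); first by rewrite expf_neq0.
  apply/SP; exists (t ^+ N *: (v *m invmx B)); last by rewrite -scalemxAl mulmxKV.
  move=> j; rewrite mxE; apply/(vge_loc hY); have -> : 0 = N%:Z + - N%:Z by rewrite addrN.
  apply: (vgeM hY) => //.
  by rewrite vge_ordE ?expf_neq0 // (ordX hY) (ord_unif hY tt) natz.
Qed.

(* The first coordinates of the elements of S form a fractional ideal; an element v
   realizing its generator splits off. *)
Lemma lattice_frame n (S : set 'rV[F]_n) : lattice S -> exists B, lframe S B.
Proof.
elim: n S => [|n IH]; last rewrite -[n.+1]/(1 + n)%N; move=> S [SD SZ [N SN] Ss].
  exists 1%:M; split; first exact: unitmx1.
  have S0 : S 0 by have [c _] := Ss 0; rewrite scaler0.
  by move=> v; split=> _; [exists 0 => [[]|]; rewrite ?mul0mx // thinmx0 | rewrite thinmx0].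
pose V : 'rV[F]_(1 + n) -> F := fun v => v 0 0.
have VE v : V v = lsubmx v 0 0 by rewrite mxE; congr (v _ _); exact/val_inj.
have S0 : S 0 by have [c _] := Ss 0; rewrite scaler0.
have [v1 [Sv1 v10 v1min]] : exists v1 : 'rV_(1 + n), [/\ S v1, V v1 != 0 &
    forall v, S v -> loc p (V v / V v1)].
  have h : exists m : nat, `[< exists v : 'rV_(1 + n), [/\ S v, V v != 0 & ord p (V v) = N + m%:Z] >].
    have [c c0 Sc] := Ss (delta_mx 0 0); have E : V (c *: delta_mx 0 0) = c by rewrite /V !mxE !eqxx mulr1.
    have := SN _ Sc 0; rewrite -/(V _) E vge_ordE // => oc.
    exists `|ord p c - N|%N; apply/asboolP; exists (c *: delta_mx 0 0); rewrite E; split=> //; lia.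
  have [m /asboolP[v1 [Sv1 v10 om]] mmin] := ex_minnP h; exists v1; split=> // v Sv.
  have [->|v0] := eqVneq (V v) 0; first by rewrite mul0r; exact: loc0.
  have iv : (V v1)^-1 != 0 by rewrite invr_eq0.
  apply/(loc_ord hY); rewrite ?mulf_neq0 // (ordM hY) // (ordV hY) om.
  have := SN _ Sv 0; rewrite -/(V v) vge_ordE // => ov.
  pose m' := `|ord p (V v) - N|%N.
  have hm : `[< exists v : 'rV_(1 + n), [/\ S v, V v != 0 & ord p (V v) = N + m'%:Z] >].
    by apply/asboolP; exists v; split=> //; rewrite /m'; lia.
  by have := mmin _ hm; rewrite /m'; lia.
have [B' [uB' B'P]] : exists B', lframe [set w : 'rV_n | S (row_mx (0 : 'rV_1) w)] B'.
  apply: IH; split.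
  - by move=> u v /= Su Sv; rewrite -[0]addr0 -add_row_mx; exact: SD.
  - by move=> c v lc /= Sv; rewrite -(scaler0 _ c) -scale_row_mx; exact: SZ.
  - exists N => v /= Sv j; have := SN _ Sv (rshift 1 j); by rewrite (row_mxEr (0 : 'rV_1)).
  - by move=> v; have [c c0 Sc] := Ss (row_mx (0 : 'rV_1) v); exists c; rewrite //= -(scaler0 _ c) -scale_row_mx.
exists (col_mx v1 (row_mx 0 B') : 'M_(1 + n)); split.
  have -> : col_mx v1 (row_mx 0 B') = block_mx (lsubmx v1) (rsubmx v1) 0 B'.
    by rewrite /block_mx hsubmxK.
  rewrite unitmxE (_ : \det _ = \det (lsubmx v1 : 'M_1) * \det B'); last exact: (@det_ublock _ 1 n).
  rewrite det_mx11 unitrM unitfE -unitmxE uB' andbT.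
  by rewrite -VE.
have V1 (w : 'rV_n) : V (row_mx 0 w) = 0.
  by rewrite VE row_mxKl mxE.
move=> v; split=> [Sv|[c lc ->]].
  set a := V v / V v1; have la : loc p a by exact: v1min.
  have wE : v - a *: v1 = row_mx 0 (rsubmx (v - a *: v1)).
    rewrite -[LHS](@hsubmxK _ 1 1 n); congr row_mx; apply/rowP => j; rewrite ord1 !mxE.
    have := VE v; have := VE v1; rewrite !mxE => <- <-.
    by rewrite /a divfK // subrr.
  have : S (v - a *: v1).
    by rewrite -scaleNr; apply: SD => //; apply: SZ => //; exact: (locN hY).
  rewrite wE => /B'P[c' lc' c'E]; exists (row_mx a%:M c').
    by apply/mxlocP/mxloc_row; apply/mxlocP => // j; rewrite ord1 !mxE eqxx mulr1n.
  by rewrite (@mul_row_col _ 1 1 n) mul_mx_row mulmx0 mul_scalar_mx -c'E -wE addrC subrK.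
rewrite -[c](@hsubmxK _ 1 1 n) (@mul_row_col _ 1 1 n) mul_mx_row mulmx0; apply: SD.
  by rewrite [lsubmx c]mx11_scalar mul_scalar_mx; apply: SZ => //; rewrite !mxE.
by apply/B'P; exists (rsubmx c) => // j; rewrite mxE.
Qed.

Lemma lframe_change n (S S' : set 'rV[F]_n) B B' : lframe S B -> lframe S' B' ->
  (forall v, S v -> S' v) -> mxloc p (B *m invmx B').
Proof.
move=> [uB SP] [uB' SP'] SS' i.
have : S (row i B).
  by apply/SP; exists (delta_mx 0 i); rewrite -?rowE // => j; rewrite mxE; case: (_ && _); [exact: loc1|exact: loc0].
move/SS'/SP'=> [c lc E] j; have := lc j.
by rewrite -[c](mulmxK uB') -E -row_mul mxE.
Qed.

Lemma ord_det_le n (S S' : set 'rV[F]_n) B B' : lframe S B -> lframe S' B' ->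
  (forall v, S v -> S' v) -> ord p (\det B') <= ord p (\det B).
Proof.
move=> hB hB' SS'; have l := loc_det hY (lframe_change hB hB' SS').
have [uB _] := hB; have [uB' _] := hB'.
move: uB uB' l; rewrite !unitmxE !unitfE => dB dB'; rewrite det_mulmx det_inv => /(vge_loc hY).
by rewrite vge_ordE ?mulf_neq0 ?invr_eq0 // (ordM hY) ?invr_eq0 // (ordV hY) subr_ge0.
Qed.

Lemma ord_det_eq n (S : set 'rV[F]_n) B B' : lframe S B -> lframe S B' ->
  ord p (\det B) = ord p (\det B').
Proof. by move=> h h'; apply: le_anti; rewrite !(ord_det_le h' h, ord_det_le h h'). Qed.

Lemma lframe1 n (A : 'M[F]_n) (S : set 'rV[F]_n) : mxunit p A -> lframe S A <-> lframe S 1%:M.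
Proof.
move=> uA; have UA := mxunit_unitmx uA; have lA : mxloc p A by case: uA.
have lV := mxunit_inv hY uA.
split=> -[_ SP]; split=> [|v]; rewrite ?unitmx1 //.
  split=> [/SP[c lc ->]|[c lc ->]].
    by exists (c *m A); rewrite ?mulmx1 //; apply/mxlocP/(mxloc_mul hY) => //; exact/mxlocP.
  apply/SP; exists (c *m invmx A); last by rewrite mulmxKV ?mulmx1.
  by apply/mxlocP/(mxloc_mul hY) => //; exact/mxlocP.
split=> [/SP[c lc ->]|[c lc ->]].
  exists (c *m invmx A); last by rewrite mulmxKV ?mulmx1.
  by apply/mxlocP/(mxloc_mul hY) => //; exact/mxlocP.
apply/SP; exists (c *m A); rewrite ?mulmx1 //.
by apply/mxlocP/(mxloc_mul hY) => //; exact/mxlocP.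
Qed.

Lemma lframe_sub n k (S : set 'rV[F]_n) (B : 'M[F]_(k, n)) : lattice S -> row_free B ->
  lattice [set v | S (v *m B)].
Proof.
move=> [SD SZ [N SN] Ss] fB; have [M BM] := row_freeP fB; split.
- by move=> u v Su Sv /=; rewrite mulmxDl; exact: SD.
- by move=> c v lc Sv /=; rewrite -scalemxAl; exact: SZ.
- have [m mP] := mx_bounded M; exists (N - m%:Z) => v Sv j.
  rewrite -[v]mulmx1 -BM mulmxA mxE; apply: (vge_sum hY) => i _.
  by apply: (vgeM hY); [exact: SN | exact: mP].
- by move=> v; have [c c0 Sc] := Ss (v *m B); exists c => //=; rewrite -scalemxAl.
Qed.

Lemma lframe_quo n k (S : set 'rV[F]_n) (Q : 'M[F]_(n, k)) : lattice S -> row_full Q ->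
  lattice [set w | exists2 v, S v & w = v *m Q].
Proof.
move=> [SD SZ [N SN] Ss] fQ; have [M MQ] := row_fullP fQ; split.
- by move=> _ _ [u Su ->] [v Sv ->]; exists (u + v); [exact: SD | rewrite mulmxDl].
- by move=> c _ lc [v Sv ->]; exists (c *: v); [exact: SZ | rewrite scalemxAl].
- have [m mP] := mx_bounded Q; exists (N - m%:Z) => _ [v Sv ->] j.
  rewrite mxE; apply: (vge_sum hY) => i _.
  by apply: (vgeM hY); [exact: SN | exact: mP].
- move=> v; have [c c0 Sc] := Ss (v *m M); exists c => //=; exists (c *: (v *m M)) => //.
  by rewrite -scalemxAl -mulmxA MQ mulmx1.
Qed.

End Lattices.

Section Bundles.
Variables (C : fieldType) (Y : curve C) (hY : regular_curve Y).
Local Notation F := (fld Y).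
Hypothesis fin : forall y : F, y != 0 -> finsupp (fun p : pt Y => ord p y).

Lemma loc_cofinite (y : F) : exists s : seq (pt Y), forall p, p \notin s -> loc p y.
Proof.
have [->|y0] := eqVneq y 0; first by exists [::] => p _; exact: loc0.
by have [s sP] := fin y0; exists s => p /sP op; apply/(loc_ord hY); rewrite ?op.
Qed.

Lemma finite_forall (I : finType) (P : I -> pt Y -> Prop) :
  (forall i, exists s : seq (pt Y), forall p, p \notin s -> P i p) ->
  exists s : seq (pt Y), forall p, p \notin s -> forall i, P i p.
Proof.
move=> /choice[f fP]; exists (flatten [seq f i | i <- enum I]) => p ps i.
apply: fP; apply: contra ps => pi; apply/flatten_mapP; exists i => //.
by rewrite mem_enum.
Qed.

Lemma mxloc_cofinite m n (A : 'M[F]_(m, n)) :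
  exists s : seq (pt Y), forall p, p \notin s -> mxloc p A.
Proof.
have [s sP] := @finite_forall ('I_m * 'I_n)%type (fun ij p => loc p (A ij.1 ij.2))
  (fun ij => loc_cofinite (A ij.1 ij.2)).
by exists s => p /sP h i j; exact: (h (i, j)).
Qed.

Lemma mxunit_cofinite n (A : 'M[F]_n) : A \in unitmx ->
  exists s : seq (pt Y), forall p, p \notin s -> mxunit p A.
Proof.
rewrite unitmxE unitfE => dA; have [s sP] := mxloc_cofinite A; have [s' sP'] := fin dA.
exists (s ++ s') => p; rewrite mem_cat negb_or => /andP[/sP h /sP' h']; split=> //.
exact/(loc_unit_ord hY).
Qed.

(** Any basis of the generic stalk is integrally equivalent to the standard one at almost all
    points, so the local triviality in [vector_bundle] can be tested on the standard frame. *)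
Definition vlattice n (st : pt Y -> set 'rV[F]_n) : Prop :=
  (forall p, exists B, lframe p (st p) B) /\
  exists s : seq (pt Y), forall p, p \notin s -> lframe p (st p) 1%:M.

Lemma vector_bundleP (E : bundle Y) : vector_bundle E <-> vlattice (@stalk _ _ E).
Proof.
split=> [vE|[h [s sP]] p].
  split=> [p|]; first by have [S [B [_ pS hB]]] := vE p; exists B; exact: hB.
  case: (pselect (exists p : pt Y, True)) => [[p _]|np]; last first.
    by exists [::] => p; case: np; exists p.
  have [S [B [/finite_seqP[s SE] pS hB]]] := vE p; have uB : B \in unitmx by case: (hB p pS).
  have [s' sP'] := mxunit_cofinite uB; exists (s ++ s') => q; rewrite mem_cat negb_or => /andP[qs /sP' uq].
  apply/(lframe1 hY _ uq)/hB; rewrite SE /=; exact/negP.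
have [B hB] := h p; have uB : B \in unitmx by case: hB.
have [s' sP'] := mxunit_cofinite uB.
exists [set` filter (predC1 p) (s ++ s')], B; split=> //.
  by rewrite /= mem_filter /= eqxx.
move=> q; rewrite /= mem_filter /= mem_cat => /negP; rewrite negb_and negbK => /orP[/eqP->//|].
by rewrite negb_or => /andP[/sP h1 /sP' uq]; apply/(lframe1 hY _ uq).
Qed.

Definition ldegree n (st : pt Y -> set 'rV[F]_n) : int :=
  - \sum_(p \in [set: pt Y]) ord p (\det (xget 0 [set B | lframe p (st p) B])).

Lemma degreeE (E : bundle Y) : degree E = ldegree (@stalk _ _ E).
Proof. by []. Qed.

Lemma ldegree_frames n (st : pt Y -> set 'rV[F]_n) (B : pt Y -> 'M[F]_n) :
  (forall p, lframe p (st p) (B p)) -> ldegree st = - \sum_(p \in [set: pt Y]) ord p (\det (B p)).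
Proof.
move=> hB; congr (- _); apply: eq_fsum => p; apply: (ord_det_eq hY) (hB p).
exact: (@xgetPex _ 0 [set B | lframe p (st p) B] (ex_intro _ (B p) (hB p))).
Qed.

Lemma vlattice_frames n (st : pt Y -> set 'rV[F]_n) : vlattice st ->
  exists B, (forall p, lframe p (st p) (B p)) /\ finsupp (fun p : pt Y => ord p (\det (B p))).
Proof.
move=> [/choice[B hB] [s sP]]; exists B; split=> //.
by exists s => p /sP h; rewrite (ord_det_eq hY (hB p) h) det1 (ordv1 hY).
Qed.

Lemma ldegree_le n (st st' : pt Y -> set 'rV[F]_n) : vlattice st -> vlattice st' ->
  (forall p v, st p v -> st' p v) -> ldegree st <= ldegree st'.
Proof.
move=> /vlattice_frames[B [hB fB]] /vlattice_frames[B' [hB' fB']] h.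
rewrite (ldegree_frames hB) (ldegree_frames hB') lerN2; apply: fsum_le => // p.
by apply: (ord_det_le hY (hB p) (hB' p)); exact: h.
Qed.

Lemma ldegree0 (st : pt Y -> set 'rV[F]_0) : ldegree st = 0.
Proof. by rewrite /ldegree fsum0 ?oppr0 // => p; rewrite det_mx00 (ordv1 hY). Qed.

Lemma vlattice_sub n k (st : pt Y -> set 'rV[F]_n) (B : 'M[F]_(k, n)) : vlattice st -> row_free B ->
  vlattice (fun p => [set v | st p (v *m B)]).
Proof.
move=> [h [s sP]] fB; split=> [p|].
  apply: (lattice_frame hY); apply: (lframe_sub hY) fB.
  by have [A hA] := h p; exact: (lframe_lattice hY hA).
have [M BM] := row_freeP fB.
have [s1 h1] := mxloc_cofinite B; have [s2 h2] := mxloc_cofinite M.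
exists (s ++ s1 ++ s2) => p; rewrite !mem_cat !negb_or => /and3P[/sP[_ stP] /h1 lB /h2 lM].
split=> [|v]; first exact: unitmx1.
split=> [/stP[c lc E]|[c /mxlocP lc ->]].
  exists v; rewrite ?mulmx1 //; apply/mxlocP; rewrite -[v]mulmx1 -BM mulmxA E mulmx1.
  by apply: (mxloc_mul hY) => //; exact/mxlocP.
apply/stP; exists (c *m B); rewrite ?mulmx1 //; apply/mxlocP; exact: (mxloc_mul hY).
Qed.

Lemma vlattice_quo n k (st : pt Y -> set 'rV[F]_n) (Q : 'M[F]_(n, k)) : vlattice st -> row_full Q ->
  vlattice (fun p => [set w | exists2 v, st p v & w = v *m Q]).
Proof.
move=> [h [s sP]] fQ; split=> [p|].
  apply: (lattice_frame hY); apply: (lframe_quo hY) fQ.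
  by have [A hA] := h p; exact: (lframe_lattice hY hA).
have [M MQ] := row_fullP fQ.
have [s1 h1] := mxloc_cofinite Q; have [s2 h2] := mxloc_cofinite M.
exists (s ++ s1 ++ s2) => p; rewrite !mem_cat !negb_or => /and3P[/sP[_ stP] /h1 lQ /h2 lM].
split=> [|w]; first exact: unitmx1.
split=> [[_ /stP[c /mxlocP lc ->] ->]|[c /mxlocP lc ->]].
  by exists (c *m Q); rewrite ?mulmx1 //; apply/mxlocP/(mxloc_mul hY).
exists (c *m M); last by rewrite mulmx1 -mulmxA MQ mulmx1.
by apply/stP; exists (c *m M); rewrite ?mulmx1 //; apply/mxlocP/(mxloc_mul hY).
Qed.

End Bundles.

Section Degrees.
Variables (C : fieldType) (Y : curve C) (hY : regular_curve Y).
Local Notation F := (fld Y).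
Hypothesis pf : forall y : F, y != 0 ->
  finsupp (fun p : pt Y => ord p y) /\ \sum_(p \in [set: pt Y]) ord p y = 0.
Let fin (y : F) (y0 : y != 0) : finsupp (fun p : pt Y => ord p y) := (pf y0).1.

(** [M] multiplies all local determinants by one and the same function, whose orders add up to 0. *)
Lemma ldegree_iso n (st st' : pt Y -> set 'rV[F]_n) (M : 'M[F]_n) : vlattice st -> M \in unitmx ->
  (forall p v, st p v <-> st' p (v *m M)) -> vlattice st' /\ ldegree st' = ldegree st.
Proof.
move=> vst uM h; have [B [hB fB]] := vlattice_frames hY vst.
have hB' p : lframe p (st' p) (B p *m M).
  have [uB BP] := hB p; split=> [|v]; first by rewrite unitmx_mul uB.
  rewrite -[v](mulmxKV uM) -h; split=> [/BP[c lc E]|[c lc E]].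
    by exists c; rewrite // mulmxA E.
  by apply/BP; exists c => //; apply: (can_inj (mulmxK uM)); rewrite E mulmxA.
have dM : \det M != 0 by move: uM; rewrite unitmxE unitfE.
have vst' : vlattice st'.
  split=> [p|]; first by exists (B p *m M).
  have [_ [s sP]] := vst; have [s' sP'] := mxunit_cofinite hY fin uM.
  exists (s ++ s') => p; rewrite mem_cat negb_or => /andP[/sP[_ stP] /sP' up].
  apply/(lframe1 hY _ up); split=> // v; rewrite -[v](mulmxKV uM) -h.
  split=> [/stP[c lc ->]|[c lc E]]; first by exists c; rewrite ?mulmx1.
  by apply/stP; exists c; rewrite ?mulmx1 //; apply: (can_inj (mulmxK uM)).
split=> //; rewrite (ldegree_frames hY hB) (ldegree_frames hY hB'); congr (- _).
have [fM sM] := pf dM; have := fsumD fB fM; rewrite sM addr0 => <-; apply: eq_fsum => p.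
rewrite det_mulmx (ordM hY) //; by have [] := hB p; rewrite unitmxE unitfE.
Qed.

(** At each point a frame of the sub and a lift of a frame of the quotient form a frame of the
    whole, block triangular in the global basis [M0]. Its determinant is the product of the two
    determinants and of $\det M_0$, which has total order 0. *)
Lemma ldegree_exact n k l (st : pt Y -> set 'rV[F]_n) (B : 'M[F]_(k, n)) (Q : 'M[F]_(n, l)) :
  vlattice st -> row_free B -> row_full Q -> (kermx Q == B)%MS ->
  ldegree st = ldegree (fun p => [set v | st p (v *m B)]) +
               ldegree (fun p => [set w | exists2 v, st p v & w = v *m Q]).
Proof.
move=> vst fB fQ kQ; have nE : n = (k + l)%N.
  have := mxrank_ker Q; rewrite (eqmxP kQ) (eqP fB) (eqP fQ) => ->.
  by rewrite subnK // -(eqP fQ) rank_leq_row.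
subst n; have [Q' Q'Q] := row_fullP fQ.
have BQ : B *m Q = 0 by apply/sub_kermxP; rewrite (eqmxP kQ).
pose M0 := col_mx B Q'.
have uM0 : M0 \in unitmx.
  rewrite -row_free_unit; apply: inj_row_free => v; rewrite -[v]hsubmxK mul_row_col => E.
  have r0 : rsubmx v = 0.
    have := congr1 (mulmx^~ Q) E; rewrite mulmxDl -!mulmxA BQ Q'Q mulmx0 add0r mulmx1 mul0mx.
    exact.
  have l0 : lsubmx v = 0.
    have [B' BB'] := row_freeP fB; have := congr1 (mulmx^~ B') E.
    by rewrite r0 mul0mx addr0 mul0mx -mulmxA BB' mulmx1.
  by rewrite l0 r0 row_mx0.
have [Bs [hBs fBs]] := vlattice_frames hY (vlattice_sub hY fin vst fB).
have [Bq [hBq fBq]] := vlattice_frames hY (vlattice_quo hY fin vst fQ).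
(* The section [Q'] of [Q] need not preserve stalks; [U] corrects it so that the lifted rows lie in
   the stalk at [p]. *)
have /choice[U UP] : forall p, exists U : 'M_(l, k), forall i, st p (row i (U *m B + Bq p *m Q')).
  move=> p; have [uq qP] := hBq p.
  have /choice[u uP] : forall i, exists u : 'rV_k, st p (u *m B + row i (Bq p) *m Q').
    move=> i; have [v sv E] : [set w | exists2 v, st p v & w = v *m Q] (row i (Bq p)).
      apply/qP; exists (delta_mx 0 i); rewrite -?rowE // => j; rewrite mxE.
      by case: (_ && _); [exact: loc1|exact: loc0].
    have : (v - row i (Bq p) *m Q' <= B)%MS.
      rewrite -(eqmxP kQ); apply/sub_kermxP; rewrite mulmxBl -mulmxA Q'Q mulmx1 E subrr.
      by [].
    by move=> /submxP[u uE]; exists u; rewrite -uE subrK.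
  by exists (\matrix_i u i) => i; rewrite linearD /= !row_mul rowK.
have hM p : lframe p (st p) (block_mx (Bs p) 0 (U p) (Bq p) *m M0).
  have [us sP] := hBs p; have [uq qP] := hBq p.
  have [SD SZ _ _] : lattice p (st p) by have [A hA] := vst.1 p; exact: (lframe_lattice hY hA).
  have S0 : st p 0 by have [A [_ hA]] := vst.1 p; apply/hA; exists 0; rewrite ?mul0mx // => j; rewrite mxE; exact: loc0.
  have rowsS : forall i, st p (row i (U p *m B + Bq p *m Q')) by exact: UP.
  have lc_st (c : 'rV_l) : (forall j, loc p (c 0 j)) -> st p (c *m (U p *m B + Bq p *m Q')).
    move=> lc; rewrite mulmx_sum_row; apply: (big_ind (st p)) => // i _.
    exact: SZ.
  have blockE (c : 'rV_(k + l)) : c *m (block_mx (Bs p) 0 (U p) (Bq p) *m M0) =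
      lsubmx c *m Bs p *m B + rsubmx c *m (U p *m B + Bq p *m Q').
    rewrite mulmxA -{1}[c]hsubmxK mul_row_block mul_row_col mulmx0 add0r.
    by rewrite !mulmxDl mulmxDr !mulmxA addrA.
  split=> [|v].
    by rewrite unitmx_mul uM0 andbT unitmxE det_lblock unitrM -!unitmxE us uq.
  split=> [sv|[c lc ->]]; last first.
    rewrite blockE; apply: SD; last by apply: lc_st => j; rewrite mxE.
    by apply/sP; exists (lsubmx c) => // j; rewrite mxE.
  have [c lc cE] : exists2 c : 'rV_l, (forall j, loc p (c 0 j)) & v *m Q = c *m Bq p.
    by apply/qP; exists v.
  have : (v - c *m (U p *m B + Bq p *m Q') <= B)%MS.
    rewrite -(eqmxP kQ); apply/sub_kermxP; rewrite mulmxBl cE -!mulmxA mulmxDl -!mulmxA BQ Q'Q.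
    by rewrite mulmx0 add0r mulmx1 subrr.
  move=> /submxP[u uE].
  have [c' lc' c'E] : exists2 c : 'rV_k, (forall j, loc p (c 0 j)) & u = c *m Bs p.
    by apply/sP; rewrite /= -uE -scaleN1r; apply: SD => //; apply: SZ; [exact/(locN hY)/loc1|exact: lc_st].
  exists (row_mx c' c); last by rewrite blockE row_mxKl row_mxKr -c'E -uE subrK.
  by apply/mxlocP/mxloc_row; exact/mxlocP.
rewrite (ldegree_frames hY hBs) (ldegree_frames hY hBq) (ldegree_frames hY hM).
have dM : \det M0 != 0 by move: uM0; rewrite unitmxE unitfE.
have [fM sM] := pf dM.
have E1 := fsumD fBs fBq; have := fsumD (finsuppD fBs fBq) fM.
rewrite sM addr0 E1 -opprD => <-; congr (- _); apply: eq_fsum => p.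
have [us _] := hBs p; have [uq _] := hBq p; move: us uq; rewrite !unitmxE !unitfE => us uq.
by rewrite det_mulmx det_lblock (ordM hY) ?mulf_neq0 // (ordM hY).
Qed.

End Degrees.

Lemma char_poly_conj (R : fieldType) n (A B M : 'M[R]_n) : M \in unitmx -> M *m A = B *m M ->
  char_poly A = char_poly B.
Proof.
move=> uM E; have EX : map_mx polyC M *m char_poly_mx A = char_poly_mx B *m map_mx polyC M.
  rewrite /char_poly_mx mulmxBr mulmxBl -!map_mxM E; congr (_ - _).
  by rewrite scalar_mxC.
have dM : (\det M)%:P != 0 by rewrite polyC_eq0; move: uM; rewrite unitmxE unitfE.
have dE : \det (map_mx polyC M) = (\det M)%:P by exact: det_map_mx.
by apply: (mulfI dM); have := congr1 determinant EX; rewrite !det_mulmx dE [RHS]mulrC.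
Qed.

Lemma char_poly_lblock (R : comNzRingType) m n (A : 'M[R]_m) (U : 'M_(n, m)) (B : 'M[R]_n) :
  char_poly (block_mx A 0 U B) = char_poly A * char_poly B.
Proof.
rewrite /char_poly /char_poly_mx map_block_mx map_mx0 scalar_mx_block opp_block_mx add_block_mx.
by rewrite oppr0 addr0 det_lblock.
Qed.

(** In a basis made of [B] and a section of [Q] the matrix is block triangular. *)
Lemma char_poly_exact (F : fieldType) n k l (A : 'M[F]_n) (B : 'M[F]_(k, n)) (Q : 'M[F]_(n, l)) S T :
  row_free B -> row_full Q -> (kermx Q == B)%MS -> S *m B = B *m A -> Q *m T = A *m Q ->
  char_poly A = char_poly S * char_poly T.
Proof.
move=> fB fQ kQ sB qQ; have nE : n = (k + l)%N.
  have := mxrank_ker Q; rewrite (eqmxP kQ) (eqP fB) (eqP fQ) => ->.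
  by rewrite subnK // -(eqP fQ) rank_leq_row.
subst n; have [Q' Q'Q] := row_fullP fQ.
have BQ : B *m Q = 0 by apply/sub_kermxP; rewrite (eqmxP kQ).
have uM0 : col_mx B Q' \in unitmx.
  rewrite -row_free_unit; apply: inj_row_free => v; rewrite -[v]hsubmxK mul_row_col => E1.
  have r0 : rsubmx v = 0.
    by have := congr1 (mulmx^~ Q) E1; rewrite mulmxDl -!mulmxA BQ Q'Q mulmx0 add0r mulmx1 mul0mx.
  have l0 : lsubmx v = 0.
    have [B' BB'] := row_freeP fB; have := congr1 (mulmx^~ B') E1.
    by rewrite r0 mul0mx addr0 mul0mx -mulmxA BB' mulmx1.
  by rewrite l0 r0 row_mx0.
have : (Q' *m A - T *m Q' <= B)%MS.
  by rewrite -(eqmxP kQ); apply/sub_kermxP; rewrite mulmxBl -!mulmxA -qQ Q'Q mulmx1 mulmxA Q'Q mul1mx subrr.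
move=> /submxP[U UE]; rewrite -(char_poly_lblock S U T); apply: char_poly_conj uM0 _.
rewrite mul_col_mx mul_block_col mul0mx addr0 sB; congr col_mx.
by rewrite -UE subrK.
Qed.

Lemma mul_col_base_eq0 (F : fieldType) m n p (A : 'M[F]_(p, m)) (W : 'M[F]_(m, n)) :
  (A *m col_base W == 0) = (A *m W == 0).
Proof.
apply/eqP/eqP => h; first by rewrite -(mulmx_base W) mulmxA h mul0mx.
have [R RR] := row_freeP (row_base_free W).
by rewrite -[LHS]mulmx1 -RR mulmxA -(mulmxA A) mulmx_base h mul0mx.
Qed.

(** * Higgs bundles and Jordan-Hoelder filtrations *)

Section HiggsBundles.
Variables (C : numClosedFieldType) (X : curve C) (hX : smooth_projective_curve X).
Local Notation F := (fld X).
Let hR := smooth_regular hX.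
Let pf := product_formula hX.
Let fin (y : F) (y0 : y != 0) : finsupp (fun p : pt X => ord p y) := (pf y0).1.
Implicit Types E G H : higgs X.

Lemma higgs_bundleP E : higgs_bundle E -> vlattice (@stalk _ _ E).
Proof. by case=> /(vector_bundleP hR fin). Qed.

(** Once the equality of ranks is substituted, the isomorphism is a square invertible matrix and
    both generic stalks have the same type. *)
Lemma higgs_iso_unfold E G : higgs_iso E G -> exists n st ph st' ph' (M : 'M[F]_n),
  [/\ E = Higgs (hbun := @Bundle C X n st) ph, G = Higgs (hbun := @Bundle C X n st') ph', M \in unitmx,
      forall p v, st p v <-> st' p (v *m M) & forall D, ph D *m M = M *m ph' D].
Proof.
case: E G => [[n st] ph] [[m st'] ph'] [M [/= fM uM hst hph]].
have nm : n = m by rewrite -(eqP fM) (eqP uM).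
subst m; exists n, st, ph, st', ph', M; split=> //.
by rewrite -row_free_unit.
Qed.

Lemma higgs_iso_refl E : higgs_iso E E.
Proof.
exists 1%:M; rewrite row_free_unit row_full_unit unitmx1; split=> // [p v|D].
  by rewrite mulmx1.
by rewrite mulmx1 mul1mx.
Qed.

Lemma higgs_iso_sym E G : higgs_iso E G -> higgs_iso G E.
Proof.
move=> /higgs_iso_unfold[n [st [ph [st' [ph' [M [-> -> uM hst hph]]]]]]].
exists (invmx M); rewrite row_free_unit row_full_unit unitmx_inv uM; split=> //= [p v|D].
  by rewrite hst mulmxKV.
by apply: (can_inj (mulKmx uM)); rewrite mulmxA -hph mulmxK // mulKVmx.
Qed.

Lemma higgs_iso_trans E G H : higgs_iso E G -> higgs_iso G H -> higgs_iso E H.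
Proof.
move=> [M [fM uM hst hph]] [N [fN uN hst' hph']]; exists (M *m N); split.
- by rewrite /row_free mxrankMfree.
- by rewrite /row_full eqmxMfull.
- by move=> p v; rewrite hst hst' mulmxA.
- by move=> D; rewrite mulmxA hph -mulmxA hph' mulmxA.
Qed.

Lemma higgs_iso_bundle E G : higgs_iso E G -> higgs_bundle E ->
  [/\ higgs_bundle G, rk G = rk E & degree G = degree E].
Proof.
move=> /higgs_iso_unfold[n [st [ph [st' [ph' [M [-> -> uM hst hph]]]]]]] hE.
have vE := higgs_bundleP hE; have [_ hs hp] := hE; rewrite /= in hs hp hph.
have [vG dG] := ldegree_iso hR pf vE uM hst; split=> //; split.
- exact/(vector_bundleP hR fin).
- move=> f D /=; apply: (can_inj (mulKmx uM)); rewrite -hph hs -scalemxAr -hph.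
  by rewrite scalemxAl.
- move=> p D v tD /=; rewrite -[v](mulmxKV uM) -hst => sv.
  rewrite (_ : _ *m _ *m ph' D = v *m invmx M *m ph D *m M); first by rewrite -hst; exact: hp.
  by rewrite -[RHS]mulmxA hph mulmxA.
Qed.

Lemma higgs_iso_char E G D : higgs_iso E G -> char_poly (phi E D) = char_poly (phi G D).
Proof.
move=> /higgs_iso_unfold[n [st [ph [st' [ph' [M [-> -> uM hst hph]]]]]]] /=.
by symmetry; apply: char_poly_conj uM _.
Qed.

Lemma inv_phi E k (B : 'M[F]_(k, rk E)) D : row_free B -> invariant B ->
  phi (subhiggs B) D *m B = B *m phi E D.
Proof. by move=> fB iB; rewrite /= mulmxKpV. Qed.

Lemma subhiggs_bundle E k (B : 'M[F]_(k, rk E)) : higgs_bundle E -> row_free B -> invariant B ->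
  higgs_bundle (subhiggs B).
Proof.
move=> hE fB iB; have vE := higgs_bundleP hE; have [_ hs hp] := hE; split.
- exact/(vector_bundleP hR fin)/(vlattice_sub hR fin).
- by move=> f D /=; rewrite hs -scalemxAr -scalemxAl.
- by move=> p D v tD sv /=; rewrite -mulmxA mulmxKpV // mulmxA; exact: hp.
Qed.

Lemma quo_phi E k l (B : 'M[F]_(k, rk E)) (Q : 'M[F]_(rk E, l)) D : row_full Q ->
  (kermx Q == B)%MS -> invariant B -> Q *m phi (quohiggs Q) D = phi E D *m Q.
Proof.
move=> fQ kQ iB; rewrite -[phi (quohiggs Q) D]/(pinvmx Q *m phi E D *m Q); move: (pinvmx Q) (mulVpmx fQ) => P PQ; apply/eqP; rewrite -subr_eq0 !mulmxA -!mulmxBl -{2}[phi E D]mul1mx -mulmxBl.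
have : (Q *m P - 1%:M <= B)%MS.
  by rewrite -(eqmxP kQ); apply/sub_kermxP; rewrite mulmxBl mul1mx -mulmxA PQ mulmx1 subrr.
move=> /submxP[U ->]; have /submxP[V E1] := iB D; rewrite -(mulmxA U) E1.
have BQ : B *m Q = 0 by apply/sub_kermxP; rewrite (eqmxP kQ).
by rewrite -!mulmxA BQ !mulmx0.
Qed.

Lemma quohiggs_bundle E k l (B : 'M[F]_(k, rk E)) (Q : 'M[F]_(rk E, l)) : higgs_bundle E ->
  row_full Q -> (kermx Q == B)%MS -> invariant B -> higgs_bundle (quohiggs Q).
Proof.
move=> hE fQ kQ iB; have vE := higgs_bundleP hE; have [_ hs hp] := hE; split.
- exact/(vector_bundleP hR fin)/(vlattice_quo hR fin).
- by move=> f D /=; rewrite hs -scalemxAr -scalemxAl.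
- move=> p D _ tD [v sv ->]; exists (v *m phi E D); first exact: hp.
  by rewrite -(mulmxA v Q) (quo_phi D fQ kQ iB) mulmxA.
Qed.

Lemma char_exact E k l (B : 'M[F]_(k, rk E)) (Q : 'M[F]_(rk E, l)) D : row_free B -> row_full Q ->
  (kermx Q == B)%MS -> invariant B ->
  char_poly (phi E D) = char_poly (phi (subhiggs B) D) * char_poly (phi (quohiggs Q) D).
Proof.
move=> fB fQ kQ iB.
exact: (char_poly_exact fB fQ kQ (inv_phi D fB iB) (quo_phi D fQ kQ iB)).
Qed.

Lemma char_dsum E G D : char_poly (phi (dsum E G) D) = char_poly (phi E D) * char_poly (phi G D).
Proof. exact: (char_poly_lblock (phi E D) 0 (phi G D)). Qed.

Lemma char_big_dsum (I : Type) (s : seq I) (f : I -> higgs X) D :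
  char_poly (phi (\big[@dsum C X/higgs0 X]_(i <- s) f i) D) = \prod_(i <- s) char_poly (phi (f i) D).
Proof.
elim: s => [|i s IH]; last by rewrite !big_cons char_dsum IH.
by rewrite !big_nil /= /char_poly det_mx00.
Qed.

Lemma jordan_holder_char E s D : jordan_holder E s ->
  char_poly (phi E D) = \prod_(H <- s) char_poly (phi H D).
Proof.
elim=> {E s} [[[n st] ph] /= n0|E k l B Q s fB fQ kQ iB _ _ _ IH].
  by subst n; rewrite big_nil /char_poly det_mx00.
by rewrite (char_exact D fB fQ kQ iB) big_cons IH.
Qed.

Lemma S_equivalent_char E G D : S_equivalent E G -> char_poly (phi E D) = char_poly (phi G D).
Proof.
move=> [s [s' [hs hs' /(higgs_iso_char D)]]].
by rewrite !char_big_dsum -(jordan_holder_char D hs) -(jordan_holder_char D hs').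
Qed.

Lemma higgs_eq n (st st' : pt X -> set 'rV[F]_n) ph ph' : (forall p v, st p v <-> st' p v) ->
  (forall D, ph D = ph' D) -> @Higgs C X (@Bundle C X n st) ph = @Higgs C X (@Bundle C X n st') ph'.
Proof.
move=> h /funext hp; have -> : st = st' by apply/funext => p; apply/seteqP; split=> v /h.
by move: ph hp => ? ->.
Qed.

(** The same list [s] serves: the graded pieces cut out by [B *m M] and [invmx M *m Q] in G are
    equal, and not merely isomorphic, to those cut out by [B] and [Q] in E. *)
Lemma jordan_holder_iso E G s : higgs_iso E G -> higgs_bundle E -> jordan_holder E s -> jordan_holder G s.
Proof.
move=> iEG hE js; elim: js G hE iEG => {E s} [E rE|E k l B Q s fB fQ kQ iB sB dB jQ IH] G hE iEG.
  by apply: JH0; have [_ -> _] := higgs_iso_bundle iEG hE.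
have [_ rG dG] := higgs_iso_bundle iEG hE.
have [n [st [ph [st' [ph' [M [eE eG uM hst hph]]]]]]] := higgs_iso_unfold iEG.
subst E G; rewrite /= in B Q fB fQ kQ iB sB dB jQ rG dG IH hE *.
pose B' := B *m M; pose Q' := invmx M *m Q.
have fB' : row_free B' by rewrite /row_free mxrankMfree // row_free_unit.
have fQ' : row_full Q' by rewrite /row_full eqmxMfull // row_full_unit unitmx_inv.
have iB' : @invariant C X (@Higgs C X (@Bundle C X n st') ph') k B'.
  move=> D /=; rewrite /B' -mulmxA -hph mulmxA; apply: submxMr; exact: iB.
have kQ' : (kermx Q' == B')%MS.
  apply/andP; split.
    apply/row_subP => i; have : (row i (kermx Q') *m invmx M <= kermx Q)%MS.
      by apply/sub_kermxP; rewrite -mulmxA -row_mul mulmx_ker row0.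
    rewrite (eqmxP kQ) => /submxP[u uE]; apply/submxP; exists u.
    by rewrite /B' mulmxA -uE mulmxKV.
  apply/sub_kermxP; rewrite /B' /Q' mulmxA mulmxK //.
  by apply/sub_kermxP; rewrite (eqmxP kQ).
have eS : subhiggs (E := @Higgs C X (@Bundle C X n st) ph) B = subhiggs (E := @Higgs C X (@Bundle C X n st') ph') B'.
  apply: higgs_eq => [p v /=|D]; first by rewrite hst /B' mulmxA.
  have [B1 BB1] := row_freeP fB'; have [B2 BB2] := row_freeP fB.
  have h1 := @inv_phi (@Higgs C X (@Bundle C X n st) ph) _ B D fB iB.
  have h2 := @inv_phi (@Higgs C X (@Bundle C X n st') ph') _ B' D fB' iB'.
  rewrite -[LHS]mulmx1 -[RHS]mulmx1 -BB1 [LHS]mulmxA [RHS]mulmxA; congr (_ *m _).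
  rewrite h2 /B' /= mulmxA; rewrite /= in h1; rewrite h1.
  by rewrite -!mulmxA hph.
have eQ : quohiggs (E := @Higgs C X (@Bundle C X n st) ph) Q = quohiggs (E := @Higgs C X (@Bundle C X n st') ph') Q'.
  apply: higgs_eq => [p v /=|D].
    split=> [[w sw ->]|[w sw ->]].
      by exists (w *m M); [exact/hst | rewrite /Q' mulmxA mulmxK].
    by exists (w *m invmx M); [apply/hst; rewrite mulmxKV | rewrite /Q' mulmxA].
  have h1 := @quo_phi (@Higgs C X (@Bundle C X n st) ph) _ _ B Q D fQ kQ iB.
  have h2 := @quo_phi (@Higgs C X (@Bundle C X n st') ph') _ _ B' Q' D fQ' kQ' iB'.
  rewrite -[LHS]mul1mx -[RHS]mul1mx -(mulVpmx fQ) -[LHS]mulmxA -[RHS]mulmxA; congr (_ *m _).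
  rewrite /= in h1 h2; rewrite h1; apply: (can_inj (mulKmx (_ : invmx M \in unitmx))).
    by rewrite unitmx_inv.
  rewrite [RHS]mulmxA -/Q' h2 /Q' !mulmxA; congr (_ *m _).
  have -> : ph D = M *m ph' D *m invmx M by rewrite -hph mulmxK.
  by rewrite !mulmxA mulVmx // mul1mx.
rewrite eS; apply: (@JHS C X (@Higgs C X (@Bundle C X n st') ph') k l B' Q' s fB' fQ' kQ' iB').
- by rewrite -eS.
- by rewrite -eS /= dB dG.
- rewrite -eQ; exact: jQ.
Qed.

(** Semistability with the slope inequality simplified by degree 0. Ranks disappear from it and
    [k = 0] is included, which suits inductions on subbundles and quotients. *)
Definition ss0 E := higgs_bundle E /\ degree E = 0 /\
  forall k (B : 'M[F]_(k, rk E)), row_free B -> invariant B -> degree (subhiggs B) <= 0.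

Lemma ss0P E r : semistable_higgs r E <-> rk E = r /\ ss0 E.
Proof.
split=> [[hE rE dE sE]|[rE [hE [dE sE]]]]; split=> //.
  split=> //; split=> // k B fB iB.
  have [k0|k0] := posnP k; first by subst k; rewrite degreeE ldegree0.
  have := sE k B k0 fB iB; rewrite dE mul0r pmulr_lle0 // ltz_nat.
  by apply: leq_trans k0 _; rewrite -(eqP fB) rank_leq_col.
move=> k B k0 fB iB; rewrite dE mul0r; apply: mulr_le0_ge0 => //.
exact: sE.
Qed.

Lemma sub_sub E k k' (B : 'M[F]_(k, rk E)) (B' : 'M[F]_(k', k)) : row_free B -> invariant B ->
  row_free B' -> @invariant C X (subhiggs B) k' B' ->
  [/\ row_free (B' *m B), invariant (B' *m B) &
      degree (subhiggs (B' *m B)) = degree (@subhiggs C X (subhiggs B) k' B')].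
Proof.
move=> fB iB fB' iB'; split.
- by rewrite /row_free mxrankMfree.
- move=> D; rewrite -mulmxA -(inv_phi D fB iB) mulmxA; apply: submxMr; exact: iB'.
- rewrite !degreeE /=; congr ldegree; apply/funext => p; apply/seteqP.
  by split=> v /=; rewrite mulmxA.
Qed.

(* An invariant subbundle of degree 0 of minimal positive rank is stable. *)
Lemma ex_stable_sub E : ss0 E -> (0 < rk E)%N -> exists k (B : 'M[F]_(k, rk E)),
  [/\ (0 < k)%N, row_free B, invariant B, degree (subhiggs B) = 0 & stable (subhiggs B)].
Proof.
move=> [hE [dE sE]] r0.
have h : exists k, `[< (0 < k)%N /\ exists B : 'M[F]_(k, rk E),
    [/\ row_free B, invariant B & degree (subhiggs B) = 0] >].
  exists (rk E); apply/asboolP; split=> //; exists 1%:M; split.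
  - by rewrite row_free_unit unitmx1.
  - by move=> D; apply: submx_full; rewrite row_full_unit unitmx1.
  - rewrite -dE !degreeE /=; congr ldegree; apply/funext => p; apply/seteqP.
    by split=> v /=; rewrite mulmx1.
have [k /asboolP[k0 [B [fB iB dB]]] kmin] := ex_minnP h.
exists k, B; split=> //; split=> // k' B' /= /andP[k'0 k'k] fB' iB'.
have [fBB iBB dBB] := sub_sub fB iB fB' iB'.
rewrite dB mul0r nmulr_rlt0 ?ltz_nat // lt_neqAle -dBB sE // andbT.
apply/eqP => d0; suff : (k <= k')%N by rewrite leqNgt k'k.
by apply: kmin; apply/asboolP; split=> //; exists (B' *m B).
Qed.

Lemma row_free_kernel k l (Q : 'M[F]_(k, l)) :
  exists m (K : 'M[F]_(m, k)), row_free K /\ (kermx Q == K)%MS.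
Proof.
exists (\rank (kermx Q)), (row_base (kermx Q)); split; first exact: row_base_free.
by apply/eqmxP/eqmx_sym/eq_row_base.
Qed.

Lemma row_full_cokernel k n (B : 'M[F]_(k, n)) : row_free B ->
  exists l (Q : 'M[F]_(n, l)), row_full Q /\ (kermx Q == B)%MS.
Proof.
move=> fB; exists (\rank (cokermx B)), (col_base (cokermx B)); split.
  exact: col_base_full.
apply/andP; split.
  by rewrite submxE -mul_col_base_eq0 mulmx_ker.
by apply/sub_kermxP/eqP; rewrite mul_col_base_eq0 mulmx_coker.
Qed.

(** The inverse image in E of an invariant subbundle of the quotient is invariant, and its degree is
    larger by that of [subhiggs B], which is 0. *)
Lemma quo_ss0 E k l (B : 'M[F]_(k, rk E)) (Q : 'M[F]_(rk E, l)) : ss0 E -> row_free B ->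
  row_full Q -> (kermx Q == B)%MS -> invariant B -> degree (subhiggs B) = 0 -> ss0 (quohiggs Q).
Proof.
move=> [hE [dE sE]] fB fQ kQ iB dB; have vE := higgs_bundleP hE.
split; first exact: (quohiggs_bundle hE fQ kQ iB).
split.
  have := ldegree_exact hR pf vE fB fQ kQ; rewrite -!degreeE => E1.
  by move: dE; rewrite E1; move: dB; rewrite degreeE => ->; rewrite add0r.
rewrite [rk _]/= => m A fA iA.
have [Q' Q'Q] := row_fullP fQ.
have BQ : B *m Q = 0 by apply/sub_kermxP; rewrite (eqmxP kQ).
(* Rows spanning the inverse image of [A]: the subbundle [B] and a lift of [A] through the section
   [Q']. *)
pose T := col_mx B (A *m Q').
have fT : row_free T.
  apply: inj_row_free => v; rewrite -[v]hsubmxK mul_row_col => E1.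
  have r0 : rsubmx v = 0.
    have := congr1 (mulmx^~ Q) E1; rewrite mulmxDl -!mulmxA BQ Q'Q mulmx0 add0r mulmx1 mul0mx.
    by have [A' AA'] := row_freeP fA => /(congr1 (mulmx^~ A')); rewrite mul0mx -mulmxA AA' mulmx1.
  have l0 : lsubmx v = 0.
    have [B' BB'] := row_freeP fB; have := congr1 (mulmx^~ B') E1.
    by rewrite r0 mul0mx addr0 mul0mx -mulmxA BB' mulmx1.
  by rewrite l0 r0 row_mx0.
have iT : invariant T.
  move=> D; rewrite mul_col_mx col_mx_sub; apply/andP; split.
    apply: submx_trans (iB D) _; apply/submxP; exists (row_mx 1%:M 0).
    by rewrite mul_row_col mul1mx mul0mx addr0.
  have /submxP[U UE] := iA D.
  have : (A *m Q' *m phi E D - U *m A *m Q' <= B)%MS.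
    rewrite -(eqmxP kQ); apply/sub_kermxP; rewrite mulmxBl -!mulmxA -(quo_phi D fQ kQ iB).
    by rewrite Q'Q mulmx1 (mulmxA Q') Q'Q mul1mx -UE subrr.
  move=> /submxP[V VE]; apply/submxP; exists (row_mx V U).
  by rewrite mul_row_col -VE mulmxA subrK.
have vT : vlattice (fun p => [set v : 'rV_(k + m) | stalk p (v *m T)]).
  exact: (vlattice_sub hR fin vE fT).
have fI : row_free (row_mx 1%:M 0 : 'M[F]_(k, k + m)).
  by apply/row_freeP; exists (col_mx 1%:M 0); rewrite mul_row_col mul1mx mul0mx addr0.
have fP : row_full (col_mx 0 1%:M : 'M[F]_(k + m, m)).
  by apply/row_fullP; exists (row_mx 0 1%:M); rewrite mul_row_col mul1mx mul0mx add0r.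
have kP : (kermx (col_mx 0 1%:M : 'M[F]_(k + m, m)) == (row_mx 1%:M 0 : 'M[F]_(k, k + m)))%MS.
  apply/andP; split; last by apply/sub_kermxP; rewrite mul_row_col mulmx0 mul0mx addr0.
  set K := kermx _; have := mulmx_ker (col_mx 0 1%:M : 'M[F]_(k + m, m)); rewrite -/K -[K]hsubmxK.
  rewrite mul_row_col mulmx0 mulmx1 add0r => ->; apply/submxP; exists (lsubmx K).
  by rewrite mul_mx_row mulmx1 mulmx0.
have := ldegree_exact hR pf vT fI fP kP.
have -> : (fun p => [set v | [set v0 : 'rV_(k + m) | stalk p (v0 *m T)] (v *m row_mx 1%:M 0)]) =
    (fun p => [set v | stalk p (v *m B)]).
  apply/funext => p; apply/seteqP; split=> v /=;
    by rewrite mul_mx_row mulmx1 mulmx0 mul_row_col mul0mx addr0.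
have -> : (fun p => [set w | exists2 v, [set v0 : 'rV_(k + m) | stalk p (v0 *m T)] v & w = v *m col_mx 0 1%:M]) =
    (fun p => [set v | exists2 u, stalk p u & v *m A = u *m Q]).
  apply/funext => p; apply/seteqP; split=> w /=.
    move=> [v sv ->]; exists (v *m T) => //; rewrite -[v in LHS]hsubmxK -[v in RHS]hsubmxK.
    rewrite !mul_row_col mulmx0 add0r mulmx1 mulmxDl -!mulmxA BQ Q'Q mulmx0 add0r mulmx1.
    by [].
  move=> [u su E1]; have : (u - w *m A *m Q' <= B)%MS.
    by rewrite -(eqmxP kQ); apply/sub_kermxP; rewrite mulmxBl -(mulmxA (w *m A)) Q'Q mulmx1 E1 subrr.
  move=> /submxP[V VE]; exists (row_mx V w); last by rewrite mul_row_col mulmx0 add0r mulmx1.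
  by rewrite /= mul_row_col -VE mulmxA subrK.
have dT : degree (subhiggs T) <= 0 by exact: sE.
move: dB dT; rewrite !degreeE /= => -> + E1; rewrite E1 add0r.
by [].
Qed.

(** Splitting off a stable subbundle of degree 0 leaves a quotient of smaller rank that is again in
    [ss0]. The reflexivity of S-equivalence rests on this. *)
Lemma ex_jordan_holder E : ss0 E -> exists s, jordan_holder E s.
Proof.
move: {2}(rk E) (leqnn (rk E)) => n; elim: n E => [|n IH] E rE sE.
  by exists [::]; apply: JH0; apply/eqP; rewrite -leqn0.
have [r0|r0] := posnP (rk E); first by exists [::]; exact: JH0.
have [k [B [k0 fB iB dB sB]]] := ex_stable_sub sE r0.
have [l [Q [fQ kQ]]] := row_full_cokernel fB.
have lE : (l < rk E)%N.
  have := mxrank_ker Q; rewrite (eqmxP kQ) (eqP fB) (eqP fQ) => kE.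
  have : (l <= rk E)%N by rewrite -(eqP fQ) rank_leq_row.
  lia.
have [|s js] := IH (quohiggs Q) _ (quo_ss0 sE fB fQ kQ iB dB).
  by rewrite /=; lia.
exists (subhiggs B :: s); apply: JHS js => //.
by have [_ [-> _]] := sE; rewrite dB !mul0r.
Qed.

Lemma S_equivalent_refl E : ss0 E -> S_equivalent E E.
Proof. by move=> /ex_jordan_holder[s js]; exists s, s; split=> //; exact: higgs_iso_refl. Qed.

Lemma ss0_iso E G : higgs_iso E G -> ss0 E -> ss0 G.
Proof.
move=> i [hE [dE sE]]; have [hG rG dG] := higgs_iso_bundle i hE.
split=> //; split; first by rewrite dG.
have [n [st [ph [st' [ph' [M [eE eG uM hst hph]]]]]]] := higgs_iso_unfold (higgs_iso_sym i).
subst E G => k B fB iB; rewrite /= in B fB iB hst hph *.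
have fBM : row_free (B *m M) by rewrite /row_free mxrankMfree // row_free_unit.
have := sE k (B *m M) fBM; rewrite !degreeE /=.
have -> : (fun p => [set v | st' p (v *m (B *m M))]) = (fun p => [set v | st p (v *m B)]).
  by apply/funext => p; apply/seteqP; split=> v /=; rewrite mulmxA -hst.
apply=> D /=; rewrite -mulmxA -hph mulmxA; apply: submxMr; exact: iB.
Qed.

Lemma moduli_point_iso r E G : higgs_iso E G -> moduli_point r E = moduli_point r G.
Proof.
suff key E' G' : higgs_iso E' G' -> forall H, moduli_point r E' H -> moduli_point r G' H.
  by move=> i; apply/seteqP; split=> H; apply: key => //; exact: higgs_iso_sym.
move=> i H [/ss0P[rE sE] sH [s [s' [js js' ss]]]]; have hE := sE.1.
have [_ rG _] := higgs_iso_bundle i hE.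
split=> //; first by apply/ss0P; rewrite rG; split=> //; exact: ss0_iso sE.
by exists s, s'; split=> //; exact: jordan_holder_iso js.
Qed.

Lemma vlattice_dsum n m (st : pt X -> set 'rV[F]_n) (st' : pt X -> set 'rV[F]_m) :
  vlattice st -> vlattice st' ->
  vlattice (fun p => [set v : 'rV_(n + m) | st p (lsubmx v) /\ st' p (rsubmx v)]) /\
  ldegree (fun p => [set v : 'rV_(n + m) | st p (lsubmx v) /\ st' p (rsubmx v)]) = ldegree st + ldegree st'.
Proof.
move=> vs vs'.
have key p B B' : lframe p (st p) B -> lframe p (st' p) B' ->
    lframe p [set v : 'rV_(n + m) | st p (lsubmx v) /\ st' p (rsubmx v)] (block_mx B 0 0 B').
  move=> [uB BP] [uB' BP']; split=> [|v].
    by rewrite unitmxE det_lblock unitrM -!unitmxE uB.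
  split=> [[/BP[c lc cE] /BP'[c' lc' cE']]|[c lc ->]].
    exists (row_mx c c'); first by apply/mxlocP/mxloc_row; exact/mxlocP.
    by rewrite mul_row_block !mulmx0 addr0 add0r -cE -cE' hsubmxK.
  rewrite -[c]hsubmxK mul_row_block !mulmx0 addr0 add0r /= row_mxKl row_mxKr.
  split; [apply/BP; exists (lsubmx c)|apply/BP'; exists (rsubmx c)] => // j; by rewrite mxE.
have [B [hB fB]] := vlattice_frames hR vs; have [B' [hB' fB']] := vlattice_frames hR vs'.
have hBB p := key p _ _ (hB p) (hB' p).
split.
  split=> [p|]; first by exists (block_mx (B p) 0 0 (B' p)).
  have [_ [s sP]] := vs; have [_ [s' sP']] := vs'; exists (s ++ s') => p.
  rewrite mem_cat negb_or => /andP[/sP h /sP' h'].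
  by have := key p _ _ h h'; rewrite -scalar_mx_block.
rewrite (ldegree_frames hR hB) (ldegree_frames hR hB') (ldegree_frames hR hBB) -opprD.
rewrite -(fsumD fB fB'); congr (- _); apply: eq_fsum => p; rewrite det_lblock.
have [uB _] := hB p; have [uB' _] := hB' p; move: uB uB'; rewrite !unitmxE !unitfE => ? ?.
by rewrite (ordM hR).
Qed.

(** For an invariant [B], the kernel of its projection to G is an invariant subbundle of E, and its
    image is contained in a saturated invariant subbundle of G of the same rank. Degrees are
    additive and can only grow under saturation. *)
Lemma ss0_dsum E G : ss0 E -> ss0 G -> ss0 (dsum E G).
Proof.
move=> [hE [dE sE]] [hG [dG sG]]; have [vD dD] := vlattice_dsum (higgs_bundleP hE) (higgs_bundleP hG).
have hD : higgs_bundle (dsum E G).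
  have [_ hs hp] := hE; have [_ hs' hp'] := hG; split.
  - exact/(vector_bundleP hR fin).
  - by move=> f D /=; rewrite hs hs' scale_block_mx !scaler0.
  - move=> p D v tD /= [h1 h2]; rewrite -[v]hsubmxK mul_row_block !mulmx0 addr0 add0r.
    by rewrite row_mxKl row_mxKr; split; [exact: hp | exact: hp'].
split=> //; split; first by rewrite degreeE dD -!degreeE dE dG addr0.
(* [N] is the projection of [B] to G; its rank factorization separates the quotient map of [B],
   given by [col_base], from a basis of the image, given by [row_base]. *)
rewrite [rk _]/= => k B fB iB; set N := rsubmx B.
have fQ : row_full (col_base N) := col_base_full N.
have fR : row_free (row_base N) := row_base_free N.
have NE : col_base N *m row_base N = N := mulmx_base N.
have iN D : (N *m phi G D <= N)%MS /\ exists U, B *m phi (dsum E G) D = U *m B /\ N *m phi G D = U *m N.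
  have /submxP[U UE] := iB D; have E1 : N *m phi G D = U *m N.
    have := congr1 (fun M : 'M_(k, rk E + rk G) => rsubmx M) UE.
    by rewrite -[B]hsubmxK /= mul_row_block !mulmx0 addr0 add0r mul_mx_row !row_mxKr.
  by split; [apply/submxP; exists U | exists U].
have [m [K [fK kK]]] := row_free_kernel (col_base N).
have KN : K *m N = 0.
  by rewrite -NE mulmxA (_ : K *m col_base N = 0) ?mul0mx //; apply/sub_kermxP; rewrite (eqmxP kK).
have vB := vlattice_sub hR fin vD fB.
have := ldegree_exact hR pf vB fK fQ kK; rewrite degreeE /= => ->.
have KB : K *m B = row_mx (K *m lsubmx B) 0 by rewrite -[B in LHS]hsubmxK mul_mx_row KN.
have fKB : row_free (K *m B) by rewrite /row_free mxrankMfree.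
have fKl : row_free (K *m lsubmx B).
  apply: inj_row_free => v E1; have [B' BB'] := row_freeP fKB.
  by rewrite -[v]mulmx1 -BB' mulmxA KB mul_mx_row E1 mulmx0 row_mx0 mul0mx.
have iKl : invariant (K *m lsubmx B).
  move=> D; have [_ [U [UE UN]]] := iN D.
  have : (K *m U <= K)%MS.
    rewrite -(eqmxP kK); apply/sub_kermxP/eqP; rewrite mul_col_base_eq0 -mulmxA -UN mulmxA KN.
    by rewrite mul0mx.
  move=> /submxP[V VE]; apply/submxP; exists V.
  have : lsubmx (B *m phi (dsum E G) D) = lsubmx (U *m B) by rewrite UE.
  rewrite -[B]hsubmxK /= mul_row_block !mulmx0 addr0 add0r mul_mx_row !row_mxKl => E1.
  by rewrite -mulmxA E1 mulmxA VE mulmxA.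
have d1 := sE _ _ fKl iKl.
have iR : invariant (row_base N).
  move=> D; have [h _] := iN D; apply: submx_trans (_ : (N *m phi G D <= _)%MS).
    by apply: submxMr; rewrite eq_row_base.
  by apply: submx_trans h _; rewrite eq_row_base.
have d2 := sG _ _ fR iR.
apply: (@le_trans _ _ (0 + 0 : int)); last by rewrite addr0.
apply: lerD.
  move: d1; rewrite degreeE /=; congr (ldegree _ <= _); apply/funext => p; apply/seteqP.
  have S0 : @stalk _ _ G p 0.
    by have [[A [_ hA]]] := (higgs_bundleP hG).1 p; apply/hA; exists 0; rewrite ?mul0mx // => j; rewrite mxE; exact: (loc0 hR).
  split=> v /=; rewrite -mulmxA KB mul_mx_row mulmx0 row_mxKl row_mxKr.
    by move=> ?; split.
  by case.
apply: le_trans (_ : ldegree (fun p => [set v | stalk p (v *m row_base N)]) <= _); last first.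
  by move: d2; rewrite degreeE.
apply: (ldegree_le hR).
- exact: (vlattice_quo hR fin vB fQ).
- exact: (vlattice_sub hR fin (higgs_bundleP hG) fR).
move=> p _ [v /= [_ h] ->]; rewrite -mulmxA NE.
by move: h; rewrite -[B]hsubmxK mul_mx_row row_mxKr.
Qed.

Lemma ss0_higgs0 : ss0 (higgs0 X).
Proof.
split.
  split=> [p|f D|p D v _ _] //=; last by rewrite scaler0.
  exists set0, 1%:M; split=> // q _.
  split=> [|v]; first exact: unitmx1.
  by split=> // _; exists 0 => [[]|]; rewrite ?mul0mx // thinmx0.
split=> [|k B fB _]; first by rewrite degreeE ldegree0.
have k0 : k = 0%N by apply/eqP; rewrite -leqn0 -(eqP fB) rank_leq_col.
by subst k; rewrite degreeE ldegree0.
Qed.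

Lemma ss0_big_dsum (I : Type) (s : seq I) (f : I -> higgs X) : (forall i, ss0 (f i)) ->
  ss0 (\big[@dsum C X/higgs0 X]_(i <- s) f i).
Proof. by move=> h; apply: big_ind => // [|E G]; [exact: ss0_higgs0 | exact: ss0_dsum]. Qed.

Lemma rk_big_dsum (I : Type) (s : seq I) (f : I -> higgs X) :
  rk (\big[@dsum C X/higgs0 X]_(i <- s) f i) = (\sum_(i <- s) rk (f i))%N.
Proof. by elim: s => [|i s IH]; rewrite ?big_nil // !big_cons /= IH. Qed.

Lemma dsum_iso E E' G G' : higgs_iso E E' -> higgs_iso G G' -> higgs_iso (dsum E G) (dsum E' G').
Proof.
move=> /higgs_iso_unfold[n [st [ph [st' [ph' [M [-> -> uM hst hph]]]]]]].
move=> /higgs_iso_unfold[m [st1 [ph1 [st1' [ph1' [M1 [-> -> uM1 hst1 hph1]]]]]]].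
have uB : block_mx M 0 0 M1 \in unitmx by rewrite unitmxE det_lblock unitrM -!unitmxE uM.
exists (block_mx M 0 0 M1); rewrite row_free_unit row_full_unit uB; split=> //= [p v|D].
  rewrite -[in X in _ <-> X](hsubmxK v) mul_row_block !mulmx0 addr0 add0r row_mxKl row_mxKr.
  by rewrite hst hst1.
by rewrite !mulmx_block !mul0mx !mulmx0 !addr0 !add0r hph hph1.
Qed.

Definition swapmx a b c : 'M[F]_(a + (b + c), b + (a + c)) :=
  block_mx 0 (row_mx 1%:M 0) (col_mx 1%:M 0) (block_mx 0 0 0 1%:M).

Lemma mul_swapmx a b c (u : 'rV_a) (v : 'rV_b) (w : 'rV_c) :
  row_mx u (row_mx v w) *m swapmx a b c = row_mx v (row_mx u w).
Proof.
rewrite /swapmx mul_row_block mulmx0 add0r mul_row_col mulmx1 mulmx0 addr0.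
rewrite mul_mx_row mul_row_block !mulmx0 !mulmx1 addr0 add0r add_row_mx addr0 add0r.
by [].
Qed.

Lemma rowmx_ext m n (A B : 'M[F]_(m, n)) : (forall v : 'rV_m, v *m A = v *m B) -> A = B.
Proof. by move=> h; apply/row_matrixP => i; rewrite !rowE. Qed.

Lemma row3_ext a b c n (A B : 'M[F]_(a + (b + c), n)) :
  (forall (u : 'rV_a) (v : 'rV_b) (w : 'rV_c), row_mx u (row_mx v w) *m A = row_mx u (row_mx v w) *m B) -> A = B.
Proof. by move=> h; apply: rowmx_ext => v; rewrite -[v]hsubmxK -[rsubmx v]hsubmxK. Qed.

Lemma swapmxK a b c : swapmx a b c *m swapmx b a c = 1%:M.
Proof. by apply: row3_ext => u v w; rewrite mulmxA !mul_swapmx mulmx1. Qed.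

Lemma dsum_swap E G H : higgs_iso (dsum E (dsum G H)) (dsum G (dsum E H)).
Proof.
exists (swapmx (rk E) (rk G) (rk H)); split.
- by apply/row_freeP; exists (swapmx (rk G) (rk E) (rk H)); exact: swapmxK.
- by apply/row_fullP; exists (swapmx (rk G) (rk E) (rk H)); exact: swapmxK.
- move=> p v /=; rewrite -[v]hsubmxK -[rsubmx v]hsubmxK mul_swapmx !row_mxKl !row_mxKr !row_mxKl.
  by split=> [[? [? ?]]|[? [? ?]]].
- move=> D; apply: row3_ext => u v w; rewrite [LHS]mulmxA [RHS]mulmxA mul_swapmx.
  have dd E1 E2 E3 (x : 'rV_(rk E1)) (y : 'rV_(rk E2)) (z : 'rV_(rk E3)) :
      row_mx x (row_mx y z) *m phi (dsum E1 (dsum E2 E3)) D =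
      row_mx (x *m phi E1 D) (row_mx (y *m phi E2 D) (z *m phi E3 D)).
    by rewrite /= !mul_row_block !mulmx0 !addr0 !add0r.
  by rewrite !dd mul_swapmx.
Qed.

(** The iterated sum is nested to the right, so reordering reduces to exchanging the first two
    summands by [dsum_swap]. *)
Lemma big_dsum_perm (I : eqType) (s s' : seq I) (f : I -> higgs X) : perm_eq s s' ->
  higgs_iso (\big[@dsum C X/higgs0 X]_(i <- s) f i) (\big[@dsum C X/higgs0 X]_(i <- s') f i).
Proof.
elim: s s' => [|x s IH] s' ss'.
  have /eqP -> : s' == [::] by rewrite -size_eq0 -(perm_size ss').
  exact: higgs_iso_refl.
have xs' : x \in s' by rewrite -(perm_mem ss') mem_head.
case/splitPr: xs' ss' => s1 s2; rewrite perm_sym perm_catC /= perm_cons perm_sym => ss.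
have ss2 : perm_eq s (s1 ++ s2) by apply: perm_trans ss _; rewrite perm_catC.
rewrite big_cons; apply: higgs_iso_trans (dsum_iso (higgs_iso_refl _) (IH _ ss2)) _.
elim: s1 {ss ss2} => [|y s1 IH1]; first by rewrite big_cons; exact: higgs_iso_refl.
rewrite /= !big_cons; apply: higgs_iso_trans (dsum_swap _ _ _) _.
by apply: dsum_iso IH1; exact: higgs_iso_refl.
Qed.

Lemma big_dsum_iso (I : Type) (s : seq I) (f g : I -> higgs X) : (forall i, higgs_iso (f i) (g i)) ->
  higgs_iso (\big[@dsum C X/higgs0 X]_(i <- s) f i) (\big[@dsum C X/higgs0 X]_(i <- s) g i).
Proof.
move=> h; elim: s => [|i s IH]; first by rewrite !big_nil; exact: higgs_iso_refl.
by rewrite !big_cons; exact: dsum_iso.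
Qed.

End HiggsBundles.

(** * Local rings of plane curves over the base *)

Section IntegralPolynomials.
Variables (C : numClosedFieldType) (X : curve C) (hR : regular_curve X) (p : pt X).
Local Notation F := (fld X).
Local Notation k := (cst X).
Implicit Types G H : {poly F}.

Definition pint G := forall i, loc p G`_i.
(** Reduction of polynomials modulo the maximal ideal of [p], meaningful on [pint]; [lift] is a
    section of it. *)
Definition bar G : {poly C} := map_poly (value p) G.
Definition lift (U : {poly C}) : {poly F} := map_poly k U.

Lemma pint0 : pint 0. Proof. by move=> i; rewrite coef0; exact: loc0. Qed.
Lemma pintC c : loc p c -> pint c%:P.
Proof. by move=> lc i; rewrite coefC; case: ifP => // _; exact: loc0. Qed.
Lemma pint1 : pint 1. Proof. exact/pintC/loc1. Qed.
Lemma pintX : pint 'X.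
Proof. by move=> i; rewrite coefX; case: eqP => _; [exact: loc1 | exact: loc0]. Qed.
Lemma pintD G H : pint G -> pint H -> pint (G + H).
Proof. by move=> h h' i; rewrite coefD; exact: (locD hR). Qed.
Lemma pintN G : pint G -> pint (- G).
Proof. by move=> h i; rewrite coefN; exact: (locN hR). Qed.
Lemma pintB G H : pint G -> pint H -> pint (G - H).
Proof. by move=> h h'; apply: pintD => //; exact: pintN. Qed.
Lemma pintM G H : pint G -> pint H -> pint (G * H).
Proof. by move=> h h' i; rewrite coefM; apply: (loc_sum hR) => j _; exact: (locM hR). Qed.
Lemma pintZ c G : loc p c -> pint G -> pint (c *: G).
Proof. by move=> lc h i; rewrite coefZ; exact: (locM hR). Qed.
Lemma pintExp G n : pint G -> pint (G ^+ n).
Proof. by move=> h; elim: n => [|n IH]; rewrite ?expr0 ?exprS; [exact: pint1 | exact: pintM]. Qed.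
Lemma pint_lift U : pint (lift U).
Proof. by move=> i; rewrite coef_map; exact: (rc_loc_cst hR). Qed.
Lemma pintXsubC a : pint ('X - (k a)%:P).
Proof. by apply: pintB; [exact: pintX | apply: pintC; exact: (rc_loc_cst hR)]. Qed.

Lemma coef_bar G i : (bar G)`_i = value p G`_i.
Proof. by rewrite coef_map_id0 // (value0 hR). Qed.

Lemma barD G H : pint G -> pint H -> bar (G + H) = bar G + bar H.
Proof. by move=> h h'; apply/polyP => i; rewrite coefD !coef_bar coefD (valueD hR). Qed.
Lemma barN G : pint G -> bar (- G) = - bar G.
Proof. by move=> h; apply/polyP => i; rewrite coefN !coef_bar coefN (valueN hR). Qed.
Lemma barB G H : pint G -> pint H -> bar (G - H) = bar G - bar H.
Proof. by move=> h h'; rewrite barD ?barN //; exact: pintN. Qed.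
Lemma barM G H : pint G -> pint H -> bar (G * H) = bar G * bar H.
Proof.
move=> h h'; apply/polyP => i; rewrite coefM !coef_bar coefM (value_sum hR) => [|j].
  by apply: eq_bigr => j _; rewrite !coef_bar (valueM hR).
exact: (locM hR).
Qed.
Lemma barC c : bar c%:P = (value p c)%:P.
Proof. by apply/polyP => i; rewrite coef_bar !coefC; case: ifP; rewrite ?(value0 hR). Qed.
Lemma bar_lift U : bar (lift U) = U.
Proof. by apply/polyP => i; rewrite coef_bar coef_map (value_cst hR). Qed.
Lemma bar1 : bar 1 = 1. Proof. by rewrite barC (value1 hR). Qed.

Lemma pint_horner G a : pint G -> loc p a -> loc p G.[a].
Proof.
by move=> h la; rewrite horner_coef; apply: (loc_sum hR) => i _; apply: (locM hR) => //; exact: (locX hR).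
Qed.

Lemma bar_horner G a : pint G -> (bar G).[a] = value p G.[k a].
Proof.
move=> h; rewrite [in RHS]horner_coef (horner_coef_wide _ (size_poly _ _ : size (bar G) <= size G)%N).
rewrite (value_sum hR) => [|i]; last by apply: (locM hR) => //; apply: (locX hR); exact: (rc_loc_cst hR).
apply: eq_bigr => i _; rewrite (valueM hR) ?coef_bar //; last by apply: (locX hR); exact: (rc_loc_cst hR).
by rewrite -rmorphXn (value_cst hR).
Qed.

Lemma bar_eq0 G t : uniformizer p t -> pint G -> bar G = 0 -> exists2 G', pint G' & G = t *: G'.
Proof.
move=> tt h G0; have t0 := unif_neq0 tt; exists (t^-1 *: G); last by rewrite scalerA divff // scale1r.
move=> i; rewrite coefZ; have : value p G`_i = 0 by rewrite -coef_bar G0 coef0.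
by move/(value_eq0 hR (h i))/(tt.2 _) => [w lw ->]; rewrite mulrCA mulVf // mulr1.
Qed.

Lemma pint_div G D : pint G -> pint D -> D \is monic ->
  exists Q R, [/\ pint Q, pint R, (size R < size D)%N & G = Q * D + R].
Proof.
move=> hG hD mD; have D0 : (0 < size D)%N by rewrite size_poly_gt0 monic_neq0.
elim: {G}(size G) {-2}G (leqnn (size G)) hG => [|n IH] G sG hG.
  by exists 0, G; split=> //; [exact: pint0 | exact: leq_ltn_trans sG D0 | rewrite mul0r add0r].
have [sGD|sDG] := ltnP (size G) (size D).
  by exists 0, G; split=> //; [exact: pint0 | rewrite mul0r add0r].
pose T := lead_coef G *: 'X^(size G - size D).
have hT : pint T by apply: pintZ; [exact: hG | apply: pintExp; exact: pintX].
have G0 : G != 0 by rewrite -size_poly_gt0; apply: leq_trans D0 sDG.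
have lT : lead_coef (T * D) = lead_coef G.
  by rewrite lead_coef_Mmonic // lead_coefZ lead_coefXn mulr1.
have sT : size (T * D) = size G.
  rewrite size_Mmonic ?scaler_eq0 ?negb_or ?lead_coef_eq0 ?G0 -?size_poly_eq0 ?size_polyXn //.
  by rewrite size_scale ?lead_coef_eq0 // size_polyXn addSn /= subnK.
have [|Q [R [hQ hR' sR E]]] := IH (G - T * D) _ (pintB hG (pintM hT hD)).
  rewrite -ltnS; apply: leq_trans sG; rewrite ltn_neqAle.
  have le : (size (G - T * D)%R <= size G)%N.
    by apply: leq_trans (size_polyD _ _) _; rewrite size_polyN sT maxnn.
  rewrite le andbT; apply/eqP => sE; have : lead_coef (G - T * D) = 0.
    by rewrite /lead_coef sE coefB -/(lead_coef G) -[X in _ - _`_X.-1]sT -/(lead_coef (T * D)) lT subrr.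
  by move/eqP; rewrite lead_coef_eq0 -size_poly_eq0 sE size_poly_eq0 (negPf G0).
exists (Q + T), R; split=> //; first exact: pintD.
by rewrite mulrDl addrAC -E subrK.
Qed.

Lemma pint_divisor K D : pint (K * D) -> pint D -> D \is monic -> pint K.
Proof.
move=> hKD hD mD; have [Q [R [hQ _ sR E]]] := pint_div hKD hD mD.
have : (K - Q) * D = R by rewrite mulrBl E addrAC subrr add0r.
have [/subr0_eq ->//|KQ] := eqVneq (K - Q) 0.
move=> E'; move: sR; rewrite -E' size_Mmonic // ltnNge.
by have := KQ; rewrite -size_poly_gt0; case: (size _) => // m _; rewrite addSn /= leq_addl.
Qed.

Lemma value_det n (A : 'M[F]_n) : mxloc p A -> value p (\det A) = \det (map_mx (value p) A).
Proof.
move=> lA; have sgn (s : nat) : loc p ((-1) ^+ s).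
  by apply: (locX hR); exact/(locN hR)/loc1.
have h (I : Type) (l : seq I) (f : I -> F) : (forall i, loc p (f i)) ->
    value p (\prod_(i <- l) f i) = \prod_(i <- l) value p (f i).
  move=> lf; elim: l => [|i l IH]; first by rewrite !big_nil (value1 hR).
  by rewrite !big_cons (valueM hR) ?IH //; exact: (loc_prod hR).
rewrite /determinant (value_sum hR) => [|s]; last first.
  by apply: (locM hR) (sgn _) _; exact: (loc_prod hR).
apply: eq_bigr => s _; rewrite (valueM hR (sgn _)); last exact: (loc_prod hR).
congr (_ * _); first by rewrite -(rmorphN1 k) -(rmorphXn k) (value_cst hR).
by rewrite h //; apply: eq_bigr => i _; rewrite mxE.
Qed.

End IntegralPolynomials.

Section SimpleExtension.
Variables (C : numClosedFieldType) (X : curve C) (hR : regular_curve X) (p : pt X).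
Local Notation F := (fld X).
Local Notation k := (cst X).
Local Notation pint := (pint p).
Local Notation bar := (bar p).
Variables (L : fieldType) (io : {rmorphism F -> L}) (y : L) (P : {poly F}) (r : nat).
Hypotheses (Pm : P \is monic) (Pint : pint P) (sP : size P = r.+1).
Local Notation e G := (map_poly io G).[y].
Hypothesis eP : forall G, e G = 0 <-> P %| G.
Let be (i : 'I_r) := y ^+ i.
Hypothesis hb : is_basis io be.
Variables (t : F) (tt : uniformizer p t).
Implicit Types G H : {poly F}.

Lemma eD G H : e (G + H) = e G + e H. Proof. by rewrite rmorphD hornerD. Qed.
Lemma eB G H : e (G - H) = e G - e H. Proof. by rewrite rmorphB hornerD hornerN. Qed.
Lemma eM G H : e (G * H) = e G * e H. Proof. by rewrite rmorphM hornerM. Qed.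
Lemma eC c : e c%:P = io c. Proof. by rewrite map_polyC hornerC. Qed.
Lemma eX : e 'X = y. Proof. by rewrite map_polyX hornerX. Qed.
Lemma e1 : e 1 = 1. Proof. by rewrite eC rmorph1. Qed.
Lemma e0 : e 0 = 0. Proof. by rewrite rmorph0 horner0. Qed.
Lemma eZ c G : e (c *: G) = io c * e G. Proof. by rewrite -mul_polyC eM eC. Qed.
Lemma eXn G n : e (G ^+ n) = e G ^+ n. Proof. by rewrite rmorphXn horner_exp. Qed.

Lemma e_rV (c : 'rV[F]_r) : e (rVpoly c) = lin io be c.
Proof.
have sc : (size (map_poly io (rVpoly c)) <= r)%N by rewrite size_map_poly size_poly.
rewrite (horner_coef_wide _ sc) /lin; apply: eq_bigr => i _; rewrite coef_map coef_rVpoly_ord.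
by [].
Qed.

(** Division by the monic integral [P] keeps coefficients integral, so the ring generated by [y]
    over the local ring is free on the powers of [y] below [r]. *)
Lemma integral_coord z : (exists2 G, pint G & z = e G) <-> mxloc p (coord_in io be z).
Proof.
split=> [[G hG ->]|lz].
  have [Q [R [hQ hR' sR ->]]] := pint_div hR hG Pint Pm.
  have -> : e (Q * P + R) = lin io be (poly_rV R).
    rewrite eD eM ((eP P).2 (dvdpp P)) mulr0 add0r -e_rV poly_rV_K //.
    by rewrite -ltnS -sP.
  by move=> i j; rewrite (linK hb) ord1 mxE; exact: hR'.
exists (rVpoly (coord_in io be z)); last by rewrite e_rV (coord_inK hb).
by move=> i; rewrite coef_rVpoly; case: insubP => // *; exact: (loc0 hR).
Qed.

Lemma e_neq0 H a : pint H -> root (bar P) a -> (bar H).[a] != 0 -> e H != 0.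
Proof.
move=> hH /rootP Pa; apply: contraNneq => /eP /dvdpP[K E]; rewrite E.
by rewrite (barM hR) ?hornerM ?Pa ?mulr0 //; apply: (pint_divisor hR) Pint Pm; rewrite -E.
Qed.

(** The cofactor comes from the adjugate of the multiplication matrix, applied to 1; the product is
    the norm. *)
Lemma integral_adj G : pint G -> G != 0 -> e G != 0 ->
  exists G' c, [/\ pint G', loc p c, c != 0 & e G * e G' = io c].
Proof.
move=> hG _ eG0; set A := mulmat io be (e G).
have lA : mxloc p A.
  move=> i j; rewrite mxE; have /integral_coord/(_ 0 j) : exists2 H, pint H & e G * be i = e H.
    exists (G * 'X^i); last by rewrite eM eXn eX.
    by apply: (pintM hR) => //; apply: (pintExp hR); exact: pintX.
  by [].
have l1 : mxloc p (coord_in io be 1).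
  by apply/integral_coord; exists 1; [exact: pint1 | rewrite e1].
have [G' hG' G'E] : exists2 G', pint G' & lin io be (coord_in io be 1 *m \adj A) = e G'.
  by apply/integral_coord; rewrite (linK hb); apply: (mxloc_mul hR) => //; exact: (mxloc_adj hR).
exists G', (\det A); split=> //; first exact: (loc_det hR).
  exact: (fnorm_neq0 hb).
rewrite -G'E; apply: (can_inj (coord_inK hb)).
rewrite (coord_inM hb) (linK hb) -mulmxA mul_adj_mx mul_mx_scalar -(coord_inZ hb) mulr1.
by [].
Qed.

(** Modulo [t] the multiplication matrix of [H] is the identity, so its determinant is a unit and
    its inverse is integral. *)
Lemma integral_inv H : pint H -> bar H = 1 -> exists2 G, pint G & e H * e G = 1.
Proof.
move=> hH H1; have [H' hH' HE] : exists2 H', pint H' & H - 1 = t *: H'.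
  apply: (bar_eq0 hR tt); first by apply: (pintB hR) => //; exact: pint1.
  by rewrite (barB hR) ?H1 ?bar1 ?subrr //; exact: pint1.
have mm G : pint G -> mxloc p (mulmat io be (e G)).
  move=> hG i j; rewrite mxE; have /integral_coord/(_ 0 j) : exists2 H, pint H & e G * be i = e H.
    exists (G * 'X^i); last by rewrite eM eXn eX.
    by apply: (pintM hR) => //; apply: (pintExp hR); exact: pintX.
  by [].
set A := mulmat io be (e H).
have AE : A = 1%:M + t *: mulmat io be (e H').
  rewrite -(mulmatZ hb) -(mulmat1 hb) -(mulmatD hb) -eZ -HE eB e1 addrC subrK.
  by [].
have uA : mxunit p A.
  split; first exact: mm.
  apply/(value_unit hR); first exact/(loc_det hR)/mm.
  have lt := unif_loc hR tt; have lm i j : loc p (mulmat io be (e H') i j) by exact: mm.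
  have l1 (i j : 'I_r) : loc p ((i == j)%:R).
    by case: (_ == _); [exact: loc1 | exact: loc0].
  rewrite (value_det hR (mm _ hH)); suff -> : map_mx (value p) (mulmat io be (e H)) = 1%:M.
    by rewrite det1 => /eqP; rewrite oner_eq0.
  apply/matrixP => i j; rewrite mxE -/A AE ![in LHS]mxE (valueD hR (l1 i j)).
    rewrite [X in _ + X](valueM hR lt); last by have := lm i j; rewrite mxE.
    have -> : value p t = 0 by apply/(value_eq0 hR) => //; exact: (unif_max hR tt).
    by rewrite mul0r addr0 mxE; case: (_ == _); rewrite ?(value1 hR) ?(value0 hR).
  by apply: (locM hR lt); have := lm i j; rewrite mxE.
have [G hG GE] : exists2 G, pint G & lin io be (coord_in io be 1 *m invmx A) = e G.
  apply/integral_coord; rewrite (linK hb); apply: (mxloc_mul hR); last exact: (mxunit_inv hR).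
  by apply/integral_coord; exists 1; [exact: pint1 | rewrite e1].
exists G => //; rewrite -GE; apply: (can_inj (coord_inK hb)).
by rewrite (coord_inM hb) (linK hb) -/A mulmxKV //; exact: mxunit_unitmx uA.
Qed.

(* The reductions of the H carrying z into N form an ideal of C[x], which is the unit
   ideal as it has no zero. *)
Lemma local_global (N : set L) z : N 0 -> (forall u v, N u -> N v -> N (u + v)) ->
  (forall G v, pint G -> N v -> N (e G * v)) ->
  (forall a, root (bar P) a -> exists H, [/\ pint H, (bar H).[a] != 0 & N (e H * z)]) -> N z.
Proof.
move=> N0 ND NM hz.
pose J (g : {poly C}) := exists H, [/\ pint H, bar H = g & N (e H * z)].
have JP : J (bar P).
  by exists P; split=> //; rewrite ((eP P).2 (dvdpp P)) mul0r.
have JD g g' : J g -> J g' -> J (g + g').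
  move=> [H [hH <- nH]] [H' [hH' <- nH']]; exists (H + H'); split.
  - exact: (pintD hR).
  - by rewrite (barD hR).
  - by rewrite eD mulrDl; exact: ND.
have JM u g : J g -> J (u * g).
  move=> [H [hH <- nH]]; exists (lift X u * H); split.
  - by apply: (pintM hR) => //; exact: pint_lift.
  - by rewrite (barM hR) ?(bar_lift hR) //; exact: pint_lift.
  - by rewrite eM -mulrA; apply: NM => //; exact: pint_lift.
have P0 : bar P != 0.
  apply/eqP => /(congr1 (fun g : {poly C} => g`_r)); rewrite (coef_bar hR) coef0.
  have -> : P`_r = 1 by move/monicP: Pm; rewrite lead_coefE sP.
  by rewrite (value1 hR) => /eqP; rewrite oner_eq0.
have h : exists n, `[< exists g : {poly C}, [/\ g != 0, size g = n & J g] >].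
  by exists (size (bar P)); apply/asboolP; exists (bar P).
have [n /asboolP[g [g0 sg Jg]] nmin] := ex_minnP h.
have gdvd g' : J g' -> g %| g'.
  move=> Jg'; rewrite /dvdp; apply/negPn/negP => m0.
  have : (n <= size (g' %% g)%R)%N.
    apply: nmin; apply/asboolP; exists (g' %% g); split=> //.
    have -> : g' %% g = g' + (- (g' %/ g)) * g by rewrite {2}(divp_eq g' g) mulNr addrAC addrN add0r.
    by apply: JD => //; exact: JM.
  by rewrite leqNgt -sg ltn_modp g0.
have [sg1|/closed_rootP[a ga]] := eqVneq (size g) 1%N; last first.
  have root_J g' : J g' -> root g' a.
    by move=> /gdvd; rewrite -!dvdp_XsubCl in ga *; exact: dvdp_trans.
  have [H [hH Ha nH]] := hz a (root_J _ JP).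
  by case/negP: Ha; apply: root_J; exists H.
move/eqP/size_poly1P: sg1 => [c c0 gE].
have [H [hH H1 nH]] : J 1.
  by have := JM (c^-1)%:P _ Jg; rewrite gE -polyCM mulVf.
have [G hG GE] := integral_inv hH H1.
by have := NM _ _ hG nH; rewrite mulrA [e G * _]mulrC GE mul1r.
Qed.

Section LocalRing.
Variables (a : C) (Pa : root (bar P) a).

Definition sloc (z : L) := exists G H, [/\ pint G, pint H, (bar H).[a] != 0 & z = e G / e H].

Lemma sloc_e G : pint G -> sloc (e G).
Proof.
move=> hG; exists G, 1; split=> //; first exact: pint1.
  by rewrite (bar1 hR) hornerC oner_eq0.
by rewrite e1 divr1.
Qed.

Lemma sloc_io c : loc p c -> sloc (io c).
Proof. by move=> lc; rewrite -eC; apply: sloc_e; exact: pintC. Qed.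

Lemma slocB z z' : sloc z -> sloc z' -> sloc (z - z').
Proof.
move=> [G [H [hG hH Ha ->]]] [G' [H' [hG' hH' Ha' ->]]].
exists (G * H' - G' * H), (H * H'); split.
- by apply: (pintB hR); apply: (pintM hR).
- exact: (pintM hR).
- by rewrite (barM hR) // hornerM mulf_neq0.
- rewrite eB !eM; have := e_neq0 hH Pa Ha; have := e_neq0 hH' Pa Ha' => h1 h2.
  by field; rewrite h1 h2.
Qed.

Lemma slocM z z' : sloc z -> sloc z' -> sloc (z * z').
Proof.
move=> [G [H [hG hH Ha ->]]] [G' [H' [hG' hH' Ha' ->]]].
exists (G * G'), (H * H'); split; try exact: (pintM hR).
- by rewrite (barM hR) // hornerM mulf_neq0.
- by rewrite !eM invfM mulrACA.
Qed.

Lemma slocX z n : sloc z -> sloc (z ^+ n).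
Proof.
move=> lz; elim: n => [|n IH]; last by rewrite exprS; exact: slocM.
by rewrite expr0 -e1; apply: sloc_e; exact: pint1.
Qed.

Lemma sloc_inv H : pint H -> (bar H).[a] != 0 -> sloc (e H)^-1.
Proof.
by move=> hH Ha; exists 1, H; split=> //; [exact: pint1 | rewrite e1 div1r].
Qed.

Lemma sloc_unitP G H : pint G -> pint H -> (bar H).[a] != 0 ->
  (e G / e H != 0 /\ sloc (e G / e H)^-1) <-> (bar G).[a] != 0.
Proof.
move=> hG hH Ha; have H0 := e_neq0 hH Pa Ha; split=> [[z0 [G' [H' [hG' hH' Ha' E]]]]|Ga].
  have H0' := e_neq0 hH' Pa Ha'.
  have G0 : e G != 0 by apply: contraNneq z0 => ->; rewrite mul0r.
  have : e (G * G' - H * H') = 0.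
    rewrite eB !eM; apply/eqP; rewrite subr_eq0; apply/eqP.
    move: E; rewrite invf_div => E; rewrite -(divfK H0' (e G')) -E.
    by field; rewrite G0.
  move=> /eP/dvdpP[K KE]; have hK : pint K.
    by apply: (pint_divisor hR) Pint Pm; rewrite -KE; apply: (pintB hR); apply: (pintM hR).
  have : bar (G * G' - H * H') = bar (K * P) by rewrite KE.
  rewrite (barB hR) ?(barM hR) //; try exact: (pintM hR).
  move/(congr1 (fun g : {poly C} => g.[a])); rewrite hornerD hornerN !hornerM (rootP Pa) mulr0.
  move/subr0_eq => E1; have : (bar H).[a] * (bar H').[a] != 0 by rewrite mulf_neq0.
  by rewrite -E1 mulf_eq0 negb_or => /andP[].
have G0 := e_neq0 hG Pa Ga; split; first by rewrite mulf_neq0 ?invr_eq0.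
by rewrite invf_div; apply: slocM; [exact: sloc_e | exact: sloc_inv].
Qed.

Lemma e_taylor G : pint G -> exists2 G', pint G' & G = G' * ('X - (k a)%:P) + (G.[k a])%:P.
Proof.
move=> hG; have [Q [R [hQ hR' sR E]]] := pint_div hR hG (pintXsubC hR p a) (monicXsubC _).
exists Q => //; rewrite {1}E; congr (_ + _).
move: sR; rewrite size_XsubC ltnS => /size1_polyC RE.
by rewrite E hornerD hornerM hornerXsubC subrr mulr0 add0r RE hornerC.
Qed.

(* [P] is congruent to [c0 + c1 (X - a)] modulo [(X - a)^2], and [c1] is a unit or
   [c0] is not divisible by [t^2]. *)
Lemma ex_sunif (c0 c1 : F) K : pint K -> P = (c0%:P + c1 *: ('X - (k a)%:P)) + K * ('X - (k a)%:P) ^+ 2 ->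
  loc_max p c0 -> loc p c1 -> loc_unit p c1 \/ loc_unit p (c0 / t) -> 
  exists w, sloc w /\ w != 0 /\ (forall G, pint G -> (bar G).[a] = 0 -> exists2 z, sloc z & e G = z * w) /\
    (exists G H, [/\ pint G, pint H, (bar H).[a] != 0, (bar G).[a] = 0 & w = e G / e H]) /\
    exists (m : nat) (z : L), sloc z /\ io t * z = w ^+ m.
Proof.
move=> hK PE mc0 lc1 cases; have lt := unif_loc hR tt; have t0 := unif_neq0 tt.
have it0 : io t != 0 by rewrite fmorph_eq0.
pose S := c1%:P + K * ('X - (k a)%:P).
have hXa := pintXsubC hR p a.
have hS : pint S by apply: (pintD hR); [exact: pintC | exact: (pintM hR)].
have Sa : (bar S).[a] = value p c1.
  by rewrite (bar_horner hR) // hornerD hornerM hornerXsubC subrr mulr0 addr0 hornerC.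
(* The equation $P(y)=0$ in the form $c_0+uS(y)=0$ with $u=y-a$. *)
have rel : io c0 + e ('X - (k a)%:P) * e S = 0.
  have := (eP P).2 (dvdpp P); rewrite PE /S; move: ('X - _) => T.
  by rewrite eD eM eXn (eD c0%:P) eC eZ (eD c1%:P) eC eM => <-; ring.
set u := e ('X - (k a)%:P) in rel *.
have lu : sloc u by exact: sloc_e.
have taylor G : pint G -> (bar G).[a] = 0 -> exists g z, [/\ loc p g, sloc z & e G = io (g * t) + z * u].
  move=> hG Ga; have [G' hG' GE] := e_taylor hG; rewrite (bar_horner hR) // in Ga.
  have /(value_eq0 hR) : value p G.[k a] = 0 by [].
  have lga : loc p G.[k a] by apply: (pint_horner hR) => //; exact: (rc_loc_cst hR).
  move=> /(_ lga)/(tt.2 _)[g lg gE]; exists g, (e G'); split=> //; first exact: sloc_e.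
  by rewrite {1}GE eD eM eC gE addrC.
have [c' lc' c0E] := (tt.2 _).1 mc0.
(* If $c_1$ is a unit at [p], then $S(y)$ is a unit at the point, $u$ is a multiple of [t], and [t]
   is a uniformizer: the curve is unramified over X there. If $c_0$ is a unit times [t], then [t] is
   a multiple of $u$, and $u$ is a uniformizer. *)
case: cases => [uc1|uc0].
  have S1 : (bar S).[a] != 0 by rewrite Sa; apply/eqP/(value_unit hR lc1).
  have S0 := e_neq0 hS Pa S1.
  have uE : u = - (io c' / e S) * io t.
    apply: (mulIf S0); apply/eqP; rewrite -subr_eq0; apply/eqP; rewrite -[RHS]rel c0E rmorphM.
    by field.
  exists (io t); split; first exact: sloc_io.
  split=> //; split.
    move=> G hG /(taylor _ hG)[g [z [lg lz ->]]].
    exists (io g - z * (io c' / e S)); last by rewrite uE rmorphM; ring.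
    apply: slocB; first exact: sloc_io.
    by apply: slocM => //; apply: slocM; [exact: sloc_io | exact: sloc_inv].
  split.
    exists t%:P, 1; split; rewrite ?eC ?rmorph1 ?divr1 ?(bar1 hR) ?hornerC ?oner_eq0 //.
    - exact: pintC.
    - exact: pint1.
    - by rewrite (barC hR) hornerC; apply/(value_eq0 hR) => //; exact: (unif_max hR tt).
  exists 1%N, 1; split; last by rewrite mulr1 expr1.
  by rewrite -e1; apply: sloc_e; exact: pint1.
have c'E : c' = c0 / t by rewrite c0E mulfK.
have [c'0 _ lc'V] : loc_unit p c' by rewrite c'E.
have tE : io t = - (io c'^-1 * e S) * u.
  have c'i : io c' != 0 by rewrite fmorph_eq0.
  rewrite fmorphV; apply: (mulfI c'i); apply/eqP; rewrite -subr_eq0; apply/eqP.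
  by rewrite -rmorphM -c0E -[RHS]rel; field.
exists u; split=> //; split.
  by apply: contraNneq it0 => u0; rewrite tE u0 mulr0.
split.
  move=> G hG /(taylor _ hG)[g [z [lg lz ->]]].
  exists (z - io g * (io c'^-1 * e S)); last by rewrite rmorphM tE; ring.
  apply: slocB => //; apply: slocM; first exact: sloc_io.
  by apply: slocM; [exact: sloc_io | exact: sloc_e].
split.
  exists ('X - (k a)%:P), 1; split=> //; rewrite ?e1 ?divr1 ?(bar1 hR) ?hornerC ?oner_eq0 //.
  - exact: pint1.
  - by rewrite (bar_horner hR) // hornerXsubC subrr (value0 hR).
(* A power of $u$ is a multiple of [t]: modulo [t] the polynomial [P] is $q(x)(x-a)^m$ with
   $q(a)\ne0$, so $q(y)u^m$ is divisible by [t], and $q(y)$ is a unit. *)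
have [m [q qa PmE]] := multiplicity_XsubC (bar P) a.
have P0 : bar P != 0.
  apply/eqP => /(congr1 (fun g : {poly C} => g`_r)); rewrite (coef_bar hR) coef0.
  have -> : P`_r = 1 by move/monicP: Pm; rewrite lead_coefE sP.
  by rewrite (value1 hR) => /eqP; rewrite oner_eq0.
rewrite P0 /= in qa.
have hq : pint (lift X q) by exact: pint_lift.
have qa' : (bar (lift X q)).[a] != 0 by rewrite (bar_lift hR).
have q0 := e_neq0 hq Pa qa'.
have hXm : pint (('X - (k a)%:P) ^+ m) by exact: (pintExp hR).
have liftXa : bar (('X - (k a)%:P) ^+ m) = ('X - a%:P) ^+ m.
  have -> : ('X - (k a)%:P) ^+ m = lift X (('X - a%:P) ^+ m).
    by rewrite /lift rmorphXn /= map_polyXsubC.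
  by rewrite (bar_lift hR).
have [S' hS' E] : exists2 S', pint S' & P - lift X q * ('X - (k a)%:P) ^+ m = t *: S'.
  apply: (bar_eq0 hR tt); first by apply: (pintB hR) => //; exact: (pintM hR).
  rewrite (barB hR) ?(barM hR) ?(bar_lift hR) ?liftXa //; last exact: (pintM hR).
  by rewrite PmE subrr.
exists m, (- e S' / e (lift X q)); split.
  apply: slocM; last exact: sloc_inv.
  by rewrite -sub0r -e0 -eB; apply: sloc_e; apply: (pintB hR) => //; exact: pint0.
have := congr1 (fun G => e G) E; rewrite /= eB eM eXn eZ ((eP P).2 (dvdpp P)) sub0r -/u => E'.
by rewrite mulrA mulrN -E' opprK mulrAC divff // mul1r.
Qed.

End LocalRing.
End SimpleExtension.

Lemma size_spectral (C : fieldType) (X : curve C) r (b : hitchin_tuple X r) D :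
  size (spectral_poly b D) = r.+1.
Proof.
rewrite /spectral_poly size_polyDl ?size_polyXn // ltnS.
apply: (leq_trans (size_sum _ _ _)); apply/bigmax_leqP => i _.
apply: leq_trans (size_scale_leq _ _) _.
by rewrite size_polyXn -subSn ?subSS ?leq_subr.
Qed.

Lemma coef_spectral (C : fieldType) (X : curve C) r (b : hitchin_tuple X r) D (i : 'I_r) :
  (spectral_poly b D)`_(r - i.+1) = b i D.
Proof.
rewrite coefD coefXn coef_sum (bigD1 i) //= coefZ coefXn eqxx mulr1 big1 => [|j ji].
  have ir := ltn_ord i; rewrite (_ : (_ == r) = false) ?add0r ?addr0 //.
  by apply/negbTE; rewrite neq_ltn; apply/orP; left; lia.
rewrite coefZ coefXn (_ : (_ == _) = false) ?mulr0 //.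
apply/negbTE; apply: contraNneq ji => /eqP E; apply/eqP/val_inj => /=.
by have := ltn_ord i; have := ltn_ord j; move/eqP: E; lia.
Qed.

Lemma coef_rev (r j : nat) : (j < r)%N -> exists i : 'I_r, j = (r - i.+1)%N.
Proof.
move=> jr; have h : (r - j.+1 < r)%N by lia.
by exists (Ordinal h) => /=; lia.
Qed.

(** The coefficient $b_i$ is homogeneous of degree $i$ in the derivation and $\lambda$ of degree 1,
    so the equation is homogeneous of degree [r]. *)
Lemma spectral_scale (C : fieldType) (X : curve C) r (b : hitchin_tuple X r) D c :
  hitchin_base b -> spectral_poly b (der_scale c D) \Po (c *: 'X) = c ^+ r *: spectral_poly b D.
Proof.
move=> hb; rewrite /spectral_poly comp_polyD comp_Xn_poly exprZn scalerDr; congr (_ + _).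
rewrite (raddf_sum (comp_poly (c *: 'X))) scaler_sumr; apply: eq_bigr => i _ /=.
rewrite comp_polyZ comp_Xn_poly exprZn; have [-> _] := hb i.
have -> : c ^+ r = c ^+ i.+1 * c ^+ (r - i.+1) by rewrite -exprD subnKC.
by rewrite !scalerA; congr (_ *: _); ring.
Qed.

(** * Smooth spectral curves *)

Section SpectralField.
Variables (C : numClosedFieldType) (X : curve C) (hX : smooth_projective_curve X).
Local Notation F := (fld X).
Local Notation k := (cst X).
Let hR := smooth_regular hX.
Variables (r : nat) (b : hitchin_tuple X r) (hb : hitchin_base b) (irr : irreducible_spectral b).
Local Notation P := (spectral_poly b (base_der X)).
Local Notation L := (spectral_fld irr).
Local Notation io := (spectral_incl irr).
Local Notation S := (spectral_curve irr).
Let mi : monic_irreducible_poly P := (irr, spectral_poly_monic b (base_der X)).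
Definition xi : L := qpolyX P.

Lemma mk_monic_spectral : mk_monic P = P. Proof. exact: (mk_monicE mi). Qed.

Lemma in_qpolyE G : (in_qpoly P G : L) = (map_poly io G).[xi].
Proof.
elim/poly_ind: G => [|G c IH]; first by rewrite in_qpoly0 rmorph0 horner0.
rewrite in_qpolyD in_qpolyM rmorphD rmorphM /= map_polyX map_polyC hornerMXaddC -IH.
congr (_ + _); apply/val_inj; apply: in_qpoly_small; rewrite size_polyC.
by apply: leq_ltn_trans (size_mk_monic_gt1 P); case: (c != 0).
Qed.

Lemma xi_eq0 G : (map_poly io G).[xi] = 0 <-> P %| G.
Proof.
rewrite -in_qpolyE; split=> [/(congr1 val) /= h|/dvdpP[K ->]].
  move: h; rewrite mk_monic_spectral => h; rewrite /dvdp.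
  rewrite (Pdiv.IdomainMonic.modpE (spectral_poly_monic _ _)).
  by apply/eqP; exact: h.
apply/val_inj => /=; rewrite mk_monic_spectral.
have := Pdiv.RingMonic.rmodp_mull (spectral_poly_monic b (base_der X)) K.
by [].
Qed.

Lemma r_gt0 : (0 < r)%N.
Proof. by have [h _] := irr; move: h; rewrite size_spectral. Qed.

Lemma size_xi (z : L) : (size ((z : {poly %/ P}) : {poly F}) <= r)%N.
Proof.
rewrite -ltnS; apply: leq_trans (size_mk_monic _) _.
by rewrite mk_monic_spectral size_spectral.
Qed.

Lemma in_qpoly_val (z : L) : in_qpoly P ((z : {poly %/ P}) : {poly F}) = z.
Proof. by apply/val_inj; apply: in_qpoly_small; exact: size_mk_monic. Qed.

Lemma lin_xi (v : 'rV[F]_r) : lin io (fun i : 'I_r => xi ^+ i) v = to_spectral irr v.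
Proof.
rewrite /to_spectral in_qpolyE.
have sc : (size (map_poly io (rVpoly v)) <= r)%N by rewrite size_map_poly size_poly.
rewrite (horner_coef_wide _ sc) /lin; apply: eq_bigr => i _.
by rewrite coef_map coef_rVpoly_ord.
Qed.

Lemma to_spectralK (z : L) : to_spectral irr (of_spectral z) = z.
Proof. by rewrite /to_spectral /of_spectral poly_rV_K ?in_qpoly_val // size_xi. Qed.

Lemma xi_basis : is_basis io (fun i : 'I_r => xi ^+ i).
Proof.
split=> [c|z]; last by exists (of_spectral z); rewrite lin_xi to_spectralK.
rewrite lin_xi /to_spectral in_qpolyE => /xi_eq0 Pc.
have r0 : rVpoly c = 0.
  apply/eqP; move: Pc; apply: contraTT => c0; apply: contraL (size_poly r _ : (size (rVpoly c) <= r)%N).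
  by move/(dvdp_leq c0); rewrite size_spectral ltnNge.
by rewrite -[c]rVpolyK r0 linear0.
Qed.

Lemma of_spectralE (z : L) : of_spectral z = coord_in io (fun i : 'I_r => xi ^+ i) z.
Proof. by apply: (lin_inj xi_basis); rewrite (coord_inK xi_basis) lin_xi to_spectralK. Qed.

Lemma of_spectralK (v : 'rV[F]_r) : of_spectral (to_spectral irr v) = v.
Proof. by rewrite of_spectralE -lin_xi (linK xi_basis). Qed.

Section AtPoint.
Variable p : pt X.
Definition fr := der_coord (tangent_frame p).
(** The value of $\lambda$ at the tangent frame at [p], whose powers span the functions regular over
    [p]. The generator [xi], the value at [base_der], serves for computations at the generic point;
    [fr] is the factor between the two. *)
Definition ysp : L := io fr * xi.
Local Notation Pp := (spectral_poly b (tangent_frame p)).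

Lemma yspE : ysp = io fr * xi. Proof. by []. Qed.

Lemma fr_neq0 : fr != 0. Proof. exact: der_coord_frame_neq0. Qed.

Lemma ysp_lambda : lambda irr (tangent_frame p) = ysp. Proof. by []. Qed.

Lemma pint_spectral : pint p Pp.
Proof.
move=> j; have [jr|rj] := ltnP j r.
  have [i ->] := coef_rev jr; rewrite coef_spectral; have [_] := hb i; apply.
  by case: (tangent_frameP hX p).
have [->|jr] := eqVneq j r.
  have /monicP := spectral_poly_monic b (tangent_frame p).
  by rewrite lead_coefE size_spectral => ->; exact: loc1.
by rewrite nth_default ?size_spectral ?ltn_neqAle 1?eq_sym ?jr //; exact: loc0.
Qed.

Lemma spectral_frame : Pp \Po (fr *: 'X) = fr ^+ r *: P.
Proof. by rewrite {1}(der_scaleE hX (tangent_frame p)) spectral_scale. Qed.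

Lemma ysp_eq0 G : (map_poly io G).[ysp] = 0 <-> Pp %| G.
Proof.
have f0 := fr_neq0.
have -> : (map_poly io G).[ysp] = (map_poly io (G \Po (fr *: 'X))).[xi].
  by rewrite map_comp_poly horner_comp linearZ /= hornerZ map_polyX hornerX.
have sc (c d : F) (H : {poly F}) : (H \Po (c *: 'X)) \Po (d *: 'X) = H \Po ((c * d) *: 'X).
  by rewrite -comp_polyA comp_polyZ comp_polyX scalerA.
have sc1 (H : {poly F}) : H \Po (1 *: 'X) = H by rewrite scale1r comp_polyXr.
rewrite xi_eq0; split=> [/dvdpP[K E]|/dvdpP[K ->]]; last first.
  by rewrite comp_polyM spectral_frame -scalerAr dvdpZr ?expf_neq0 // dvdp_mull.
have -> : G = (G \Po (fr *: 'X)) \Po (fr^-1 *: 'X) by rewrite sc divff // sc1.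
rewrite E comp_polyM; apply: dvdp_mull.
have -> : Pp = fr ^+ r *: (P \Po (fr^-1 *: 'X)).
  by rewrite -comp_polyZ -spectral_frame sc divff // sc1.
by rewrite dvdpZl ?expf_neq0.
Qed.

Lemma ysp_basis : is_basis io (fun i : 'I_r => ysp ^+ i).
Proof.
have h : forall i : 'I_r, fr ^+ i != 0 by move=> i; rewrite expf_neq0 // fr_neq0.
have := basis_scale xi_basis h; rewrite (_ : (fun i => _) = (fun i : 'I_r => ysp ^+ i)) //.
by apply/funext => i; rewrite /ysp exprMn rmorphXn.
Qed.

Lemma locus_root a : spectral_locus b (p, a) <-> root (bar p Pp) a.
Proof.
rewrite /spectral_locus /= rootE (bar_horner hR _ pint_spectral).
have l : loc p Pp.[k a] by apply: (pint_horner hR pint_spectral); exact: (rc_loc_cst hR).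
by rewrite -(value_eq0 hR l); split=> /eqP.
Qed.

End AtPoint.

Lemma pt_root (q : pt S) : root (bar (val q).1 (spectral_poly b (tangent_frame (val q).1))) (val q).2.
Proof. by apply/locus_root; have := set_mem (valP q); case: (val q). Qed.

Lemma spectral_locE (q : pt S) (z : L) : @loc _ S q z <->
  sloc (val q).1 io (ysp (val q).1) (val q).2 z.
Proof.
set p := (val q).1; set a := (val q).2.
have u H : pint p H -> loc_unit p H.[k a] <-> (bar p H).[a] != 0.
  move=> hH; have l : loc p H.[k a] by apply: (pint_horner hR hH); exact: (rc_loc_cst hR).
  by rewrite -(value_unit hR l) -(bar_horner hR _ hH); split=> /eqP.
split=> [[G [H [hG hH /(u _ hH) Ha E]]]|[G [H [hG hH /(u _ hH) Ha E]]]]; exists G, H; split=> //.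
Qed.

Lemma ex_spectral_unif (sm : smooth_spectral b) p a t : uniformizer p t -> spectral_locus b (p, a) ->
  exists w, [/\ sloc p io (ysp p) a w, w != 0,
    (forall G, pint p G -> (bar p G).[a] = 0 ->
       exists2 z, sloc p io (ysp p) a z & (map_poly io G).[ysp p] = z * w),
    (exists G H, [/\ pint p G, pint p H, (bar p H).[a] != 0, (bar p G).[a] = 0 &
       w = (map_poly io G).[ysp p] / (map_poly io H).[ysp p]]) &
    exists (m : nat) z, sloc p io (ysp p) a z /\ io t * z = w ^+ m].
Proof.
move=> tt qa; have hPp := pint_spectral p; set Pp := spectral_poly b (tangent_frame p) in hPp.
have ra : root (bar p Pp) a by apply/locus_root.
have [K1 hK1 E1] := e_taylor hR a hPp; have [K hK E2] := e_taylor hR a hK1.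
set c0 := Pp.[k a] in E1; set c1 := K1.[k a] in E2.
have mc0 : loc_max p c0 by exact: qa.
have lc1 : loc p c1 by apply: (pint_horner hR hK1); exact: (rc_loc_cst hR).
have PE : Pp = (c0%:P + c1 *: ('X - (k a)%:P)) + K * ('X - (k a)%:P) ^+ 2.
  by rewrite {1}E1 {1}E2 -mul_polyC; ring.
(* Otherwise $c_0$ is in the square of the maximal ideal of [p] and $c_1$ in the maximal ideal, so
   that the equation lies in the square of the maximal ideal of $(p,a)$, against smoothness. *)
have cases : loc_unit p c1 \/ loc_unit p (c0 / t).
  apply: contrapT => /not_orP[nu1 nu0]; apply: (sm _ qa); rewrite /=.
  have uu : uniformizer p (unif p).
    by apply: (@xgetPex _ 0 [set t | uniformizer p t]); exists t.
  have mp x : loc_max p x -> max_pow p 1 x.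
    by move=> /(uu.2 _)[z lz ->]; exists z; rewrite ?expr1.
  have Ec : Pp \Po ('X + (k a)%:P) = c0%:P + c1 *: 'X + (K \Po ('X + (k a)%:P)) * 'X^2.
    rewrite PE !comp_polyD comp_polyC comp_polyZ comp_polyM -[X in _ * (X \Po _)]/(_ ^+ 2).
    rewrite rmorphXn /= comp_polyB comp_polyX comp_polyC addrK.
    by [].
  have pc G : pint p G -> pint p (G \Po ('X + (k a)%:P)).
    move=> hG; rewrite comp_polyE; apply: (big_ind (pint p)) => [||i _].
    - exact: pint0.
    - by move=> *; exact: (pintD hR).
    apply: (pintZ hR) => //; apply: (pintExp hR); apply: (pintD hR); first exact: pintX.
    by apply: pintC => //; exact: (rc_loc_cst hR).
  move=> j; case: j => [|[|j]].
  - rewrite Ec !coefD coefMXn coefC coefZ coefX /= mulr0 !addr0 subn0.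
    have [c' lc' c0E] := (tt.2 _).1 mc0.
    have [c'' lc'' c'E] : max_pow p 1 c'.
      apply: mp; split=> // uc; apply: nu0; rewrite c0E mulfK //; exact: unif_neq0 tt.
    have [t' lt' tE] : max_pow p 1 t by apply: mp; exact: (unif_max hR tt).
    exists (c'' * t'); first exact: (locM hR).
    by rewrite c0E c'E tE expr1; ring.
  - rewrite Ec !coefD coefMXn coefC coefZ coefX /= mulr1 add0r addr0.
    by apply: mp; split.
  - rewrite [(2 - _)%N](_ : _ = 0%N) //; exists (Pp \Po ('X + (k a)%:P))`_j.+2; last by rewrite expr0 mulr1.
    exact: pc.
have [w [h1 [h2 [h3 [h4 h5]]]]] := ex_sunif hR (spectral_poly_monic _ _) hPp (size_spectral _ _)
  (@ysp_eq0 p) tt ra hK PE mc0 lc1 cases.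
by exists w.
Qed.

Lemma spectral_unitP (q : pt S) G H : pint (val q).1 G -> pint (val q).1 H ->
  (bar (val q).1 H).[(val q).2] != 0 ->
  loc_unit q ((map_poly io G).[ysp (val q).1] / (map_poly io H).[ysp (val q).1] : fld S) <->
  (bar (val q).1 G).[(val q).2] != 0.
Proof.
move=> hG hH Ha.
have h := sloc_unitP hR (spectral_poly_monic _ _) (pint_spectral _)
  (@ysp_eq0 _) (pt_root q) hG hH Ha.
rewrite -h; split=> [[z0 _ /spectral_locE lV]|[z0 lV]]; first by split.
by split=> //; apply/spectral_locE => //; exists G, H.
Qed.

Lemma spectral_regular (sm : smooth_spectral b) : regular_curve S.
Proof.
apply: mk_regular.
- move=> q c; apply/spectral_locE; rewrite /= /spectral_cst /=.
  by apply: (sloc_io hR); exact: (rc_loc_cst hR).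
- move=> q x y /spectral_locE lx /spectral_locE ly; apply/spectral_locE.
  exact: (slocB hR (spectral_poly_monic _ _) (pint_spectral _) (@ysp_eq0 _) (pt_root q)).
- move=> q x y /spectral_locE lx /spectral_locE ly; apply/spectral_locE.
  exact: (slocM hR).
- move=> q x /spectral_locE[G [H [hG hH Ha xE]]].
  exists ((bar (val q).1 G).[(val q).2] / (bar (val q).1 H).[(val q).2]).
  set c := _ / _; pose G' := G - (k c)%:P * H.
  have hc : pint (val q).1 (k c)%:P by apply: pintC => //; exact: (rc_loc_cst hR).
  have hG' : pint (val q).1 G' by apply: (pintB hR) => //; exact: (pintM hR).
  have H0 := e_neq0 hR (spectral_poly_monic _ _) (pint_spectral _) (@ysp_eq0 _) hH (pt_root q) Ha.
  have -> : x - cst S c = (map_poly io G').[ysp (val q).1] / (map_poly io H).[ysp (val q).1].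
    rewrite xE eB eM eC mulrBl; congr (_ - _); rewrite mulfK //.
  split; first by apply/spectral_locE; exists G', H.
  move=> /(spectral_unitP hG' hH Ha)/negP; apply; apply/eqP.
  rewrite (barB hR) ?(barM hR) ?(barC hR) ?(value_cst hR) //; last exact: (pintM hR).
  by rewrite hornerD hornerN hornerM hornerC /c divfK // subrr.
- move=> q x; set p := (val q).1.
  have [t tt] := rc_ex_uniformizer hR p.
  (* Multiplication by [t ^+ N] clears the poles of the coordinates of [x] in the powers of
     [ysp p]. *)
  have [N NP] := mx_bounded p (coord_in io (fun i : 'I_r => ysp p ^+ i) x).
  have t0 := unif_neq0 tt; have it0 : io (t ^+ N) != 0 by rewrite fmorph_eq0 expf_neq0.
  exists (io (t ^+ N) * x), (io (t ^+ N)); split=> //; last by rewrite mulrC mulKf.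
    apply/spectral_locE; have [G hG ->] : exists2 G, pint p G & io (t ^+ N) * x = (map_poly io G).[ysp p].
      apply/(integral_coord hR (spectral_poly_monic _ _) (pint_spectral _) (size_spectral _ _) (@ysp_eq0 _) (ysp_basis p)).
      move=> i j; rewrite (coord_inZ (ysp_basis p)) mxE; apply/(vge_loc hR).
      have -> : 0 = N%:Z + - N%:Z by rewrite addrN.
      apply: (vgeM hR) (NP _ _).
      by rewrite vge_ordE ?expf_neq0 // (ordX hR) (ord_unif hR tt) natz.
    exact: (sloc_e hR).
  by apply/spectral_locE; apply: (sloc_io hR); apply: (locX hR); exact: (unif_loc hR tt).
- move=> q; set p := (val q).1; set a := (val q).2.
  have [t tt] := rc_ex_uniformizer hR p.
  have qa : spectral_locus b (p, a) by have := set_mem (valP q); rewrite /p /a; case: (val q).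
  have [w [lw w0 wP [G0 [H0 [hG0 hH0 H0a G0a wE]]] [m [z [lz zE]]]]] := ex_spectral_unif sm tt qa.
  have sM := @slocM _ _ hR p L io (ysp p) a.
  exists w; split.
    split=> // x; split=> [[/spectral_locE[G [H [hG hH Ha xE]]] nu]|[y /spectral_locE[G [H [hG hH Ha yE]]] ->]].
      have Ga : (bar p G).[a] = 0.
        by apply/eqP/negPn/negP => Ga; apply: nu; rewrite xE; apply/spectral_unitP.
      have [y ly E] := wP G hG Ga; exists (y * ((map_poly io H).[ysp p])^-1); last by rewrite xE E; ring.
      by apply/spectral_locE; apply: (sM) => //; exact: (sloc_inv hR).
    have E : y * w = (map_poly io (G * G0)).[ysp p] / (map_poly io (H * H0)).[ysp p].
      by rewrite !eM yE wE invfM mulrACA.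
    have hGG : pint p (G * G0) by exact: (pintM hR).
    have hHH : pint p (H * H0) by exact: (pintM hR).
    have HHa : (bar p (H * H0)).[a] != 0 by rewrite (barM hR) // hornerM mulf_neq0.
    split; first by rewrite E; apply/spectral_locE; exists (G * G0), (H * H0).
    rewrite E => /(spectral_unitP hGG hHH HHa)/negP; apply.
    by rewrite (barM hR) // hornerM G0a mulr0.
  move=> x /spectral_locE[G [H [hG hH Ha xE]]] x0.
  have H1 := e_neq0 hR (spectral_poly_monic _ _) (pint_spectral _) (@ysp_eq0 _) hH (pt_root q) Ha.
  have G1 : (map_poly io G).[ysp p] != 0 by apply: contraNneq x0 => G1; rewrite xE G1 mul0r.
  (* Every nonzero element divides a power of [w]: its numerator divides an element [c] of the local
     ring of [p], which is a unit times [t ^+ n], and [t] divides [w ^+ m]. *)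
  have [|G' [c [hG' lc c0 cE]]] := integral_adj hR (spectral_poly_monic _ _) (pint_spectral _)
    (size_spectral _ _) (@ysp_eq0 _) (ysp_basis p) hG _ G1.
    by apply: contraNneq G1 => ->; rewrite e0.
  have [u [u0 lu luV] uE] := ordvP hR tt c0.
  have oc : 0 <= ord p c by apply/(loc_ord hR).
  have [n nE] : exists n : nat, ord p c = n%:Z by exists `|ord p c|%N; rewrite gez0_abs.
  rewrite nE -exprnP in uE.
  exists (m * n)%N, ((map_poly io H).[ysp p] * (map_poly io G').[ysp p] * io u^-1 * z ^+ n); split.
    apply/spectral_locE; apply: (sM); last exact: slocX.
    apply: (sM); last by apply: (sloc_io hR).
    by apply: (sM); exact: (sloc_e hR).
  have -> : x * ((map_poly io H).[ysp p] * (map_poly io G').[ysp p] * io u^-1 * z ^+ n) =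
     ((map_poly io G).[ysp p] * (map_poly io G').[ysp p]) * io u^-1 * z ^+ n.
    have gen (K : fieldType) (A B A' v v' : K) : B != 0 -> A / B * (B * A' * v * v') = A * A' * v * v'.
      by move=> B0; field.
    by rewrite xE gen.
  rewrite cE -rmorphM uE mulrAC divff // mul1r rmorphXn -exprMn zE exprM.
  by [].
Qed.

Section SpectralCover.
Hypothesis sm : smooth_spectral b.
Let hS := spectral_regular sm.
Variable g : nat.
Hypothesis hg : genus X g.

(** The points over [p] correspond to the roots of the equation reduced at [p], nonzero because it
    is monic. *)
Lemma ex_spectral_fibres : exists fib : pt X -> seq (pt S),
  (forall p, uniq (fib p)) /\ forall p q, (q \in fib p) = ((val q).1 == p).
Proof.
have h p : exists qs : seq (pt S), uniq qs /\ forall q, (q \in qs) = ((val q).1 == p).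
  pose Pb := bar p (spectral_poly b (tangent_frame p)).
  have Pb0 : Pb != 0.
    apply/eqP => /(congr1 (fun g : {poly C} => g`_r)); rewrite (coef_bar hR) coef0.
    have /monicP := spectral_poly_monic b (tangent_frame p); rewrite lead_coefE size_spectral => ->.
    by rewrite (value1 hR) => /eqP; rewrite oner_eq0.
  have [s sE] := closed_field_poly_normal Pb.
  have lb : lead_coef Pb != 0 by rewrite lead_coef_eq0.
  exists (pmap insub [seq (p, a) | a <- undup s]); split.
    by apply: pmap_sub_uniq; rewrite map_inj_uniq ?undup_uniq // => a a' [].
  move=> q; rewrite mem_pmap_sub; apply/mapP/eqP => [[a _ ->]//|qp].
  have := pt_root q; rewrite qp -/Pb sE rootZ // root_prod_XsubC => qs.
  by exists (val q).2; rewrite ?mem_undup // -qp; case: (val q).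
by have /choice[fib fibP] := h; exists fib; split=> p; case: (fibP p).
Qed.

Variables (fib : pt X -> seq (pt S)) (ufib : forall p, uniq (fib p)).
Hypothesis fibP : forall p q, (q \in fib p) = ((val q).1 == p).

Let lio p (q : pt S) : q \in fib p -> (val q).1 = p.
Proof. by rewrite fibP => /eqP. Qed.

Lemma spectral_integral p z : (exists2 G, pint p G & z = (map_poly io G).[ysp p]) <->
  mxloc p (coord_in io (fun i : 'I_r => ysp p ^+ i) z).
Proof.
exact: (integral_coord hR (spectral_poly_monic _ _) (pint_spectral p) (size_spectral _ _) (@ysp_eq0 p) (ysp_basis p)).
Qed.

Lemma spectral_value (q : pt S) G : pint (val q).1 G ->
  loc q ((map_poly io G).[ysp (val q).1] : fld S) /\
  ((bar (val q).1 G).[(val q).2] = 0 <-> loc_max q ((map_poly io G).[ysp (val q).1] : fld S)).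
Proof.
move=> hG; have h1 : pint (val q).1 1 by exact: pint1.
have h1a : (bar (val q).1 1).[(val q).2] != 0 by rewrite (bar1 hR) hornerC oner_eq0.
have := spectral_unitP hG h1 h1a; rewrite e1 divr1 => h.
have lG : loc q ((map_poly io G).[ysp (val q).1] : fld S) by apply/spectral_locE; exact: (sloc_e hR).
split=> //; split=> [G0|[_ nu]].
  by split=> // /h; rewrite G0 eqxx.
by apply/eqP/negPn/negP => G0; apply: nu; apply/h.
Qed.

Lemma spectral_glue p (N : set L) z : N 0 -> (forall u v, N u -> N v -> N (u + v)) ->
  (forall G v, pint p G -> N v -> N ((map_poly io G).[ysp p] * v)) ->
  (forall q : pt S, (val q).1 = p -> exists H, [/\ pint p H, (bar p H).[(val q).2] != 0 &
     N ((map_poly io H).[ysp p] * z)]) -> N z.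
Proof.
move=> N0 ND NM h; have [t tt] := rc_ex_uniformizer hR p.
apply: (local_global hR (spectral_poly_monic _ _) (pint_spectral p) (size_spectral _ _) (@ysp_eq0 p) (ysp_basis p) tt N0 ND NM).
move=> a /locus_root qa; pose q : pt S := SigSub (mem_set qa).
by have [|H] := h q; rewrite ?SubK //; exists H.
Qed.

(** Separating functions are the products of $y-c$ over the other points of the fibre, with $y$
    standing for [ysp p]. A function regular along the fibre is polynomial in $y$ by
    [spectral_glue], as at each point some denominator not vanishing there makes it so. *)
Lemma spectral_cover p : @cover_at C X S io p (fib p) r (fun i => ysp p ^+ i).
Proof.
split=> //.
- move=> q qp; have qE := lio qp; pose s := [seq (val q').2 | q' <- rem q (fib p)].
  pose W := lift X (\prod_(c <- s) ('X - c%:P)).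
  have hW : pint p W by exact: pint_lift.
  have wE (q' : pt S) : q' \in fib p -> loc q' ((map_poly io W).[ysp p] : fld S) /\
      ((\prod_(c <- s) ('X - c%:P)).[(val q').2] = 0 <-> loc_max q' ((map_poly io W).[ysp p] : fld S)).
    move=> q'p; have q'E := lio q'p; have := @spectral_value q' W; rewrite q'E.
    by rewrite /W (bar_lift hR); apply.
  exists (map_poly io W).[ysp p]; split.
  + by move=> q' /wE[].
  + have [lq mq] := wE _ qp; apply: contrapT => nu; have /mq/rootP : loc_max q ((map_poly io W).[ysp p] : fld S) by split.
    rewrite root_prod_XsubC => /mapP[q' q'r E].
    have q'p : q' \in fib p by exact: mem_rem q'r.
    have : q' = q.
      apply/val_inj; rewrite [RHS]surjective_pairing [LHS]surjective_pairing E.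
      by rewrite (lio q'p) qE.
    by move=> q'q; move: q'r; rewrite q'q mem_rem_uniq // inE eqxx.
  + move=> q' q'p q'q; apply/(wE _ q'p).2/rootP; rewrite root_prod_XsubC; apply/mapP.
    by exists q' => //; rewrite mem_rem_uniq // inE q'q.
- by move=> q x /lio qE lx; apply/spectral_locE; apply: (sloc_io hR); rewrite qE.
- move=> q x /lio qE mx; have hx : pint p x%:P by apply: pintC => //; case: mx.
  have := @spectral_value q x%:P; rewrite qE => /(_ hx)[_].
  rewrite eC (barC hR) hornerC => [[h _]]; apply: h.
  by apply/(value_eq0 hR); case: mx.
- exact: ysp_basis.
- move=> z; rewrite -spectral_integral; split=> [lz|[G hG ->] q /lio qE]; last first.
    by have := @spectral_value q G; rewrite qE => /(_ hG)[].
  apply: (@spectral_glue p (fun z => exists2 G, pint p G & z = (map_poly io G).[ysp p])).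
  + by exists 0; rewrite ?e0 //; exact: pint0.
  + by move=> _ _ [G hG ->] [G' hG' ->]; exists (G + G'); rewrite ?eD //; exact: (pintD hR).
  + by move=> G _ hG [G' hG' ->]; exists (G * G'); rewrite ?eM //; exact: (pintM hR).
  move=> q qp; have qf : q \in fib p by rewrite fibP qp.
  have /spectral_locE := lz q qf; rewrite qp => -[G [H [hG hH Ha ->]]].
  exists H; split=> //; exists G => //.
  have := e_neq0 hR (spectral_poly_monic _ _) (pint_spectral p) (@ysp_eq0 p) hH _ Ha.
  have := pt_root q; rewrite qp => ra /(_ ra) H0.
  by rewrite mulrC divfK.
Qed.

Lemma fr_cofinite : exists s : seq (pt X), forall p, p \notin s -> loc_unit p (fr p).
Proof.
have [[s sP] _] := canonical_degree hX hg; exists s => p /sP op.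
by apply/(loc_unit_ord hR); split; [exact: fr_neq0 | ].
Qed.

(* Where the frame of the tangent bundle is a unit multiple of [base_der], the powers of
   [xi] and those of [ysp p] span the same lattice. *)
Lemma coord_ysp p z : loc_unit p (fr p) ->
  mxloc p (coord_in io (fun i : 'I_r => ysp p ^+ i) z) <-> mxloc p (of_spectral z).
Proof.
move=> uf; have E (i : 'I_r) : of_spectral z 0 i = fr p ^+ i * coord_in io (fun i : 'I_r => ysp p ^+ i) z 0 i.
  have : of_spectral z = \row_i (fr p ^+ i * coord_in io (fun i : 'I_r => ysp p ^+ i) z 0 i).
    rewrite of_spectralE; apply: (lin_inj xi_basis); rewrite (coord_inK xi_basis).
    rewrite -{1}(coord_inK (ysp_basis p) z); apply: eq_bigr => j _.
    by rewrite mxE /ysp exprMn rmorphM rmorphXn; ring.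
  by move=> ->; rewrite mxE.
have u (i : 'I_r) : loc_unit p (fr p ^+ i) by exact: (loc_unitX hR).
split=> h i j; rewrite ord1; last first.
  have := h 0 j; rewrite E => l; have [f0 _ lV] := u j.
  by rewrite -[coord_in _ _ _ _ _](mulKf f0); apply: (locM hR).
by rewrite E; apply: (locM hR) => //; case: (u j).
Qed.

(** Over almost all points of X the coordinates of [z] and of its inverse in the powers of [xi] are
    integral, and [xi] and [ysp p] differ by a unit. *)
Lemma spectral_cofinite (z : fld S) : z != 0 -> finsupp (fun q : pt S => ord q z).
Proof.
have lc (w : fld S) : exists s : seq (pt X), forall q : pt S, (val q).1 \notin s -> loc q w.
  have [s1 h1] := fr_cofinite.
  have [s2 h2] := mxloc_cofinite hR (fun y y0 => (product_formula hX y0).1) (of_spectral (w : L)).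
  exists (s1 ++ s2) => q; rewrite mem_cat negb_or => /andP[/h1 u /h2 l].
  have /(cv_semiloc (spectral_cover (val q).1)) := (coord_ysp (w : L) u).2 l.
  by apply; rewrite fibP.
move=> z0; have [s1 h1] := lc z; have [s2 h2] := lc z^-1.
exists (flatten [seq fib p | p <- s1 ++ s2]) => q nq.
have : (val q).1 \notin s1 ++ s2.
  by apply: contra nq => qs; apply/flatten_mapP; exists (val q).1; rewrite // fibP.
rewrite mem_cat negb_or => /andP[/h1 l1 /h2 l2].
by apply: (ord_unit hS).
Qed.

End SpectralCover.
End SpectralField.

(** * The spectral correspondence *)

Section HornerAction.
Variables (F : fieldType) (n : nat) (A : 'M[F]_n).
Implicit Types (G H : {poly F}) (v : 'rV[F]_n).

(** The F[x]-module structure on rows with the variable acting as [A], in a form that includes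
    [n = 0]. *)
Definition hact G v : 'rV[F]_n := \sum_(i < size G) G`_i *: iter i (mulmx^~ A) v.

Lemma hact_wide m G v : (size G <= m)%N -> hact G v = \sum_(i < m) G`_i *: iter i (mulmx^~ A) v.
Proof.
move=> sG; rewrite /hact (big_ord_widen m (fun i => G`_i *: iter i (mulmx^~ A) v) sG) big_mkcond.
by apply: eq_bigr => i _; case: ltnP => // h; rewrite nth_default ?scale0r.
Qed.

Lemma hactD G H v : hact (G + H) v = hact G v + hact H v.
Proof.
have sG := leq_maxl (size G) (size H); have sH := leq_maxr (size G) (size H).
rewrite (hact_wide _ sG) (hact_wide _ sH) (hact_wide _ (size_polyD G H)) -big_split.
by apply: eq_bigr => i _; rewrite coefD scalerDl.
Qed.

Lemma hactZ c G v : hact (c *: G) v = c *: hact G v.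
Proof.
rewrite (hact_wide v (size_scale_leq c G)) scaler_sumr.
by apply: eq_bigr => i _; rewrite coefZ scalerA.
Qed.

Lemma hactC c v : hact c%:P v = c *: v.
Proof. by rewrite (hact_wide v (size_polyC_leq1 c)) big_ord1 coefC. Qed.

Lemma hactXM G v : hact (G * 'X) v = hact G v *m A.
Proof.
have s1 : (size (G * 'X)%R <= (size G).+1)%N.
  by apply: leq_trans (size_polyMleq _ _) _; rewrite size_polyX addn2.
rewrite (hact_wide v s1) big_ord_recl coefMX scale0r add0r /hact mulmx_suml.
by apply: eq_bigr => i _; rewrite coefMX /= scalemxAl.
Qed.

Lemma hact0 v : hact 0 v = 0. Proof. by rewrite -polyC0 hactC scale0r. Qed.

Lemma hactr0 G : hact G 0 = 0.
Proof.
elim/poly_ind: G => [|G c IH]; first exact: hact0.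
by rewrite hactD hactXM IH mul0mx hactC scaler0 addr0.
Qed.

Lemma hactA G H v : hact (G * H) v = hact H (hact G v).
Proof.
elim/poly_ind: H => [|H c IH]; first by rewrite mulr0 !hact0.
rewrite mulrDr mulrA !hactD !hactXM IH hactC; congr (_ + _).
by rewrite mulrC mul_polyC hactZ.
Qed.

End HornerAction.

Lemma hact_char (F : fieldType) n (A : 'M[F]_n) (v : 'rV_n) : hact A (char_poly A) v = 0.
Proof.
case: n A v => [|m] B v; first by rewrite [v]thinmx0 thinmx0.
have E (G : {poly F}) : \sum_(i < size G) G`_i *: iter i (mulmx^~ B) v = v *m horner_mx B G.
  rewrite -[G in RHS]coefK poly_def raddf_sum mulmx_sumr; apply: eq_bigr => i _ /=.
  rewrite horner_mxZ -scalemxAr rmorphXn /= horner_mx_X; congr (_ *: _).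
  elim: (nat_of_ord i) => [|j IH]; first by rewrite expr0 mulmx1.
  by rewrite exprSr -[_ * B]/(_ *m B) mulmxA -IH.
by rewrite /hact E Cayley_Hamilton mulmx0.
Qed.

(** Cayley-Hamilton for the multiplication matrix, applied to the coordinates of 1. *)
Lemma char_mulmat (K L : fieldType) (io : {rmorphism K -> L}) d (e : 'I_d -> L)
  (he : is_basis io e) z : (map_poly io (char_poly (mulmat io e z))).[z] = 0.
Proof.
have E G y : coord_in io e ((map_poly io G).[z] * y) = hact (mulmat io e z) G (coord_in io e y).
  elim/poly_ind: G => [|G c IH].
    by rewrite rmorph0 horner0 mul0r (coord_in0 he) hact0.
  rewrite rmorphD rmorphM /= map_polyX map_polyC hornerMXaddC mulrDl (coord_inD he).
  rewrite (coord_inZ he) hactD hactXM hactC -IH -(coord_inM he); congr (coord_in _ _ _ + _).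
  by rewrite mulrAC mulrC.
by apply: (can_inj (coord_inK he)); rewrite -[X in coord_in _ _ X]mulr1 E hact_char (coord_in0 he).
Qed.

Lemma char_poly_scale (R : comNzRingType) n (A : 'M[R]_n) c :
  char_poly (c *: A) \Po (c *: 'X) = c ^+ n *: char_poly A.
Proof.
have -> : c ^+ n *: char_poly A = \det (c%:P *: char_poly_mx A) by rewrite detZ -rmorphXn mul_polyC.
rewrite /char_poly -[LHS]/(comp_poly (c *: 'X) _) -det_map_mx; congr (\det _).
apply/matrixP => i j; rewrite !mxE rmorphB rmorphMn /= comp_polyX comp_polyC.
by rewrite mulrBr -polyCM mulrnAr mul_polyC.
Qed.

Lemma char_poly0 (R : comNzRingType) n : char_poly (0 : 'M[R]_n) = 'X^n.
Proof. by rewrite /char_poly /char_poly_mx map_mx0 subr0 det_scalar. Qed.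

Section HomogeneousChar.
Variables (C : numClosedFieldType) (X : curve C) (hX : smooth_projective_curve X).
Local Notation F := (fld X).

(** Both sides are homogeneous in the derivation, and every derivation is a multiple of [base_der];
    for the zero derivation both sides are $x^r$. *)
Lemma spectral_char r (b : hitchin_tuple X r) (ph : der X -> 'M[F]_r) : hitchin_base b ->
  (forall f D, ph (der_scale f D) = f *: ph D) ->
  char_poly (ph (base_der X)) = spectral_poly b (base_der X) ->
  forall D, char_poly (ph D) = spectral_poly b D.
Proof.
move=> hb hp h D; rewrite (der_scaleE hX D); set c := der_coord D.
have [->|c0] := eqVneq c 0.
  rewrite hp scale0r char_poly0 /spectral_poly big1 ?addr0 // => i _.
  by have [-> _] := hb i; rewrite expr0n mul0r scale0r.
have E : char_poly (ph (der_scale c (base_der X))) \Po (c *: 'X) =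
    spectral_poly b (der_scale c (base_der X)) \Po (c *: 'X).
  by rewrite hp char_poly_scale spectral_scale // h.
have inv (G : {poly F}) : (G \Po (c *: 'X)) \Po (c^-1 *: 'X) = G.
  by rewrite -comp_polyA comp_polyZ comp_polyX scalerA divff // scale1r comp_polyXr.
by rewrite -[LHS]inv E inv.
Qed.

Lemma irreducible_ss0 (E : higgs X) : higgs_bundle E -> degree E = 0 ->
  irreducible_poly (char_poly (phi E (base_der X))) -> ss0 E.
Proof.
move=> hE dE [_ irr]; split=> //; split=> // k B fB iB.
have [k0|k0] := eqVneq k 0%N; first by subst k; rewrite degreeE (ldegree0 (smooth_regular hX)).
have [l [Q [fQ kQ]]] := row_full_cokernel fB.
have E1 := char_exact (base_der X) fB fQ kQ iB.
(* The characteristic polynomial of the subbundle is a nonconstant factor, so it has full degree;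
   then [B] is square and defines an isomorphism onto E. *)
have := irr (char_poly (phi (subhiggs B) (base_der X))); rewrite size_char_poly eqSS k0.
rewrite E1 dvdp_mulr // => /(_ isT isT)/eqp_size; rewrite -E1 !size_char_poly => -[kr].
rewrite /= in kr; have i : higgs_iso (subhiggs B) E.
  exists B; split=> //.
    by rewrite /row_full (eqP fB) /= kr.
  by move=> D; rewrite (inv_phi D fB iB).
have [_ _ dd] := higgs_iso_bundle hX i (subhiggs_bundle hX hE fB iB).
by rewrite -dd dE.
Qed.

End HomogeneousChar.

(** * Push-forward of line bundles from a spectral curve *)

Section PushForward.
Variables (C : numClosedFieldType) (X : curve C) (hX : smooth_projective_curve X).
Local Notation F := (fld X).
Let hR := smooth_regular hX.
Variables (r : nat) (b : hitchin_tuple X r) (hb : hitchin_base b) (irr : irreducible_spectral b).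
Hypothesis sm : smooth_spectral b.
Variables (g : nat) (hg : genus X g).
Local Notation P := (spectral_poly b (base_der X)).
Local Notation L := (spectral_fld irr).
Local Notation io := (spectral_incl irr).
Local Notation S := (spectral_curve irr).
Local Notation xi := (xi irr).
Local Notation ysp := (ysp irr).
Local Notation bx := (fun i : 'I_r => xi ^+ i).
Local Notation by_ p := (fun i : 'I_r => ysp p ^+ i).
Let hS : regular_curve S := spectral_regular hX hb irr sm.
Let bxP : is_basis io bx := xi_basis irr.
Let byP p : is_basis io (by_ p) := ysp_basis hX irr p.
Variables (fib : pt X -> seq (pt S)) (ufib : forall p, uniq (fib p)).
Hypothesis fibP : forall p q, (q \in fib p) = ((val q).1 == p).
Let cov p := spectral_cover hX hb ufib fibP p.
Let finS (z : fld S) (z0 : z != 0) : finsupp (fun q : pt S => ord q z) :=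
  spectral_cofinite hX hb sm hg ufib fibP z0.
Let finX (y : F) (y0 : y != 0) : finsupp (fun p : pt X => ord p y) := (product_formula hX y0).1.

Lemma push_phi (Lb : bundle S) D : phi (spectral_push Lb) D = mulmat io bx (lambda irr D).
Proof.
apply/row_matrixP => i; apply/rowP => j; rewrite [in RHS]/mulmat rowK [LHS]mxE [LHS]mxE.
by rewrite (of_spectralE) -lin_xi lin_delta.
Qed.

Lemma mul_push (Lb : bundle S) D (v : 'rV_r) :
  v *m phi (spectral_push Lb) D = of_spectral (lambda irr D * to_spectral irr v).
Proof. by rewrite push_phi of_spectralE (coord_inM bxP) -lin_xi (linK bxP). Qed.

(** The characteristic polynomial of multiplication by [xi] is monic of degree [r] with root [xi],
    so it is divisible by [P], and equal to it by degrees. *)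
Lemma char_push (Lb : bundle S) D : char_poly (phi (spectral_push Lb) D) = spectral_poly b D.
Proof.
apply: (spectral_char hX (ph := phi (spectral_push Lb))) hb _ _ D.
  move=> f D; rewrite !push_phi -(mulmatZ bxP); congr mulmat.
  by rewrite /lambda (der_coord_scale hX) rmorphM mulrA.
rewrite push_phi; have -> : lambda irr (base_der X) = xi.
  by rewrite /lambda (@der_coordE _ _ hX _ 1) ?rmorph1 ?mul1r // => x; rewrite mul1r.
have /(xi_eq0 irr) Pd := char_mulmat bxP xi.
have mc : char_poly (mulmat io bx xi) \is monic := char_poly_monic _.
apply/eqP; rewrite eq_sym -(eqp_monic (spectral_poly_monic b _) mc) -dvdp_size_eqp //.
by rewrite size_spectral size_char_poly.
Qed.

Lemma line_unfold (Lb : bundle S) : line_bundle Lb -> exists st, Lb = @Bundle C S 1 st.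
Proof. by case: Lb => n st [/= n1 _]; subst n; exists st. Qed.

Lemma rv1 (R : fieldType) (c z : R) (B : 'M_1) : const_mx z = (const_mx c : 'rV_1) *m B <-> z = c * B 0 0.
Proof.
split=> [/rowP/(_ 0)|->]; first by rewrite !mxE big_ord1 mxE.
by apply/rowP => i; rewrite !mxE big_ord1 ?mxE (ord1 i).
Qed.

Lemma frame1 (q : pt S) (T : set 'rV[fld S]_1) B : lframe q T B ->
  B 0 0 != 0 /\ forall z, T (const_mx z) <-> loc q (z / B 0 0).
Proof.
move=> [uB BP]; have B0 : B 0 0 != 0 by move: uB; rewrite unitmxE unitfE det_mx11.
split=> // z; rewrite BP; split=> [[c lc E]|l].
  have := lc 0; move: E; rewrite [c](_ : _ = const_mx (c 0 0)); last first.
    by apply/rowP => i; rewrite ord1 mxE.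
  by move/rv1 => ->; rewrite !mxE mulfK.
exists (const_mx (z / B 0 0)); first by move=> j; rewrite mxE.
by apply/rv1; rewrite divfK.
Qed.

Lemma push_stalk (st : pt S -> set 'rV[fld S]_1) p (v : 'rV_r) :
  @stalk _ _ (spectral_push (@Bundle C S 1 st)) p v <->
  forall q : pt S, (val q).1 = p -> st q (const_mx (to_spectral irr v)).
Proof. by []. Qed.

Lemma push_lattice (Lb : bundle S) : line_bundle Lb ->
  vlattice (@stalk _ _ (spectral_push Lb)) /\
  degree (spectral_push Lb) = degree Lb - (r%:Z ^+ 2 - r%:Z) * (g%:Z - 1).
Proof.
move=> lb; have [st LE] := line_unfold lb; subst Lb; have [_ /(vector_bundleP hS finS) /= vL] := lb.
have [B [hB fB]] := vlattice_frames hS vL.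
pose s (q : pt S) : fld S := B q 0 0.
have s0 q : s q != 0 by have [] := frame1 (hB q).
(* A single function with the right orders along the fibre generates L there, so the stalk of the
   push-forward at [p] is [z p] times the semilocal ring. *)
have /choice[z zP] : forall p, exists z : fld S, z != 0 /\ forall q, q \in fib p -> ord q z = ord q (s q).
  by move=> p; exact: (ex_orders hS (cv_uniq (cov p)) (cv_sep (cov p))).
have z0 p : z p != 0 by case: (zP p).
have divP q (v u : fld S) : u != 0 -> loc q (v / u) <-> v = 0 \/ ord q u <= ord q v.
  move=> u0; have [->|v0] := eqVneq v 0.
    by rewrite mul0r; split=> _; [left | exact: (loc0 hS)].
  rewrite (loc_ord hS) ?mulf_neq0 ?invr_eq0 // (ordM hS) ?invr_eq0 // (ordV hS) subr_ge0.
  by split=> [|[/eqP|//]]; [right | rewrite (negPf v0)].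
have stP p (v : 'rV_r) : @stalk _ _ (spectral_push (@Bundle C S 1 st)) p v <->
    mxloc p (coord_in io (by_ p) (to_spectral irr v / z p : L)).
  split=> [/push_stalk h|/(cv_semiloc (cov p)) h].
    apply/(cv_semiloc (cov p)) => q qp; have /h : (val q).1 = p by apply/eqP; rewrite -fibP.
    by move/(frame1 (hB q)).2/(divP _ _ _ (s0 q)) => h1; apply/(divP _ _ _ (z0 p)); rewrite (zP p).2.
  apply/push_stalk => q qp; have qf : q \in fib p by rewrite fibP qp.
  apply/(frame1 (hB q)).2/(divP _ _ _ (s0 q)).
  by have /(divP _ _ _ (z0 p)) := h q qf; rewrite (zP p).2.
(* The rows are the products of [z p] with the powers of [ysp p], written in the powers of [xi]; the
   diagonal factor is the change between the two bases. *)
pose T p : 'M[F]_r := diag_mx (\row_i fr p ^+ i) *m mulmat io bx (z p : L).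
have dT p : \det (T p) = (\prod_(i < r) fr p ^+ i) * fnorm io (by_ p) (z p : L).
  rewrite det_mulmx det_diag -[\det (mulmat _ _ _)]/(fnorm io bx _) (fnorm_chg _ bxP (byP p)).
  by congr (_ * _); apply: eq_bigr => i _; rewrite mxE.
have f0 p : fr p != 0 := fr_neq0 hX p.
have pf0 (p : pt X) : \prod_(i < r) fr p ^+ i != 0 by apply/prodf_neq0 => i _; apply: expf_neq0; exact: f0.
have nf0 p : fnorm io (by_ p) (z p : L) != 0 := fnorm_neq0 (byP p) (z0 p).
have TE p (c : 'rV_r) : c *m T p = of_spectral ((z p : L) * lin io (by_ p) c).
  rewrite /T mulmxA of_spectralE mulrC.
  have -> : c *m diag_mx (\row_i fr p ^+ i) = coord_in io bx (lin io (by_ p) c).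
    apply: (lin_inj bxP); rewrite (coord_inK bxP); apply: eq_bigr => i _.
    by rewrite mul_mx_diag !mxE yspE exprMn rmorphM rmorphXn mulrA.
  by rewrite -(coord_inM bxP) mulrC.
have hT p : lframe p (@stalk _ _ (spectral_push (@Bundle C S 1 st)) p) (T p).
  split; first by rewrite unitmxE unitfE dT mulf_neq0.
  move=> v; split=> [/stP l|[c lc ->]].
    exists (coord_in io (by_ p) (to_spectral irr v / z p : L)); first by move=> j; exact: l.
    by rewrite TE (coord_inK (byP p)) mulrC divfK // of_spectralK.
  apply/stP; rewrite TE to_spectralK mulrAC divff // mul1r (linK (byP p)); exact/mxlocP.
(* The norm gives the orders of L along the fibre, and the exponents $0,\dots,r-1$ of [fr p] add up
   to the binomial coefficient. *)
have ordT p : ord p (\det (T p)) = \sum_(q <- fib p) ord q (\det (B q)) + ord p (fr p) * 'C(r, 2)%:Z.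
  rewrite dT (ordM hR) // addrC; congr (_ + _).
    have [t tt] := rc_ex_uniformizer hR p.
    rewrite (ord_fnorm hR hS (cov p) tt (z0 p)); apply: eq_big_seq => q /(zP p).2 ->.
    by rewrite det_mx11.
  rewrite (ord_prod hR) => [|i]; last by rewrite expf_neq0.
  rewrite -bin2_sum (big_morph Posz PoszD (erefl _)) big_mkord mulr_sumr.
  by apply: eq_bigr => i _; rewrite (ordX hR) -mulr_natr natz.
split.
  split=> [p|]; first by exists (T p).
  have [_ [sl slP]] := vL; have [sf sfP] := fr_cofinite hX hg.
  exists ([seq (val q).1 | q <- sl] ++ sf) => p; rewrite mem_cat negb_or => /andP[psl /sfP uf].
  have std (q : pt S) : (val q).1 = p -> lframe q (st q) 1%:M.
    move=> qp; apply: slP; apply: contra psl => qsl; apply/mapP; by exists q.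
  split=> [|v]; first exact: unitmx1.
  have E : semiloc (fib p) (to_spectral irr v : fld S) <-> mxloc p v.
    by rewrite (cv_semiloc (cov p)) (coord_ysp hX _ uf) of_spectralK.
  split=> [/push_stalk h|[c lc cE]].
    exists v; rewrite ?mulmx1 // => j; apply: E.1 => q; rewrite fibP => /eqP qp.
    by have := h q qp; move/(frame1 (std q qp)).2; rewrite mxE eqxx divr1.
  apply/push_stalk => q qp; apply/(frame1 (std q qp)).2; rewrite mxE eqxx divr1; apply: E.2; last by rewrite fibP qp.
  by rewrite cE mulmx1; exact/mxlocP.
rewrite degreeE (ldegree_frames hR hT) (degreeE (@Bundle C S 1 st)) (ldegree_frames hS hB).
have [fK sK] := canonical_degree hX hg.
have [ff sf] := fsum_fibre ufib fibP fB.
have fK2 : finsupp (fun p : pt X => ord p (fr p) * 'C(r, 2)%:Z).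
  by have [s' sP'] := fK; exists s' => p /sP'; rewrite /fr => ->; rewrite mul0r.
rewrite (eq_fsum ordT) (fsumD ff fK2) -sf (fsumMn _ fK) sK opprD; congr (_ - _).
(* As deg K is $2(g-1)$, the correction is $\binom r2\cdot2(g-1)=(r^2-r)(g-1)$. *)
have b2 : 'C(r, 2)%:Z * 2 = r%:Z ^+ 2 - r%:Z.
  have h2 : ('C(r, 2) * 2 = r * r.-1)%N by have := bin_ffact r 2; rewrite ffactnS ffactn1.
  have r1 : r.-1%:Z = r%:Z - 1 by have := r_gt0 irr; case: (r) => // n _; rewrite -addn1 PoszD addrK addn1.
  have -> : r%:Z ^+ 2 - r%:Z = r%:Z * (r%:Z - 1) by ring.
  by rewrite -r1 -!PoszM -h2.
rewrite -b2; ring.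
Qed.

Lemma lambda_frame p D : tangent p D -> exists2 f, loc p f & lambda irr D = io f * ysp p.
Proof.
move=> tD; have [_ h] := tangent_frameP hX p; have [f lf ->] := h D tD; exists f => //.
by rewrite /lambda (der_coord_scale hX) rmorphM mulrA.
Qed.

Lemma loc_ysp (q : pt S) : loc q (ysp (val q).1 : fld S).
Proof.
apply/(spectral_locE hX); have := sloc_e (smooth_regular hX) io (ysp (val q).1) (val q).2 (pintX hR (val q).1).
by rewrite map_polyX hornerX.
Qed.

Lemma push_ss0 (Lb : bundle S) : line_bundle Lb -> degree Lb = (r%:Z ^+ 2 - r%:Z) * (g%:Z - 1) ->
  ss0 (spectral_push Lb).
Proof.
move=> lb dL; have [vP dP] := push_lattice lb.
apply: (irreducible_ss0 hX); last by rewrite char_push.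
  split.
  - exact/(vector_bundleP hR finX).
  - move=> f D; rewrite !push_phi -(mulmatZ bxP); congr mulmat.
    by rewrite /lambda (der_coord_scale hX) rmorphM mulrA.
  - move=> p D v tD; have [st LE] := line_unfold lb; subst Lb => sv.
    have [_ /(vector_bundleP hS finS) /= vL] := lb.
    apply/push_stalk => q qp.
    have -> := mul_push (@Bundle C S 1 st) D v; rewrite to_spectralK.
    have [B hB] := vL.1 q; apply/(frame1 hB).2.
    have /(frame1 hB).2 l := (push_stalk _ _ _).1 sv q qp.
    have [f lf lE] := lambda_frame tD.
    have ll : loc q (lambda irr D).
      rewrite lE -qp in lf *; apply: (locM hS); last exact: loc_ysp.
      by apply: (cv_loc (cov (val q).1)) lf; rewrite fibP.
    by rewrite -mulrA; exact: (locM hS ll l).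
by rewrite dP dL subrr.
Qed.

(** * From a Higgs bundle to a line bundle on its spectral curve *)

Section Cyclic.
Variables (st : pt X -> set 'rV[F]_r) (ph : der X -> 'M[F]_r).
Local Notation E := (@Higgs C X (@Bundle C X r st) ph).
Hypotheses (hE : higgs_bundle E) (cE : char_poly (ph (base_der X)) = P).
Let A := ph (base_der X).
(** By irreducibility of [P] any nonzero row would be a cyclic vector; the first basis row is
    chosen. *)
Let v0 : 'rV[F]_r := delta_mx 0 (Ordinal (r_gt0 irr)).
Let M : 'M[F]_r := \matrix_(i < r) iter i (mulmx^~ A) v0.

Let hactM (G : {poly F}) : (size G <= r)%N -> hact A G v0 = poly_rV G *m M.
Proof.
move=> sG; rewrite (hact_wide A v0 sG) mulmx_sum_row; apply: eq_bigr => i _.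
by rewrite rowK mxE.
Qed.

(** A nonzero polynomial of degree below [r] is coprime to [P]; if it killed [v0], a Bezout relation
    together with Cayley-Hamilton would make 1 kill [v0]. *)
Let uM : M \in unitmx.
Proof.
rewrite -row_free_unit; apply: inj_row_free => c cM.
have hc : hact A (rVpoly c) v0 = 0 by rewrite hactM ?size_poly // rVpolyK.
apply/eqP/negPn/negP => c0.
have G0 : rVpoly c != 0 by apply: contraNneq c0 => h; rewrite -[c]rVpolyK h linear0.
have cop : coprimep P (rVpoly c).
  rewrite irreducible_poly_coprime //; apply/negP => /(dvdp_leq G0).
  by rewrite size_spectral ltnNge size_poly.
have [[U W] /= UW] := Bezout_eq1_coprimepP _ _ cop.
have : hact A 1 v0 = 0.
  rewrite -UW hactD [U * _]mulrC [W * _]mulrC !hactA hc hactr0 -cE hact_char hactr0.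
  by rewrite addr0.
rewrite -polyC1 hactC scale1r => /(congr1 (fun v : 'rV_r => v 0 (Ordinal (r_gt0 irr)))).
by rewrite !mxE !eqxx => /eqP; rewrite oner_eq0.
Qed.

(** Identifies the function field of the spectral curve with the generic stalk of E, sending 1 to
    [v0] and multiplication by $\lambda$ to the Higgs field. *)
Let T (z : L) : 'rV[F]_r := of_spectral z *m M.

Let T_hact G : T (map_poly io G).[xi] = hact A G v0.
Proof.
have m := spectral_poly_monic b (base_der X).
have hP : hact A P v0 = 0 by rewrite -cE hact_char.
rewrite (divp_eq G P) rmorphD rmorphM /= hornerD hornerM (_ : (map_poly io P).[xi] = 0); last first.
  exact/(xi_eq0 irr)/dvdpp.
rewrite mulr0 add0r hactD [_ * P]mulrC hactA hP hactr0 add0r.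
have sR : (size (G %% P)%R <= r)%N.
  by rewrite -ltnS -(size_spectral b (base_der X)) ltn_modp monic_neq0.
rewrite hactM //; congr (_ *m M); rewrite of_spectralE; apply: (lin_inj bxP).
by rewrite (coord_inK bxP) lin_xi /to_spectral in_qpolyE poly_rV_K.
Qed.

Let T_xi z : T (xi * z) = T z *m A.
Proof.
have -> : z = (map_poly io (rVpoly (of_spectral z))).[xi].
  by rewrite -(in_qpolyE irr) -[LHS]to_spectralK.
set G := rVpoly _; rewrite [xi * _]mulrC.
have -> : (map_poly io G).[xi] * xi = (map_poly io (G * 'X)).[xi].
  by rewrite rmorphM /= map_polyX hornerM hornerX.
by rewrite !T_hact hactXM.
Qed.

Let TD z z' : T (z + z') = T z + T z'.
Proof. by rewrite /T !of_spectralE (coord_inD bxP) mulmxDl. Qed.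

Let TZ c z : T (io c * z) = c *: T z.
Proof. by rewrite /T !of_spectralE (coord_inZ bxP) scalemxAl. Qed.

Let T_lambda D z : T (lambda irr D * z) = T z *m ph D.
Proof.
have [_ hs _] := hE; rewrite /lambda -mulrA TZ T_xi {2}(der_scaleE hX D) -[ph]/(phi E) hs.
by rewrite scalemxAr.
Qed.

(** The stalk of E at [p] seen in the function field of the spectral curve, where it is stable under
    integral polynomials in [ysp p]. *)
Let N p (z : L) := st p (T z).

Let N_props p : [/\ N p 0, forall u v, N p u -> N p v -> N p (u + v) &
  forall G v, pint p G -> N p v -> N p ((map_poly io G).[ysp p] * v)].
Proof.
have vE := higgs_bundleP hX hE; have [B hB] := vE.1 p.
have [SD SZ _ _] := lframe_lattice hR hB; have [_ _ hp] := hE.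
have N0 : N p 0.
  rewrite /N (_ : T 0 = 0); last by rewrite /T of_spectralE (coord_in0 bxP) mul0mx.
  by have [_ BP] := hB; apply/BP; exists 0; rewrite ?mul0mx // => j; rewrite mxE; exact: (loc0 hR).
have ND u v : N p u -> N p v -> N p (u + v) by move=> h h'; rewrite /N TD; exact: SD.
split=> // G v hG nv.
have ny z : N p z -> N p (ysp p * z).
  move=> nz; rewrite /N -(ysp_lambda irr p) T_lambda; apply: hp => //.
  by case: (tangent_frameP hX p).
have nyX i : N p (ysp p ^+ i * v).
  by elim: i => [|i IH]; rewrite ?expr0 ?mul1r // exprS -mulrA; exact: ny.
rewrite horner_coef mulr_suml; apply: (big_ind (N p)) => // i _.
by rewrite coef_map -mulrA /N TZ; apply: SZ; [exact: hG | exact: nyX].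
Qed.

(** The localization of [N] at [q]: a denominator is an integral polynomial in [ysp] that does not
    vanish at [q]. *)
Let stL (q : pt S) : set 'rV[fld S]_1 := [set w | exists H : {poly F},
  [/\ pint (val q).1 H, (bar (val q).1 H).[(val q).2] != 0 &
      N (val q).1 ((map_poly io H).[ysp (val q).1] * (w 0 0 : L))]].

Let stL_lattice q : lattice q (stL q).
Proof.
set p := (val q).1; have [N0 ND NM] := N_props p.
have vE := higgs_bundleP hX hE; have [B hB] := vE.1 p.
have [SD SZ [N1 SN] Ss] := lframe_lattice hR hB.
have h1 : pint p 1 by exact: pint1.
have h1a : (bar p 1).[(val q).2] != 0 by rewrite (bar1 hR) hornerC oner_eq0.
have qf : q \in fib p by rewrite fibP.
split.
- move=> u v [H [hH Ha nu]] [H' [hH' Ha' nv]]; exists (H * H'); split.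
  + exact: (pintM hR).
  + by rewrite (barM hR) // hornerM mulf_neq0.
  + rewrite mxE mulrDr; apply: ND.
      by rewrite [H * H']mulrC eM -mulrA; exact: NM.
    by rewrite eM -mulrA; exact: NM.
- move=> c v /(spectral_locE hX)[G [H [hG hH Ha cE']]] [H' [hH' Ha' nv]]; exists (H * H'); split.
  + exact: (pintM hR).
  + by rewrite (barM hR) // hornerM mulf_neq0.
  + have H0 := e_neq0 hR (spectral_poly_monic _ _) (pint_spectral hX hb p) (ysp_eq0 hX hb irr p) hH (pt_root hX hb q) Ha.
    have -> : (map_poly io (H * H')).[ysp p] * ((c *: v) 0 0 : L) =
        (map_poly io G).[ysp p] * ((map_poly io H').[ysp p] * (v 0 0 : L)).
      rewrite mxE eM cE'; have gen (K : fieldType) (x y z w : K) : x != 0 -> x * y * (z / x * w) = z * (y * w).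
        by move=> x0; field.
      exact: gen.
    exact: NM.
- have [m mP] := mx_bounded p (invmx M *m chgmx io (by_ p) bx).
  have [t tt] := rc_ex_uniformizer hR p; have t0 := unif_neq0 tt.
  have vz z : N p z -> forall j, vge p (N1 - m%:Z) (coord_in io (by_ p) z 0 j).
    move=> nz j; have -> : coord_in io (by_ p) z = T z *m (invmx M *m chgmx io (by_ p) bx).
      by rewrite /T mulmxA mulmxK // of_spectralE (coord_chg (byP p) bxP).
    rewrite mxE; apply: (vge_sum hR) => i _; apply: (vgeM hR); [exact: SN | exact: mP].
  (* The coordinates of elements of [N] have bounded poles, so [t ^+ n] carries [N] into the
     semilocal ring; this bounds the poles in the localization at [q]. *)
  pose n := `|N1 - m%:Z|%N; pose u : fld S := io (t ^+ n).
  have u0 : u != 0 by rewrite fmorph_eq0 expf_neq0.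
  exists (- ord q u) => w [H [hH Ha nw]] j; rewrite [j]ord1.
  have H0 := e_neq0 hR (spectral_poly_monic _ _) (pint_spectral hX hb p) (ysp_eq0 hX hb irr p) hH (pt_root hX hb q) Ha.
  have -> : w 0 0 = ((map_poly io H).[ysp p])^-1 * (u^-1 * (u * ((map_poly io H).[ysp p] * (w 0 0 : L)))) :> fld S.
    by rewrite (mulKf u0) mulKf.
  apply: (vge_locM hS).
    by apply/(spectral_locE hX); exact: (sloc_inv hR).
  rewrite mulrC; apply: (vge_locM hS); last exact: (vgeV hS).
  have /(cv_semiloc (cov p)) : mxloc p (coord_in io (by_ p) (u * ((map_poly io H).[ysp p] * (w 0 0 : L)) : L)).
    move=> i l; rewrite (coord_inZ (byP p)) mxE ord1; apply/(vge_loc hR).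
    have := vgeM hR (vge_ord p (t ^+ n)) (vz _ nw l); apply: (vgeW (p := p)).
    rewrite (ordX hR) (ord_unif hR tt) natz /n; lia.
  by apply.
- move=> v; have [c c0 Sc] := Ss (T (v 0 0 : L)); exists (io c : fld S); first by rewrite fmorph_eq0.
  exists 1; split=> //; rewrite e1 mul1r mxE.
  by rewrite /N TZ.
Qed.

(** An element lying in the localizations of [N] at all points of the fibre lies in [N], by
    [spectral_glue]. *)
Let stL_glue p z : N p z <-> forall q : pt S, (val q).1 = p -> stL q (const_mx (z : fld S)).
Proof.
have [N0 ND NM] := N_props p; split=> [nz q qp|h].
  exists 1; split; first exact: pint1.
    by rewrite (bar1 hR) hornerC oner_eq0.
  by rewrite e1 mul1r mxE qp.
apply: (spectral_glue hX hb N0 ND NM) => q qp.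
have [H [hH Ha nH]] := h q qp; rewrite qp in hH Ha nH; exists H; split=> //.
by move: nH; rewrite mxE.
Qed.

Let Lb := @Bundle C S 1 stL.

Let Lb_line : line_bundle Lb.
Proof.
split=> //; apply/(vector_bundleP hS finS); split=> [q|]; first exact: (lattice_frame hS (stL_lattice q)).
have [_ [s1 h1]] := higgs_bundleP hX hE; have [s2 h2] := fr_cofinite hX hg.
have [s3 h3] := mxunit_cofinite hR finX uM.
exists (flatten [seq fib p | p <- s1 ++ s2 ++ s3]) => q nq; set p := (val q).1.
have : p \notin s1 ++ s2 ++ s3.
  by apply: contra nq => ps; apply/flatten_mapP; exists p; rewrite // fibP.
rewrite !mem_cat !negb_or => /and3P[/h1 [_ std] /h2 uf /h3 up].
(* At almost all points the standard basis is a frame of E, [M] is integrally invertible and [fr p]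
   is a unit; there [N] is the ring of integral polynomials in [ysp p], and its localizations are
   the local rings. *)
have NE z : N p z <-> exists2 G, pint p G & z = (map_poly io G).[ysp p].
  rewrite (spectral_integral hX hb) (coord_ysp hX z uf); have lM : mxloc p M by case: up.
  have lV := mxunit_inv hR up.
  split=> [/std[c /mxlocP lc E]|l]; last first.
    by apply/std; exists (T z); rewrite ?mulmx1 //; apply/mxlocP; exact: (mxloc_mul hR).
  rewrite -[of_spectral z](mulmxK uM) -/(T z) E mulmx1; exact: (mxloc_mul hR).
split=> [|w]; first exact: unitmx1.
split=> [[H [hH Ha /NE[G hG E]]]|[c lc ->]].
  exists w; rewrite ?mulmx1 // => j; rewrite [j]ord1; apply/(spectral_locE hX); exists G, H; split=> //.
  have H0 := e_neq0 hR (spectral_poly_monic _ _) (pint_spectral hX hb p) (ysp_eq0 hX hb irr p) hH (pt_root hX hb q) Ha.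
  by rewrite -E mulrC mulKf.
have /(spectral_locE hX)[G [H [hG hH Ha E]]] := lc 0; exists H; split=> //; apply/NE; exists G => //.
have H0 := e_neq0 hR (spectral_poly_monic _ _) (pint_spectral hX hb p) (ysp_eq0 hX hb irr p) hH (pt_root hX hb q) Ha.
by rewrite mulmx1 E mulrC divfK.
Qed.

Lemma cyclic_push : exists Lb0 : bundle S, line_bundle Lb0 /\ higgs_iso E (spectral_push Lb0).
Proof.
exists Lb; split; first exact: Lb_line.
exists (invmx M); rewrite row_free_unit row_full_unit unitmx_inv uM; split=> // [p v|D].
  have h : v = T (to_spectral irr (v *m invmx M)) by rewrite /T of_spectralK mulmxKV.
  by rewrite {1}h; exact: (stL_glue p (to_spectral irr (v *m invmx M))).
apply: rowmx_ext => v; rewrite [RHS]mulmxA mul_push; apply: (can_inj (mulmxK uM)).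
rewrite [RHS]T_lambda /T of_spectralK mulmxKV // mulmxA mulmxKV //.
Qed.

End Cyclic.

Lemma higgs_push (G : higgs X) : higgs_bundle G -> rk G = r -> char_poly (phi G (base_der X)) = P ->
  degree G = 0 ->
  exists Lb : bundle S, [/\ line_bundle Lb, degree Lb = (r%:Z ^+ 2 - r%:Z) * (g%:Z - 1) &
    higgs_iso G (spectral_push Lb)].
Proof.
move=> hG; case: G hG => -[n st] ph hG /= nr; subst n => cG dG.
have [Lb [lb i]] := cyclic_push hG cG; exists Lb; split=> //.
have [_ _] := higgs_iso_bundle hX i hG; rewrite (push_lattice lb).2 dG => /eqP.
by rewrite subr_eq0 => /eqP.
Qed.

End PushForward.

(* If [P] divides [P * Q \in t], the cofactor [Q] is absorbed into another element of
   [t]; the product is irreducible by induction, so [Q] is constant. *)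
Lemma irreducible_factors_perm (F : fieldType) (s t : seq {poly F}) :
  (forall G, G \in s -> irreducible_poly G /\ G \is monic) ->
  (forall G, G \in t -> (1 < size G)%N /\ G \is monic) ->
  size s = size t -> \prod_(G <- s) G = \prod_(G <- t) G -> perm_eq s t.
Proof.
elim: s t => [|P s IH] t hs ht st; first by case: t ht st.
rewrite big_cons => e; have [irP mP] := hs P (mem_head _ _).
have [G Gt PG] : exists2 G, G \in t & P %| G.
  apply/hasP/negPn/negP => /hasPn nt.
  have : coprimep P (\prod_(G <- t) G).
    rewrite big_seq; apply: (big_ind (fun G => coprimep P G)) => [|G H PG PH|G Gt].
    - exact: coprimep1.
    - by rewrite coprimepMr PG.
    - by rewrite irreducible_poly_coprime // nt.
  by rewrite -e coprimepMr coprimepp => /andP[/eqP h _]; case: irP; rewrite h.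
have [sG mG] := ht G Gt; have tE := perm_to_rem Gt.
have GE : G = P * (G %/ P) by rewrite mulrC divpK.
set Q := G %/ P in GE; have mQ : Q \is monic by move: mG; rewrite GE monicMl.
have e' : \prod_(G <- s) G = Q * \prod_(H <- rem G t) H.
  apply: (mulfI (monic_neq0 mP)); rewrite e mulrA -GE (perm_big _ tE) big_cons //.
have st' : size s = size (rem G t) by rewrite size_rem // -st.
have hs' H : H \in s -> irreducible_poly H /\ H \is monic by move=> Hs; apply: hs; rewrite inE Hs orbT.
have Qone : size Q = 1%N -> Q = 1.
  by move=> /eqP/size_poly1P[c c0 QE]; move: mQ; rewrite QE monicE lead_coefC => /eqP ->.
suff [Q1 p] : Q = 1 /\ perm_eq s (rem G t).
  have GP : G = P by rewrite GE Q1 mulr1.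
  by apply: (perm_trans (y := G :: rem G t)); [rewrite GP perm_cons -GP | rewrite perm_sym].
have ht' H : H \in rem G t -> (1 < size H)%N /\ H \is monic by move=> /mem_rem; exact: ht.
case: (rem G t) st' ht' e' => [|H u] st' ht' e'.
  case: s st' e' {IH hs st hs' e} => // _; rewrite !big_nil mulr1 => <-; split=> //.
have [sH mH] := ht' H (mem_head _ _).
have pu : perm_eq s (Q * H :: u).
  apply: IH => // [K|]; last by rewrite big_cons e' big_cons mulrA.
  rewrite inE => /orP[/eqP ->|Ku]; last by apply: ht'; rewrite inE Ku orbT.
  split; last by rewrite monicMl.
  by rewrite (leq_trans sH) // dvdp_leq ?dvdp_mull // mulf_neq0 ?monic_neq0.
have [irQH _] : irreducible_poly (Q * H) /\ Q * H \is monic.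
  by apply: hs'; rewrite (perm_mem pu) mem_head.
have Q1 : Q = 1.
  apply: Qone; apply/eqP/negPn/negP => sQ.
  have /eqp_size := irQH.2 Q sQ (dvdp_mulr _ (dvdpp _)).
  rewrite size_Mmonic ?monic_neq0 // => h.
  have : (0 < size Q)%N by rewrite size_poly_gt0 monic_neq0.
  by move: h sH; case: (size (H : seq F)) => [|[|a]] //; rewrite !addnS -addnS /= => /eqP; rewrite -{1}[size Q]addn0 eqn_add2l.
by split=> //; move: pu; rewrite Q1 mul1r.
Qed.

(** A value may be attained at several indices, so the matching is made on positions in the
    enumeration. That [sg] is a bijection is expressed as a permutation of [index_enum], the form
    required by [big_dsum_perm]. *)
Lemma perm_eq_reindex (I : finType) (T : eqType) (f h : I -> T) :
  perm_eq [seq f k | k <- index_enum I] [seq h k | k <- index_enum I] ->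
  exists2 sg : I -> I, perm_eq (index_enum I) [seq sg k | k <- index_enum I] & forall k, h (sg k) = f k.
Proof.
set e := index_enum I => p.
have [k0|k0] := pickP (fun _ : I => true); last by exists id => [|k]; [rewrite map_id | have := k0 k].
move=> _; have [Is pI fE] := perm_iotaP (f k0) p; rewrite size_map in pI.
pose s' := map (nth k0 e) Is.
have ps : perm_eq s' e.
  by rewrite (perm_trans (perm_map (nth k0 e) pI)) // map_nth_iota0 // take_size.
have sz : size s' = size e := perm_size ps.
have ue : uniq e := index_enum_uniq I.
have se : s' = [seq nth k0 s' (index k e) | k <- e].
  apply: (@eq_from_nth _ k0) => [|i]; rewrite ?sz; rewrite ?size_map // => ie.
  by rewrite (nth_map k0) // index_uniq.
exists (fun k => nth k0 s' (index k e)) => [|k]; first by rewrite -se perm_sym.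
have ke : k \in e by rewrite mem_index_enum.
have ki : (index k e < size e)%N by rewrite index_mem.
have := congr1 (nth (f k0) ^~ (index k e)) fE.
rewrite (nth_map k0) // nth_index // => ->.
have kI : (index k e < size Is)%N by rewrite -(size_map (nth k0 e)) -/s' sz.
rewrite /s' !(nth_map 0%N) // (nth_map k0) //.
by have : nth 0%N Is (index k e) \in Is; [exact: mem_nth | rewrite (perm_mem pI) mem_iota].
Qed.

(** The Hitchin coefficients are those below the top one, and both polynomials are monic of degree
    [n]. *)
Lemma hitchin_char (C : fieldType) (X : curve C) (I : finType) (r : I -> nat) (n : nat)
  (b : forall k, hitchin_tuple X (r k)) (E : higgs X) : (\sum_k r k)%N = n -> rk E = n ->
  hitchin E = hitchin_mul n b <-> forall D, char_poly (phi E D) = \prod_k spectral_poly (b k) D.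
Proof.
move=> sr rE.
have mE D' := char_poly_monic (phi E D'); have sE D' : size (char_poly (phi E D')) = n.+1 := etrans (size_char_poly _) (congr1 S rE).
have mP D' : \prod_k spectral_poly (b k) D' \is monic by apply: monic_prod => k _; exact: spectral_poly_monic.
have sP D' : size (\prod_k spectral_poly (b k) D') = n.+1.
  rewrite size_prod => [|k _]; last exact/monic_neq0/spectral_poly_monic.
  under eq_bigr do rewrite size_spectral -addn1.
  by rewrite big_split /= sr sum1_card subSn ?leq_addl // addnK.
split=> [h D'|h]; last by apply/funext => i; apply/funext => D'; rewrite /hitchin h.
apply/polyP => j; have [jn|nj|->] := ltngtP j n.
- have [i ->] := coef_rev jn.
  by have := congr1 (fun c : hitchin_tuple X n => c i D') h.
- by rewrite !nth_default // ?sE ?sP.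
- have := mE D'; have := mP D'; rewrite !monicE !lead_coefE sE sP /= => /eqP -> /eqP ->.
  by [].
Qed.
Theorem proposition7p5 (R : realType) (X : curve R[i]) (g : nat)
  (hX : smooth_projective_curve X) (hg : genus X g)
  (s n : nat) (r m : 'I_s -> nat)
  (hs : (0 < s)%N)
  (hr0 : forall l, (0 < r l)%N)
  (hr : forall l l' : 'I_s, (l < l')%N -> (r l < r l')%N)
  (hm : forall l, (0 < m l)%N)
  (hn : (\sum_(l < s) m l * r l)%N = n)
  (b : forall k : {l : 'I_s & 'I_(m l)}, hitchin_tuple X (r (tag k)))
  (hb : nodal_locus b) :
  let beta := hitchin_mul n b in
  let delta (l : 'I_s) : int :=
    ((r l)%:Z ^+ 2 - (r l)%:Z) * (g%:Z - 1) in
  hitchin_fibre beta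
    `&` levi_locus X (fun k : {l : 'I_s & 'I_(m l)} => r (tag k)) n
  = nu_check n @` jacobian hb (fun k => delta (tag k)).
Proof.
move=> beta delta; pose I : finType := {l : 'I_s & 'I_(m l)}; pose rr := fun k : I => r (tag k).
have sr : (\sum_(k : I) rr k)%N = n.
  rewrite -hn (eq_bigr (fun l => (\sum_(i < m l) r l)%N)) => [|l _]; last by rewrite sum_nat_const card_ord.
  by rewrite sig_big_dep.
have hB k : hitchin_base (b k) by case: hb => h _ _ _; exact: (h k).1.
have sm k : smooth_spectral (b k) by case: hb => h _ _ _; exact: (h k).2.
have irr k : irreducible_spectral (b k) := nodal_irreducible hb k.
have push (k : I) (L : bundle (normalization hb k)) : line_bundle L -> degree L = delta (tag k) ->
  ss0 (spectral_push L).
  move=> lL dL; have [fib [ufib fibP]] := ex_spectral_fibres hX (hB k) (nodal_irreducible hb k).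
  exact: (push_ss0 hX (hB k) (sm k) hg ufib fibP lL dL).
have pushc (k : I) (L : bundle (normalization hb k)) D :
  char_poly (phi (spectral_push L) D) = spectral_poly (b k) D.
  exact: (char_push hX (hB k)).
apply/seteqP; split=> [c [[E [sE hE cE]] [Es sEs cEs]]|c [L hL <-]].
- have [rE s0E] := (ss0P hX _ _).1 sE.
  have cP D : \prod_(k : I) char_poly (phi (Es k) D) = \prod_(k : I) spectral_poly (b k) D.
    rewrite -char_big_dsum -((hitchin_char b sr rE).1 hE).
    (* The class of E contains E itself; being also the class of the sum of the [Es k], it yields an
       S-equivalence between the two. *)
    have : moduli_point n E E by split=> //; exact: (S_equivalent_refl hX).
    by rewrite -cE -cEs => -[_ _]; exact: S_equivalent_char.
  have /perm_eq_reindex[sg psg sgP] : perm_eq [seq spectral_poly (b k) (base_der X) | k <- index_enum I]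
      [seq char_poly (phi (Es k) (base_der X)) | k <- index_enum I].
    apply: irreducible_factors_perm => [G /mapP[k _ ->]|G /mapP[k _ ->]||]; rewrite ?size_map ?big_map ?cP //.
      by split; [exact: irr | exact: spectral_poly_monic].
    have [_ rk_ _ _] := sEs k; rewrite char_poly_monic; split=> //.
    by rewrite (etrans (size_char_poly _) (congr1 S rk_)) ltnS; exact: hr0.
  have push_inv (k : I) : exists L : bundle (normalization hb k),
      [/\ line_bundle L, degree L = delta (tag k) & higgs_iso (Es (sg k)) (spectral_push L)].
    have [hEk rk_ dEk _] := sEs (sg k).
    (* A priori [sg k] may lie in another block of indices; the equality of characteristic
       polynomials forces the rank to agree. *)
    have rkk : rk (Es (sg k)) = rr k.
      by have /(congr1 (fun G : {poly _} => size G)) := sgP k; rewrite size_char_poly size_spectral => -[].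
    have [fib [ufib fibP]] := ex_spectral_fibres hX (hB k) (nodal_irreducible hb k).
    exact: (higgs_push hX (hB k) (sm k) hg ufib fibP hEk rkk (sgP k) dEk).
  (* The type of the line bundle depends on [k], so the choice is made separately for each
     component. *)
  exists (fun k => projT1 (cid (push_inv k))) => [k|].
    by case: (projT2 (cid (push_inv k))).
  rewrite -cEs /nu_check; apply/esym/(moduli_point_iso hX).
  apply: (higgs_iso_trans (big_dsum_perm Es psg)); rewrite big_map.
  by apply: big_dsum_iso => k; case: (projT2 (cid (push_inv k))).
- have sL k : ss0 (spectral_push (L k)) by case: (hL k) => lL dL; exact: push lL dL.
  have sS : ss0 (nu_push L) := ss0_big_dsum hX _ sL.
  have rS : rk (nu_push L) = n by rewrite -sr; exact: rk_big_dsum.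
  split.
  - exists (nu_push L); split=> //; first exact/(ss0P hX).
    by apply/(hitchin_char b sr rS) => D; rewrite char_big_dsum; apply: eq_bigr => k _; exact: pushc.
  - by exists (fun k => spectral_push (L k)) => // k; apply/(ss0P hX).
Qed.
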